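(* Let $\Omega\subseteq\mathbf{R}^n$ ($n\geq 2$) be a bounded domain with smooth boundary. Let $K\in\mathcal{A}$, with $K(x,0,0)=0$ for all $x\in\Omega$, be such that there is $\eta\in\left]0,\frac{\lambda_1}{2}\right[$ with $$K(x,s,t)\leq\eta(s^2+t^2)$$ for all $x\in\Omega$, $s,t\in\mathbf{R}$. Moreover, let $\Phi:\mathbf{R}^2\to\mathbf{R}$ be a non-constant $C^1$ function, with $\Phi(0,0)=0$, belonging to $\mathcal{A}$, with $p=\frac{2}{n-2}$ when $n>2$. Then, for every convex set $S\subseteq L^\infty(\Omega)\times L^\infty(\Omega)$ dense in $L^2(\Omega)\times L^2(\Omega)$, there exists $(\alpha,\beta)\in S$ such that the problem $$\begin{cases}-\Delta u=(\alpha(x)\cos(\Phi(u,v))-\beta(x)\sin(\Phi(u,v)))\Phi_u(u,v)+K_u(x,u,v)&\text{in }\Omega\\ -\Delta v=(\alpha(x)\cos(\Phi(u,v))-\beta(x)\sin(\Phi(u,v)))\Phi_v(u,v)+K_v(x,u,v)&\text{in }\Omega\\ u=v=0&\text{on }\partial\Omega\end{cases}$$ has at least three weak solutions, two of which are global minima in $H^1_0(\Omega)\times H^1_0(\Omega)$ of the functional $$(u,v)\mapsto\frac12\left(\int_\Omega|\nabla u(x)|^2dx+\int_\Omega|\nabla v(x)|^2dx\right)-\int_\Omega(\alpha(x)\sin(\Phi(u(x),v(x)))+\beta(x)\cos(\Phi(u(x),v(x)))+K(x,u(x),v(x)))\,dx.$$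
   Context: $\mathcal{A}$ denotes the class of all functions $H:\Omega\times\mathbf{R}^2\to\mathbf{R}$, $(x,u,v)\mapsto H(x,u,v)$, which are measurable in $\Omega$ (i.e. $H(\cdot,u,v)$ is measurable for each $(u,v)$), $C^1$ in $\mathbf{R}^2$ (i.e. $H(x,\cdot,\cdot)$ is $C^1$ for each $x$) and satisfy $$\sup_{(x,u,v)\in\Omega\times\mathbf{R}^2}\frac{|H_u(x,u,v)|+|H_v(x,u,v)|}{1+|u|^p+|v|^p}<+\infty$$ for some $p>0$, with $p<\frac{n+2}{n-2}$ when $n>2$. Here $H_u$ (resp. $H_v$) is the derivative of $H$ with respect to $u$ (resp. $v$). The function $\Phi$ on $\mathbf{R}^2$ is regarded as a function on $\Omega\times\mathbf{R}^2$ independent of $x$; thus ''$\Phi\in\mathcal{A}$ with $p=\frac{2}{n-2}$ when $n>2$'' means $$\sup_{(u,v)\in\mathbf{R}^2}\frac{|\Phi_u(u,v)|+|\Phi_v(u,v)|}{1+|u|^p+|v|^p}<+\infty$$ with $p=\frac{2}{n-2}$ when $n>2$, and with some $p>0$ when $n=2$. $\lambda_1$ is the first eigenvalue of the Dirichlet problem $-\Delta u=\lambda u$ in $\Omega$, $u=0$ on $\partial\Omega$. For $H:\Omega\times\mathbf{R}^2\to\mathbf{R}$, a weak solution of the problem $-\Delta u=H_u(x,u,v)$, $-\Delta v=H_v(x,u,v)$ in $\Omega$, $u=v=0$ on $\partial\Omega$, is any $(u,v)\in H^1_0(\Omega)\times H^1_0(\Omega)$ such that $$\int_\Omega\nabla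 u(x)\nabla\varphi(x)dx=\int_\Omega H_u(x,u(x),v(x))\varphi(x)dx,\qquad\int_\Omega\nabla v(x)\nabla\psi(x)dx=\int_\Omega H_v(x,u(x),v(x))\psi(x)dx$$ for all $\varphi,\psi\in H^1_0(\Omega)$. The problem in the claim is of this form with $H(x,u,v)=\alpha(x)\sin(\Phi(u,v))+\beta(x)\cos(\Phi(u,v))+K(x,u,v)$. *)

(* Defs.v *)
From HB Require Import structures.
From mathcomp Require Import all_boot all_order all_algebra.
From mathcomp Require Import all_classical all_reals all_analysis.
Set Implicit Arguments.
Unset Strict Implicit.
Unset Printing Implicit Defensive.
Import Order.TTheory GRing.Theory Num.Theory.
Import numFieldNormedType.Exports.
Local Open Scope classical_set_scope.
Local Open Scope ring_scope.

(* A point of R^n is a row vector 'rV[R]_n; its topology is the usual one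
   (the library norms 'rV[R]_n by the maximum norm). *)

Section lebesgue.
Variables (R : realType) (n : nat).

(* The half-open box ]a_1, b_1] x ... x ]a_n, b_n], coded by (a, b). *)
Definition box (c : 'rV[R]_n * 'rV[R]_n) : set 'rV[R]_n :=
  [set x | forall i, c.1 0 i < x 0 i <= c.2 0 i].

Definition box_vol (c : 'rV[R]_n * 'rV[R]_n) : \bar R :=
  (\prod_(i < n) Num.max 0 (c.2 0 i - c.1 0 i))%:E.

Definition box_cover (A : set 'rV[R]_n) : set (set ('rV[R]_n * 'rV[R]_n)) :=
  [set C | countable C /\ A `<=` \bigcup_(c in C) box c].

Definition lebesgue_outer (A : set 'rV[R]_n) : \bar R :=
  ereal_inf [set (\esum_(c in C) box_vol c)%E | C in box_cover A].

Local Open Scope ereal_scope.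

Lemma box_vol_ge0 c : 0 <= box_vol c.
Proof. by rewrite lee_fin; apply: prodr_ge0 => i _; rewrite le_max lexx. Qed.

Lemma lebesgue_outer_ge0 A : 0 <= lebesgue_outer A.
Proof.
by apply: le_ereal_inf_tmp => _ [C _ <-]; apply: esum_ge0 => c _; exact: box_vol_ge0.
Qed.

Lemma lebesgue_outer0 : lebesgue_outer set0 = 0.
Proof.
apply/eqP; rewrite eq_le lebesgue_outer_ge0 andbT.
by apply: ereal_inf_lbound; exists set0; [split|rewrite esum_set0].
Qed.

Lemma le_lebesgue_outer : {homo lebesgue_outer : A B / A `<=` B >-> A <= B}.
Proof.
move=> A B AB; apply/ereal_inf_le_tmp => x [C [cC BC] <-].
by exists C => //; split => //; exact: subset_trans AB BC.
Qed.

Lemma box_vol_esumS (C D : set ('rV[R]_n * 'rV[R]_n)) : C `<=` D ->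
  \esum_(c in C) box_vol c <= \esum_(c in D) box_vol c.
Proof.
move=> CD; apply: ge_ereal_sup => _ [F [fF FC] <-].
by apply: ereal_sup_ubound; exists F => //; split => //; exact: subset_trans FC CD.
Qed.

Lemma lebesgue_outer_sigma_subadditive : sigma_subadditive lebesgue_outer.
Proof.
move=> A; have [[i ioo]|] := pselect (exists i, lebesgue_outer (A i) = +oo).
  rewrite (eseries_pinfty _ _ ioo) ?leey// => k _.
  by rewrite -ltNye (lt_le_trans _ (lebesgue_outer_ge0 _)).
rewrite -forallNE => Aoo.
suff add2e (e : {posnum R}) : lebesgue_outer (\bigcup_n A n) <=
    \sum_(i <oo) lebesgue_outer (A i) + e%:num%:E.
  by apply/lee_addgt0Pr => _/posnumP[].
rewrite (le_trans _ (epsilon_trick _ _ _))//; last first.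
  by move=> k; exact: lebesgue_outer_ge0.
pose P k (C : set ('rV[R]_n * 'rV[R]_n)) := box_cover (A k) C /\
  \esum_(c in C) box_vol c <=
    lebesgue_outer (A k) + (e%:num / (2 ^ k.+1)%:R)%:E.
have [G PG] : {G : nat -> set ('rV[R]_n * 'rV[R]_n) & forall k, P k (G k)}.
  apply: (@choice _ _ P) => k; rewrite /P.
  have e0 : (0 < e%:num / (2 ^ k.+1)%:R)%R by [].
  have fA : lebesgue_outer (A k) \is a fin_num.
    by rewrite ge0_fin_numE ?lebesgue_outer_ge0// ltey; apply/eqP/Aoo.
  have [_ [C CA <-] /ltW] := lb_ereal_inf_adherent e0 fA.
  by exists C.
apply: (@le_trans _ _ (\esum_(c in \bigcup_k seqDU G k) box_vol c)).
  apply: ereal_inf_lbound; exists (\bigcup_k seqDU G k) => //.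
  rewrite -seqDU_bigcup_eq; split.
    by apply: bigcup_countable => // k _; have [[]] := PG k.
  move=> x [k _ Akx]; have [[_ /(_ _ Akx) [c Gc xc]] _] := PG k.
  by exists c => //; exists k.
rewrite (esum_bigcupT _ _ (@trivIset_seqDU _ G) box_vol_ge0).
rewrite -nneseries_esumT; last first.
  by move=> k; apply: esum_ge0 => c _; exact: box_vol_ge0.
apply: lee_nneseries => [k _ _|k _].
  by apply: esum_ge0 => c _; exact: box_vol_ge0.
by apply: (le_trans _ (PG k).2); apply: box_vol_esumS; exact: subset_seqDU.
Qed.

HB.instance Definition _ := isOuterMeasure.Build R 'rV[R]_n lebesgue_outer
  lebesgue_outer0 lebesgue_outer_ge0 le_lebesgue_outer
  lebesgue_outer_sigma_subadditive.

(* R^n with the sigma-algebra of Lebesgue measurable sets; it is convertible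
   to 'rV[R]_n. *)
Definition Rn := caratheodory_type
  (lebesgue_outer : {outer_measure set 'rV[R]_n -> \bar R}).
HB.instance Definition _ := Measurable.on Rn.

Definition leb : set Rn -> \bar R := lebesgue_outer.
HB.instance Definition _ := Measure.copy leb
  ((lebesgue_outer : {outer_measure set 'rV[R]_n -> \bar R}) : set Rn -> _).

End lebesgue.

Arguments leb {R n}.

Section calculus.
Variables (R : realType) (n : nat).
Implicit Types (f g : 'rV[R]_n -> R) (Omega : set 'rV[R]_n).

Definition partial (i : 'I_n) f : 'rV[R]_n -> R := 'D_(delta_mx 0 i) f.

Definition iter_partial (s : seq 'I_n) f : 'rV[R]_n -> R := foldr partial f s.

Definition smooth f := forall (s : seq 'I_n),
  continuous (iter_partial s f) /\
  forall i x, derivable (iter_partial s f) x (delta_mx 0 i).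

Definition test_function Omega f :=
  [/\ smooth f, compact (closure [set x | f x != 0]) &
      closure [set x | f x != 0] `<=` Omega].

End calculus.

Section domains.
Variables (R : realType) (n : nat).
Implicit Types (Omega : set 'rV[R]_n).

Definition bounded_domain Omega :=
  [/\ open Omega, connected Omega, Omega !=set0 & bounded_set Omega].

(* Near each boundary point, after relabelling and reorienting the axes,
   Omega is the region above the graph of a smooth function of the n - 1
   other coordinates (col' i x is x without its i-th coordinate). *)
Definition smooth_boundary Omega :=
  forall x0, (closure Omega `\` interior Omega) x0 ->
  exists (r : R) (i : 'I_n) (b : bool) (gamma : 'rV[R]_n.-1 -> R),
    [/\ 0 < r, smooth gamma &
      Omega `&` ball x0 r =
      [set x | gamma (col' i x) < (-1) ^+ b * x 0 i] `&` ball x0 r].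

End domains.

Section sobolev.
Variables (R : realType) (n : nat) (Omega : set 'rV[R]_n).
Implicit Types (u v w g phi : Rn R n -> R).

(* Elements of the function spaces on Omega are represented by functions on
   R^n whose values outside Omega are irrelevant. *)
Definition in_Lp (p : \bar R) u : Prop := u \_ Omega \in Lfun (@leb R n) p.

Definition weak_partial (i : 'I_n) u g := forall phi, test_function Omega phi ->
  \int[leb]_(x in Omega) (u x * partial i phi x) =
  - \int[leb]_(x in Omega) (g x * phi x).

Definition H1 u := in_Lp 2%:E u /\
  forall i, exists g, in_Lp 2%:E g /\ weak_partial i u g.

(* The i-th component of the weak gradient, unique up to a null set for u in
   H^1(Omega). *)
Definition wD u (i : 'I_n) : Rn R n -> R :=
  get [set g | in_Lp 2%:E g /\ weak_partial i u g].

Definition dirichlet u v : R :=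
  \int[leb]_(x in Omega) \sum_(i < n) wD u i x * wD v i x.

Definition H1_norm u : R :=
  Num.sqrt (\int[leb]_(x in Omega) (u x ^+ 2) + dirichlet u u).

Definition H10 u := H1 u /\ forall e : R, 0 < e ->
  exists2 phi, test_function Omega phi & H1_norm (u \- phi) < e.

Definition eq_ae_Omega u v := u = v %[ae leb in Omega].

(* l is an eigenvalue of - Delta u = l u in Omega, u = 0 on the boundary. *)
Definition dirichlet_eigenvalue (l : R) := exists u,
  [/\ H10 u, ~ eq_ae_Omega u (cst 0) & forall phi, H10 phi ->
    dirichlet u phi = l * \int[leb]_(x in Omega) (u x * phi x)].

Definition lambda1 : R := inf [set l | dirichlet_eigenvalue l].

(* Weak solutions of - Delta u = f(x,u,v), - Delta v = g(x,u,v) in Omega,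
   u = v = 0 on the boundary. *)
Definition weak_solution (f g : Rn R n -> R -> R -> R) u v :=
  [/\ H10 u, H10 v,
    forall phi, H10 phi -> dirichlet u phi =
      \int[leb]_(x in Omega) (f x (u x) (v x) * phi x) &
    forall psi, H10 psi -> dirichlet v psi =
      \int[leb]_(x in Omega) (g x (u x) (v x) * psi x)].

Definition global_min_H10 (J : (Rn R n -> R) -> (Rn R n -> R) -> R) u v :=
  [/\ H10 u, H10 v & forall w z, H10 w -> H10 z -> J u v <= J w z].

(* (u1, v1) and (u2, v2) define the same element of the product space. *)
Definition eq_pair (p q : (Rn R n -> R) * (Rn R n -> R)) :=
  eq_ae_Omega p.1 q.1 /\ eq_ae_Omega p.2 q.2.

Definition dense_L2L2 (S : set ((Rn R n -> R) * (Rn R n -> R))) :=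
  forall f g, in_Lp 2%:E f -> in_Lp 2%:E g -> forall e : R, 0 < e ->
  exists2 ab, S ab &
    ('N[leb]_2%:E[EFin \o ((f \- ab.1)%R \_ Omega)] < e%:E)%E /\
    ('N[leb]_2%:E[EFin \o ((g \- ab.2)%R \_ Omega)] < e%:E)%E.

End sobolev.

Section nonlinearities.
Variable (R : realType).

Definition du (F : R -> R -> R) (u v : R) : R := derive1 (fun s => F s v) u.
Definition dv (F : R -> R -> R) (u v : R) : R := derive1 (F u) v.

Definition C1 (F : R -> R -> R) :=
  [/\ forall u v, derivable (fun s => F s v) u 1,
      forall u v, derivable (F u) v 1,
      continuous (fun z : R * R => du F z.1 z.2) &
      continuous (fun z : R * R => dv F z.1 z.2)].

(* The class A of nonlinearities: the growth exponent p is kept explicit, since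
   it is sometimes prescribed. *)
Definition classA_exp n (Omega : set 'rV[R]_n) (p : R)
    (H : Rn R n -> R -> R -> R) :=
  [/\ forall u v, measurable_fun (Omega : set (Rn R n)) (fun x => H x u v),
      forall x, Omega x -> C1 (H x),
      0 < p, (2 < n)%N -> p < (n%:R + 2) / (n%:R - 2) &
      exists M : R, forall x u v, Omega x ->
        (`|du (H x) u v| + `|dv (H x) u v|) / (1 + `|u| `^ p + `|v| `^ p) <= M].

Definition classA n (Omega : set 'rV[R]_n) (H : Rn R n -> R -> R -> R) :=
  exists p, classA_exp Omega p H.

End nonlinearities.

(* Main.v *)
Require Import Defs.
From HB Require Import structures.
From mathcomp Require Import all_boot all_order all_algebra.
From mathcomp Require Import all_classical all_reals all_analysis.
From mathcomp Require Import measurable_realfun ess_sup_inf ring lra zify.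
Set Implicit Arguments.
Unset Strict Implicit.
Unset Printing Implicit Defensive.
Import Order.TTheory GRing.Theory Num.Theory.
Import numFieldNormedType.Exports.
Local Open Scope classical_set_scope.
Local Open Scope ring_scope.

(* On V = H10 x H10 with the Dirichlet form a, the functional is
   J_y z = a z z / 2 - Psi z - <Theta z, y>, where y = (alpha, beta),
   Psi z = \int K(x, z) and Theta z = (sin Phi(z), cos Phi(z)). By Rellich's
   theorem Psi and Theta are continuous from the weak topology, and the bound
   on K makes J_y coercive. The values of Theta lie on a sphere of L^2 x L^2
   and Theta is not constant, so the midpoint h of two of its values is
   strictly inside that sphere.

   Suppose that J_y had a unique minimizer for every y in S. Evaluating J_y at
   the two points which define h gives min_x (J_y x + <h, y>) <= r for all y in
   S, with r independent of y. A minimax argument on finite dimensional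
   simplices, where uniqueness of minimizers is used, turns this into: for
   finitely many y_i in S a single x satisfies J_{y_i} x + <h, y_i> <= r for
   all i. On the other hand, as h is not a value of Theta and S is dense, near
   each value Theta x_0 some y in S, close to a large multiple of
   h - Theta x_0, violates this inequality. Choosing such y_i one after the
   other yields a bounded sequence x_k whose images Theta x_k are uniformly
   separated, against compactness. So some J_y, y in S, has two global
   minimizers, and a mountain pass between them is a third critical point.

   Rellich's and Sobolev's theorems come from averaging over boxes which are
   halved repeatedly: each halving changes the average by a difference quotient
   of the function, and the changes sum up geometrically in L^q for q below
   the critical exponent. *)

(** * Semi-inner products and weak limits *)

(** For fixed x the function y -> J_y x + <h, y> is affine: it equals a x x / 2 - Psi x + <h - Theta
    x, y>. Its minimum over x is therefore concave in y, and a minimax argument needs only that S be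
    convex. As S need not be closed, a maximum over y is taken only on simplices spanned by finitely
    many points of S, where it is attained. The pair (sin, cos) has constant norm because sin^2 +
    cos^2 = 1; the squared radius of the sphere is the measure of Omega. The bound on K enters
    through the least Rayleigh quotient m >= lambda_1: it gives a z z / 2 - Psi z >= (1/2 - eta / m)
    a z z. Growth of order p calls for the embedding into L^q with q = p + 1, and subcriticality is
    kept in the form (n - 2) (q - 2) < 4, which covers n = 2 and n > 2 at once. This expression is,
    up to a positive factor, the decay exponent in the halving estimate. *)

Section ultra.
Variable R : realType.

(* Every bounded real sequence converges along an ultrafilter, so limits along a
   fixed free ultrafilter replace the extraction of subsequences. *)
Lemma free_ultrafilter : exists U : set_system nat, UltraFilter U /\ \oo `<=` U.
Proof. exact: ultraFilterLemma. Qed.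

(** The image of an ultrafilter is an ultrafilter, and a compact interval that belongs to an
    ultrafilter contains a limit of it. *)
Lemma ultra_bounded_cvg (U : set_system nat) (f : nat -> R) (M : R) :
  UltraFilter U -> (forall k, `|f k| <= M) -> exists l : R, f @ U --> l.
Proof.
move=> UU fM; pose F : set_system R := f @ U.
have FF : ProperFilter F by exact: fmap_proper_filter.
have [G [GU FG]] := ultraFilterLemma FF.
have UF : UltraFilter F.
  split => // G' pG' FG'; apply/seteqP; split => // A G'A.
  have [//|UnA] := in_ultra_setVsetC (f @^-1` A) UU.
  have := FG' (~` A) UnA => G'nA.
  have := filterI G'A G'nA; rewrite setICr => /(_ _) H.
  by have := @filter_not_empty _ G' pG' H.
have := @segment_compact R (- M) M; rewrite compact_ultra => /(_ F UF).
have FM : F `[- M, M]%classic.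
  rewrite /F /fmap /=; apply: filterS (@filterT _ U _) => k _ /=.
  by rewrite in_itv /= -ler_norml.
by move=> /(_ FM) [l [_ Fl]]; exists l.
Qed.

Lemma free_cvg (U : set_system nat) (T : topologicalType) (f : nat -> T) (l : T) :
  \oo `<=` U -> f @ \oo --> l -> f @ U --> l.
Proof. by move=> oU fl A /fl /= /oU. Qed.

Lemma Rcvg_unique T (F : set_system T) {FF : ProperFilter F} (f : T -> R) (l l' : R) :
  f @ F --> l -> f @ F --> l' -> l = l'.
Proof. by apply: cvg_unique; exact: Rhausdorff. Qed.

Lemma Rcvg_ge T (F : set_system T) {FF : ProperFilter F} (f : T -> R) (l c : R) :
  f @ F --> l -> (forall k, c <= f k) -> c <= l.
Proof. by move=> fl H; apply: (@closed_cvg _ _ F FF f [set x | c <= x] (@closed_ge _ _) _ _ fl); near=> k; exact: H.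
Unshelve. all: by end_near. Qed.

Lemma Rcvg_le T (F : set_system T) {FF : ProperFilter F} (f : T -> R) (l c : R) :
  f @ F --> l -> (forall k, f k <= c) -> l <= c.
Proof. by move=> fl H; apply: (@closed_cvg _ _ F FF f [set x | x <= c] (@closed_le _ _) _ _ fl); near=> k; exact: H.
Unshelve. all: by end_near. Qed.

Lemma Rsqueeze0 T (F : set_system T) {FF : Filter F} (f h : T -> R) :
  (forall k, 0 <= f k <= h k) -> h @ F --> (0 : R) -> f @ F --> (0 : R).
Proof.
move=> H; apply: squeeze_cvgr; last exact: cvg_cst.
by near=> k; exact: H.
Unshelve. all: by end_near. Qed.

End ultra.

(* Functions equal almost everywhere are not identified, so the forms below are
   only positive semidefinite and limits are unique up to [sn a] = 0. *)
Record semi_inner (R : realType) (V : lmodType R) (a : V -> V -> R) : Prop :=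
  SemiInner {
  siDl : forall x y z, a (x + y) z = a x z + a y z;
  siZl : forall k x z, a (k *: x) z = k * a x z;
  siC : forall x y, a x y = a y x;
  si_ge0 : forall x, 0 <= a x x }.

Definition sn (R : realType) (V : lmodType R) (a : V -> V -> R) x : R := Num.sqrt (a x x).

Definition si_complete (R : realType) (V : lmodType R) (a : V -> V -> R) :=
  forall x_ : nat -> V,
  (forall e : R, 0 < e -> exists N, forall m n, (N <= m)%N -> (N <= n)%N ->
     sn a (x_ m - x_ n) < e) ->
  exists x, (fun k => sn a (x_ k - x)) @ \oo --> (0 : R).

Section semi_inner_theory.
Variables (R : realType) (V : lmodType R) (a : V -> V -> R).
Hypothesis ha : semi_inner a.
Implicit Types x y z : V.

Lemma siDr x y z : a x (y + z) = a x y + a x z.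
Proof. by rewrite siC// siDl// !(siC ha x). Qed.

Lemma siZr k x z : a x (k *: z) = k * a x z.
Proof. by rewrite siC// siZl// (siC ha x). Qed.

Lemma siNl x y : a (- x) y = - a x y.
Proof. by rewrite -scaleN1r siZl// mulN1r. Qed.

Lemma siNr x y : a x (- y) = - a x y.
Proof. by rewrite siC// siNl siC. Qed.

Lemma siBl x y z : a (x - y) z = a x z - a y z.
Proof. by rewrite siDl// siNl. Qed.

Lemma siBr x y z : a x (y - z) = a x y - a x z.
Proof. by rewrite siDr siNr. Qed.

Lemma si0l y : a 0 y = 0.
Proof. by rewrite -(scale0r 0) siZl// mul0r. Qed.

Lemma si0r y : a y 0 = 0.
Proof. by rewrite siC// si0l. Qed.

Definition siE := (siBl, siBr, siNl, siNr, siDl ha, siDr, siZl ha, siZr, si0l, si0r).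

Lemma sn_ge0 x : 0 <= sn a x. Proof. exact: sqrtr_ge0. Qed.

Lemma sn_sqr x : sn a x ^+ 2 = a x x.
Proof. by rewrite sqr_sqrtr// si_ge0. Qed.

Lemma si_CS2 x y : a x y ^+ 2 <= a x x * a y y.
Proof.
have H t : 0 <= a x x + 2 * t * a x y + t ^+ 2 * a y y.
  have := si_ge0 ha (x + t *: y); rewrite !siE (siC ha y x); lra.
have [ayy0|ayy0] := eqVneq (a y y) 0.
  rewrite ayy0 mulr0.
  have [->|axy0] := eqVneq (a x y) 0; first by rewrite expr0n.
  (* For [a y y = 0] the polynomial is affine in [t], and this [t] gives it the value -1. *)
  have := H (- (a x x + 1) / (2 * a x y)); rewrite ayy0.
  have -> : 2 * (- (a x x + 1) / (2 * a x y)) * a x y = - (a x x + 1) by field.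
  by lra.
have ayy : 0 < a y y by rewrite lt_neqAle eq_sym ayy0 si_ge0.
have := H (- a x y / a y y).
have -> : a x x + 2 * (- a x y / a y y) * a x y + (- a x y / a y y) ^+ 2 * a y y
   = (a x x * a y y - a x y ^+ 2) / a y y by field.
by rewrite pmulr_lge0 ?invr_gt0// subr_ge0.
Qed.

Lemma si_CS x y : `|a x y| <= sn a x * sn a y.
Proof.
rewrite -(@ler_pXn2r _ 2) ?nnegrE ?mulr_ge0 ?sn_ge0//.
by rewrite exprMn !sn_sqr// real_normK ?num_real// si_CS2.
Qed.

Lemma sn0 : sn a 0 = 0.
Proof. by rewrite /sn si0l sqrtr0. Qed.

Lemma snN x : sn a (- x) = sn a x.
Proof. by rewrite /sn !siE opprK. Qed.

Lemma snB x y : sn a (x - y) = sn a (y - x).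
Proof. by rewrite -snN opprB. Qed.

Lemma snZ k x : sn a (k *: x) = `|k| * sn a x.
Proof. by rewrite /sn !siE mulrA -expr2 sqrtrM ?sqr_ge0// sqrtr_sqr. Qed.

Lemma snD x y : sn a (x + y) <= sn a x + sn a y.
Proof.
rewrite -(@ler_pXn2r _ 2) ?nnegrE ?addr_ge0 ?sn_ge0//.
have := le_trans (ler_norm _) (si_CS x y).
by rewrite sqrrD !sn_sqr// !siE (siC ha y x); lra.
Qed.

Lemma sn_dist x y z : sn a (x - z) <= sn a (x - y) + sn a (y - z).
Proof. by apply: le_trans (snD _ _); rewrite addrA subrK. Qed.

Lemma sn_ltB x y : `|sn a x - sn a y| <= sn a (x - y).
Proof.
rewrite ler_norml; apply/andP; split.
  have := snD (y - x) x; rewrite subrK (snB y); lra.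
by have := snD (x - y) y; rewrite subrK; lra.
Qed.

Lemma sn_le2 x (M : R) : 0 <= M -> a x x <= M ^+ 2 -> sn a x <= M.
Proof.
by move=> M0 H; rewrite -(@ler_pXn2r _ 2) ?nnegrE ?sn_ge0// sn_sqr.
Qed.

Lemma cvg_sn_a T (F : set_system T) (x_ : T -> V) x y {FF : Filter F} :
  (fun k => sn a (x_ k - x)) @ F --> (0 : R) ->
  (fun k => a (x_ k) y) @ F --> (a x y : R).
Proof.
move=> H.
have H1 : (fun k => sn a (x_ k - x) * sn a y) @ F --> (0 : R).
  by rewrite -[X in _ --> X](mul0r (sn a y)); apply: cvgMl.
apply/cvgrPdist_lt => e e0; move/cvgr0Pnorm_lt : H1 => /(_ _ e0).
apply: filterS => k; rewrite distrC -siBl; apply: le_lt_trans.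
by rewrite (le_trans (si_CS _ _))// ler_norm.
Qed.

Lemma si_parallelogram x y :
  a (x - y) (x - y) = 2 * a x x + 2 * a y y - a (x + y) (x + y).
Proof. by rewrite !siE (siC ha y x); ring. Qed.

Hypothesis hcomp : si_complete a.

(** Direct method: the representing vector minimizes [a x x - 2 * l x]. The parallelogram identity
    makes a minimizing sequence Cauchy, and the first variation vanishes at its limit. *)
Lemma si_riesz (l : V -> R) (C : R) :
  (forall x y, l (x + y) = l x + l y) -> (forall k x, l (k *: x) = k * l x) ->
  (forall x, `|l x| <= C * sn a x) -> exists z, forall y, l y = a z y.
Proof.
move=> lD lZ lC.
pose F x := a x x - 2 * l x.
have FC x : - C ^+ 2 <= F x.
  rewrite /F -(sn_sqr x); have := lC x; rewrite ler_norml => /andP[_].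
  have := sqr_ge0 (sn a x - C); nra.
pose E := range F.
have Ei : has_inf E.
  by split; [exists (F 0), 0 | exists (- C ^+ 2) => _ [x _ <-]].
have [x_ x_P] : {x_ : nat -> V & forall k, F (x_ k) < inf E + k.+1%:R^-1}.
  apply: (@choice _ _ (fun k x => F x < inf E + k.+1%:R^-1)) => k.
  have k0 : 0 < k.+1%:R^-1 :> R by rewrite invr_gt0.
  by have [_ [x _ <-] H] := inf_adherent k0 Ei; exists x.
have Fm x : inf E <= F x by apply: ge_inf; [exact: Ei.2 | exists x].
have par x y : a (x - y) (x - y) = 2 * F x + 2 * F y - 4 * F (2^-1 *: (x + y)).
  rewrite si_parallelogram /F lZ lD !siE (siC ha y x); by field.
have hcomp_x : exists x, (fun k => sn a (x_ k - x)) @ \oo --> (0 : R).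
  apply: hcomp.
  move=> e e0.
  have e24 : 0 < e ^+ 2 / 4 by rewrite divr_gt0// exprn_gt0.
  have [N _ NP] := near_infty_natSinv_lt (PosNum e24).
  exists N => m n Nm Nn.
  rewrite -(@ltr_pXn2r _ 2) ?nnegrE ?sn_ge0 ?(ltW e0)// sn_sqr par.
  have hm : m.+1%:R^-1 < e ^+ 2 / 4 := NP m Nm.
  have hn : n.+1%:R^-1 < e ^+ 2 / 4 := NP n Nn.
  have hm' := x_P m; have hn' := x_P n; have hmn := Fm (2^-1 *: (x_ m + x_ n)).
  move: (F (x_ m)) (F (x_ n)) (F _) (inf E) hm hn hm' hn' hmn => p q r u.
  move: (m.+1%:R^-1) (n.+1%:R^-1) (e ^+ 2) => p' q' r' *; lra.
have [x xP] := hcomp_x; exists x => y.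
(* The difference [F (x_ k + t *: y) - F (x_ k)] is affine in [x_ k], so the inequality passes to
   the limit without continuity of [F]. *)
have key t k : 0 <= t ^+ 2 * a y y + 2 * t * (a (x_ k) y - l y) + k.+1%:R^-1.
  have := Fm (x_ k + t *: y); have := x_P k; rewrite /F lD lZ !siE (siC ha y (x_ k)).
  by move: (k.+1%:R^-1) => e; lra.
have key2 t : 0 <= t ^+ 2 * a y y + 2 * t * (a x y - l y).
  apply: (@Rcvg_ge _ _ \oo _ (fun k => t ^+ 2 * a y y + 2 * t * (a (x_ k) y - l y) + k.+1%:R^-1)) => //.
  rewrite -[X in _ --> X]addr0; apply: cvgD; last exact: cvg_harmonic.
  apply: cvgD; first exact: cvg_cst.
  apply: cvgMr; apply: cvgB; last exact: cvg_cst.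
  exact: cvg_sn_a.
have [//|d0] := eqVneq (a x y - l y) 0.
  by move/eqP; rewrite subr_eq0 => /eqP.
have A0 := si_ge0 ha y.
set d := a x y - l y in key2 d0 *.
(* The optimal value would be [- d / a y y]; adding 1 to the denominator covers [a y y = 0]. *)
have := key2 (- d / (a y y + 1)).
have -> : (- d / (a y y + 1)) ^+ 2 * a y y + 2 * (- d / (a y y + 1)) * d
  = - (d ^+ 2 * (a y y + 2) / (a y y + 1) ^+ 2) by field; lra.
have : 0 < d ^+ 2 * (a y y + 2) / (a y y + 1) ^+ 2.
  have d2 : 0 < d ^+ 2 by rewrite exprn_even_gt0.
  by rewrite divr_gt0//; [rewrite mulr_gt0//|rewrite exprn_gt0//]; clear -A0; lra.
lra.
Qed.

(** When [a] is complete, [si_riesz] shows that testing against vectors is testing against all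
    functionals bounded by [sn a]. *)
Definition wlim (U : set_system nat) (x_ : nat -> V) x :=
  forall y, (fun k => a (x_ k) y) @ U --> (a x y : R).

(** The scalar limits along [U] exist by boundedness and form a bounded functional of [y], which
    Riesz's theorem represents. *)
Lemma wlim_exists (U : set_system nat) (x_ : nat -> V) (M : R) :
  UltraFilter U -> (forall k, sn a (x_ k) <= M) -> exists x, wlim U x_ x.
Proof.
move=> UU xM.
have bd y k : `|a (x_ k) y| <= M * sn a y.
  by rewrite (le_trans (si_CS _ _))// ler_wpM2r ?sn_ge0.
have [l lP] : {l : V -> R & forall y, (fun k => a (x_ k) y) @ U --> l y}.
  apply: (@choice _ _ (fun y l => (fun k => a (x_ k) y) @ U --> l)) => y.
  exact: ultra_bounded_cvg (bd y).
have [z zP] : exists z, forall y, l y = a z y.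
  apply: (si_riesz (C := M)).
  - move=> x y; apply: (Rcvg_unique (lP (x + y))).
    rewrite (_ : (fun k => _) = (fun k => a (x_ k) x + a (x_ k) y)).
      by apply: cvgD.
    by apply/funext => k; rewrite siDr.
  - move=> k x; apply: (Rcvg_unique (lP (k *: x))).
    rewrite (_ : (fun k => _) = (fun j => k * a (x_ j) x)).
      by apply: cvgMr.
    by apply/funext => j; rewrite siZr.
  - move=> x; rewrite ler_norml; apply/andP; split.
      by apply: (Rcvg_ge (lP x)) => k; have := bd x k; rewrite ler_norml; case/andP.
    by apply: (Rcvg_le (lP x)) => k; have := bd x k; rewrite ler_norml; case/andP.
by exists z => y; rewrite -zP.
Qed.

Lemma wlim_dist (U : set_system nat) (x_ : nat -> V) x (l : R) {FU : Filter U} :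
  wlim U x_ x -> (fun k => a (x_ k) (x_ k)) @ U --> l ->
  (fun k => a (x_ k - x) (x_ k - x)) @ U --> l - a x x.
Proof.
move=> xx xl.
have -> : (fun k => a (x_ k - x) (x_ k - x)) =
   (fun k => a (x_ k) (x_ k) - 2 * a (x_ k) x + a x x).
  by apply/funext => k; rewrite !siE (siC ha x); ring.
have -> : l - a x x = l - 2 * a x x + a x x by ring.
apply: cvgD; last exact: cvg_cst.
by apply: cvgB => //; apply: cvgMr.
Qed.

Lemma wlim_lsc (U : set_system nat) (x_ : nat -> V) x (l : R) {FU : ProperFilter U} :
  wlim U x_ x -> (fun k => a (x_ k) (x_ k)) @ U --> l -> a x x <= l.
Proof.
move=> xx xl; rewrite -subr_ge0.
by apply: (Rcvg_ge (wlim_dist xx xl)) => k; exact: si_ge0.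
Qed.

Lemma wlim_strong (U : set_system nat) (x_ : nat -> V) x {FU : ProperFilter U} :
  wlim U x_ x -> (fun k => a (x_ k) (x_ k)) @ U --> (a x x : R) ->
  (fun k => sn a (x_ k - x)) @ U --> (0 : R).
Proof.
move=> xx xl; have := wlim_dist xx xl; rewrite subrr => /(_ _) H.
rewrite -(sqrtr0 R); by apply: continuous_cvg => //; exact: sqrt_continuous.
Qed.

Lemma wlim_unique (U : set_system nat) (x_ : nat -> V) x y {FU : ProperFilter U} :
  wlim U x_ x -> wlim U x_ y -> sn a (x - y) = 0.
Proof.
move=> hx hy; have H := Rcvg_unique (hx (x - y)) (hy (x - y)).
by rewrite /sn siBl H subrr sqrtr0.
Qed.

Lemma strong_wlim (U : set_system nat) (x_ : nat -> V) x {FU : Filter U} :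
  (fun k => sn a (x_ k - x)) @ U --> (0 : R) -> wlim U x_ x.
Proof. by move=> H y; exact: cvg_sn_a. Qed.

End semi_inner_theory.

Section weakly_continuous.
Variables (R : realType) (V : lmodType R) (a : V -> V -> R).
Hypotheses (ha : semi_inner a) (hcomp : si_complete a).

(** Sequential weak continuity on bounded sets. The bound [M] singles out the sequences for which
    [wlim_exists] provides a limit. *)
Definition wcont (Psi : V -> R) := forall U x_ x M, UltraFilter U -> \oo `<=` U ->
  (forall k, sn a (x_ k) <= M) -> wlim a U x_ x ->
  (fun k => Psi (x_ k)) @ U --> (Psi x : R).

Definition wscont (W : lmodType R) (b : W -> W -> R) (G : V -> W) :=
  forall U x_ x M, UltraFilter U -> \oo `<=` U ->
  (forall k, sn a (x_ k) <= M) -> wlim a U x_ x ->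
  (fun k => sn b (G (x_ k) - G x)) @ U --> (0 : R).

Definition coercive (J : V -> R) := forall c, exists M, forall x, J x <= c -> sn a x <= M.

(** The constant sequence [x] also converges weakly to [y]. Hence weakly continuous functionals do
    not see vectors of seminorm 0. *)
Lemma wcont_congr Psi x y : wcont Psi -> sn a (x - y) = 0 -> Psi x = Psi y.
Proof.
move=> hP xy; have [U [UU oU]] := free_ultrafilter.
apply: (Rcvg_unique (F := U) (f := fun=> Psi x)); first exact: cvg_cst.
apply: (hP U (fun=> x) y (sn a x) UU oU) => //.
by apply: (strong_wlim ha); rewrite xy; exact: cvg_cst.
Qed.

Lemma sn_congr x y : sn a (x - y) = 0 -> sn a x = sn a y.
Proof.
by move=> xy; apply/eqP; rewrite -subr_eq0 -normr_eq0 eq_le normr_ge0 andbT -xy sn_ltB.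
Qed.

Section functional.
Variable Psi : V -> R.
Hypothesis hPsi : wcont Psi.
Let J x := 2^-1 * a x x - Psi x.

Lemma functional_congr x y : sn a (x - y) = 0 -> J x = J y.
Proof.
by move=> xy; rewrite /J (wcont_congr hPsi xy) -!(sn_sqr ha) (sn_congr xy).
Qed.

(** The quadratic part is lower semicontinuous and [Psi] converges. Equality [J x = c] forces the
    seminorms to converge as well, and weak convergence with convergence of seminorms is strong. *)
Lemma wlim_functional (U : set_system nat) x_ x M (c : R) : UltraFilter U ->
  \oo `<=` U -> (forall k, sn a (x_ k) <= M) -> wlim a U x_ x ->
  (fun k => J (x_ k)) @ U --> c ->
  J x <= c /\ (J x = c -> (fun k => sn a (x_ k - x)) @ U --> (0 : R)).
Proof.
move=> UU oU xM xx Jc.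
have Px := hPsi UU oU xM xx.
have H : (fun k => a (x_ k) (x_ k)) @ U --> 2 * (c + Psi x).
  rewrite (_ : (fun k => _) = (fun k => 2 * (J (x_ k) + Psi (x_ k)))).
    by apply: cvgMr; exact: cvgD.
  by apply/funext => k; rewrite /J; field.
split=> [|Jx].
  have := wlim_lsc ha xx H => /(_ _) H'; rewrite /J.
  by move: (a x x) (Psi x) H' => p q; lra.
apply: (wlim_strong ha xx); rewrite (_ : a x x = 2 * (c + Psi x))//.
by rewrite -Jx /J; field.
Qed.

Lemma functional_min : coercive J -> (exists m, forall x, m <= J x) ->
  exists x, forall y, J x <= J y.
Proof.
move=> hco [m mJ].
pose E := range J.
have Ei : has_inf E by split; [exists (J 0), 0 | exists m => _ [x _ <-]].
have [x_ x_P] : {x_ : nat -> V & forall k, J (x_ k) < inf E + k.+1%:R^-1}.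
  apply: (@choice _ _ (fun k x => J x < inf E + k.+1%:R^-1)) => k.
  have k0 : 0 < k.+1%:R^-1 :> R by rewrite invr_gt0.
  by have [_ [x _ <-] H] := inf_adherent k0 Ei; exists x.
have Em x : inf E <= J x by apply: ge_inf; [exact: Ei.2 | exists x].
have [M MP] := hco (inf E + 1).
have xM k : sn a (x_ k) <= M.
  apply: MP; rewrite (le_trans (ltW (x_P k)))// lerD2l invf_le1//.
  by rewrite ler1n.
have [U [UU oU]] := free_ultrafilter.
have [x xx] := wlim_exists ha hcomp UU xM.
exists x => y; apply: le_trans (Em y).
apply: (wlim_functional UU oU xM xx _).1; apply: free_cvg => //.
apply: (@squeeze_cvgr _ _ _ _ (fun=> inf E) (fun k => inf E + k.+1%:R^-1)).
- by near=> k; rewrite Em (ltW (x_P k)).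
- exact: cvg_cst.
- by rewrite -[X in _ --> X]addr0; apply: cvgD; [exact: cvg_cst|exact: cvg_harmonic].
Unshelve. all: by end_near. Qed.

Lemma wcont_bounded M : exists C, forall x, sn a x <= M -> `|Psi x| <= C.
Proof.
apply: contrapT => /forallNP H.
have [x_ x_P] : {x_ : nat -> V & forall k, sn a (x_ k) <= M /\ k%:R < `|Psi (x_ k)|}.
  apply: (@choice _ _ (fun k x => sn a x <= M /\ k%:R < `|Psi x|)) => k.
  have /existsNP[x /not_implyP[xM /negP]] := H k%:R.
  by rewrite -ltNge; exists x.
have [U [UU oU]] := free_ultrafilter.
have xM k := (x_P k).1.
have [x xx] := wlim_exists ha hcomp UU xM.
have Px := hPsi UU oU xM xx.
have : U (fun k => `|Psi (x_ k)| < `|Psi x| + 1).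
  move/cvgrPdist_lt : Px => /(_ _ ltr01); apply: filterS => k.
  move=> H1; have := lerB_dist (Psi (x_ k)) (Psi x); rewrite (distrC (Psi x)) in H1.
  lra.
have : U (fun k => `|Psi x| + 1 < k%:R).
  by apply: oU; exact: nbhs_infty_gtr.
move=> H1 H2; have [k [kx1 kx2]] := filter_ex (filterI H1 H2).
by have := (x_P k).2; rewrite ltNge (ltW (lt_trans kx2 kx1)).
Qed.

End functional.

Section gradient.
Variable G : V -> V.
Hypothesis hG : wscont a G.

Lemma wscont_bounded M : exists C, forall x, sn a x <= M -> sn a (G x) <= C.
Proof.
apply: contrapT => /forallNP H.
have [x_ x_P] : {x_ : nat -> V & forall k, sn a (x_ k) <= M /\ k%:R < sn a (G (x_ k))}.
  apply: (@choice _ _ (fun k x => sn a x <= M /\ k%:R < sn a (G x))) => k.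
  have /existsNP[x /not_implyP[xM /negP]] := H k%:R.
  by rewrite -ltNge; exists x.
have [U [UU oU]] := free_ultrafilter.
have xM k := (x_P k).1.
have [x xx] := wlim_exists ha hcomp UU xM.
have Px := hG UU oU xM xx.
have : U (fun k => sn a (G (x_ k)) < sn a (G x) + 1).
  move/cvgrPdist_lt : Px => /(_ _ ltr01); apply: filterS => k /=.
  rewrite sub0r normrN ger0_norm ?sn_ge0//.
  move=> H1; have := snD ha (G (x_ k) - G x) (G x); rewrite subrK; lra.
have : U (fun k => sn a (G x) + 1 < k%:R).
  by apply: oU; exact: nbhs_infty_gtr.
move=> H1 H2; have [k [kx1 kx2]] := filter_ex (filterI H1 H2).
by have := (x_P k).2; rewrite ltNge (ltW (lt_trans kx2 kx1)).
Qed.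

(** By compactness: pairs that violate the bound at distances tending to 0 have a common weak limit,
    at which both images converge. This uniform continuity takes the place of a Lipschitz condition
    in the descent steps below. *)
Lemma wscont_unif M (e : R) : 0 < e -> exists2 d, 0 < d & forall x y, sn a x <= M ->
  sn a y <= M -> sn a (x - y) <= d -> sn a (G x - G y) <= e.
Proof.
move=> e0; apply: contrapT => /forall2NP H.
have [x_ x_P] : {x_ : nat -> V * V & forall k, [/\ sn a (x_ k).1 <= M,
    sn a (x_ k).2 <= M, sn a ((x_ k).1 - (x_ k).2) <= k.+1%:R^-1 &
    e < sn a (G (x_ k).1 - G (x_ k).2)]}.
  apply: (@choice _ _ (fun k z => [/\ sn a z.1 <= M,
    sn a z.2 <= M, sn a (z.1 - z.2) <= k.+1%:R^-1 & e < sn a (G z.1 - G z.2)])) => k.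
  have [/negP|] := H k.+1%:R^-1; first by rewrite -leNgt leNgt invr_gt0 ltr0Sn.
  move=> /existsNP[x] /existsNP[y] /not_implyP[xM] /not_implyP[yM] /not_implyP[xy] /negP.
  by rewrite -ltNge => exy; exists (x, y).
have [U [UU oU]] := free_ultrafilter.
have xM k : sn a (x_ k).1 <= M by case: (x_P k).
have yM k : sn a (x_ k).2 <= M by case: (x_P k).
have [x xx] := wlim_exists ha hcomp UU xM.
have d0 : (fun k => sn a ((x_ k).1 - (x_ k).2)) @ U --> (0 : R).
  apply: free_cvg => //.
  apply: (@squeeze_cvgr _ _ _ _ (fun=> 0) (fun k => k.+1%:R^-1)).
  - by near=> k; rewrite sn_ge0; case: (x_P k).
  - exact: cvg_cst.
  - exact: cvg_harmonic.
have yx : wlim a U (fun k => (x_ k).2) x.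
  move=> z; rewrite -[a x z]subr0.
  rewrite (_ : (fun k => _) = (fun k => a (x_ k).1 z - a ((x_ k).1 - (x_ k).2) z)).
    apply: cvgB; first exact: xx.
    rewrite -(si0l ha z); apply: (cvg_sn_a ha).
    by under eq_fun do rewrite subr0.
  by apply/funext => k; rewrite siBl//; ring.
have H1 := hG UU oU xM xx; have H2 := hG UU oU yM yx.
have H3 : (fun k => sn a (G (x_ k).1 - G x) + sn a (G (x_ k).2 - G x)) @ U --> (0 : R).
  by rewrite -[X in _ --> X]addr0; exact: cvgD.
have [k] := filter_ex ((cvgrPdist_lt _ _).1 H3 _ e0).
rewrite sub0r normrN ger0_norm ?addr_ge0 ?sn_ge0//= => H4.
have [_ _ _ H5] := x_P k.
have := sn_dist ha (G (x_ k).1) (G x) (G (x_ k).2); rewrite (snB ha (G x)); lra.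
Unshelve. all: by end_near. Qed.

End gradient.

End weakly_continuous.

(** * The mountain pass *)

Section mountain_pass.
Variables (R : realType) (V : lmodType R) (a : V -> V -> R).
Hypotheses (ha : semi_inner a) (hcomp : si_complete a).
Variables (Psi : V -> R) (G : V -> V).
Hypotheses (hPsi : wcont a Psi) (hG : wscont a a G).
(** Differentiability enters in mean value form only: [G] acts as the gradient of [Psi], and [g] as
    that of [J]. *)
Hypothesis hMVT : forall x y, exists2 s, 0 <= s <= 1 &
  Psi (x + y) - Psi x = a (G (x + s *: y)) y.
Let J x := 2^-1 * a x x - Psi x.
Let g x := x - G x.

(** For [t <= 1] the quadratic term of the expansion consumes at most half of the first-order
    decrease; the last term is the error from the variation of [G] along the step. *)
Lemma gradient_step x (t e : R) : 0 <= t <= 1 ->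
  (forall s, 0 <= s <= 1 -> sn a (G (x - (s * t) *: g x) - G x) <= e) ->
  J (x - t *: g x) <= J x - t * (sn a (g x) ^+ 2 / 2) + t * (e * sn a (g x)).
Proof.
move=> /andP[t0 t1] H; have [s s01 E] := hMVT x (- (t *: g x)).
rewrite scalerN scalerA in E; have := H s s01; set z := x - (s * t) *: g x in E * => Hz.

have CS : a (G z - G x) (g x) <= e * sn a (g x).
  apply: le_trans (ler_norm _) _; apply: le_trans (si_CS ha _ _) _.
  by rewrite ler_wpM2r ?sn_ge0.
have Eg : a x (g x) = a (g x) (g x) + a (G x) (g x).
  by rewrite {2}/g siBl//; ring.
have EJ : J (x - t *: g x) = J x - t * a (g x) (g x) + t ^+ 2 / 2 * a (g x) (g x)
    + t * a (G z - G x) (g x).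
  rewrite /J; have -> : Psi (x - t *: g x) = Psi x + a (G z) (- (t *: g x)).
    by rewrite -E; ring.
  move: (g x) Eg (z) => w Ew z'.
  by rewrite !(siE ha) (siC ha w x) Ew; field.
rewrite EJ sn_sqr//.
have A0 := si_ge0 ha (g x).
move: (a (g x) (g x)) (a (G z - G x) (g x)) (e * sn a (g x)) A0 CS => p q r p0 qr.
have : t * q <= t * r by rewrite ler_wpM2l.
have : t ^+ 2 * p <= t * p by rewrite ler_wpM2r// expr2 ler_piMl.
by lra.
Qed.

Lemma min_critical x : (forall y, J x <= J y) -> sn a (g x) = 0.
Proof.
move=> xmin; apply/eqP; rewrite eq_le sn_ge0 andbT leNgt; apply/negP => d0.
set d := sn a (g x) in d0 *.
have e0 : 0 < d / 8 by lra.
have [dl dl0 H] := wscont_unif ha hcomp hG (sn a x + d) e0.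
(* The step has length [t * d <= dl], so [G] varies by at most [d / 8] along it, while any variation
   below [d / 2] yields a strict decrease. *)
pose t := Num.min 1 (dl / d).
have t0 : 0 < t by rewrite lt_min ltr01 divr_gt0.
have t1 : t <= 1 by rewrite ge_min lexx.
have tdl : t * d <= dl by rewrite -ler_pdivlMr// ge_min lexx orbT.
have := @gradient_step x t (d / 8); rewrite (ltW t0) t1 => /(_ isT) Hs.
have : J (x - t *: g x) <= J x - t * (d ^+ 2 / 2) + t * (d / 8 * d).
  apply: Hs => s /andP[s0 s1]; apply: H.
  - apply: le_trans (snD ha _ _) _; rewrite lerD2l snN// snZ// -/d ger0_norm ?mulr_ge0 ?(ltW t0)//.
    by rewrite ler_piMl// ?(ltW d0)// mulr_ile1// ltW.
  - by rewrite lerDl ltW.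
  - rewrite addrAC subrr sub0r snN// snZ// -/d ger0_norm ?mulr_ge0 ?(ltW t0)//.
    by rewrite -mulrA (le_trans _ tdl)// ler_piMl// mulr_ge0// ltW.
have := xmin (x - t *: g x).
have : 0 < t * d ^+ 2 by rewrite mulr_gt0// exprn_gt0.
by rewrite !mulrA; lra.
Qed.

Hypothesis hco : coercive a J.
Variables x1 x2 : V.
Hypotheses (x1min : forall y, J x1 <= J y) (x2min : forall y, J x2 <= J y).
Hypothesis x12 : 0 < sn a (x1 - x2).

(* A path from [x1] to [x2] below level [c] is replaced by a finite chain with
   small steps. At the least admissible level, if there were no critical point
   far from [x1] and [x2], one gradient step applied to a chain would lower it
   below that level. *)
Definition chain (e c : R) := exists (N : nat) (f : nat -> V),
  [/\ sn a (f 0%N - x1) = 0, sn a (f N - x2) = 0,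
     (forall k, (k < N)%N -> sn a (f k.+1 - f k) <= e) &
     forall k, (k <= N)%N -> J (f k) <= c].

Definition admissible c := forall e, 0 < e -> chain e c.

Lemma J_bounded M : exists C, forall x, sn a x <= M -> J x <= C.
Proof.
have [C HC] := wcont_bounded ha hcomp hPsi M.
exists (2^-1 * M ^+ 2 + C) => x xM.
have := HC x xM; rewrite ler_norml => /andP[h _].
have : a x x <= M ^+ 2 by rewrite -sn_sqr// ler_pXn2r// nnegrE ?sn_ge0// (le_trans _ xM)// sn_ge0.
by rewrite /J; lra.
Qed.

Lemma admissible_nonempty : exists c, admissible c.
Proof.
have [C HC] := J_bounded (sn a x1 + sn a (x2 - x1)).
exists C => e e0.
set d := sn a (x2 - x1).
have d0 : 0 <= d by exact: sn_ge0.
have [N NP] : exists N, d < e * N.+1%:R.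
  have [N _ /(_ N (leqnn N)) /= NP] := nbhs_infty_gtr (d / e).
  exists N; rewrite mulrC -ltr_pdivrMr// (lt_trans NP)//.
  by rewrite ltr_nat.
exists N.+1, (fun k => x1 + (k%:R / N.+1%:R) *: (x2 - x1)); split.
- by rewrite mul0r scale0r addr0 subrr sn0.
- by rewrite divff ?pnatr_eq0// scale1r [x1 + _]addrC subrK subrr sn0.
- move=> k kN; rewrite opprD addrACA subrr add0r -scalerBl -mulrBl -natrB// subSnn.
  by rewrite snZ// mul1r ger0_norm ?invr_ge0// mulrC ler_pdivrMr// ltW.
- move=> k kN; apply: HC; apply: le_trans (snD ha _ _) _; rewrite lerD2l snZ//.
  rewrite ger0_norm ?divr_ge0// ler_piMl// ler_pdivrMr// mul1r ler_nat//.
Qed.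

Let A := [set c | admissible c].

Lemma admissible_ge c : A c -> J x1 <= c.
Proof. by move=> /(_ 1 ltr01) [N [f [_ _ _ H]]]; apply: le_trans (x1min _) (H 0%N _). Qed.

Lemma admissible_has_inf : has_inf A.
Proof.
split; first by have [c] := admissible_nonempty; exists c.
by exists (J x1) => c; exact: admissible_ge.
Qed.

(** A discrete intermediate value theorem: the first point of the chain at distance at least half of
    [sn a (x1 - x2)] from [x1] overshoots that distance by at most one step. *)
Lemma chain_crossing e c : 0 < e -> chain e c -> exists2 y, J y <= c &
  `|sn a (y - x1) - sn a (x1 - x2) / 2| <= e.
Proof.
have r0 := x12; move=> e0 [N [f [f0 fN fe fc]]]; set r := sn a (x1 - x2) in r0 *.
have fNr : r / 2 <= sn a (f N - x1).
  have := sn_dist ha x1 (f N) x2; rewrite fN addr0 (snB ha x1 (f N)) -/r; lra.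
have ex : exists k, r / 2 <= sn a (f k - x1) by exists N.
have [k kr kmin] := ex_minnP ex.
have kN : (k <= N)%N by apply: kmin.
exists (f k); first exact: fc.
case: k => [|k] in kr kmin kN *; first by move: kr; rewrite f0; lra.
have : sn a (f k - x1) < r / 2.
  by rewrite ltNge; apply/negP => /kmin; rewrite ltnn.
have := sn_dist ha (f k.+1) (f k) x1; have := fe k kN.
by rewrite ger0_norm ?subr_ge0//; lra.
Qed.

Lemma third_critical_point : exists x3, [/\ sn a (g x3) = 0, 0 < sn a (x3 - x1) &
  0 < sn a (x3 - x2)].
Proof.
apply: contrapT => no3.
have no3P x : sn a (g x) = 0 -> sn a (x - x1) = 0 \/ sn a (x - x2) = 0.
  move=> gx; apply: contrapT => /not_orP[h1 h2]; apply: no3; exists x; split => //.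
    by rewrite lt_neqAle sn_ge0 andbT eq_sym; apply/eqP.
  by rewrite lt_neqAle sn_ge0 andbT eq_sym; apply/eqP.
pose m := J x1.
have mE : J x2 = m by apply/eqP; rewrite eq_le x1min x2min.
have critm x : sn a (g x) = 0 -> J x = m.
  move=> /no3P[] /(functional_congr ha hPsi); first by [].
  by rewrite -mE.
pose r := sn a (x1 - x2); have r0 : 0 < r by exact: x12.
(* A minimum on the sphere of radius [r / 2] around [x1] would be a critical point away from both
   [x1] and [x2]. *)
have nocross x : `|sn a (x - x1)| = r / 2 -> m < J x.
  move=> xr; rewrite lt_neqAle x1min andbT; apply/eqP => xm.
  have xr' : sn a (x - x1) = r / 2 by rewrite -xr ger0_norm ?sn_ge0.
  have /no3P[] : sn a (g x) = 0 by apply: min_critical => y; rewrite -xm.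
    by rewrite xr'; lra.
  have := sn_dist ha x1 x x2; rewrite (snB ha x1 x) xr' -/r; lra.
have hA := admissible_has_inf.
pose c := inf A.
(* Otherwise chains of nearly minimal level cross that sphere at points whose values tend to [m].
   They have a weak limit, which is a minimizer; convergence to it is therefore strong, and it lies
   on the sphere. *)
have mc : m < c.
  rewrite ltNge; apply/negP => cm.
  have [y_ y_P] : {y_ : nat -> V & forall k, J (y_ k) <= m + k.+1%:R^-1 /\
      `|sn a (y_ k - x1) - r / 2| <= k.+1%:R^-1}.
    apply: (@choice _ _ (fun k y => J y <= m + k.+1%:R^-1 /\
      `|sn a (y - x1) - r / 2| <= k.+1%:R^-1)) => k.
    have k0 : 0 < k.+1%:R^-1 :> R by rewrite invr_gt0.
    have [c' Ac' c'lt] := inf_adherent k0 hA.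
    have [y yc yr] := chain_crossing k0 (Ac' _ k0).
    exists y; split => //; rewrite (le_trans yc)// (le_trans (ltW c'lt))//.
    by rewrite lerD2r.
  have [M HM] := hco (m + 1).
  have k1 k : k.+1%:R^-1 <= 1 :> R by rewrite invf_le1// ler1n.
  have yM k : sn a (y_ k) <= M.
    by apply: HM; apply: le_trans (y_P k).1 _; rewrite lerD2l.
  have [U [UU oU]] := free_ultrafilter.
  have [y yy] := wlim_exists ha hcomp UU yM.
  have Jm : (fun k => J (y_ k)) @ U --> m.
    apply: free_cvg => //.
    apply: (@squeeze_cvgr _ _ _ _ (fun=> m) (fun k => m + k.+1%:R^-1)).
    - by near=> k; rewrite x1min; case: (y_P k).
    - exact: cvg_cst.
    - by rewrite -[X in _ --> X]addr0; apply: cvgD; [exact: cvg_cst|exact: cvg_harmonic].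
  have [ym yst] := wlim_functional ha hPsi UU oU yM yy Jm.
  have ymE : J y = m by apply/eqP; rewrite eq_le ym x1min.
  have ys := yst ymE.
  have cr : (fun k => sn a (y_ k - x1)) @ U --> r / 2.
    apply: free_cvg => //; apply/cvgrPdist_le => e e0.
    near=> k; rewrite distrC; apply: le_trans (y_P k).2 _; near: k.
    by have [N _ NP] := near_infty_natSinv_lt (PosNum e0); exists N => // k /NP /ltW.
  have cr2 : (fun k => sn a (y_ k - x1)) @ U --> sn a (y - x1).
    apply/cvgrPdist_lt => e e0; move/cvgrPdist_lt : ys => /(_ e e0).
    apply: filterS => k; rewrite sub0r normrN ger0_norm ?sn_ge0//; apply: le_lt_trans.
    rewrite distrC; apply: le_trans (sn_ltB ha _ _) _.
    by rewrite opprB addrA subrK.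
  have : m < J y.
    by apply: nocross; rewrite ger0_norm ?sn_ge0//; exact: Rcvg_unique cr2 cr.
  by rewrite ymE ltxx.
(* The Palais-Smale condition in uniform form. Almost critical points with values tending to [c]
   converge strongly to a critical point of level [c], whereas by [critm] all critical points have
   level [m < c]. *)
have [kap [kap0 [e0 [e00 PS]]]] : exists kap, 0 < kap /\ exists e0, 0 < e0 /\
    forall x, c - e0 <= J x <= c + e0 -> kap <= sn a (g x).
  apply: contrapT => H.
  have [y_ y_P] : {y_ : nat -> V & forall k, (c - k.+1%:R^-1 <= J (y_ k) <= c + k.+1%:R^-1) /\
      sn a (g (y_ k)) <= k.+1%:R^-1}.
    apply: (@choice _ _ (fun k y => (c - k.+1%:R^-1 <= J y <= c + k.+1%:R^-1) /\
      sn a (g y) <= k.+1%:R^-1)) => k.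
    have k0 : 0 < k.+1%:R^-1 :> R by rewrite invr_gt0.
    apply: contrapT => /forallNP H'; apply: H; exists k.+1%:R^-1; split => //.
    exists k.+1%:R^-1; split => // x hx; rewrite leNgt; apply/negP => /ltW h.
    by apply: (H' x).
  have [M HM] := hco (c + 1).
  have k1 k : k.+1%:R^-1 <= 1 :> R by rewrite invf_le1// ler1n.
  have yM k : sn a (y_ k) <= M.
    apply: HM; have [/andP[_ h] _] := y_P k.
    by apply: le_trans h _; rewrite lerD2l.
  have [U [UU oU]] := free_ultrafilter.
  have [y yy] := wlim_exists ha hcomp UU yM.
  have Gy := hG UU oU yM yy.
  have gy : (fun k => sn a (g (y_ k))) @ U --> (0 : R).
    apply: free_cvg => //.
    apply: (@squeeze_cvgr _ _ _ _ (fun=> 0) (fun k => k.+1%:R^-1)).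
    - by near=> k; rewrite sn_ge0; case: (y_P k).
    - exact: cvg_cst.
    - exact: cvg_harmonic.
  have ys : (fun k => sn a (y_ k - G y)) @ U --> (0 : R).
    have H3 : (fun k => sn a (g (y_ k)) + sn a (G (y_ k) - G y)) @ U --> (0 : R).
      by rewrite -[X in _ --> X]addr0; exact: cvgD.
    by apply: Rsqueeze0 H3 => k; rewrite sn_ge0 /= /g sn_dist.
  have yG : sn a (y - G y) = 0 by exact: wlim_unique yy (strong_wlim ha ys).
  have Jy : J y = c.
    have ys' : (fun k => sn a (y_ k - y)) @ U --> (0 : R).
      apply: Rsqueeze0 ys => k; rewrite sn_ge0 /=.
      have := sn_dist ha (y_ k) (G y) y; rewrite (snB ha (G y)) yG; lra.
    have aa : (fun k => a (y_ k) (y_ k)) @ U --> (a y y : R).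
      rewrite -(sn_sqr ha y) (_ : (fun k => _) = (fun k => sn a (y_ k) * sn a (y_ k))); last first.
        by apply/funext => k; rewrite -(sn_sqr ha).
      have sy : (fun k => sn a (y_ k)) @ U --> (sn a y : R).
        apply/cvgrPdist_lt => e e1; move/cvgrPdist_lt : ys' => /(_ e e1).
        apply: filterS => k; rewrite sub0r normrN ger0_norm ?sn_ge0//; apply: le_lt_trans.
        by rewrite distrC; exact: sn_ltB.
      by rewrite expr2; exact: cvgM.
    have JJ : (fun k => J (y_ k)) @ U --> (J y : R).
      by apply: cvgB; [exact: cvgMr | exact: hPsi yy].
    apply: (Rcvg_unique JJ); apply: free_cvg => //.
    apply/cvgrPdist_le => e e1; near=> k; rewrite distrC.
    have [hk _] := y_P k.
    apply: (@le_trans _ _ k.+1%:R^-1); first by rewrite ler_distl.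
    near: k.
    by have [N _ NP] := near_infty_natSinv_lt (PosNum e1); exists N => // k /NP /ltW.
  have gy0 : sn a (g y) = 0 := yG.
  by move: mc; rewrite -Jy (critm _ gy0) ltxx.
have [R0 HR0] := hco (c + 1).
have [B0 HB0] := wscont_bounded ha hcomp hG R0.
pose B := Num.max 0 (R0 + B0) + 1.
have B0' : 0 < B.
  have : 0 <= Num.max 0 (R0 + B0) by rewrite le_max lexx.
  by rewrite /B; lra.
have gB x : sn a x <= R0 -> sn a (g x) <= B.
  move=> xR; apply: (@le_trans _ _ (R0 + B0)).
    rewrite /g; apply: le_trans (snD ha _ _) _; rewrite snN//.
    by apply: lerD => //; exact: HB0.
  by rewrite /B ler_wpDr// le_max lexx orbT.
have kap4 : 0 < kap / 4 by lra.
have [dl dl0 Hdl] := wscont_unif ha hcomp hG (R0 + B) kap4.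
(* The second bound keeps steps shorter than [dl], so that [G] varies by at most [kap / 4]; the
   third limits a possible increase of [J] in one step to [e0 / 2]. *)
pose t := Num.min 1 (Num.min (dl / B) (e0 / (2 * (kap / 4 * B)))).
have kB : 0 < 2 * (kap / 4 * B) by rewrite !mulr_gt0.
have t0 : 0 < t by rewrite !lt_min ltr01 !divr_gt0.
have t1 : t <= 1 by rewrite ge_min lexx.
have tdl : t * B <= dl by rewrite -ler_pdivlMr// !ge_min lexx !orbT.
have te0 : t * (kap / 4 * B) <= e0 / 2.
  suff : t * (2 * (kap / 4 * B)) <= e0 by lra.
  by rewrite -ler_pdivlMr// !ge_min lexx !orbT.
pose eta x := x - t *: g x.
have step x : sn a x <= R0 ->
    J (eta x) <= J x - t * (sn a (g x) ^+ 2 / 2) + t * (kap / 4 * sn a (g x)).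
  move=> xR; apply: gradient_step; first by rewrite ltW.
  move=> s /andP[s0 s1]; apply: Hdl.
  - apply: le_trans (snD ha _ _) _; apply: lerD => //.
    rewrite snN// snZ// ger0_norm ?mulr_ge0 ?(ltW t0)//.
    apply: le_trans (gB _ xR).
    by rewrite ler_piMl// ?sn_ge0// mulr_ile1// ltW.
  - by apply: le_trans xR _; rewrite lerDl ltW.
  - rewrite addrAC subrr sub0r snN// snZ// ger0_norm ?mulr_ge0 ?(ltW t0)//.
    apply: le_trans tdl; rewrite -mulrA.
    apply: (@le_trans _ _ (t * sn a (g x))).
      by rewrite ler_piMl// mulr_ge0// ?sn_ge0// ltW.
    by rewrite ler_wpM2l ?gB// ltW.
(* Where the gradient is at least [kap], a step lowers [J] by at least [t * kap ^+ 2 / 4], that is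
   [2 * u]. Starting below [c + e2 <= c + u] it ends below [c - u]; starting below [c - e0] it ends
   below [c - e0 / 2]. *)
pose u := t * kap ^+ 2 / 8.
have u0 : 0 < u by rewrite /u divr_gt0// mulr_gt0// exprn_gt0.
pose e2 := Num.min 1 (Num.min e0 u).
have e20 : 0 < e2 by rewrite !lt_min ltr01 e00 u0.
have e21 : e2 <= 1 by rewrite ge_min lexx.
have e2e0 : e2 <= e0 by rewrite !ge_min lexx !orbT.
have e2u : e2 <= u by rewrite !ge_min lexx !orbT.
pose c' := Num.max (c - u) (c - e0 / 2).
have c'c : c' < c by rewrite gt_max; apply/andP; split; lra.
have low x : J x <= c + e2 -> J (eta x) <= c'.
  move=> Jx; have xR : sn a x <= R0 by apply: HR0; lra.
  have Hs := step x xR; have G0 := sn_ge0 a (g x).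
  have [Jlow|Jhigh] := ltP (J x) (c - e0).
    rewrite le_max; apply/orP; right.
    have h1 : t * (sn a (g x) ^+ 2 / 2) >= 0.
      by rewrite mulr_ge0 ?(ltW t0)// divr_ge0// exprn_ge0.
    have h2 : t * (kap / 4 * sn a (g x)) <= t * (kap / 4 * B).
      by rewrite ler_wpM2l ?(ltW t0)// ler_wpM2l ?(ltW kap4)// gB.
    lra.
  rewrite le_max; apply/orP; left.
  have kg : kap <= sn a (g x) by apply: PS; apply/andP; split; lra.
  have h : kap ^+ 2 / 4 <= sn a (g x) ^+ 2 / 2 - kap / 4 * sn a (g x).
    by move: (sn a (g x)) kg G0 => q *; nra.
  have : t * (kap ^+ 2 / 4) <= t * (sn a (g x) ^+ 2 / 2 - kap / 4 * sn a (g x)).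
    by rewrite ler_wpM2l// ltW.
  by rewrite /u in e2u *; lra.
have : c <= c'.
  apply: ge_inf; first exact: hA.2.
  move=> e e_0.
  have e_4 : 0 < e / 2 by lra.
  have [d2 d20 Hd2] := wscont_unif ha hcomp hG R0 e_4.
  have [c1 Ac1 c1lt] := inf_adherent e20 hA.
  have mind : 0 < Num.min (e / 4) d2 by rewrite lt_min d20 andbT; lra.
  have [N [f [f0 fN fe fc]]] := Ac1 _ mind.
  have fc2 k : (k <= N)%N -> J (f k) <= c + e2.
    by move=> kN; apply: le_trans (fc k kN) _; rewrite ltW.
  (* Minimizers are critical, so the deformation keeps the endpoints of the chain in place. *)
  have eta_fix x y : (forall z, J y <= J z) -> sn a (x - y) = 0 -> sn a (eta x - y) = 0.
    move=> ymin xy.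
    have gx : sn a (g x) = 0.
      have Jxy : J x = J y by exact: functional_congr.
      by apply: min_critical => z; rewrite Jxy.
    apply/eqP; rewrite eq_le sn_ge0 andbT.
    have -> : eta x - y = (x - y) - t *: g x by rewrite /eta addrAC.
    by apply: le_trans (snD ha _ _) _; rewrite snN// snZ// gx xy mulr0 addr0.
  exists N, (eta \o f); split => /=.
  - exact: eta_fix.
  - exact: eta_fix.
  - move=> k kN; have := fe k kN; rewrite le_min => /andP[f1 f2].
    have R1 : sn a (f k.+1) <= R0 by apply: HR0; apply: le_trans (fc2 _ kN) _; lra.
    have R2 : sn a (f k) <= R0 by apply: HR0; apply: le_trans (fc2 _ (ltnW kN)) _; lra.
    have G12 := Hd2 _ _ R1 R2 f2.
    (* A convex combination of a step of the old chain, at most [e / 4], and of a difference of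
       values of [G], at most [e / 2]. *)
    have -> : eta (f k.+1) - eta (f k) =
        (1 - t) *: (f k.+1 - f k) + t *: (G (f k.+1) - G (f k)).
      have etaE w : eta w = (1 - t) *: w + t *: G w.
        by rewrite /eta /g scalerBr scalerBl scale1r opprB addrA addrAC.
      by rewrite !etaE !scalerBr opprD addrACA.
    apply: le_trans (snD ha _ _) _; rewrite !snZ//.
    rewrite ger0_norm ?subr_ge0// (ger0_norm (ltW t0)).
    have : (1 - t) * sn a (f k.+1 - f k) <= sn a (f k.+1 - f k).
      by rewrite ler_piMl ?sn_ge0//; lra.
    have : t * sn a (G (f k.+1) - G (f k)) <= sn a (G (f k.+1) - G (f k)).
      by rewrite ler_piMl ?sn_ge0//; lra.
    lra.
  - by move=> k kN; apply: low; exact: fc2.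
by rewrite leNgt c'c.
Unshelve. all: by end_near. Qed.

End mountain_pass.

(** * Two global minima *)

Section two_minima.
Variables (R : realType) (V : lmodType R) (a : V -> V -> R).
Hypotheses (ha : semi_inner a) (hcomp : si_complete a).
Variables (Y : lmodType R) (b : Y -> Y -> R).
Hypothesis hb : semi_inner b.
Variables (Psi : V -> R) (phi : V -> Y) (rho c0 : R) (S : set Y).
Hypotheses (hPsi : wcont a Psi) (hphi : wscont a b phi).
Hypothesis phi_norm : forall x, b (phi x) (phi x) = rho.
Hypothesis phi_nonconst : exists x x', 0 < sn b (phi x - phi x').
Hypothesis c00 : 0 < c0.
Hypothesis hcoer : forall x, c0 * a x x <= 2^-1 * a x x - Psi x.
Hypothesis S_convex : forall y y' t, 0 <= t <= 1 -> S y -> S y' ->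
  S (t *: y + (1 - t) *: y').
Hypothesis S_dense : forall y (e : R), 0 < e -> exists2 y', S y' & sn b (y' - y) < e.

Let J y x := 2^-1 * a x x - (Psi x + b (phi x) y).

Let Psi_ y x := Psi x + b (phi x) y.

Lemma wcont_pairing y : wcont a (Psi_ y).
Proof.
move=> U x_ x M UU oU xM xx; apply: cvgD; first exact: hPsi xx.
apply: (cvg_sn_a hb); exact: hphi xM xx.
Qed.

Lemma pairing_bound x y : `|b (phi x) y| <= Num.sqrt rho * sn b y.
Proof. by apply: le_trans (si_CS hb _ _) _; rewrite /sn phi_norm. Qed.

Lemma coercive_pairing y : coercive a (J y).
Proof.
move=> c; pose K := Num.sqrt rho * sn b y.
exists (Num.sqrt ((`|c| + K) / c0)) => x Jx.
rewrite /sn ler_wsqrtr// ler_pdivlMr// mulrC (le_trans (hcoer x))//.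
have := pairing_bound x y; rewrite ler_norml -/K => /andP[_ h].
by rewrite /J in Jx; have := ler_norm c; lra.
Qed.

Lemma pairing_min y : exists x, forall z, J y x <= J y z.
Proof.
apply: (functional_min ha hcomp (@wcont_pairing y) (@coercive_pairing y)).
exists (- (Num.sqrt rho * sn b y)) => x.
have := pairing_bound x y; rewrite ler_norml => /andP[_ h].
have := hcoer x; have : 0 <= c0 * a x x by rewrite mulr_ge0// ?si_ge0// ltW.
rewrite /Psi_; lra.
Qed.

Hypothesis uniq_min : forall y, S y -> forall x x',
  (forall z, J y x <= J y z) -> (forall z, J y x' <= J y z) -> sn a (x - x') = 0.

(* If the value at the minimizer is largest at [y] on the segment from [y] to
   [y'], its one-sided derivative at [y], which by uniqueness of the minimizer
   [x] is the slope of the affine function [fun w => J w x + b z w], is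
   nonpositive. *)
Lemma directional z y y' (r : R) : S y -> S y' ->
  (forall t x, 0 <= t <= 1 -> (forall x', J (t *: y' + (1 - t) *: y) x <=
       J (t *: y' + (1 - t) *: y) x') ->
     J (t *: y' + (1 - t) *: y) x + b z (t *: y' + (1 - t) *: y) <= r) ->
  forall x, (forall x', J y x <= J y x') -> J y x + b z y = r ->
  J y' x + b z y' <= r.
Proof.
move=> Sy Sy' H x xmin xr.
pose t_ k : R := k.+1%:R^-1.
have t01 k : 0 <= t_ k <= 1 by rewrite /t_ invr_ge0 ler0n invf_le1// ler1n.
have t0 k : 0 < t_ k by rewrite /t_ invr_gt0.
pose y_ k := t_ k *: y' + (1 - t_ k) *: y.
have [x_ x_P] : {x_ : nat -> V & forall k x', J (y_ k) (x_ k) <= J (y_ k) x'}.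
  by apply: (@choice _ _ (fun k x => forall x', J (y_ k) x <= J (y_ k) x')) => k; exact: pairing_min.
(* For a fixed point [u] the expression is affine along the segment. *)
have JE t u : J (t *: y' + (1 - t) *: y) u + b z (t *: y' + (1 - t) *: y) =
    t * (J y' u + b z y') + (1 - t) * (J y u + b z y).
  by rewrite /J !(siE hb); ring.
have H1 k : J (y_ k) (x_ k) + b z (y_ k) <= r by apply: (H (t_ k)); [exact: t01 | exact: x_P].
have H2 k : r <= J y (x_ k) + b z y by rewrite -xr lerD2r.
(* Along the segment the affine function of [x_ k] is at least [r] at [y] and at most [r] at [y_ k],
   hence at most [r] at [y']. *)
have H3 k : J y' (x_ k) + b z y' <= r.
  have := H1 k; rewrite JE => h1; rewrite -(ler_pM2l (t0 k)).
  have : (1 - t_ k) * r <= (1 - t_ k) * (J y (x_ k) + b z y).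
    by rewrite ler_wpM2l//; have := t01 k; lra.
  move: (t_ k * (J y' _ + _)) h1 => p; move: (_ * (J y _ + _)) => q; lra.
have [M HM] := @coercive_pairing y' (r - b z y').
have xM k : sn a (x_ k) <= M by apply: HM; have := H3 k; lra.
have [U [UU oU]] := free_ultrafilter.
have [xb xxb] := wlim_exists ha hcomp UU xM.
have aM k : `|a (x_ k) (x_ k)| <= M ^+ 2.
  rewrite -(sn_sqr ha) ger0_norm ?exprn_ge0 ?sn_ge0//.
  by rewrite ler_pXn2r// nnegrE ?sn_ge0// (le_trans _ (xM k))// sn_ge0.
have [l al] := ultra_bounded_cvg UU aM.
have Jl w : (fun k => J w (x_ k)) @ U --> 2^-1 * l - (Psi xb + b (phi xb) w).
  by apply: cvgB; [exact: cvgMr | exact: (@wcont_pairing w) xxb].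
have lb : a xb xb <= l by exact: (wlim_lsc ha xxb al).
have Jlb w : J w xb <= 2^-1 * l - (Psi xb + b (phi xb) w).
  by rewrite /J lerD2r ler_wpM2l.
have Jy'xb : J y' xb + b z y' <= r.
  apply: le_trans (_ : 2^-1 * l - (Psi xb + b (phi xb) y') + b z y' <= r).
    by rewrite lerD2r.
  apply: (Rcvg_le (F := U) (f := fun k => J y' (x_ k) + b z y')) => //.
  by apply: cvgD; [exact: Jl|exact: cvg_cst].
(* Here the parameter [t_ k] tends to 0, so only the value at [y] survives. *)
have Jyxb : J y xb + b z y <= r.
  apply: le_trans (_ : 2^-1 * l - (Psi xb + b (phi xb) y) + b z y <= r).
    by rewrite lerD2r.
  have HA : (fun k => t_ k * (J y' (x_ k) + b z y') + (1 - t_ k) * (J y (x_ k) + b z y)) @ U -->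
     0 * (2^-1 * l - (Psi xb + b (phi xb) y') + b z y') +
     (1 - 0) * (2^-1 * l - (Psi xb + b (phi xb) y) + b z y).
    have tt : t_ @ U --> (0 : R) by apply: free_cvg => //; exact: cvg_harmonic.
    apply: cvgD; apply: cvgM => //.
    - by apply: cvgD; [exact: Jl|exact: cvg_cst].
    - by apply: cvgB => //; exact: cvg_cst.
    - by apply: cvgD; [exact: Jl|exact: cvg_cst].
  rewrite mul0r add0r subr0 mul1r in HA.
  by apply: (Rcvg_le HA) => k; rewrite -JE; exact: H1.
(* The weak limit [xb] thus reaches the minimal value of [J y], and uniqueness identifies it with
   [x], for which the inequality at [y'] is claimed. *)
have xbmin x' : J y xb <= J y x'.
  by apply: le_trans (xmin x'); rewrite -(lerD2r (b z y)) xr.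
have xx := uniq_min Sy xbmin xmin.
rewrite (_ : J y' x = J y' xb)//.
rewrite /J; have := functional_congr ha (@wcont_pairing y') xx.
by rewrite /Psi_ => <-.
Qed.

Definition comb N (y : 'I_N -> Y) (l : 'I_N -> R) := \sum_i l i *: y i.

Definition simplex N (l : 'I_N -> R) := (forall i, 0 <= l i) /\ \sum_i l i = 1.

Lemma convex_comb N (y : 'I_N -> Y) (l : 'I_N -> R) :
  (forall i, S (y i)) -> simplex l -> S (comb y l).
Proof.
elim: N => [|N IH] in y l *; first by move=> _ [_]; rewrite big_ord0 => /esym /eqP; rewrite oner_eq0.
move=> Sy [l0 l1]; rewrite /comb big_ord_recl.
rewrite big_ord_recl in l1.
have [l01|l01] := eqVneq (l ord0) 1.
  have lz i : l (lift ord0 i) = 0.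
    have : \sum_(i < N) l (lift ord0 i) = 0 by rewrite l01 in l1; lra.
    by move=> /eqP; rewrite psumr_eq0// => /allP /(_ i (mem_index_enum _)) /eqP.
  rewrite big1 ?addr0 ?l01 ?scale1r//.
  by move=> i _; rewrite lz scale0r.
have lt1 : l ord0 < 1.
  rewrite lt_neqAle l01 /= -l1 lerDl sumr_ge0//.
have l1' : 1 - l ord0 != 0 by rewrite subr_eq0 eq_sym.
have := IH (fun i => y (lift ord0 i)) (fun i => l (lift ord0 i) / (1 - l ord0)).
have h1 : forall i, S (y (lift ord0 i)) by [].
have h2 : simplex (fun i => l (lift ord0 i) / (1 - l ord0)).
  split; first by move=> i; rewrite divr_ge0// subr_ge0 ltW.
  by rewrite -mulr_suml -l1 addrAC subrr add0r divff//; move: l1'; rewrite -l1 addrAC subrr add0r.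
move=> /(_ h1 h2) Sc.
have := S_convex (t := l ord0) _ (Sy ord0) Sc; rewrite l0 (ltW lt1) => /(_ isT).
rewrite /comb scaler_sumr.
rewrite (eq_bigr (fun i => l (lift ord0 i) *: y (lift ord0 i)))// => i _.
by rewrite scalerA mulrCA divff// mulr1.
Qed.

Lemma combD N (y : 'I_N -> Y) l l' t : t *: comb y l + (1 - t) *: comb y l' =
  comb y (fun i => t * l i + (1 - t) * l' i).
Proof.
rewrite /comb !scaler_sumr -big_split /=; apply: eq_bigr => i _.
by rewrite [RHS]scalerDl !scalerA.
Qed.

Lemma b_comb z N (y : 'I_N -> Y) l : b z (comb y l) = \sum_i l i * b z (y i).
Proof.
rewrite /comb; elim/big_ind2 : _ => [|u v w q <- <-|i _]; first exact: si0r.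
  by rewrite siDr.
by rewrite siZr.
Qed.

(** The minimal value of [J w x + b z w] over [x] attains its maximum over the [w] in the simplex of
    the [y i]. At a maximal [w], [directional] towards each vertex bounds all the values at the
    minimizer [x] of [J w] by that maximum. *)
Lemma finite_intersection z (r : R) N (y : 'I_N.+1 -> Y) : (forall i, S (y i)) ->
  (forall w x, S w -> (forall x', J w x <= J w x') -> J w x + b z w <= r) ->
  exists x, forall i, J (y i) x + b z (y i) <= r.
Proof.
move=> Sy H.
pose gg := [set s | exists l x, [/\ simplex l, forall x', J (comb y l) x <= J (comb y l) x' &
   s = J (comb y l) x + b z (comb y l)]].
pose l0 := fun i : 'I_N.+1 => if i == ord0 then 1 else 0 : R.
have sl0 : simplex l0.
  split; first by move=> i; rewrite /l0; case: ifP.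
  by rewrite /l0 -big_mkcond /= big_pred1_eq.
have gs : has_sup gg.
  split.
    have [x xP] := pairing_min (comb y l0).
    by exists (J (comb y l0) x + b z (comb y l0)), l0, x.
  exists r => _ [l [x [sl xm ->]]]; apply: H => //; exact: convex_comb.
have [w_ w_P] : {w_ : nat -> (('I_N.+1 -> R) * V) & forall k,
    [/\ simplex (w_ k).1, forall x', J (comb y (w_ k).1) (w_ k).2 <= J (comb y (w_ k).1) x' &
     sup gg - k.+1%:R^-1 < J (comb y (w_ k).1) (w_ k).2 + b z (comb y (w_ k).1)]}.
  apply: (@choice _ _ (fun k w => [/\ simplex w.1, forall x', J (comb y w.1) w.2 <= J (comb y w.1) x' &
     sup gg - k.+1%:R^-1 < J (comb y w.1) w.2 + b z (comb y w.1)])) => k.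
  have k0 : 0 < k.+1%:R^-1 :> R by rewrite invr_gt0.
  by have [_ [l [x [sl xm ->]]] Hx] := sup_adherent k0 gs; exists (l, x).
have [U [UU oU]] := free_ultrafilter.
have lb i k : `|(w_ k).1 i| <= 1.
  have [[p s1] _ _] := w_P k; rewrite ger0_norm// -s1 (bigD1 i)//= lerDl.
  by apply: sumr_ge0.
have [l lP] : {l : 'I_N.+1 -> R & forall i, (fun k => (w_ k).1 i) @ U --> l i}.
  apply: (@choice _ _ (fun i li => (fun k => (w_ k).1 i) @ U --> li)) => i.
  exact: ultra_bounded_cvg (lb i).
have sl : simplex l.
  split=> [i|].
    by apply: (Rcvg_ge (lP i)) => k; have [[p _] _ _] := w_P k.
  have Hs : (fun k => \sum_i (w_ k).1 i) @ U --> \sum_i l i.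
    by apply: cvg_big => //; exact: add_continuous.
  apply: (Rcvg_unique Hs); rewrite (_ : (fun k => _) = fun=> 1); first exact: cvg_cst.
  by apply/funext => k; have [[]] := w_P k.
have [x xm] := pairing_min (comb y l).
have bl u : (fun k => b u (comb y (w_ k).1)) @ U --> b u (comb y l).
  rewrite b_comb (_ : (fun k => _) = (fun k => \sum_i (w_ k).1 i * b u (y i))); last first.
    by apply/funext => k; rewrite b_comb.
  by apply: cvg_big => [|i _]; [exact: add_continuous|exact: cvgMl].
have supE : J (comb y l) x + b z (comb y l) = sup gg.
  apply/eqP; rewrite eq_le; apply/andP; split.
    apply: ub_le_sup; first exact: gs.2.
    by exists l, x.
  (* The minimal value at the [k]-th weights is at most the value there of the fixed point [x],
     which is affine in the weights and converges. Hence only upper semicontinuity of the minimal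
     value is involved. *)
  have Hl : (fun k => 2^-1 * a x x - (Psi x + b (phi x) (comb y (w_ k).1)) +
       b z (comb y (w_ k).1) + k.+1%:R^-1) @ U --> J (comb y l) x + b z (comb y l) + 0.
    apply: cvgD; last by apply: free_cvg => //; exact: cvg_harmonic.
    apply: cvgD => //; apply: cvgB; first exact: cvg_cst.
    by apply: cvgD => //; exact: cvg_cst.
  rewrite addr0 in Hl; apply: (Rcvg_ge Hl) => k.
  have [_ m3 h3] := w_P k.
  have := m3 x; rewrite /J in h3 *; move: (k.+1%:R^-1) h3 => q h3.
  set A := 2^-1 * a (w_ k).2 _ - _ in h3 *; lra.
exists x => i.
pose di := fun j : 'I_N.+1 => if j == i then 1 else 0 : R.
have sdi : simplex di.
  split; first by move=> j; rewrite /di; case: ifP.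
  by rewrite /di -big_mkcond /= big_pred1_eq.
have ydi : comb y di = y i.
  rewrite /comb (bigD1 i)//= /di eqxx scale1r big1 ?addr0// => j /negPf ->.
  by rewrite scale0r.
rewrite -ydi; apply: le_trans (_ : sup gg <= r); last first.
  by rewrite -supE; apply: H => //; exact: convex_comb.
apply: (directional (y := comb y l) (y' := comb y di) _ _ _ xm) => //.
- exact: convex_comb.
- by rewrite ydi.
- move=> t u /andP[t0 t1] um; apply: ub_le_sup; first exact: gs.2.
  rewrite combD in um *; exists (fun j => t * di j + (1 - t) * l j), u; split => //.
  split=> [j|]; first by rewrite addr_ge0// mulr_ge0// ?sdi.1 ?sl.1// subr_ge0.
  by rewrite big_split /= -!mulr_sumr sdi.2 sl.2 !mulr1 addrC subrK.
Qed.

Lemma two_minima_absurd : False.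
Proof.
have [xa [xb xab]] := phi_nonconst.
pose z := 2^-1 *: (phi xa + phi xb).
pose r := 2^-1 * (2^-1 * a xa xa - Psi xa + (2^-1 * a xb xb - Psi xb)).
(* A minimum is at most the mean of the values at [xa] and [xb]; the terms in [w] cancel because [z]
   is the midpoint of [phi xa] and [phi xb]. *)
have H w x : S w -> (forall x', J w x <= J w x') -> J w x + b z w <= r.
  move=> Sw xm; have := xm xa; have := xm xb.
  by rewrite {2}/J {3}/J /z /r !(siE hb); lra.
pose zz := b z z.
(* The parallelogram identity, by which the midpoint of two distinct points of a sphere is strictly
   inside. *)
have zzE : 4 * zz = 4 * rho - sn b (phi xa - phi xb) ^+ 2.
  by rewrite (sn_sqr hb) /zz /z !(siE hb) !phi_norm (siC hb (phi xb)); field.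
have zrho : zz < rho.
  have : 0 < sn b (phi xa - phi xb) ^+ 2 by rewrite exprn_gt0.
  by lra.
have rz : sn b z < Num.sqrt rho.
  by rewrite /sn ltr_sqrt//; apply: le_lt_trans zrho; exact: si_ge0.
pose d := Num.sqrt rho - sn b z.
have d0 : 0 < d by rewrite subr_gt0.
have dP x : d ^+ 2 <= b (z - phi x) (z - phi x).
  rewrite -(sn_sqr hb) ler_pXn2r ?nnegrE ?(ltW d0) ?sn_ge0//.
  have := sn_ltB hb z (phi x); rewrite ler_norml => /andP[h _].
  have E : sn b (phi x) = Num.sqrt rho by rewrite /sn phi_norm.
  by rewrite /d -E; lra.
pose q := Num.sqrt rho.
have q0 : 0 <= q by exact: sqrtr_ge0.
have zphi x : sn b (z - phi x) <= 2 * q.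
  apply: le_trans (snD hb _ _) _; rewrite snN// {2}/sn phi_norm -/q.
  by rewrite mulr_natl mulr2n lerD2r ltW.
(* As [sn b (z - phi x0) <= 2 * q], moving [phi x0] by [e] changes the pairing with [z - phi x0] by
   at most [d ^+ 2 / 2], half of its value. *)
pose e := d ^+ 2 / (4 * (q + 1)).
have e0 : 0 < e by rewrite divr_gt0 ?exprn_gt0//; lra.
have far x0 : exists y, S y /\ forall x, sn b (phi x - phi x0) <= e -> r < J y x + b z y.
  (* The pairing of [z - phi x] with [T *: (z - phi x0)] is then at least [T * d ^+ 2 / 2], that is
     [|r| + 2 * q + 1]. This exceeds [r] plus the error [2 * q] made in replacing that vector by an
     element of [S] at distance less than 1. *)
  pose T := 2 * (`|r| + 2 * q + 1) / d ^+ 2.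
  have T0 : 0 <= T.
    by rewrite divr_ge0// ?exprn_ge0// ?(ltW d0)// mulr_ge0// addr_ge0// addr_ge0// mulr_ge0.
  have [y Sy yT] := S_dense (T *: (z - phi x0)) ltr01.
  exists y; split => // x xe.
  have E : J y x + b z y = 2^-1 * a x x - Psi x + b (z - phi x) (T *: (z - phi x0)) +
      b (z - phi x) (y - T *: (z - phi x0)).
    have E2 u v : b u v + b u (y - v) = b u y by rewrite siBr//; ring.
    by rewrite -[RHS]addrA E2 /J (siBl hb); ring.
  have h1 : 0 <= 2^-1 * a x x - Psi x.
    by apply: le_trans (hcoer x); rewrite mulr_ge0// ?si_ge0// ltW.
  have h2 : - (2 * q) <= b (z - phi x) (y - T *: (z - phi x0)).
    have := le_trans (si_CS hb (z - phi x) (y - T *: (z - phi x0)))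
      (ler_pM (sn_ge0 _ _) (sn_ge0 _ _) (zphi x) (ltW yT)).
    by rewrite mulr1 ler_norml => /andP[].
  have h3 : d ^+ 2 / 2 <= b (z - phi x) (z - phi x0).
    have -> : b (z - phi x) (z - phi x0) = b (z - phi x0) (z - phi x0) -
        b (phi x - phi x0) (z - phi x0).
      by rewrite -siBl// opprB addrA subrK.
    have h4 : b (phi x - phi x0) (z - phi x0) <= e * (2 * q).
      apply: le_trans (ler_norm _) _; apply: le_trans (si_CS hb _ _) _.
      by apply: ler_pM => //; exact: sn_ge0.
    have h5 : e * (2 * q) <= d ^+ 2 / 2.
      rewrite /e mulrAC ler_pdivrMr; last by lra.
      have : 0 <= d ^+ 2 by rewrite sqr_ge0.
      by move: (d ^+ 2) => D D0; nra.
    by have := dP x0; lra.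
  have h6 : `|r| + 2 * q + 1 <= T * b (z - phi x) (z - phi x0).
    apply: le_trans (ler_wpM2l T0 h3).
    rewrite /T le_eqVlt; apply/orP; left; apply/eqP; field.
    by rewrite gt_eqF.
  by rewrite E siZr//; have := ler_norm r; lra.
have [y0 Sy0] : exists y, S y.
  by have [y [Sy _]] := far 0; exists y.
have [ny nyP] : {ny : V -> Y & forall x0, S (ny x0) /\
    forall x, sn b (phi x - phi x0) <= e -> r < J (ny x0) x + b z (ny x0)}.
  by apply: (@choice _ _ (fun x0 y => S y /\ forall x, sn b (phi x - phi x0) <= e ->
     r < J y x + b z y)) => x0; exact: far.
have fi (s : seq Y) : (forall y, y \in s -> S y) ->
    exists x, forall y, y \in y0 :: s -> J y x + b z y <= r.
  move=> Ss; have [|x xP] := @finite_intersection z r (size s) (fun i => nth y0 (y0 :: s) i) _ H.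
    move=> i; have := mem_nth y0 (ltn_ord i : (i < size (y0 :: s))%N).
    by rewrite inE => /orP[/eqP -> //|/Ss].
  exists x => y ys.
  have yi : (index y (y0 :: s) < (size s).+1)%N by have := index_mem y (y0 :: s); rewrite ys.
  by have := xP (Ordinal yi); rewrite /= nth_index.
have [sel selP] : {sel : seq Y -> V & forall s, (forall y, y \in s -> S y) ->
    forall y, y \in y0 :: s -> J y (sel s) + b z y <= r}.
  apply: (@choice _ _ (fun s x => (forall y, y \in s -> S y) ->
    forall y, y \in y0 :: s -> J y x + b z y <= r)) => s.
  have [Ss|nS] := pselect (forall y, y \in s -> S y); last by exists 0.
  by have [x] := fi s Ss; exists x.
(* Each new point satisfies the inequalities of all previous [y], and the [y] attached to an earlier
   point is violated wherever [phi] is within [e] of its value there. *)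
pose ss := fix ss k := if k is k'.+1 then ny (sel (ss k')) :: ss k' else [::].
have ssS k y : y \in ss k -> S y.
  elim: k => [//|k IH]; rewrite inE => /orP[/eqP ->|/IH //].
  exact: (nyP _).1.
pose x_ k := sel (ss k).
have sep k k' : (k < k')%N -> e < sn b (phi (x_ k') - phi (x_ k)).
  move=> kk'; rewrite ltNge; apply/negP => /(nyP (x_ k)).2.
  rewrite ltNge; apply/negP/negPn; apply: selP; first exact: ssS.
  rewrite inE; apply/orP; right.
  elim: k' kk' => [//|k' IH]; rewrite ltnS leq_eqVlt => /orP[/eqP <-|/IH].
    by rewrite inE eqxx.
  by move=> h; rewrite inE h orbT.
(* The inequality for [y0], which is imposed on every point, bounds the sequence by coercivity. *)
have [M HM] := @coercive_pairing y0 (r - b z y0).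
have xM k : sn a (x_ k) <= M.
  apply: HM; have := selP (ss k) (@ssS k) y0; rewrite inE eqxx => /(_ isT).
  by rewrite -/(x_ k); lra.
have [U [UU oU]] := free_ultrafilter.
have [x xx] := wlim_exists ha hcomp UU xM.
have px := hphi UU oU xM xx.
have e2 : 0 < e / 2 by lra.
have UA : U (fun k => sn b (phi (x_ k) - phi x) < e / 2).
  move/cvgrPdist_lt : px => /(_ _ e2); apply: filterS => k.
  by rewrite sub0r normrN ger0_norm ?sn_ge0.
have [k kA] := filter_ex UA.
have Uk : U (fun k' => (k < k')%N) by apply: oU; exact: nbhs_infty_gt.
have [k' [k'A kk']] := filter_ex (filterI UA Uk).
have := sep _ _ kk'; have := sn_dist hb (phi (x_ k')) (phi x) (phi (x_ k)).
by rewrite (snB hb (phi x)); rewrite /= in kA k'A; lra.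
Qed.

End two_minima.

(** * Lebesgue measure of boxes *)

Section box_volume.
Variable R : realType.

Lemma integral_scaled_itv (c a b : R) : 0 <= c ->
  (\int[lebesgue_measure]_x (c * (a < x <= b)%R%:R)%:E = (c * Num.max 0 (b - a))%:E)%E.
Proof.
move=> c0.
transitivity (\int[@lebesgue_measure R]_x (c%:E * (\1_(`]a, b]%classic) x)%:E))%E.
  by apply: eq_integral => x _; rewrite -EFinM indicE mem_setE in_itv.
rewrite ge0_integralZl//; last first.
  by apply/measurable_EFinP; exact: measurable_indic.
rewrite integral_indic// setIT/= lebesgue_measure_itv/= lte_fin EFinM; congr (_ * _)%E.
case: ifPn => [ab|]; first by rewrite -EFinB max_r// subr_ge0 ltW.
by rewrite -leNgt => ba; rewrite max_l// subr_le0.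
Qed.

Definition cons_fun n (t : R) (x : 'I_n -> R) (i : 'I_n.+1) := oapp x t (unlift ord0 i).

Lemma cons_fun0 n t (x : 'I_n -> R) : cons_fun t x ord0 = t.
Proof. by rewrite /cons_fun unlift_none. Qed.

Lemma cons_funS n t (x : 'I_n -> R) i : cons_fun t x (lift ord0 i) = x i.
Proof. by rewrite /cons_fun liftK. Qed.

(* Integrating out one coordinate at a time replaces the product measure. *)
Lemma weighted_cover n (a b : 'I_n -> R) (A B : nat -> 'I_n -> R) (w : R) (W : nat -> R) :
  0 <= w -> (forall k, 0 <= W k) ->
  (forall x : 'I_n -> R, ((w * \prod_i (a i < x i <= b i)%R%:R)%:E <=
     \sum_(k <oo) (W k * \prod_i (A k i < x i <= B k i)%R%:R)%:E)%E) ->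
  ((w * \prod_i Num.max 0 (b i - a i))%:E <=
     \sum_(k <oo) (W k * \prod_i Num.max 0 (B k i - A k i))%:E)%E.
Proof.
elim: n => [|n IH] in a b A B w W *.
  move=> w0 W0 /(_ (fun=> 0)); rewrite !big_ord0; congr (_ <= _)%E.
  by apply: eq_eseriesr => k _; rewrite !big_ord0.
move=> w0 W0 H.
have P0 m (f : 'I_m -> R) : 0 <= \prod_i Num.max 0 (f i).
  by apply: prodr_ge0 => i _; rewrite le_max lexx.
(* On the slice with first coordinate [t] the weights absorb the indicators of the first intervals,
   and the induction hypothesis applies. The result is then integrated in [t]. *)
have step (t : R) :
  (((w * \prod_(i < n) Num.max 0 (b (lift ord0 i) - a (lift ord0 i)))
      * (a ord0 < t <= b ord0)%R%:R)%:E <=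
   \sum_(k <oo) ((W k * \prod_(i < n) Num.max 0 (B k (lift ord0 i) - A k (lift ord0 i)))
      * (A k ord0 < t <= B k ord0)%R%:R)%:E)%E.
  rewrite mulrAC; under eq_eseriesr do rewrite mulrAC.
  apply: IH => [|k|x]; [by rewrite mulr_ge0| by rewrite mulr_ge0|].
  have E (a' b' : 'I_n.+1 -> R) :
      \prod_(i < n) (a' (lift ord0 i) < cons_fun t x (lift ord0 i) <= b' (lift ord0 i))%R%:R =
      \prod_(i < n) (a' (lift ord0 i) < x i <= b' (lift ord0 i))%R%:R :> R.
    by apply: eq_bigr => i _; rewrite cons_funS.
  have := H (cons_fun t x).
  rewrite big_ord_recl cons_fun0 mulrA E.
  move/le_trans; apply.
  rewrite le_eqVlt; apply/orP; left; apply/eqP; apply: eq_eseriesr => k _.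
  by rewrite big_ord_recl cons_fun0 mulrA E.
have mf (a1 b1 c1 : R) : measurable_fun setT (fun x : R => (c1 * (a1 < x <= b1)%R%:R)%:E).
  apply/measurable_EFinP; apply: measurable_funM => //.
  rewrite (_ : (fun x => _) = \1_(`]a1, b1]%classic)); first exact: measurable_indic.
  by apply/funext => y; rewrite indicE mem_setE in_itv.
have W1 k : 0 <= W k * \prod_(i < n) Num.max 0 (B k (lift ord0 i) - A k (lift ord0 i)).
  by rewrite mulr_ge0.
have := @ge0_le_integral _ _ R (@lebesgue_measure R) setT measurableT _ _
  (fun t _ => _) (mf _ _ _) _ (fun t _ => step t).
rewrite integral_scaled_itv ?mulr_ge0// integral_nneseries//; last 2 first.
- by move=> k; exact: mf.
- by move=> k t _; rewrite lee_fin mulr_ge0.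
under eq_eseriesr do rewrite integral_scaled_itv//.
have -> : w * \prod_i Num.max 0 (b i - a i) =
    w * \prod_(i < n) Num.max 0 (b (lift ord0 i) - a (lift ord0 i)) *
    Num.max 0 (b ord0 - a ord0) by rewrite big_ord_recl; ring.
move=> IN; apply: le_trans (IN _ _) _.
- by move=> t; rewrite lee_fin !mulr_ge0.
- apply: ge0_emeasurable_sum => [k t _ _|k _]; first by rewrite lee_fin mulr_ge0.
  exact: mf.
- rewrite le_eqVlt; apply/orP; left; apply/eqP; apply: eq_eseriesr => k _.
  by rewrite big_ord_recl; congr EFin; ring.
Qed.

End box_volume.

Lemma maxr_split (R : realType) (u v t : R) :
  Num.max 0 (Num.min v t - u) + Num.max 0 (v - Num.max u t) = Num.max 0 (v - u).
Proof.
have [vt|/ltW tv] := leP v t; have [ut|/ltW tu] := leP u t.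
- by rewrite [X in _ + X]max_l ?addr0// subr_le0.
- have vu := le_trans vt tu.
  by rewrite !max_l ?addr0 ?subr_le0.
- rewrite !max_r ?subr_ge0//; last exact: le_trans tv.
  by ring.
- by rewrite [X in X + _]max_l ?add0r ?subr_le0.
Qed.

Section lebesgue_theory.
Variables (R : realType) (n : nat).
Hypothesis n0 : (0 < n)%N.
Local Notation cell := ('rV[R]_n * 'rV[R]_n)%type.
Implicit Types (A X : set 'rV[R]_n) (c : cell).

Lemma outer_le_series A (a : nat -> cell) : A `<=` \bigcup_k box (a k) ->
  (lebesgue_outer A <= \sum_(k <oo) box_vol (a k))%E.
Proof.
move=> Aa; apply: le_trans (le_lebesgue_outer Aa) _.
apply: le_trans (lebesgue_outer_sigma_subadditive _) _.
apply: lee_nneseries => [k _ _|k _]; first exact: lebesgue_outer_ge0.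
apply: ereal_inf_lbound; exists [set a k]; last by rewrite esum_set1// box_vol_ge0.
by split; [exact: countable1|move=> x ax; exists (a k)].
Qed.

Lemma outer_cover_seq A (x : \bar R) : (lebesgue_outer A < x)%E ->
  exists2 a : nat -> cell, A `<=` \bigcup_k box (a k) &
    (\sum_(k <oo) box_vol (a k) < x)%E.
Proof.
move=> /ereal_inf_lt[_ [C [cC AC] <-]] Cx.
have /countable_bijP[B] := cC; rewrite card_eq_sym => /card_set_bijP[f fbij].
(* Indices outside [B] receive a box that is empty and, since [n > 0], of volume 0. *)
pose a k : cell := if k \in B then f k else (0, 0).
exists a.
  move=> y /AC[c Cc cy].
  have [_ _ /(_ _ Cc)[k Bk fk]] := fbij.
  by exists k => //; rewrite /a mem_set// fk.
rewrite (_ : (\sum_(k <oo) _)%E = \esum_(c in C) box_vol c)%E//.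
rewrite (@reindex_esum _ _ _ B C f _ fbij) -(set_mem_set B) -nneseries_esum; last by move=> *; exact: box_vol_ge0.
rewrite [RHS]eseries_mkcond; apply: eq_eseriesr => k _; rewrite /a.
case: ifP => // _; rewrite /box_vol; case: n n0 => // m _.
by rewrite big_ord_recl !mxE subrr maxxx mul0r.
Qed.

(** That no countable cover is cheaper than the box itself is a pointwise inequality between
    indicators, to which [weighted_cover] applies with all weights 1. *)
Lemma leb_box c : (leb (box c : set (Rn R n)) = box_vol c)%E.
Proof.
apply/eqP; rewrite eq_le; apply/andP; split.
  apply: ereal_inf_lbound; exists [set c]; last by rewrite esum_set1// box_vol_ge0.
  by split; [exact: countable1|move=> x ax; exists c].
rewrite leNgt; apply/negP => /outer_cover_seq[a ca].
apply/negP; rewrite -leNgt.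
have := @weighted_cover R n (fun i => c.1 0 i) (fun i => c.2 0 i)
  (fun k i => (a k).1 0 i) (fun k i => (a k).2 0 i) 1 (fun=> 1) ler01 (fun=> ler01).
rewrite mul1r /box_vol; under eq_eseriesr do rewrite mul1r.
apply => x; rewrite mul1r; under eq_eseriesr do rewrite mul1r.
have prodE (d : cell) : \prod_i (d.1 0 i < x i <= d.2 0 i)%R%:R =
    (\row_i x i \in box d)%:R :> R.
  have [h|h] := boolP (_ \in box d).
    move: h; rewrite inE => h; rewrite big1// => i _.
    by have := h i; rewrite mxE => ->.
  have /existsNP[i] : ~ box d (\row_i x i) by move=> h'; move: h; rewrite mem_set.
  by rewrite mxE => /negP/negbTE hi; rewrite (bigD1 i)//= hi mul0r.
rewrite prodE; under eq_eseriesr do rewrite prodE.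
have ge0 k : (0 <= (\row_i x i \in box (a k))%:R%:E :> \bar R)%E by rewrite lee_fin.
case: (boolP (_ \in box c)) => [|_]; last by rewrite nneseries_ge0.
rewrite inE => /ca[k _ xk].
apply: (@le_trans _ _ (\sum_(i < k.+1) ((\row_i0 x i0 \in box (a i))%:R%:E))%E).
  by rewrite big_ord_recr /= (mem_set xk) leeDr// sume_ge0.
by rewrite -(big_mkord xpredT (fun i => ((\row_i0 x i0 \in box (a i))%:R%:E))%E); exact: nneseries_lim_ge.
Qed.

Definition upd (v : 'rV[R]_n) (i : 'I_n) (t : R) : 'rV[R]_n :=
  \row_j (if j == i then t else v 0 j).

Definition cell_lo c i t : cell := (c.1, upd c.2 i (Num.min (c.2 0 i) t)).
Definition cell_hi c i t : cell := (upd c.1 i (Num.max (c.1 0 i) t), c.2).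

Lemma box_lo c i t : box (cell_lo c i t) = box c `&` [set x | x 0 i <= t].
Proof.
apply/seteqP; split => x /=.
  move=> h; split=> [j|].
    have := h j; rewrite /= mxE; case: eqP => [->|//].
    by rewrite le_min => /and3P[-> ->].
  by have := h i; rewrite /= mxE eqxx le_min => /and3P[].
move=> [h xt] j; rewrite mxE; case: eqP => [->|_]; last exact: h.
by rewrite le_min xt andbT; exact: h.
Qed.

Lemma box_hi c i t : box (cell_hi c i t) = box c `&` ~` [set x | x 0 i <= t].
Proof.
apply/seteqP; split => x /=.
  move=> h; split=> [j|].
    have := h j; rewrite /= mxE; case: eqP => [->|//].
    by rewrite gt_max => /andP[/andP[-> _] ->].
  by have := h i; rewrite /= mxE eqxx gt_max => /andP[/andP[_ h1] _]; apply/negP; rewrite -ltNge.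
move=> [h /negP]; rewrite -ltNge => xt j; rewrite mxE; case: eqP => [->|_]; last exact: h.
by rewrite gt_max xt andbT; exact: h.
Qed.

Lemma box_vol_split c i t :
  (box_vol (cell_lo c i t) + box_vol (cell_hi c i t) = box_vol c)%E.
Proof.
rewrite /box_vol -EFinD; congr EFin.
rewrite (bigD1 i)//= [X in _ + X](bigD1 i)//= [RHS](bigD1 i)//=.
rewrite !mxE eqxx.
have E (f g : 'I_n -> R) : (forall j, j != i -> f j = g j) ->
   \prod_(j < n | j != i) f j = \prod_(j < n | j != i) g j.
  by move=> fg; apply: eq_bigr => j ji; rewrite fg.
rewrite (E _ (fun j => Num.max 0 (c.2 0 j - c.1 0 j))); last first.
  by move=> j /negPf ji; rewrite mxE ji.
rewrite [X in _ + _ * X](E _ (fun j => Num.max 0 (c.2 0 j - c.1 0 j))); last first.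
  by move=> j /negPf ji; rewrite mxE ji.
rewrite -mulrDl; congr (_ * _); set u := c.1 0 i; set v := c.2 0 i.
exact: maxr_split.
Qed.

(** Caratheodory's criterion holds because the hyperplane cuts every box of a cover into two boxes
    whose volumes add up. *)
Lemma measurable_halfspace (i : 'I_n) (t : R) :
  measurable ([set x | x 0 i <= t] : set (Rn R n)).
Proof.
apply: le_caratheodory_measurable => X /=.
rewrite -/([set x : 'rV[R]_n | x 0 i <= t]); set H := [set x | _].
have [->|Xfin] := eqVneq (lebesgue_outer X) +oo%E; first by rewrite leey.
have Xf : lebesgue_outer X \is a fin_num.
  by rewrite ge0_fin_numE ?lebesgue_outer_ge0// ltey.
apply/lee_addgt0Pr => e e0.
have [|a Xa ae] := @outer_cover_seq X (lebesgue_outer X + e%:E)%E.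
  by rewrite lteDl// lte_fin.
apply: le_trans (ltW ae).
under eq_eseriesr do rewrite -(box_vol_split _ i t).
rewrite nneseriesD; [|by move=> *; exact: box_vol_ge0..].
apply: leeD; apply: outer_le_series.
  move=> x [/Xa[k _ ak] xH]; exists k => //; by rewrite box_lo.
move=> x [/Xa[k _ ak] xH]; exists k => //; by rewrite box_hi.
Qed.

Lemma measurable_box c : measurable (box c : set (Rn R n)).
Proof.
rewrite (_ : box c = \bigcap_(i in [set: 'I_n])
   (~` [set x : Rn R n | (x : 'rV[R]_n) 0 i <= c.1 0 i] `&` [set x : Rn R n | (x : 'rV[R]_n) 0 i <= c.2 0 i])).
  apply: fin_bigcap_measurable => // i _; apply: measurableI; last exact: measurable_halfspace.
  by apply: measurableC; exact: measurable_halfspace.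
apply/seteqP; split => x /= h i; first by have /andP[h1 h2] := h i; split => //; apply/negP; rewrite -ltNge.
by have [/negP h1 h2] := h i I; rewrite -ltNge in h1; rewrite h1.
Qed.

Lemma ball_rowE (x y : 'rV[R]_n) (e : R) :
  ball x e y <-> 0 < e /\ forall i, `|x 0 i - y 0 i| < e.
Proof.
split=> [[e0 h]|[e0 h]]; first by split => // i; exact: (h 0 i).
by split => // i j; rewrite (ord1 i); exact: h.
Qed.

(** An open set is the union of the countably many boxes with rational corners that it contains. *)
Lemma measurable_open (U : set 'rV[R]_n) : open U -> measurable (U : set (Rn R n)).
Proof.
move=> oU.
pose B (p : 'rV[rat]_n * 'rV[rat]_n) : cell := (map_mx ratr p.1, map_mx ratr p.2).
pose F p : set (Rn R n) := if `[< box (B p) `<=` U >] then box (B p) else set0.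
rewrite (_ : U = \bigcup_p F p); last first.
  apply/seteqP; split => x; last first.
    by move=> [p _]; rewrite /F; case: asboolP => // h /h.
  move=> Ux; have [e /= e0 xeU] := (nbhs_ballP _ _).1 (oU x Ux).
  have [f fP] : {f : 'I_n -> rat * rat & forall i,
      [/\ x 0 i - e < ratr (f i).1, ratr (f i).1 < x 0 i, x 0 i < ratr (f i).2 &
       ratr (f i).2 < x 0 i + e]}.
    apply: (@choice _ _ (fun i q => [/\ x 0 i - e < ratr q.1, ratr q.1 < x 0 i, x 0 i < ratr q.2 &
       ratr q.2 < x 0 i + e])) => i.
    have [q1] : exists q, ratr q \in `](x 0 i - e), (x 0 i)[ by apply: rat_in_itvoo; lra.
    have [q2] : exists q, ratr q \in `](x 0 i), (x 0 i + e)[ by apply: rat_in_itvoo; lra.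
    by rewrite !in_itv /= => /andP[? ?] /andP[? ?]; exists (q1, q2).
  exists (\row_i (f i).1, \row_i (f i).2) => //; rewrite /F; case: asboolP => [_ i|h].
    by rewrite !mxE; have [_ -> /ltW ->] := fP i.
  exfalso; apply: h => y yB; apply: xeU; apply/ball_rowE; split => // i.
  have := yB i; rewrite !mxE => /andP[h1 h2]; have [h3 h4 h5 h6] := fP i.
  by rewrite ltr_distl; apply/andP; split; lra.
apply: countable_bigcupT_measurable => //.
by move=> p; rewrite /F; case: ifP => // _; exact: measurable_box.
Qed.

Lemma measurable_continuous (f : 'rV[R]_n -> R) : continuous f ->
  measurable_fun setT (f : Rn R n -> R).
Proof.
move=> /continuousP cf; apply: (measurability _ (RGenOpens.measurableE R)).
move=> _ [_ [a [b ->] <-]]; rewrite setTI; apply: measurable_open.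
by apply: cf; exact: interval_open.
Qed.

Lemma outer_translate_le v A : (lebesgue_outer [set x | A (x + v)%R] <= lebesgue_outer A)%E.
Proof.
have [->|Afin] := eqVneq (lebesgue_outer A) +oo%E; first by rewrite leey.
have Xf : lebesgue_outer A \is a fin_num.
  by rewrite ge0_fin_numE ?lebesgue_outer_ge0// ltey.
apply/lee_addgt0Pr => e e0.
have [|a Aa ae] := @outer_cover_seq A (lebesgue_outer A + e%:E)%E.
  by rewrite lteDl// lte_fin.
apply: le_trans (ltW ae).
apply: le_trans (outer_le_series (a := fun k => ((a k).1 - v, (a k).2 - v)) _) _.
  move=> x /= /Aa [k _ h]; exists k => // i; have := h i.
  by rewrite !mxE /= ltrBlDr lerBrDr.
rewrite le_eqVlt; apply/orP; left; apply/eqP; apply: eq_eseriesr => k _.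
rewrite /box_vol /=; congr EFin; apply: eq_bigr => i _; congr Num.max.
by rewrite !mxE; ring.
Qed.

Lemma outer_translate v A : (lebesgue_outer [set x | A (x + v)%R] = lebesgue_outer A)%E.
Proof.
apply/eqP; rewrite eq_le outer_translate_le /=.
have := outer_translate_le (- v) [set x | A (x + v)].
rewrite (_ : [set x | [set x0 | A (x0 + v)%R] (x - v)%R] = A)//.
by apply/funext => x /=; rewrite subrK.
Qed.

Lemma measurable_translate v (A : set (Rn R n)) : measurable A ->
  measurable ([set x : 'rV[R]_n | A (x + v)%R] : set (Rn R n)).
Proof.
move=> mA; have mA' : caratheodory_measurable (@lebesgue_outer R n) A by exact: mA.
apply: le_caratheodory_measurable => X /=.
have := mA' [set x | X (x - v)%R].
rewrite (outer_translate (- v) X) => ->.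
rewrite -(outer_translate v (_ `&` A)) -(outer_translate v (_ `&` ~` A)).
rewrite (_ : [set x | ([set x0 | X (x0 - v)] `&` A) (x + v)] = X `&` [set x | A (x + v)%R]); last first.
  by apply/funext => x /=; rewrite addrK.
rewrite (_ : [set x | ([set x0 | X (x0 - v)] `&` ~` A) (x + v)] = X `&` ~` [set x | A (x + v)%R])//.
by apply/funext => x /=; rewrite addrK.
Qed.

Definition translate (v : 'rV[R]_n) : Rn R n -> Rn R n := fun x => (x : 'rV[R]_n) + v.

Lemma measurable_fun_translate v : measurable_fun setT (translate v).
Proof. by move=> _ A mA; rewrite setTI; exact: measurable_translate. Qed.

Lemma leb_translate v (A : set (Rn R n)) : pushforward leb (translate v) A = leb A.
Proof. exact: outer_translate. Qed.

Lemma ge0_integral_translate v (f : Rn R n -> \bar R) : measurable_fun setT f ->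
  (forall x, 0 <= f x)%E ->
  (\int[leb]_x f (translate v x) = \int[leb]_x f x)%E.
Proof.
move=> mf f0.
have := @ge0_integral_pushforward _ _ _ _ _ _ (measurable_fun_translate v)
  (@leb R n) setT f measurableT mf (fun x _ => f0 x).
rewrite preimage_setT => <-.
apply: eq_measure_integral => [|mphi A mA _]; first exact: measurable_fun_translate.
exact: leb_translate.
Qed.

Lemma integral_translate v (f : Rn R n -> R) : (@leb R n).-integrable setT (EFin \o f) ->
  (\int[leb]_x f (translate v x) = \int[leb]_x f x)%R.
Proof.
move=> /integrableP[mf intf]; rewrite /Rintegral; congr fine.
rewrite integralE [RHS]integralE; congr (_ - _)%E.
  have := @ge0_integral_translate v (EFin \o f)^\+%E (measurable_funepos mf) (fun x => funepos_ge0 _ x).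
  by move=> <-; apply: eq_integral => x _; exact: (congr1 (fun g => g x) (funepos_comp (EFin \o f) (translate v))).
have := @ge0_integral_translate v (EFin \o f)^\-%E (measurable_funeneg mf) (fun x => funeneg_ge0 _ x).
by move=> <-; apply: eq_integral => x _; exact: (congr1 (fun g => g x) (funeneg_comp (EFin \o f) (translate v))).
Qed.

Lemma bounded_sub_box A : bounded_set A -> exists M : R, 0 < M /\
  A `<=` box (const_mx (- M), const_mx M).
Proof.
move=> /pinfty_ex_gt0 [M M0 HM]; exists (M + 1); split; first by lra.
move=> x /HM /= xM i; rewrite !mxE.
have : `|x 0 i| <= M.
  apply: le_trans xM; rewrite [leRHS]mx_normrE.
  exact: (le_bigmax_cond _ (fun ij : 'I_1 * 'I_n => `|x ij.1 ij.2|) (j := (0, i))).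
by rewrite ler_norml => /andP[? ?]; apply/andP; split; lra.
Qed.

Lemma leb_bounded (A : set (Rn R n)) : bounded_set (A : set 'rV[R]_n) -> (leb A < +oo)%E.
Proof.
move=> /bounded_sub_box[M [_ AM]].
by apply: le_lt_trans (le_lebesgue_outer AM) _; rewrite [ltLHS]leb_box ltry.
Qed.

Lemma leb_open_gt0 (U : set 'rV[R]_n) : open U -> U !=set0 -> (0 < leb (U : set (Rn R n)))%E.
Proof.
move=> oU [x Ux]; have [e /= e0 xeU] := (nbhs_ballP _ _).1 (oU x Ux).
pose c : cell := (x - const_mx (e / 2), x + const_mx (e / 2)).
apply: (@lt_le_trans _ _ (leb (box c : set (Rn R n)))).
  rewrite leb_box lte_fin; apply: prodr_gt0 => i _.
  by rewrite lt_max !mxE; apply/orP; right; lra.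
apply: le_lebesgue_outer => y yc; apply: xeU; apply/ball_rowE; split => // i.
have := yc i; rewrite !mxE => /andP[h1 h2].
by rewrite ltr_distl; apply/andP; split; lra.
Qed.

End lebesgue_theory.

Lemma geometric_half (R : realType) N : \sum_(k < N) 2^-1 ^+ k <= 2 :> R.
Proof.
have := subrX1 (2^-1 : R) N.
by have : 0 <= 2^-1 ^+ N :> R by []; lra.
Qed.

Section almost_everywhere_lemmas.
Context d (T : measurableType d) (R : realType).
Variable mu : {measure set T -> \bar R}.
Implicit Types P Q S : T -> Prop.

Lemma ae_imp P Q : {ae mu, forall x, P x} -> (forall x, P x -> Q x) -> {ae mu, forall x, Q x}.
Proof. by move=> hP PQ; apply: filterS hP. Qed.

Lemma ae_imp2 P Q S : {ae mu, forall x, P x} -> {ae mu, forall x, Q x} ->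
  (forall x, P x -> Q x -> S x) -> {ae mu, forall x, S x}.
Proof. by move=> hP hQ PQ; apply: filterS2 hP hQ. Qed.

Lemma ae_all (P : nat -> T -> Prop) : (forall k, {ae mu, forall x, P k x}) ->
  {ae mu, forall x, forall k, P k x}.
Proof. by move=> h; apply/ae_foralln. Qed.

Lemma ae_true P : (forall x, P x) -> {ae mu, forall x, P x}.
Proof. by move=> h; apply: aeW. Qed.

End almost_everywhere_lemmas.

(** * Real-valued integrals *)

Section real_integral.
Context d (T : measurableType d) (R : realType).
Variables (mu : {measure set T -> \bar R}) (D : set T).
Hypothesis mD : measurable D.
Implicit Types (f g u v : T -> R).

Local Notation intg f := (mu.-integrable D (EFin \o f)).
Local Notation I f := (\int[mu]_(x in D) f x).

Lemma intgP f : intg f <->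
  measurable_fun D f /\ (\int[mu]_(x in D) `|f x|%:E < +oo)%E.
Proof.
split=> [/integrableP[/measurable_EFinP mf] fi|[mf fi]]; first by split.
by apply/integrableP; split; first exact/measurable_EFinP.
Qed.

Lemma intg_meas f : intg f -> measurable_fun D f.
Proof. by move=> /intgP[]. Qed.

Lemma intg_le f g : measurable_fun D f -> intg g ->
  (forall x, D x -> `|f x| <= g x) -> intg f.
Proof.
move=> mf ig fg; apply: le_integrable ig => //; first exact/measurable_EFinP.
move=> x Dx; rewrite lee_fin; apply: le_trans (fg x Dx) _.
by rewrite ger0_norm// (le_trans _ (fg x Dx)).
Qed.

Lemma eq_intg f g : (forall x, D x -> f x = g x) -> intg f -> intg g.
Proof. by move=> fg; apply: eq_integrable => // x /[!inE] Dx /=; rewrite fg. Qed.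

Lemma intgD f g : intg f -> intg g -> intg (fun x => f x + g x).
Proof. by move=> hf hg; have := integrableD mD hf hg; apply: eq_integrable. Qed.

Lemma intgZ k f : intg f -> intg (fun x => k * f x).
Proof. by move=> hf; have := integrableZl mD k hf; apply: eq_integrable. Qed.

Lemma intgN f : intg f -> intg (fun x => - f x).
Proof. by move=> /(intgZ (-1)); apply: eq_intg => x _; rewrite mulN1r. Qed.

Lemma intgB f g : intg f -> intg g -> intg (fun x => f x - g x).
Proof. by move=> hf /intgN; exact: intgD. Qed.

Lemma intg_abs f : intg f -> intg (fun x => `|f x|).
Proof. by move=> hf; have := integrable_abse hf; apply: eq_integrable. Qed.

Lemma intg0 : intg (fun=> 0).
Proof. exact: integrable0. Qed.

Lemma intg_sum (J : Type) (s : seq J) (f : J -> T -> R) : (forall j, intg (f j)) ->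
  intg (fun x => \sum_(j <- s) f j x).
Proof.
move=> hf; elim: s => [|j s IH].
  by apply: eq_intg intg0 => x _; rewrite big_nil.
by apply: eq_intg (intgD (hf j) IH) => x _; rewrite big_cons.
Qed.

Lemma Rint_sum (J : Type) (s : seq J) (f : J -> T -> R) : (forall j, intg (f j)) ->
  I (fun x => \sum_(j <- s) f j x) = \sum_(j <- s) I (f j).
Proof.
move=> hf; elim: s => [|j s IH].
  rewrite big_nil (@eq_Rintegral _ _ _ _ _ (fun=> 0)); first by rewrite Rintegral_cst// mul0r.
  by move=> x _; rewrite big_nil.
rewrite big_cons -IH -RintegralD//; last exact: intg_sum.
by apply: eq_Rintegral => x _; rewrite big_cons.
Qed.

Lemma Rint_abs f : intg f -> (\int[mu]_(x in D) `|f x|%:E = (I (fun x => `|f x|))%:E)%E.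
Proof.
move=> /intgP[mf fi]; rewrite /Rintegral fineK// ge0_fin_numE//.
exact: integral_ge0.
Qed.

Lemma Rint_nneg f : intg f -> (forall x, D x -> 0 <= f x) ->
  (\int[mu]_(x in D) (f x)%:E = (I f)%:E)%E.
Proof.
move=> fi f0; have E : I (fun x => `|f x|) = I f.
  by apply: eq_Rintegral => x /[!inE] Dx; rewrite ger0_norm ?f0.
rewrite -E -Rint_abs//; apply: eq_integral => x /[!inE] Dx; by rewrite ger0_norm ?f0.
Qed.

Lemma intg_nneg f (M : R) : measurable_fun D f -> (forall x, D x -> 0 <= f x) ->
  (\int[mu]_(x in D) (f x)%:E <= M%:E)%E -> intg f /\ I f <= M.
Proof.
move=> mf f0 fM.
have hf : intg f.
  apply/intgP; split => //; apply: le_lt_trans (ltry M).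
  apply: le_trans fM; rewrite le_eqVlt; apply/orP; left; apply/eqP.
  by apply: eq_integral => x /[!inE] Dx; rewrite ger0_norm ?f0.
by split => //; rewrite -lee_fin -Rint_nneg.
Qed.

Lemma ae_Rint f g : measurable_fun D f -> measurable_fun D g ->
  {ae mu, forall x, D x -> f x = g x} -> I f = I g.
Proof.
move=> mf mg fg; congr fine; apply: ae_eq_integral => //; try exact/measurable_EFinP.
by apply: filterS fg => x h Dx; rewrite h.
Qed.

Lemma ae_intg f g : measurable_fun D g ->
  {ae mu, forall x, D x -> f x = g x} -> intg f -> intg g.
Proof.
move=> mg fg /intgP[mf fi]; apply/intgP; split => //.
rewrite -(@ae_eq_integral _ _ _ mu D _ (fun x => `|f x|%:E)) //.
- by apply/measurable_EFinP; exact: measurableT_comp.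
- by apply/measurable_EFinP; exact: measurableT_comp.
- by apply: filterS fg => x h Dx; rewrite h.
Qed.

Lemma Rint_eq0_ae f : intg f -> (forall x, D x -> 0 <= f x) -> I f = 0 ->
  {ae mu, forall x, D x -> f x = 0}.
Proof.
move=> fi f0 If0.
have /(ae_eq_integral_abs mu mD) : measurable_fun D (EFin \o f).
  by apply/measurable_EFinP; exact: intg_meas.
move=> [H _].
have /H : (\int[mu]_(x in D) `|(EFin \o f) x| = 0)%E.
  by rewrite (_ : (\int[mu]_(x in D) _)%E = (I (fun x => `|f x|))%:E) ?Rint_abs// ?Rint_abs// (@eq_Rintegral _ _ _ _ _ f) ?If0// => x /[!inE] Dx; rewrite ger0_norm ?f0.
by apply: filterS => x h Dx; have := h Dx => -[].
Qed.

Lemma RDCT (f_ : nat -> T -> R) f g : (forall k, measurable_fun D (f_ k)) ->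
  measurable_fun D f -> intg g ->
  {ae mu, forall x, D x -> (fun k => f_ k x) @ \oo --> f x} ->
  {ae mu, forall x, D x -> forall k, `|f_ k x| <= g x} ->
  intg f /\ (fun k => I (f_ k)) @ \oo --> (I f : R).
Proof.
move=> mf_ mf ig cf bf.
have [|||||h1 _ h2] := @dominated_convergence _ _ R mu D mD (fun k => EFin \o f_ k) (EFin \o f) (EFin \o g).
- by move=> k; apply/measurable_EFinP.
- exact/measurable_EFinP.
- by apply: filterS cf => x h Dx; apply/fine_cvgP; split; [exact: nearW|exact: h].
- exact: ig.
- by apply: filterS bf => x h k Dx; rewrite lee_fin; exact: h.
split => //.
by apply: fine_cvg; rewrite fineK; [exact: h2|exact: integrable_fin_num].
Qed.

(** An upper limit made real: measurable without any convergence, and equal to the limit wherever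
    there is one. *)
Definition alim (f_ : nat -> T -> R) x := fine (limn_esup (fun k => (f_ k x)%:E)).

Lemma measurable_alim (f_ : nat -> T -> R) : (forall k, measurable_fun D (f_ k)) ->
  measurable_fun D (alim f_).
Proof.
move=> mf; apply: (measurableT_comp (f := fine)) => //.
by apply: measurable_fun_limn_esup => k; apply/measurable_EFinP.
Qed.

Lemma alimE (f_ : nat -> T -> R) x l : (fun k => f_ k x) @ \oo --> l -> alim f_ x = l.
Proof.
move=> fl; rewrite /alim (_ : limn_esup _ = l%:E)//.
by apply: (cvg_limn_einf_sup _).2; apply/fine_cvgP; split; [exact: nearW|].
Qed.

Lemma Rfatou (f_ : nat -> T -> R) f (M : R) : (forall k, intg (f_ k)) ->
  (forall k x, D x -> 0 <= f_ k x) -> measurable_fun D f -> (forall x, D x -> 0 <= f x) ->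
  {ae mu, forall x, D x -> (fun k => f_ k x) @ \oo --> f x} ->
  (forall k, I (f_ k) <= M) -> intg f /\ I f <= M.
Proof.
move=> hf f0 mf f00 cf fM; apply: intg_nneg => //.
have := @fatou _ _ R mu D mD (fun k => EFin \o f_ k) _ _.
move=> /(_ _ _)-F.
apply: (@le_trans _ _ (\int[mu]_(x in D) limn_einf (fun k => (f_ k x)%:E))%E).
  rewrite le_eqVlt; apply/orP; left; apply/eqP; apply: ae_eq_integral => //.
  - exact/measurable_EFinP.
  - rewrite (_ : (fun x => _) = (fun x => - limn_esup (fun k => (- f_ k x)%:E))%E); last first.
      by apply/funext => x; rewrite -(limn_einfN (fun k => (- f_ k x)%:E)); congr limn_einf; apply/funext => k /=; rewrite opprK.
    apply: measurableT_comp => //; apply: measurable_fun_limn_esup => k.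
    by apply/measurable_EFinP; apply: measurableT_comp => //; exact: intg_meas.
  - apply: filterS cf => x h Dx; apply/esym; apply: (cvg_limn_einf_sup _).1.
    by apply/fine_cvgP; split; [exact: nearW|exact: h].
apply: le_trans (F _ _) _.
- by move=> k; apply/measurable_EFinP; exact: intg_meas.
- by move=> k x Dx; rewrite lee_fin f0.
rewrite limn_einf_lim; apply: lime_le; first exact: is_cvg_einfs.
apply: nearW => k; apply: (@le_trans _ _ (\int[mu]_(x in D) (f_ k x)%:E)%E).
  by apply: ereal_inf_lbound; exists k => //=.
by rewrite Rint_nneg// ?lee_fin//; exact: f0.
Qed.

(** By monotone convergence the sum of the series is integrable, hence finite almost everywhere. The
    sum itself serves as the majorant [G]. *)
Lemma ae_summable (f_ : nat -> T -> R) (M : R) : (forall k, intg (f_ k)) ->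
  (forall k x, D x -> 0 <= f_ k x) -> (forall N, \sum_(k < N) I (f_ k) <= M) ->
  exists2 G : T -> R, intg G &
   {ae mu, forall x, D x -> cvgn (series (fun k => f_ k x)) /\ forall k, f_ k x <= G x}.
Proof.
move=> hf f0 hM.
pose S x := (\sum_(k <oo) (f_ k x)%:E)%E.
have mS : measurable_fun D S.
  apply: ge0_emeasurable_sum => [k x Dx _|k _]; first by rewrite lee_fin f0.
  by apply/measurable_EFinP; exact: intg_meas.
have S0 x : D x -> (0 <= S x)%E.
  by move=> Dx; apply: nneseries_ge0 => k _ _; rewrite lee_fin f0.
have iS : mu.-integrable D S.
  apply/integrableP; split => //.
  apply: (@le_lt_trans _ _ M%:E); last exact: ltry.
  rewrite (_ : (\int[mu]_(x in D) _)%E = (\int[mu]_(x in D) S x)%E); last first.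
    by apply: eq_integral => x /[!inE] Dx; rewrite gee0_abs// S0.
  rewrite integral_nneseries//; last first.
    by move=> k; apply/measurable_EFinP; exact: intg_meas.
  under eq_eseriesr do rewrite (Rint_nneg (hf _) (f0 _)).
  apply: lime_le.
    by apply: is_cvg_nneseries => k _ _; rewrite lee_fin; apply: Rintegral_ge0 => x; exact: f0.
  by apply: nearW => N; rewrite big_mkord sumEFin lee_fin.
have Sfin := integrable_ae mD iS.
exists (fun x => fine (S x)).
  apply/intgP; split; first exact: (measurableT_comp (f := fine)).
  move/integrableP : iS => [_]; apply: le_lt_trans.
  rewrite le_eqVlt; apply/orP; left; apply/eqP; apply: ae_eq_integral => //.
  - apply/measurable_EFinP; apply: measurableT_comp => //.
    exact: (measurableT_comp (f := fine)).
  - exact: measurableT_comp.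
  - by apply: filterS Sfin => x h Dx; rewrite -{2}(fineK (h Dx)).
apply: filterS Sfin => x h Dx; have {}h := h Dx; split.
  apply: nnseries_is_cvg => [k|]; first exact: f0.
  by rewrite ltey_eq h.
move=> k; rewrite -lee_fin fineK//.
apply: (@le_trans _ _ (\sum_(0 <= i < k.+1) (f_ i x)%:E)%E); last first.
  by apply: nneseries_lim_ge => i _ _; rewrite lee_fin f0.
by rewrite big_nat_recr//= leeDr// sume_ge0// => i _; rewrite lee_fin f0.
Qed.

(** A subsequence with integrals at most 2^-j is summable almost everywhere. Besides convergence
    this gives a common integrable majorant, as dominated convergence requires in
    [nemytskii_seq]. *)
Lemma ae_cvg_subseq (f_ : nat -> T -> R) : (forall k, intg (f_ k)) ->
  (forall k x, D x -> 0 <= f_ k x) -> (fun k => I (f_ k)) @ \oo --> (0 : R) ->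
  exists psi : nat -> nat, [/\ forall j, (j <= psi j)%N &
   exists2 G : T -> R, intg G & {ae mu, forall x, D x ->
     (fun j => f_ (psi j) x) @ \oo --> (0 : R) /\ forall j, f_ (psi j) x <= G x}].
Proof.
move=> hf f0 If0.
have [psi psiP] : {psi : nat -> nat & forall j, (j <= psi j)%N /\ I (f_ (psi j)) <= 2^-1 ^+ j}.
  apply: (@choice _ _ (fun j k => (j <= k)%N /\ I (f_ k) <= 2^-1 ^+ j)) => j.
  have e0 : 0 < 2^-1 ^+ j :> R by rewrite exprn_gt0.
  move/cvgr0Pnorm_le : If0 => /(_ _ e0) [N _ HN].
  exists (maxn j N); split; first exact: leq_maxl.
  by apply: le_trans (ler_norm _) _; apply: HN => /=; exact: leq_maxr.
exists psi; split=> [j|]; first exact: (psiP j).1.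
have [|||G iG HG] := @ae_summable (fun j => f_ (psi j)) 2.
- by move=> j.
- by move=> j x; exact: f0.
- move=> N; apply: (@le_trans _ _ (\sum_(k < N) 2^-1 ^+ k)).
    by apply: ler_sum => k _; exact: (psiP k).2.
  exact: geometric_half.
exists G => //; apply: filterS HG => x h Dx; have [h1 h2] := h Dx; split => //.
exact: cvg_series_cvg_0.
Qed.

Definition L2 u := measurable_fun D u /\ intg (fun x => u x ^+ 2).

Lemma L2_mul u v : L2 u -> L2 v -> intg (fun x => u x * v x).
Proof.
move=> [mu_ iu] [mv iv]; apply: (intg_le (g := fun x => u x ^+ 2 + v x ^+ 2)).
- exact: measurable_funM.
- exact: intgD.
- move=> x _; rewrite normrM -[u x ^+ 2]real_normK ?num_real//.
  rewrite -[v x ^+ 2]real_normK ?num_real//.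
  by have := sqr_ge0 (`|u x| - `|v x|); have := sqr_ge0 (`|u x|); have := sqr_ge0 (`|v x|); nra.
Qed.

Lemma L2_lin k u v : L2 u -> L2 v -> L2 (fun x => k * u x + v x).
Proof.
move=> hu hv; have iuv := L2_mul hu hv; move: hu hv => [mu_ iu] [mv iv]; split.
  by apply: measurable_funD => //; exact: measurable_funM.
apply: (eq_intg (f := fun x => k ^+ 2 * u x ^+ 2 + (2 * k * (u x * v x) + v x ^+ 2))).
  by move=> x _; ring.
by apply: intgD; [exact: intgZ|apply: intgD => //; exact: intgZ].
Qed.

Lemma L2_0 : L2 (fun=> 0).
Proof. by split => //; apply: eq_intg intg0 => x _; rewrite expr0n. Qed.

Lemma L2_ext u v : (forall x, D x -> u x = v x) -> L2 u -> L2 v.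
Proof.
move=> uv [mu_ iu]; split; first by apply: eq_measurable_fun mu_ => x /[!inE]; exact: uv.
by apply: eq_intg iu => x Dx; rewrite uv.
Qed.

Lemma L2_B u v : L2 u -> L2 v -> L2 (fun x => u x - v x).
Proof.
move=> hu hv; have := L2_lin (-1) hv hu; apply: L2_ext => x _.
by rewrite mulN1r addrC.
Qed.

Lemma L2_ae_subseq (u_ : nat -> T -> R) u : (forall k, L2 (u_ k)) -> L2 u ->
  (fun k => I (fun x => (u_ k x - u x) ^+ 2)) @ \oo --> (0 : R) ->
  exists psi : nat -> nat, (forall j, (j <= psi j)%N) /\
   {ae mu, forall x, D x -> (fun j => u_ (psi j) x) @ \oo --> u x}.
Proof.
move=> hu_ hu H.
have [|||psi [psij [G _ HG]]] := @ae_cvg_subseq (fun k x => (u_ k x - u x) ^+ 2).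
- by move=> k; exact: (L2_B (hu_ k) hu).2.
- by move=> k x _; rewrite sqr_ge0.
- exact: H.
exists psi; split => //; apply: filterS HG => x h Dx; have [h1 _] := h Dx.
have h2 : (fun j => `|u_ (psi j) x - u x|) @ \oo --> (0 : R).
  rewrite -(sqrtr0 R) (_ : (fun j => _) = (fun j => Num.sqrt ((u_ (psi j) x - u x) ^+ 2))).
    by apply: continuous_cvg => //; exact: sqrt_continuous.
  by apply/funext => j; rewrite sqrtr_sqr.
by apply/cvgrPdist_lt => e e0; move/cvgr0Pnorm_lt : h2 => /(_ _ e0); apply: filterS => j; rewrite normr_id distrC.
Qed.

Lemma intg_indic (A : set T) : measurable A -> (mu A < +oo)%E -> intg (\1_A : T -> R).
Proof.
move=> mA muA; apply/intgP; split; first exact: measurable_indic.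
rewrite (eq_integral (fun x => (\1_A x)%:E)); last by move=> x _; rewrite ger0_norm.
rewrite integral_indic//; apply: le_lt_trans muA; apply: le_measure; rewrite ?inE//.
exact: measurableI.
Qed.

Lemma intg_supp f : (forall x, ~ D x -> f x = 0) ->
  mu.-integrable setT (EFin \o f) <-> intg f.
Proof.
move=> f0; have E : EFin \o f = (EFin \o f) \_ D.
  by apply/funext => x; rewrite patchE; case: ifPn => // /negP; rewrite inE /= => /f0 ->.
by rewrite {1}E; split=> /(integrable_mkcond _ mD).
Qed.

Lemma Rint_supp f : (forall x, ~ D x -> f x = 0) -> \int[mu]_x f x = I f.
Proof.
move=> f0; rewrite [RHS]Rintegral_mkcond; apply: eq_Rintegral => x _.
by rewrite patchE; case: ifPn => // /negP; rewrite inE /= => /f0 ->.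
Qed.

Hypothesis muD : (mu D < +oo)%E.

Lemma intg_cst (k : R) : intg (fun=> k).
Proof.
apply/intgP; split => //; rewrite integral_cst//.
by rewrite lte_mul_pinfty// ?lee_fin.
Qed.

Lemma L2_cst (k : R) : L2 (fun=> k).
Proof. by split => //; exact: intg_cst. Qed.

(** Riesz-Fischer: along a fast subsequence the increments are summable almost everywhere, and
    Fatou's lemma turns the Cauchy condition into a bound on the distance to the limit. *)
Lemma L2_complete (u_ : nat -> T -> R) : (forall k, L2 (u_ k)) ->
  (forall e : R, 0 < e -> exists N, forall m n, (N <= m)%N -> (N <= n)%N ->
     I (fun x => (u_ m x - u_ n x) ^+ 2) < e) ->
  exists2 u, L2 u & (fun k => I (fun x => (u_ k x - u x) ^+ 2)) @ \oo --> (0 : R).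
Proof.
move=> hu hC.
have e0 j : 0 < 4^-1 ^+ j :> R by rewrite exprn_gt0.
have [N_ N_P] : {N_ : nat -> nat & forall j m n, (N_ j <= m)%N -> (N_ j <= n)%N ->
     I (fun x => (u_ m x - u_ n x) ^+ 2) < 4^-1 ^+ j}.
  by apply: (@choice _ _ (fun j N => forall m n, (N <= m)%N -> (N <= n)%N ->
     I (fun x => (u_ m x - u_ n x) ^+ 2) < 4^-1 ^+ j)) => j; exact: hC.
(* A sum of thresholds lies above each of them, so [phi j] is beyond [N_ i] for all [i <= j]. *)
pose phi j := (\sum_(i < j.+1) N_ i)%N.
have phiN i j : (i <= j)%N -> (N_ i <= phi j)%N.
  by move=> ij; rewrite /phi (bigD1 (Ordinal (ij : (i < j.+1)%N)))//= leq_addr.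
pose d_ j x := `|u_ (phi j.+1) x - u_ (phi j) x|.
have Id j : I (d_ j) <= 2^-1 ^+ j * (1 + fine (mu D)).
  have h2 := L2_B (hu (phi j.+1)) (hu (phi j)).
  (* The pointwise inequality |t| <= 2^j t^2 + 2^-j turns the bound 4^-j on squares into a bound of
     order 2^-j on absolute values, as the measure is finite. *)
  apply: (@le_trans _ _ (I (fun x => 2 ^+ j * (u_ (phi j.+1) x - u_ (phi j) x) ^+ 2 + 2^-1 ^+ j))).
    apply: le_Rintegral => //.
    - apply: (intg_le (g := fun x => (u_ (phi j.+1) x - u_ (phi j) x) ^+ 2 + 1)).
      + by apply: measurableT_comp => //; exact: h2.1.
      + by apply: intgD; [exact: h2.2|exact: intg_cst].
      + move=> x _; rewrite normr_id; set t := _ - _.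
        by have := sqr_ge0 (`|t| - 1); rewrite -(real_normK (num_real t)); have := sqr_ge0 (`|t|); nra.
    - by apply: intgD; [exact: intgZ h2.2|exact: intg_cst].
    - move=> x _; rewrite /d_; set t := _ - _.
      have E : 2 ^+ j * 2^-1 ^+ j = 1 :> R by rewrite -exprMn divff ?expr1n.
      have p0 : 0 < 2 ^+ j :> R by rewrite exprn_gt0.
      have q0 : 0 < 2^-1 ^+ j :> R by rewrite exprn_gt0.
      rewrite -(real_normK (num_real t)).
      have : 0 <= 2 ^+ j * (`|t| - 2^-1 ^+ j) ^+ 2 by rewrite mulr_ge0 ?sqr_ge0// ltW.
      have -> : 2 ^+ j * (`|t| - 2^-1 ^+ j) ^+ 2 = 2 ^+ j * `|t| ^+ 2 -
          2 * (2 ^+ j * 2^-1 ^+ j) * `|t| + (2 ^+ j * 2^-1 ^+ j) * 2^-1 ^+ j by ring.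
      by rewrite E; have := normr_ge0 t; lra.
  rewrite RintegralD//; [|exact: intgZ h2.2|exact: intg_cst].
  rewrite RintegralZl//; last exact: h2.2.
  rewrite Rintegral_cst// mulrDr mulr1 lerD2r.
  have := N_P j (phi j.+1) (phi j) (phiN _ _ (leqnSn _)) (phiN _ _ (leqnn _)) => /ltW h.
  apply: le_trans (ler_wpM2l _ h) _; first by rewrite exprn_ge0.
  by rewrite -exprMn (_ : 2 * 4^-1 = 2^-1)//; field.
have mu0 : 0 <= fine (mu D) by rewrite fine_ge0.
have [|||G _ HG] := @ae_summable d_ (2 * (1 + fine (mu D))).
- move=> j; have h2 := L2_B (hu (phi j.+1)) (hu (phi j)); apply: intg_abs.
  apply: (eq_intg _ (L2_mul h2 (L2_cst 1))).
  by move=> x _; rewrite mulr1.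
- by move=> k x _; exact: normr_ge0.
- move=> N; apply: (@le_trans _ _ (\sum_(k < N) 2^-1 ^+ k * (1 + fine (mu D)))).
    by apply: ler_sum => k _; exact: Id.
  rewrite -mulr_suml ler_wpM2r ?addr_ge0//.
  exact: geometric_half.
pose u := alim (fun j => u_ (phi j)).
have mu_ : measurable_fun D u by apply: measurable_alim => j; exact: (hu _).1.
have cu : {ae mu, forall x, D x -> (fun j => u_ (phi j) x) @ \oo --> u x}.
  apply: filterS HG => x h Dx; have [h1 _] := h Dx.
  have /normed_cvg h2 : cvgn [normed series (fun j => u_ (phi j.+1) x - u_ (phi j) x)] by exact: h1.
  have h3 : cvgn (fun j => u_ (phi j) x).
    have : cvgn (fun j => series (fun j => u_ (phi j.+1) x - u_ (phi j) x) j + u_ (phi 0%N) x).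
      by apply: is_cvgD => //; exact: is_cvg_cst.
    rewrite (_ : (fun j => _) = (fun j => u_ (phi j) x))//.
    by apply/funext => j; rewrite /series /= (telescope_sumr (fun j => u_ (phi j) x))// subrK.
  have [l hl] := (cvg_ex _).1 h3.
  by rewrite /u (alimE hl).
have key i k : (N_ i <= k)%N -> L2 u /\ I (fun x => (u_ k x - u x) ^+ 2) <= 4^-1 ^+ i.
  move=> ik.
  have [||||||h1 h2] := @Rfatou (fun j x => (u_ k x - u_ (phi (j + i)%N) x) ^+ 2)
     (fun x => (u_ k x - u x) ^+ 2) (4^-1 ^+ i).
  - by move=> j; exact: (L2_B (hu _) (hu _)).2.
  - by move=> j x _; exact: sqr_ge0.
  - apply: measurable_funX; apply: measurable_funB => //; exact: (hu k).1.
  - by move=> x _; exact: sqr_ge0.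
  - apply: filterS cu => x h Dx; have {}h := h Dx.
    have h' : (fun j => u_ (phi (j + i)%N) x) @ \oo --> u x by exact: (cvg_comp _ _ (cvg_addnr i) h).
    have h3 : (fun j => u_ k x - u_ (phi (j + i)%N) x) @ \oo --> u_ k x - u x.
      by apply: cvgB => //; exact: cvg_cst.
    by rewrite expr2; under eq_fun do rewrite expr2; exact: cvgM.
  - by move=> j; apply: ltW; apply: N_P => //; apply: phiN; rewrite leq_addl.
  split => //; apply: (L2_ext (u := fun x => u_ k x - (u_ k x - u x))).
    by move=> x _; rewrite subKr.
  apply: L2_B => //; split => //.
  by apply: measurable_funB => //; exact: (hu k).1.
exists u; first by have [] := key 0%N (N_ 0%N) (leqnn _).
apply/cvgr0Pnorm_le => e ep.
have [i _ iP] : \forall i \near \oo, 4^-1 ^+ i < e.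
  have /cvgr0Pnorm_lt : (fun i => 4^-1 ^+ i : R) @ \oo --> (0 : R).
    by apply: cvg_expr; rewrite ger0_norm//; lra.
  move=> /(_ _ ep) [i _ iP]; exists i => // j /iP /=; apply: le_lt_trans; exact: ler_norm.
exists (N_ i) => // k /= ik; have [_ h] := key i k ik.
rewrite ger0_norm; last by apply: Rintegral_ge0 => x _; exact: sqr_ge0.
by apply: le_trans h _; apply: ltW; apply: iP => /=.
Qed.

End real_integral.

(** * Test functions *)

Section flat_functions.
Variable R : realType.
Implicit Types (P Q : {poly R}) (s t : R).

(** The polynomial in [t^-1] makes this family closed under differentiation. *)
Definition flat P t : R := if 0 < t then P.[t^-1] * expR (- t^-1) else 0.

(** The inequality 1 + x <= exp x at x = s / (i + 1), raised to the power i + 1. *)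
Lemma pow_expR_le (i : nat) s : 0 < s -> s ^+ i * expR (- s) <= i.+1%:R ^+ i.+1 / s.
Proof.
move=> s0; have m0 : 0 < i.+1%:R :> R by [].
have h : (s / i.+1%:R) ^+ i.+1 <= expR s.
  have -> : expR s = expR (s / i.+1%:R) ^+ i.+1.
    by rewrite -expRM_natl mulrC divfK ?gt_eqF.
  apply: lerXn2r; rewrite ?nnegrE ?expR_ge0 ?divr_ge0 ?(ltW s0)//.
  by apply: le_trans (expR_ge1Dx _); rewrite lerDr.
rewrite expRN ler_pdivlMr// mulrAC -exprSr ler_pdivrMr ?expR_gt0//.
by rewrite -ler_pdivrMl ?exprn_gt0// mulrC -expr_div_n.
Qed.

Lemma flat_bound P : exists C, forall t, 0 < t -> `|flat P t| <= C * t.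
Proof.
exists (\sum_(i < size P) `|P`_i| * i.+1%:R ^+ i.+1) => t t0.
rewrite /flat t0 horner_coef mulr_suml mulr_suml.
apply: le_trans (ler_norm_sum _ _ _) _; apply: ler_sum => i _.
have tV : 0 < t^-1 by rewrite invr_gt0.
rewrite -mulrA normrM -mulrA; apply: ler_wpM2l => //.
rewrite ger0_norm ?mulr_ge0 ?exprn_ge0 ?expR_ge0 ?(ltW tV)//.
by apply: le_trans (pow_expR_le _ tV) _; rewrite invrK.
Qed.

Definition flat_deriv P : {poly R} := 'X^2 * (P - P^`()).

Lemma flat_is_derive P t : is_derive t 1 (flat P) (flat (flat_deriv P) t).
Proof.
have [t0|t0|t0] := ltgtP t 0.
- have E : flat (flat_deriv P) t = 0 by rewrite /flat ltNge (ltW t0).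
  rewrite E; apply: near_eq_is_derive (is_derive_cst (0 : R) t (1 : R)).
  near=> s; rewrite /flat ltNge ltW//; near: s.
  exact: lt_nbhsl.
- have tn0 : t != 0 by rewrite gt_eqF.
  have dV : is_derive t 1 (fun s : R => s^-1) (- t ^- 2).
    have := @is_deriveV R id t 1 1 tn0 (is_derive_id _ _).
    by rewrite /GRing.scale /= mulr1.
  have d1 := is_derive1_comp (is_derive_poly P t^-1) dV.
  have dN : is_derive t 1 (fun s : R => - s^-1) (- - t ^- 2) by exact: is_deriveN.
  have d2 := is_derive1_comp (f := expR) (g := fun s : R => - s^-1) (is_derive_expR (- t^-1)) dN.
  have d3 := is_deriveM d1 d2.
  have E : \forall s \near t, (((horner P \o GRing.inv) * (expR \o (fun s : R => - s^-1))) : R -> R) s = flat P s.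
    near=> s; rewrite /flat ifT//; near: s.
    exact: lt_nbhsr.
  have d4 := near_eq_is_derive E d3.
  apply: is_derive_eq d4 _.
  rewrite /flat t0 /flat_deriv !hornerE /= /GRing.scale /=; by field.
- rewrite t0 {t t0}; have E : flat (flat_deriv P) 0 = 0 by rewrite /flat ltxx.
  rewrite E.
  (* The difference quotient at 0 is [flat ('X * P)] for [h > 0] and 0 otherwise, so it is of order
     [h]. *)
  have [C CP] := flat_bound ('X * P).
  have H h : `|h^-1 *: (flat P (h *: 1 + 0) - flat P 0)| <= `|C| * `|h|.
    rewrite /GRing.scale /= mulr1 addr0 {2}/flat ltxx subr0.
    have [h0|h0] := ltP 0 h; last first.
      by rewrite /flat ltNge h0 mulr0 normr0 mulr_ge0.
    have -> : h^-1 * flat P h = flat ('X * P) h by rewrite /flat h0 hornerM hornerX mulrA.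
    apply: le_trans (CP h h0) _; rewrite (gtr0_norm h0) ler_wpM2r ?(ltW h0)//.
    exact: ler_norm.
  have HC : (fun h => h^-1 *: (flat P (h *: 1 + 0) - flat P 0)) @ 0^' --> (0 : R).
    apply/cvgr0Pnorm_lt => e e0; near=> h.
    apply: le_lt_trans (H h) _.
    apply: (@le_lt_trans _ _ ((`|C| + 1) * `|h|)); first by rewrite ler_wpM2r// lerDl.
    rewrite mulrC -ltr_pdivlMr; last by rewrite ltr_wpDl.
    near: h; apply: dnbhs0_lt; rewrite divr_gt0// ltr_wpDl//.
  by apply: DeriveDef; [apply/cvg_ex; exists 0|apply: cvg_lim].
Unshelve. all: by end_near. Qed.

Lemma flat_continuous P : continuous (flat P).
Proof.
move=> t; apply: differentiable_continuous; apply/derivable1_diffP.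
by have [] := flat_is_derive P t.
Qed.

Lemma flat1E t : flat 1 t = if 0 < t then expR (- t^-1) else 0.
Proof. by rewrite /flat hornerC mul1r. Qed.

Lemma flat1_ge0 t : 0 <= flat 1 t.
Proof. by rewrite flat1E; case: ifP => // _; exact: expR_ge0. Qed.

Lemma flat1_le1 t : flat 1 t <= 1.
Proof.
rewrite flat1E; case: ifP => // t0.
by rewrite -expR0 ler_expR oppr_le0 invr_ge0 ltW.
Qed.

Lemma flat1_gt0 t : (flat 1 t != 0) = (0 < t).
Proof. by rewrite flat1E; case: ifP => _; rewrite ?eqxx// gt_eqF ?expR_gt0. Qed.

Lemma flat1_mono t s : t <= s -> flat 1 t <= flat 1 s.
Proof.
move=> ts; rewrite [leLHS]flat1E; case: ifP => t0; last exact: flat1_ge0.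
rewrite flat1E (lt_le_trans t0 ts) ler_expR lerN2 lef_pV2// posrE//.
exact: lt_le_trans ts.
Qed.

Lemma flat1_cvg1 d : 0 < d -> (fun k => flat 1 (k%:R * d)) @ \oo --> (1 : R).
Proof.
move=> d0.
have H : (fun k => expR (- (k.+1%:R^-1 * d^-1 : R))) @ \oo --> (1 : R).
  rewrite -[X in _ --> X]expR0; apply: continuous_cvg; first exact: continuous_expR.
  rewrite -[X in _ --> X]oppr0; apply: cvgN; rewrite -[X in _ --> X](mul0r d^-1); apply: cvgMl; exact: cvg_harmonic.
rewrite -cvg_shiftS; apply: cvg_trans H.
apply: near_eq_cvg; near=> k.
by rewrite /= flat1E pmulr_rgt0 ?ltr0Sn// d0 invfM.
Unshelve. all: by end_near. Qed.

End flat_functions.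

Section flat_product.
Variables (R : realType) (n : nat).

(** A class stable under partial derivatives and made of continuous functions, so that smoothness
    follows by induction on the list of derivatives. *)
Inductive flat_poly : ('rV[R]_n -> R) -> Prop :=
| fp_flat P k a j : flat_poly (fun x => flat P (k * x 0 j + a))
| fp_cst c : flat_poly (fun=> c)
| fp_add f g : flat_poly f -> flat_poly g -> flat_poly (fun x => f x + g x)
| fp_mul f g : flat_poly f -> flat_poly g -> flat_poly (fun x => f x * g x).

Lemma is_derive_coord (h dh : R -> R) (i j : 'I_n) x :
  (forall t : R, is_derive t (1 : R) h (dh t)) ->
  is_derive (x : 'rV[R]_n) (delta_mx 0 i) (fun x : 'rV[R]_n => h (x 0 j)) ((j == i)%:R * dh (x 0 j)).
Proof.
move=> hd; case: (eqVneq j i) => [<-|ji].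
  rewrite mul1r; have [d1 d2] := hd (x 0 j).
  have E : (fun t => t^-1 *: (h ((t *: delta_mx 0 j + x) 0 j) - h (x 0 j))) =
     (fun t => t^-1 *: (h (t *: 1 + x 0 j) - h (x 0 j))).
    by apply/funext => t; rewrite !mxE !eqxx.
  split; first by rewrite /derivable E.
  by rewrite /derive E.
rewrite mul0r.
have E : (fun t => t^-1 *: (h ((t *: delta_mx 0 i + x) 0 j) - h (x 0 j))) = (fun=> 0 : R).
  apply/funext => t; rewrite !mxE !eqxx (negPf ji) mulr0 add0r subrr.
  by rewrite scaler0.
split; first by rewrite /derivable E; exact: is_cvg_cst.
by rewrite /derive E lim_cst.
Qed.

Lemma flat_poly_continuous f : flat_poly f -> continuous f.
Proof.
elim=> [P k a j|c|g h _ cg _ ch|g h _ cg _ ch] x.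
- have ca : continuous (fun x : 'rV[R]_n => k * x 0 j + a).
    move=> y; have cj : (fun x : 'rV[R]_n => x 0 j) @ y --> y 0 j by exact: coord_continuous.
    exact: (cvgD (cvgM (cvg_cst k) cj) (cvg_cst a)).
  exact: (continuous_comp (ca x) (@flat_continuous R P _)).
- exact: cst_continuous.
- exact: (cvgD (cg x) (ch x)).
- exact: (cvgM (cg x) (ch x)).
Qed.

Lemma flat_poly_derive f i : flat_poly f ->
  exists2 g, flat_poly g & forall x, is_derive x (delta_mx 0 i) f (g x).
Proof.
elim=> [P k a j|c|g h hg [g' fg dg] hh [h' fh dh]|g h hg [g' fg dg] hh [h' fh dh]].
- exists (fun x => ((j == i)%:R) * (k * flat (flat_deriv P) (k * x 0 j + a))).
    by do 2![apply: fp_mul; first exact: fp_cst]; exact: fp_flat.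
  move=> x; apply: (@is_derive_coord (fun t => flat P (k * t + a))
    (fun t => k * flat (flat_deriv P) (k * t + a))) => t.
  have dl : is_derive t 1 (fun t : R => k * t + a) k.
    have h := is_deriveD (is_deriveZ k (is_derive_id t 1)) (is_derive_cst a t 1).
    rewrite [k%:A]mulr1 addr0 in h.
    by rewrite (_ : (fun t => _) = k \*: (id : R -> R) + cst a).
  by rewrite mulrC; exact: (is_derive1_comp (flat_is_derive P _) dl).
- by exists (fun=> 0); [exact: fp_cst|move=> x; exact: is_derive_cst].
- by exists (fun x => g' x + h' x); [exact: fp_add|move=> x; exact: is_deriveD].
- exists (fun x => g x * h' x + h x * g' x); first by apply: fp_add; exact: fp_mul.
  by move=> x; exact: is_deriveM.
Qed.

Lemma flat_poly_partial f i : flat_poly f -> flat_poly (partial i f).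
Proof.
move=> /(flat_poly_derive i)[g fg dg]; rewrite (_ : partial i f = g)//.
by apply/funext => x; have [_] := dg x.
Qed.

Lemma flat_poly_smooth f : flat_poly f -> smooth f.
Proof.
move=> ff s; have fs : flat_poly (iter_partial s f).
  by elim: s => [//|i s IH]; exact: flat_poly_partial.
split=> [|i x]; first exact: flat_poly_continuous.
by have [g _ /(_ x)[]] := flat_poly_derive i fs.
Qed.

Lemma fp_prod (s : seq 'I_n) (F : 'I_n -> 'rV[R]_n -> R) :
  (forall i, flat_poly (F i)) -> flat_poly (fun x => \prod_(i <- s) F i x).
Proof.
move=> hF; elim: s => [|i s IH].
  rewrite (_ : (fun x => _) = (fun=> 1)); first exact: fp_cst.
  by apply/funext => x; rewrite big_nil.
rewrite (_ : (fun x => _) = (fun x => F i x * \prod_(i <- s) F i x)); first exact: fp_mul.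
by apply/funext => x; rewrite big_cons.
Qed.

(** The first factor starts at [c.1 0 i]; the second vanishes from [c.2 0 i + 1/k] on, and with the
    slope [k^2] its argument is at least [k] up to and including [c.2 0 i]. Hence the limit is the
    indicator of the half-open interval, right endpoint included. *)
Definition bump1 (k : nat) (c : 'rV[R]_n * 'rV[R]_n) i (x : 'rV[R]_n) : R :=
  flat 1 (k%:R * x 0 i + (- (k%:R * c.1 0 i))) *
  flat 1 (- (k%:R ^+ 2) * x 0 i + (k%:R ^+ 2 * c.2 0 i + k%:R)).

Definition bump k c x := \prod_i bump1 k c i x.

Lemma bump_flat_poly k c : flat_poly (bump k c).
Proof. by apply: fp_prod => i; apply: fp_mul; exact: fp_flat. Qed.

Lemma bump_ge0 k c x : 0 <= bump k c x.
Proof. by apply: prodr_ge0 => i _; rewrite mulr_ge0// flat1_ge0. Qed.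

Lemma bump_le1 k c x : bump k c x <= 1.
Proof.
apply: prodr_ile1 => i _; rewrite mulr_ge0 ?flat1_ge0//=.
by rewrite mulr_ile1 ?flat1_ge0 ?flat1_le1.
Qed.

Lemma bump_supp k c x i : bump k c x != 0 -> c.1 0 i < x 0 i < c.2 0 i + k%:R^-1.
Proof.
move=> /prodf_neq0 /(_ i isT); rewrite /bump1 mulf_eq0 negb_or !flat1_gt0 => /andP[h1 h2].
case: k h1 h2 => [|k] h1 h2; first by move: h1; rewrite !mul0r subr0 ltxx.
have k0 : 0 < k.+1%:R :> R by [].
move: h1; rewrite -mulrBr pmulr_rgt0// subr_gt0 => -> /=.
move: h2; have -> : - k.+1%:R ^+ 2 * x 0 i + (k.+1%:R ^+ 2 * c.2 0 i + k.+1%:R) =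
  k.+1%:R ^+ 2 * (c.2 0 i + k.+1%:R^-1 - x 0 i) :> R by field; rewrite gt_eqF.
by rewrite pmulr_rgt0 ?exprn_gt0// subr_gt0.
Qed.

Lemma bump1_cvg (c : 'rV[R]_n * 'rV[R]_n) i (x : 'rV[R]_n) : c.1 0 i < x 0 i <= c.2 0 i ->
  (fun k => bump1 k c i x) @ \oo --> (1 : R).
Proof.
move=> /andP[ax xb]; rewrite /bump1 -[X in _ --> X]mulr1; apply: cvgM.
  under eq_fun do rewrite -mulrBr.
  by apply: flat1_cvg1; rewrite subr_gt0.
have h1 := @flat1_cvg1 R 1 ltr01.
apply: (@squeeze_cvgr _ _ _ _ (fun k => flat 1 (k%:R * 1 : R)) (fun=> 1)) => //; last exact: cvg_cst.
near=> k; rewrite flat1_le1 andbT; apply: flat1_mono.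
have : 0 <= k%:R ^+ 2 * (c.2 0 i - x 0 i) by rewrite mulr_ge0 ?exprn_ge0// subr_ge0.
by lra.
Unshelve. all: by end_near. Qed.

Lemma bump_cvg c x : (fun k => bump k c x) @ \oo --> ((x \in box c)%:R : R).
Proof.
case: (boolP (x \in box c)) => [|h].
  rewrite inE => xc.
  have -> : (true%:R : R) = \prod_(i < n) 1 by rewrite big1.
  apply: cvg_big => [|i _]; first exact: mul_continuous.
  exact: bump1_cvg.
have /existsNP[i /negP] : ~ box c x by move=> h'; move: h; rewrite mem_set.
rewrite negb_and -!leNgt => hi.
have E : \forall k \near \oo, 0 = bump k c x.
  near=> k; have k0 : (0 < k)%N by near: k; exact: nbhs_infty_gt.
  have k0R : 0 < k%:R :> R by rewrite ltr0n.
  rewrite /bump (bigD1 i)//= {1}/bump1.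
  case/orP: hi => [xa|].
    by rewrite {1}/flat ltNge -mulrBr (pmulr_rle0 _ k0R) subr_le0 xa !mul0r.
  rewrite -ltNge => bx; rewrite [X in _ * X * _]/flat ltNge.
  suff -> : - k%:R ^+ 2 * x 0 i + (k%:R ^+ 2 * c.2 0 i + k%:R) <= 0 by rewrite mulr0 mul0r.
  have bx0 : 0 < x 0 i - c.2 0 i by rewrite subr_gt0.
  have hk : (x 0 i - c.2 0 i)^-1 < k%:R by near: k; exact: nbhs_infty_gtr.
  have : 1 <= k%:R * (x 0 i - c.2 0 i).
    by rewrite -ler_pdivrMr// div1r ltW.
  rewrite -(ler_pM2l k0R) mulr1 mulrA -expr2 => h1; lra.
exact: cvg_trans (near_eq_cvg E) (cvg_cst _).
Unshelve. all: by end_near. Qed.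

End flat_product.

Section test_functions.
Variables (R : realType) (n : nat).
Implicit Types (f g : 'rV[R]_n -> R) (Omega : set 'rV[R]_n).

Definition cbox (a b : 'rV[R]_n) : set 'rV[R]_n :=
  [set x | forall i, a 0 i <= x 0 i <= b 0 i].

Lemma cbox_compact a b : compact (cbox a b).
Proof.
have := @rV_compact R n (fun i => `[a 0 i, b 0 i]%classic) (fun i => @segment_compact R _ _).
by congr compact; apply/seteqP; split => x /= h i; have := h i; rewrite /= in_itv.
Qed.

Lemma bump_test Omega k (c : 'rV[R]_n * 'rV[R]_n) :
  cbox c.1 (c.2 + const_mx k%:R^-1) `<=` Omega -> test_function Omega (bump k c).
Proof.
move=> cO.
have cl : closure [set x | bump k c x != 0] `<=` cbox c.1 (c.2 + const_mx k%:R^-1).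
  have cc : closed (cbox c.1 (c.2 + const_mx k%:R^-1)).
    exact: compact_closed (@norm_hausdorff _ _) (@cbox_compact _ _).
  rewrite [X in _ `<=` X](closure_id _).1//; apply: closure_subset => x hx i.
  by have /andP[/ltW h1 /ltW h2] := bump_supp i hx; rewrite h1 !mxE.
split.
- exact/flat_poly_smooth/bump_flat_poly.
- exact: subclosed_compact (@closed_closure _ _) (@cbox_compact _ _) cl.
- exact: subset_trans cl cO.
Qed.

Lemma is_derive_line f (x : 'rV[R]_n) i s : derivable f (x + s *: delta_mx 0 i) (delta_mx 0 i) ->
  is_derive s (1 : R) (fun t => f (x + t *: delta_mx 0 i)) (partial i f (x + s *: delta_mx 0 i)).
Proof.
move=> d1.
have E : (fun t : R => t^-1 *: (f (x + (t *: 1 + s) *: delta_mx 0 i) - f (x + s *: delta_mx 0 i))) =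
    (fun t => t^-1 *: (f (t *: delta_mx 0 i + (x + s *: delta_mx 0 i)) - f (x + s *: delta_mx 0 i))).
  apply/funext => t; congr (_ *: (f _ - _)).
  by rewrite [t *: 1]mulr1 scalerDl addrCA.
split; first by rewrite /derivable E.
by rewrite /partial /derive E.
Qed.

End test_functions.

Section compactly_supported.
Variables (R : realType) (n : nat).
Hypothesis n0 : (0 < n)%N.
Implicit Types (f g : 'rV[R]_n -> R) (Omega : set 'rV[R]_n).

Definition cube (L : R) : set 'rV[R]_n := cbox (const_mx (- L)) (const_mx L).

Lemma cubeP L x : cube L x <-> forall i, `|x 0 i| <= L.
Proof. by split=> h i; have := h i; rewrite !mxE ler_norml. Qed.

Lemma cube_compact L : compact (cube L).
Proof. exact: cbox_compact. Qed.

Lemma cube_closed L : closed (cube L).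
Proof. exact: compact_closed (@norm_hausdorff _ _) (@cube_compact L). Qed.

Lemma measurable_cube L : measurable (cube L : set (Rn R n)).
Proof.
rewrite -[cube L]setCK; apply: measurableC; apply: measurable_open => //.
exact/closed_openC/cube_closed.
Qed.

Lemma cube_mono L L' : L <= L' -> cube L `<=` cube L'.
Proof. by move=> LL x /cubeP h; apply/cubeP => i; exact: le_trans (h i) LL. Qed.

Lemma leb_cube L : (leb (cube L : set (Rn R n)) < +oo)%E.
Proof.
apply: leb_bounded => //.
have := compact_bounded (@cube_compact L); exact.
Qed.

Lemma compact_sub_cube (A : set 'rV[R]_n) : compact A -> exists2 L, 0 < L & A `<=` cube L.
Proof.
move=> /compact_bounded /bounded_sub_box [M [M0 H]]; exists M => // x /H h.
by move=> i; have /andP[h1 h2] := h i; rewrite (ltW h1) h2.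
Qed.

(** The bounds are explicit so that a whole sequence, such as the difference quotients of one
    function, has the common integrable majorant [M] times the indicator of [cube L]. *)
Definition bcs (f : Rn R n -> R) (M L : R) :=
  [/\ measurable_fun setT f, forall x, `|f x| <= M & forall x, ~ cube L x -> f x = 0].

Lemma cube_indic_intg (D : set (Rn R n)) M L : measurable D ->
  (@leb R n).-integrable D (EFin \o (fun x => M * (\1_(cube L : set (Rn R n)) x : R))).
Proof.
move=> mD; apply: intgZ => //; apply: intg_indic => //; [exact: measurable_cube|exact: leb_cube].
Qed.

Lemma bcs_le_indic f M L x : bcs f M L -> `|f x| <= M * (\1_(cube L : set (Rn R n)) x : R).
Proof.
move=> [_ fM f0]; rewrite indicE; have [h|h] := boolP (_ \in _); first by rewrite mulr1.
by rewrite f0 ?normr0 ?mulr0//; move=> /mem_set; rewrite (negPf h).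
Qed.

Lemma bcs_intg (D : set (Rn R n)) f M L : measurable D -> bcs f M L ->
  (@leb R n).-integrable D (EFin \o f).
Proof.
move=> mD hf; apply: (intg_le mD (g := fun x => M * (\1_(cube L : set (Rn R n)) x : R))).
- by have [mf _ _] := hf; exact: measurable_funTS.
- exact: cube_indic_intg.
- by move=> x _; exact: bcs_le_indic.
Qed.

Lemma bcs_mul f g M L M' L' : bcs f M L -> bcs g M' L' -> bcs (fun x => f x * g x) (M * M') L.
Proof.
move=> [mf fM f0] [mg gM _]; split.
- exact: measurable_funM.
- by move=> x; rewrite normrM ler_pM.
- by move=> x /f0 ->; rewrite mul0r.
Qed.

Lemma bcs_sqr f M L : bcs f M L -> bcs (fun x => f x ^+ 2) (M ^+ 2) L.
Proof. by move=> h; have := bcs_mul h h. Qed.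

Lemma bcs_L2 (D : set (Rn R n)) f M L : measurable D -> bcs f M L -> L2 leb D f.
Proof.
move=> mD h; split; first by have [mf _ _] := h; exact: measurable_funTS.
exact: bcs_intg (bcs_sqr h).
Qed.

Lemma bcs_RDCT (f_ : nat -> Rn R n -> R) (f : Rn R n -> R) M L : (forall k, bcs (f_ k) M L) ->
  measurable_fun setT f -> (forall x, (fun k => f_ k x) @ \oo --> f x) ->
  (fun k => \int[leb]_x f_ k x) @ \oo --> (\int[leb]_x f x : R).
Proof.
move=> hf mf cf; apply: (RDCT measurableT (f_ := f_) (f := f) _ _ (@cube_indic_intg setT M L measurableT) _ _).2.
- by move=> k; have [] := hf k.
- exact: mf.
- by apply: aeW => x _; exact: cf.
- by apply: aeW => x _ k; exact: bcs_le_indic.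
Qed.

Definition C1c (i : 'I_n) f (M L : R) := [/\ continuous f, continuous (partial i f),
  forall x, derivable f x (delta_mx 0 i), forall x, `|f x| <= M /\ `|partial i f x| <= M &
  forall x, ~ cube L x -> f x = 0 /\ partial i f x = 0].

Lemma C1c_bcs i f M L : C1c i f M L -> bcs f M L /\ bcs (partial i f) M L.
Proof.
move=> [cf cp _ b z]; split; split.
- exact: measurable_continuous.
- by move=> x; exact: (b x).1.
- by move=> x /z[].
- exact: measurable_continuous.
- by move=> x; exact: (b x).2.
- by move=> x /z[].
Qed.

Lemma continuous_compact_bounded f (A : set 'rV[R]_n) : continuous f -> compact A ->
  exists2 M, 0 < M & forall x, A x -> `|f x| <= M.
Proof.
move=> cf cA.
have /compact_bounded /pinfty_ex_gt0 [M M0 HM] : compact (f @` A).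
  by apply: continuous_compact => //; exact: continuous_subspaceT.
by exists M => // x Ax; apply: HM; exists x.
Qed.

Lemma C1cI i f L : continuous f -> continuous (partial i f) ->
  (forall x, derivable f x (delta_mx 0 i)) -> (forall x, ~ cube L x -> f x = 0) ->
  exists M, C1c i f M L.
Proof.
move=> cf cp df f0.
have p0 x : ~ cube L x -> partial i f x = 0.
  move=> xL; rewrite /partial; have E : \forall y \near x, 0 = f y.
    have := open_nbhs_nbhs (conj (closed_openC (@cube_closed L)) xL).
    by apply: filterS => y /f0.
  by have [_ ->] := near_eq_is_derive E (is_derive_cst (0 : R) x (delta_mx 0 i)).
have [M1 M10 h1] := continuous_compact_bounded cf (@cube_compact L).
have [M2 M20 h2] := continuous_compact_bounded cp (@cube_compact L).
exists (M1 + M2); split => // x; last by move=> h; rewrite f0 ?p0.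
have [/[dup] /h1 k1 /h2 k2|h] := pselect (cube L x); first by split; lra.
by rewrite f0// p0// normr0; split; lra.
Qed.

Lemma test_C1c Omega f i : test_function Omega f -> exists M L, C1c i f M L.
Proof.
move=> [sf cf _]; have [L L0 HL] := compact_sub_cube cf; have [c0 d0] := sf [::].
have [c1 _] := sf [:: i].
have f0 x : ~ cube L x -> f x = 0.
  by move=> h; apply/eqP/negP => /negP fx; apply/h/HL/subset_closure.
by have [M HM] := C1cI c0 c1 (d0 i) f0; exists M, L.
Qed.

Definition dq (i : 'I_n) f (h : R) : Rn R n -> R := fun x : 'rV[R]_n =>
  h^-1 * (f (x + h *: delta_mx 0 i) - f x).

Lemma dq_mvt i f M L h x : C1c i f M L -> exists s : R,
  f (x + h *: delta_mx 0 i) - f x = partial i f (x + s *: delta_mx 0 i) * h.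
Proof.
move=> [cf _ df _ _]; pose F (t : R) := f (x + t *: delta_mx 0 i).
have dF (t : R) : is_derive t (1 : R) F (partial i f (x + t *: delta_mx 0 i)).
  exact: is_derive_line.
have cF : continuous F.
  by move=> t; apply: differentiable_continuous; apply/derivable1_diffP; have [] := dF t.
have [h0|h0] := leP 0 h.
  have [s _] := MVT_segment h0 (fun t _ => dF t) (continuous_subspaceT cF).
  by rewrite /F scale0r addr0 subr0 => ->; exists s.
have [s _] := MVT_segment (ltW h0) (fun t _ => dF t) (continuous_subspaceT cF).
rewrite /F scale0r addr0 sub0r => E; exists s.
by rewrite -opprB E mulrN opprK.
Qed.

Lemma translate_continuous f (v : 'rV[R]_n) : continuous f -> continuous (fun x : 'rV[R]_n => f (x + v)).
Proof.
move=> cf x; apply: (@continuous_comp _ _ _ (fun x : 'rV[R]_n => x + v) f); last exact: cf.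
exact: (cvgD (@cvg_id _ _) (cvg_cst v)).
Qed.

Lemma dq_continuous i f h : continuous f -> continuous (dq i f h : 'rV[R]_n -> R).
Proof.
move=> cf x; have h1 := @translate_continuous f (h *: delta_mx 0 i) cf x.
exact: (cvgM (cvg_cst h^-1) (cvgB h1 (cf x))).
Qed.

Lemma dq_bcs i f M L T h : C1c i f M L -> h != 0 -> `|h| <= T -> bcs (dq i f h) M (L + T).
Proof.
move=> hf h0 hT; have [cf _ _ b z] := hf; split.
- exact/measurable_continuous/dq_continuous.
- move=> x; rewrite /dq; have [s ->] := dq_mvt h x hf.
  by rewrite mulrC mulfK//; exact: (b _).2.
- move=> x hx; rewrite /dq; suff [-> ->] : f x = 0 /\ f (x + h *: delta_mx 0 i) = 0.
    by rewrite subr0 mulr0.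
  have T0 : 0 <= T by exact: le_trans hT.
  split.
    suff /z[] : ~ cube L x by [].
    by move=> c; apply/hx/(cube_mono _ c); rewrite lerDl.
  suff /z[] : ~ cube L (x + h *: delta_mx 0 i) by [].
  move=> /cubeP c; apply/hx/cubeP => j.
  have := c j; rewrite !mxE eqxx /=; case: eqP => _; rewrite ?mulr1 ?mulr0 ?addr0 => cj; last by lra.
  by have := ler_normB (x 0 j + h) h; rewrite addrK; lra.
Qed.

Lemma dq_cvg i f M L x (h_ : nat -> R) : C1c i f M L -> (forall k, h_ k != 0) ->
  h_ @ \oo --> (0 : R) -> (fun k => dq i f (h_ k) x) @ \oo --> partial i f x.
Proof.
move=> [_ _ df _ _] h0 hc.
have h1 : (fun h : R => h^-1 *: (f (h *: delta_mx 0 i + x) - f x)) @ 0^' --> partial i f x.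
  exact: df.
have h2 : h_ @ \oo --> 0^'.
  move=> A [e /= e0 He]; move/cvgr0Pnorm_lt : hc => /(_ e e0); apply: filterS => k hk.
  by apply: He => //=; rewrite sub0r normrN.
have := cvg_comp _ _ h2 h1; apply: cvg_trans; apply: near_eq_cvg; apply: nearW => k /=.
by rewrite /dq [_ + x]addrC.
Qed.

Definition diff i f (h : R) : Rn R n -> R := fun x : 'rV[R]_n => f (x + h *: delta_mx 0 i) - f x.

Lemma diff_dq i f h x : h != 0 -> diff i f h x = h * dq i f h x.
Proof. by move=> h0; rewrite /dq mulVKf. Qed.

Lemma harmonic_step (t : R) : t != 0 -> [/\ forall k, t * k.+1%:R^-1 != 0,
  forall k, `|t * k.+1%:R^-1| <= `|t| & (fun k => t * k.+1%:R^-1) @ \oo --> (0 : R)].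
Proof.
move=> t0; split.
- by move=> k; rewrite mulf_neq0// invr_eq0.
- by move=> k; rewrite normrM ler_piMr// ger0_norm// invf_le1// ler1n.
- by rewrite -[X in _ --> X](mulr0 t); apply: cvgMr; exact: cvg_harmonic.
Qed.

(** Difference quotients have integral 0 by translation invariance, and they converge boundedly to
    the partial derivative. *)
Lemma int_partial0 i f M L : C1c i f M L -> \int[leb]_x (partial i f : Rn R n -> R) x = 0.
Proof.
move=> hf; have [bf bp] := C1c_bcs hf.
have [h0 h1 hc] := harmonic_step (oner_neq0 R).
have c1 : (fun k => \int[leb]_x dq i f (1 * k.+1%:R^-1) x) @ \oo --> \int[leb]_x (partial i f : Rn R n -> R) x.
  apply: (@bcs_RDCT _ _ M (L + `|1|)).
  - by move=> k; exact: dq_bcs.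
  - by case: bp.
  - by move=> x; exact: (@dq_cvg i f M L x _ hf h0).
have E : (fun k => \int[leb]_x dq i f (1 * k.+1%:R^-1) x) = (fun=> 0).
  apply/funext => k; set h := 1 * _.
  have If := bcs_intg measurableT bf.
  have Id := bcs_intg measurableT (dq_bcs hf (h0 k) (h1 k)).
  have := integral_translate n0 (h *: delta_mx 0 i) If.
  rewrite (@eq_Rintegral _ _ _ _ _ (fun x => h * dq i f h x + f x)); last first.
    by move=> x _; rewrite -diff_dq ?h0// subrK.
  rewrite RintegralD//; last exact: intgZ.
  rewrite RintegralZl// => /(canRL (addrK _)); rewrite subrr => /eqP.
  by rewrite mulf_eq0 (negPf (h0 k)) => /eqP.
by move: c1; rewrite E => c1; apply/esym; apply: (Rcvg_unique _ c1); exact: cvg_cst.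
Qed.

Lemma sqr_sum_le (a : nat -> R) N : (\sum_(k < N) a k) ^+ 2 <= N%:R * \sum_(k < N) a k ^+ 2.
Proof.
elim: N => [|N IH]; first by rewrite !big_ord0 expr0n mulr0.
rewrite !big_ord_recr /=; move: IH.
set s := \sum_(k < N) a k; set q := \sum_(k < N) a k ^+ 2.
have q0 : 0 <= q by apply: sumr_ge0 => k _; exact: sqr_ge0.
case: N @s @q q0 => [|N] s q q0 h.
  by rewrite /s /q !big_ord0 !add0r mul1r.
have N0 : 0 < N.+1%:R :> R by [].
rewrite -[N.+2]addn1 natrD; move: (N.+1%:R : R) N0 h => m m0 h.
rewrite -(ler_pM2l m0); have := sqr_ge0 (s - m * a N.+1).
have : m * s ^+ 2 <= m * (m * q) by rewrite ler_pM2l.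
by have := sqr_ge0 s; nra.
Qed.

Lemma integrable_translate (v : 'rV[R]_n) (f : Rn R n -> R) :
  (@leb R n).-integrable setT (EFin \o f) ->
  (@leb R n).-integrable setT (EFin \o (fun x => f (translate v x))).
Proof.
move=> /intgP[mf fi]; apply/intgP; split.
  by apply: (measurableT_comp mf); exact: measurable_fun_translate.
have mn : measurable_fun setT (fun x : Rn R n => `|f x|%:E).
  by apply/measurable_EFinP; exact: measurableT_comp.
have e := ge0_integral_translate n0 v mn (fun x => abse_ge0 (f x)%:E).
by rewrite -e in fi.
Qed.

(* A translation by [N * h] is a sum of [N] translations by [h]; letting [h] go
   to 0 turns the right-hand side into the integral of the squared derivative. *)
Lemma diff_sqr_scale i f M L h N : C1c i f M L -> h != 0 ->
  \int[leb]_x (diff i f (N%:R * h) x ^+ 2) <= N%:R ^+ 2 * \int[leb]_x (diff i f h x ^+ 2).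
Proof.
move=> hf h0; case: N => [|N].
  rewrite mul0r expr0n mul0r (@eq_Rintegral _ _ _ _ _ (fun=> 0)) ?Rintegral_cst ?mul0r// => x _.
  by rewrite /diff scale0r addr0 subrr expr0n.
have bF t : t != 0 -> (@leb R n).-integrable setT (EFin \o (fun x => diff i f t x ^+ 2)).
  move=> t0; apply: (@eq_intg _ _ _ _ _ measurableT (fun x => t ^+ 2 * dq i f t x ^+ 2)).
    by move=> x _; rewrite (diff_dq i f x t0) (exprMn 2 t).
  apply: intgZ => //; exact: (bcs_intg measurableT (bcs_sqr (dq_bcs hf t0 (lexx _)))).
pose v k := (k%:R * h) *: delta_mx 0 i : 'rV[R]_n.
have tI k := integral_translate n0 (v k) (bF h h0).
have bT k : (@leb R n).-integrable setT (EFin \o (fun x => diff i f h (translate (v k) x) ^+ 2)).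
  by move: (integrable_translate (v k) (bF h h0)).
apply: (@le_trans _ _ (\int[leb]_x (N.+1%:R * \sum_(k < N.+1) diff i f h (translate (v k) x) ^+ 2))).
  apply: le_Rintegral => //.
  - by apply: bF; rewrite mulf_neq0.
  - by apply: intgZ => //; apply: intg_sum.
  - move=> x _; have := sqr_sum_le (fun k => diff i f h (translate (v k) x)) N.+1.
    congr (_ ^+ 2 <= _).
    pose G k := f ((x : 'rV[R]_n) + v k).
    transitivity (\sum_(k < N.+1) (G k.+1 - G k)).
      apply: eq_bigr => k _; rewrite /diff /G /translate -addrA; congr (f (_ + _) - _).
      by rewrite /v -scalerDl -natr1 mulrDl mul1r.
    by rewrite -(big_mkord xpredT (fun k => G k.+1 - G k)) telescope_sumr// /G /v mul0r scale0r addr0.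
rewrite RintegralZl//; last exact: intg_sum.
rewrite Rint_sum// (eq_bigr (fun=> \int[leb]_x (diff i f h x ^+ 2))); last by move=> k _; exact: tI.
by rewrite sumr_const card_ord -[X in _ * X <= _]mulr_natl mulrA expr2.
Qed.

Lemma diff_sqr_le i f M L t : C1c i f M L ->
  \int[leb]_x (diff i f t x ^+ 2) <= t ^+ 2 * \int[leb]_x ((partial i f : Rn R n -> R) x ^+ 2).
Proof.
move=> hf; have [->|t0] := eqVneq t 0.
  rewrite (@eq_Rintegral _ _ _ _ _ (fun=> 0)) ?Rintegral_cst// ?mul0r ?mulr_ge0 ?sqr_ge0 ?Rintegral_ge0// => x _.
  - by rewrite sqr_ge0.
  - by rewrite /diff scale0r addr0 subrr expr0n.
have [bf bp] := C1c_bcs hf.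
have [h0 h1 hc] := harmonic_step t0.
have c1 : (fun k => \int[leb]_x (dq i f (t * k.+1%:R^-1) x ^+ 2)) @ \oo -->
    \int[leb]_x ((partial i f : Rn R n -> R) x ^+ 2).
  apply: (@bcs_RDCT _ _ (M ^+ 2) (L + `|t|)).
  - by move=> k; apply: bcs_sqr; exact: dq_bcs.
  - by have [] := bcs_sqr bp.
  - move=> x; have c := (@dq_cvg i f M L x _ hf h0) hc.
    by rewrite expr2; under eq_fun do rewrite expr2; exact: cvgM.
have c2 : (fun k => t ^+ 2 * \int[leb]_x (dq i f (t * k.+1%:R^-1) x ^+ 2)) @ \oo -->
    t ^+ 2 * \int[leb]_x ((partial i f : Rn R n -> R) x ^+ 2) by exact: cvgMr.
apply: (Rcvg_ge c2) => k.
set h := t * _; have k0 : k.+1%:R != 0 :> R by [].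
have E : t = k.+1%:R * h by rewrite /h mulrCA mulfV// mulr1.
have := diff_sqr_scale k.+1 hf (h0 k); rewrite -/h -E => /le_trans; apply.
have -> : t ^+ 2 = k.+1%:R ^+ 2 * h ^+ 2 by rewrite -(exprMn 2) -E.
rewrite -mulrA le_eqVlt; apply/orP; left; apply/eqP; congr (_ * _).
rewrite -RintegralZl//; last exact: (bcs_intg measurableT (bcs_sqr (dq_bcs hf (h0 k) (h1 k)))).
by apply: eq_Rintegral => x _; rewrite (diff_dq i f x (h0 k)) (exprMn 2 h).
Qed.

End compactly_supported.

(** * The fundamental lemma of the calculus of variations *)

Section pi_lambda.
Context d (T : measurableType d) (R : realType).
Variables (mu : {measure set T -> \bar R}) (D : set T).
Hypothesis mD : measurable D.
Variable G : set (set T).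
Hypothesis GI : setI_closed G.
Hypothesis mG : G `<=` measurable.
(** Lebesgue measurable sets need not belong to the sigma-algebra generated by boxes; this bridges
    the gap up to null sets. *)
Hypothesis hull : forall A, measurable A -> (mu A < +oo)%E ->
  exists B, [/\ <<s G >> B, A `<=` B & mu (B `\` A) = 0].

Local Notation intg f := (mu.-integrable D (EFin \o f)).
Local Notation I f := (\int[mu]_(x in D) f x).

Lemma intg_mul_indic h (A : set T) : intg h -> measurable A -> intg (fun x => h x * (\1_A x : R)).
Proof.
move=> ih mA; apply: (intg_le mD _ (intg_abs mD ih)).
  apply: measurable_funM; [exact: intg_meas ih|exact: measurable_indic].
by move=> x _; rewrite normrM ler_piMr// indicE; case: (_ \in _); rewrite ?normr1 ?normr0.
Qed.

Lemma pi_lambda_int0 h : intg h -> I h = 0 ->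
  (forall A, G A -> I (fun x => h x * (\1_A x : R)) = 0) ->
  forall A, <<s G >> A -> I (fun x => h x * (\1_A x : R)) = 0.
Proof.
move=> ih h0 hG.
pose H := [set A | measurable A /\ I (fun x => h x * (\1_A x : R)) = 0].
suff : <<s G >> `<=` H by move=> HH A /HH[].
apply: lambda_system_subset => //; last by move=> A GA; split; [exact: mG|exact: hG].
split => //.
- split => //; rewrite -h0; apply: eq_Rintegral => x _.
  by rewrite indicE in_setT mulr1.
- move=> A B BA [mA A0] [mB B0]; split; first exact: measurableD.
  rewrite -(subrr 0) -{1}A0 -B0 -RintegralB//; [|exact: intg_mul_indic|exact: intg_mul_indic].
  apply: eq_Rintegral => x _; rewrite -mulrBr; congr (_ * _); rewrite !indicE in_setD.
  have [xB|xB] := boolP (x \in B); last by rewrite andbT subr0.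
  by rewrite (_ : x \in A) ?subrr//; rewrite inE; apply: BA; rewrite -inE.
- move=> F ndF HF; have mF k := (HF k).1.
  have mU : measurable (\bigcup_i F i) by exact: bigcup_measurable.
  split => //.
  have [||||_ c] := RDCT mD (f_ := fun k x => h x * (\1_(F k) x : R))
     (f := fun x => h x * (\1_(\bigcup_i F i) x : R)) _ _ (intg_abs mD ih).
  + by move=> k; exact: intg_meas (intg_mul_indic ih (mF k)).
  + exact: intg_meas (intg_mul_indic ih mU).
  + apply: aeW => x _; apply: cvgMr; rewrite indicE.
    have [|xU] := boolP (x \in _).
      rewrite inE => -[k _ Fkx]; have E : \forall j \near \oo, 1 = \1_(F j) x :> R.
        exists k => // j /= kj; rewrite indicE mem_set//.
        by move/subsetPset : (ndF _ _ kj); exact.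
      exact: cvg_trans (near_eq_cvg E) (cvg_cst _).
    rewrite (_ : (fun k => _) = (fun=> 0)); first exact: cvg_cst.
    apply/funext => k; rewrite indicE memNset// => Fkx.
    by move/negP : xU; apply; rewrite inE; exists k.
  + apply: aeW => x _ k.
    by rewrite normrM ler_piMr// indicE; case: (_ \in _); rewrite ?normr1 ?normr0.
  apply: (Rcvg_unique c); rewrite (_ : (fun k => _) = (fun=> 0)); first exact: cvg_cst.
  by apply/funext => k; exact: (HF k).2.
Qed.

(** The test set is the one where [h > 0], of finite measure because it lies in [Q], enlarged by a
    null set so as to belong to the generated sigma-algebra. *)
Lemma pi_lambda_ae_le0 h (Q : set T) : measurable Q -> (mu Q < +oo)%E ->
  (forall x, ~ Q x -> h x = 0) -> intg h -> I h = 0 ->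
  (forall A, G A -> I (fun x => h x * (\1_A x : R)) = 0) ->
  {ae mu, forall x, D x -> h x <= 0}.
Proof.
move=> mQ muQ hQ ih h0 hG; pose A := D `&` h @^-1` `]0, +oo[%classic.
have mA : measurable A by exact: (intg_meas ih).
have muA : (mu A < +oo)%E.
  apply: le_lt_trans muQ; apply: le_measure; rewrite ?inE//.
  move=> x [_]; rewrite /= in_itv /= andbT => hx; apply: contrapT => /hQ E.
  by move: hx; rewrite E ltxx.
have [B [sB AB BA0]] := hull mA muA.
have mB : measurable B.
  by apply: (smallest_sub (@sigma_algebra_measurable _ T) mG).
have E : I (fun x => h x * (\1_A x : R)) = 0.
  rewrite -(pi_lambda_int0 ih h0 hG sB); apply: ae_Rint => //.
  - exact: intg_meas (intg_mul_indic ih mA).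
  - exact: intg_meas (intg_mul_indic ih mB).
  exists (B `\` A); split; [exact: measurableD|exact: BA0|].
  move=> x /= /not_implyP[Dx hx]; split.
    apply: contrapT => Bx; apply: hx; rewrite !indicE !memNset//.
    by move=> /AB.
  move=> Ax; apply: hx; rewrite !indicE !mem_set//; exact: AB.
have /(Rint_eq0_ae mD) : intg (fun x => h x * (\1_A x : R)) by exact: intg_mul_indic.
move=> /(_ _ E); have H x : D x -> 0 <= h x * (\1_A x : R).
  move=> Dx; rewrite indicE; have [|_] := boolP (x \in A); last by rewrite mulr0.
  by rewrite inE => -[_]; rewrite /= in_itv /= andbT mulr1 => /ltW.
move=> /(_ H); apply: filterS => x hx Dx; rewrite leNgt; apply/negP => hx0.
have := hx Dx; rewrite indicE mem_set ?mulr1 => [E0|]; first by move: hx0; rewrite E0 ltxx.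
by split => //=; rewrite in_itv /= hx0.
Qed.

Lemma pi_lambda_ae0 h (Q : set T) : measurable Q -> (mu Q < +oo)%E ->
  (forall x, ~ Q x -> h x = 0) -> intg h -> I h = 0 ->
  (forall A, G A -> I (fun x => h x * (\1_A x : R)) = 0) ->
  {ae mu, forall x, D x -> h x = 0}.
Proof.
move=> mQ muQ hQ ih h0 hG.
have h1 := pi_lambda_ae_le0 mQ muQ hQ ih h0 hG.
have h2 : {ae mu, forall x, D x -> - h x <= 0}.
  apply: (@pi_lambda_ae_le0 (fun x => - h x) Q) => //.
  - by move=> x /hQ ->; rewrite oppr0.
  - exact: intgN.
  - rewrite (@eq_Rintegral _ _ _ _ _ (fun x => -1 * h x)) ?RintegralZl// ?h0 ?mulr0// => x _.
    by rewrite mulN1r.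
  - move=> A GA; rewrite (@eq_Rintegral _ _ _ _ _ (fun x => -1 * (h x * (\1_A x : R)))).
      by rewrite RintegralZl// ?hG ?mulr0//; apply: intg_mul_indic => //; exact: mG.
    by move=> x _; rewrite mulN1r mulNr.
apply: filterS2 h1 h2 => x a b Dx; apply/eqP; rewrite eq_le a//=.
by have := b Dx; rewrite oppr_le0.
Qed.

End pi_lambda.

Section fundamental_lemma.
Variables (R : realType) (n : nat).
Hypothesis n0 : (0 < n)%N.
Implicit Types (Omega : set 'rV[R]_n) (c : 'rV[R]_n * 'rV[R]_n).

Definition box_cap c c' : 'rV[R]_n * 'rV[R]_n :=
  (\row_i Num.max (c.1 0 i) (c'.1 0 i), \row_i Num.min (c.2 0 i) (c'.2 0 i)).

Lemma box_capE c c' : box (box_cap c c') = box c `&` box c'.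
Proof.
apply/seteqP; split => x.
  by move=> h; split => i; have := h i; rewrite !mxE gt_max le_min => /andP[/andP[h1 h2] /andP[h3 h4]]; apply/andP.
by move=> [h1 h2] i; have /andP[a b] := h1 i; have /andP[a' b'] := h2 i; rewrite !mxE gt_max le_min a b a' b'.
Qed.

(** Outer regularity: [B] is the intersection of countable unions of boxes that cover [A] and whose
    measures tend to that of [A]. *)
Lemma box_hull (A : set (Rn R n)) : measurable A -> (leb A < +oo)%E ->
  exists B : set (Rn R n), [/\ <<s range (@box R n) >> B, A `<=` B & leb (B `\` A) = 0].
Proof.
move=> mA lA.
have /choice[a_ aP] : forall k, exists a : nat -> 'rV[R]_n * 'rV[R]_n,
    A `<=` \bigcup_j box (a j) /\ (leb (\bigcup_j box (a j) : set (Rn R n)) < leb A + k.+1%:R^-1%:E)%E.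
  move=> k; have h : (lebesgue_outer A < leb A + k.+1%:R^-1%:E)%E.
    by rewrite -[ltLHS]/(leb A) lteDl ?ge0_fin_numE// lte_fin invr_gt0.
  have [a Aa sa] := outer_cover_seq n0 h; exists a; split => //.
  by apply: le_lt_trans sa; exact: outer_le_series.
pose B := \bigcap_k \bigcup_j box (a_ k j) : set (Rn R n).
have mU k : measurable (\bigcup_j box (a_ k j) : set (Rn R n)).
  by apply: bigcup_measurable => j _; exact: measurable_box.
exists B; split.
- rewrite -[B]setCK setC_bigcap -setTD; apply: sigma_algebraCD.
  rewrite -(setC_bigcap setT (fun k => \bigcup_j box (a_ k j))) setC_bigcap.
  apply: sigma_algebra_bigcup => k; rewrite -setTD; apply: sigma_algebraCD.
  by apply: sigma_algebra_bigcup => j; apply: sub_sigma_algebra; exists (a_ k j).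
- by move=> x Ax k _; have [h _] := aP k; exact: h.
- have mB : measurable B by exact: bigcap_measurable.
  apply/eqP; rewrite eq_le measure_ge0 andbT; apply/lee_addgt0Pr => e e0.
  have [k _ /(_ k (leqnn _)) ke] : \forall k \near \oo, k.+1%:R^-1 < e :> R.
    exact: near_infty_natSinv_lt (PosNum e0).
  have [h1 h2] := aP k.
  apply: (@le_trans _ _ (leb (\bigcup_j box (a_ k j) `\` A : set (Rn R n)))).
    apply: le_measure; rewrite ?inE; [exact: measurableD|exact: measurableD|].
    by apply: setSD => x /(_ k); exact.
  rewrite [leLHS]measureD//; last first.
    by apply: lt_trans h2 _; rewrite -ge0_fin_numE ?adde_ge0// fin_numD ge0_fin_numE// lA.
  rewrite setIidr// add0e leeBlDr ?ge0_fin_numE// addeC.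
  by apply: le_trans (ltW h2) _; rewrite leeD2l// lee_fin ltW.
Qed.

(** Bump functions converge boundedly to the indicator of the box, and the margin [e] leaves room
    for their supports inside [Omega]. *)
Lemma int_box_test Omega (g : Rn R n -> R) c (e : R) :
  open Omega -> (@leb R n).-integrable Omega (EFin \o g) ->
  (forall phi, test_function Omega phi -> \int[leb]_(x in Omega) (g x * (phi : Rn R n -> R) x) = 0) ->
  0 < e -> cbox c.1 (c.2 + const_mx e) `<=` Omega ->
  \int[leb]_(x in Omega) (g x * (\1_(box c : set (Rn R n)) x : R)) = 0.
Proof.
move=> oO ig hg e0 cO; have mO : measurable (Omega : set (Rn R n)) by exact: measurable_open.
have [k0 _ k0P] : \forall k \near \oo, k.+1%:R^-1 < e :> R.
  exact: near_infty_natSinv_lt (PosNum e0).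
pose f_ k (x : Rn R n) := g x * bump (k0 + k).+1 c x.
have mf_ k : measurable_fun (Omega : set (Rn R n)) (f_ k).
  apply: measurable_funM; first exact: intg_meas ig.
  apply: measurable_funTS; apply: measurable_continuous => //.
  exact/flat_poly_continuous/bump_flat_poly.
have [|||_ h] := RDCT mO (f_ := f_) (f := fun x => g x * (\1_(box c : set (Rn R n)) x : R)) mf_ _ (intg_abs mO ig).
- exact: intg_meas (intg_mul_indic mO ig (measurable_box n0 c)).
- apply: aeW => x _; apply: cvgMr; rewrite indicE.
  have := @bump_cvg R n c x; rewrite -(cvg_shiftn k0.+1); apply: cvg_trans; apply: near_eq_cvg.
  by apply: nearW => k; rewrite /= addnS [(k + k0)%N]addnC.
- apply: aeW => x _ k; rewrite normrM ler_piMr//.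
  by rewrite ger0_norm ?bump_ge0// bump_le1.
apply: (Rcvg_unique h); rewrite (_ : (fun k => _) = (fun=> 0)); first exact: cvg_cst.
apply/funext => k; apply: hg; apply: bump_test; apply: subset_trans cO => x hx i.
have /andP[h1 h2] := hx i; rewrite h1 /=; apply: le_trans h2 _; rewrite !mxE lerD2l.
by apply/ltW/k0P => /=; rewrite leq_addr.
Qed.

Lemma fundamental_box Omega (g : Rn R n -> R) q (e : R) :
  open Omega -> (@leb R n).-integrable Omega (EFin \o g) ->
  (forall phi, test_function Omega phi -> \int[leb]_(x in Omega) (g x * (phi : Rn R n -> R) x) = 0) ->
  0 < e -> cbox q.1 (q.2 + const_mx e) `<=` Omega ->
  {ae leb, forall x, Omega x -> box q x -> g x = 0}.
Proof.
move=> oO ig hg e0 qO; have mO : measurable (Omega : set (Rn R n)) by exact: measurable_open.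
have mq : measurable (box q : set (Rn R n)) by exact: measurable_box.
have ib c : cbox c.1 (c.2 + const_mx e) `<=` Omega ->
    \int[leb]_(x in Omega) (g x * (\1_(box c : set (Rn R n)) x : R)) = 0.
  exact: int_box_test.
have : {ae leb, forall x, Omega x -> g x * (\1_(box q : set (Rn R n)) x : R) = 0}.
  apply: (@pi_lambda_ae0 _ (Rn R n) R leb Omega mO (range (@box R n)) _ _ box_hull _ (box q) mq).
  - by move=> _ _ [c _ <-] [c' _ <-]; exists (box_cap c c') => //; exact: box_capE.
  - by move=> _ [c _ <-]; exact: measurable_box.
  - by rewrite [ltLHS](leb_box n0) ltry.
  - by move=> x qx; rewrite indicE memNset// mulr0.
  - exact: intg_mul_indic.
  - exact: ib.
  - move=> _ [c _ <-]; rewrite -[RHS](ib (box_cap q c)).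
      by apply: eq_Rintegral => x _; rewrite box_capE indicI -mulrA.
    move=> x hx; apply: qO => i; have := hx i; rewrite !mxE ge_max -lerBlDr le_min !lerBlDr.
    by move=> /andP[/andP[h1 h2] /andP[h3 h4]]; apply/andP.
by move=> h; apply: (ae_imp h) => {h} x h Ox qx; have := h Ox; rewrite indicE mem_set// mulr1.
Qed.

(** Countably many boxes, overlapping so that each point of an open set lies in one that is
    contained in the set together with a margin. *)
Definition grid_box (p : 'rV[int]_n * nat) : 'rV[R]_n * 'rV[R]_n :=
  (\row_i (((p.1 0 i)%:~R - 1) / p.2.+1%:R), \row_i (((p.1 0 i)%:~R + 1) / p.2.+1%:R)).

Lemma grid_cover Omega x : open Omega -> Omega x ->
  exists p, box (grid_box p) x /\ cbox (grid_box p).1 ((grid_box p).2 + const_mx p.2.+1%:R^-1) `<=` Omega.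
Proof.
move=> oO Ox; have [e /= e0 xeO] := (nbhs_ballP _ _).1 (oO x Ox).
have [k _ /(_ k (leqnn _)) ke] : \forall k \near \oo, k.+1%:R^-1 < e / 4 :> R.
  have e4 : 0 < e / 4 by rewrite divr_gt0.
  exact: near_infty_natSinv_lt (PosNum e4).
have k0 : 0 < k.+1%:R :> R by [].
exists (\row_i Num.floor (x 0 i * k.+1%:R), k).
have f1 i := ge_floor (x 0 i * k.+1%:R).
have f2 i := floorD1_gt (x 0 i * k.+1%:R).
split.
  move=> i; rewrite !mxE ltr_pdivrMr// ler_pdivlMr//.
  have := f1 i; have := f2 i; rewrite intrD; lra.
move=> y hy; apply: xeO; apply/ball_rowE; split => // i.
have : ((Num.floor (x 0 i * k.+1%:R))%:~R - 1) / k.+1%:R <= y 0 i <=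
  ((Num.floor (x 0 i * k.+1%:R))%:~R + 1) / k.+1%:R + k.+1%:R^-1.
  by have := hy i; rewrite !mxE.
have -> z : (z + 1) / k.+1%:R + k.+1%:R^-1 = (z + 2) / k.+1%:R :> R by field; rewrite gt_eqF.
rewrite ler_pdivrMr// ler_pdivlMr//.
have h1 := f1 i; have := f2 i; rewrite intrD => h2 /andP[h3 h4].
rewrite -(ltr_pM2r k0) -[X in `|_| * X](gtr0_norm k0) -normrM mulrBl ltr_distl.
have : 4 < e * k.+1%:R by move: ke; rewrite -ltf_pV2 ?posrE ?invr_gt0 ?divr_gt0// invrK invf_div ltr_pdivrMr// mulrC.
by move=> h5; apply/andP; split; lra.
Qed.

Lemma fundamental_lemma Omega (g : Rn R n -> R) :
  open Omega -> (@leb R n).-integrable Omega (EFin \o g) ->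
  (forall phi, test_function Omega phi -> \int[leb]_(x in Omega) (g x * (phi : Rn R n -> R) x) = 0) ->
  {ae leb, forall x, Omega x -> g x = 0}.
Proof.
move=> oO ig hg.
pose P (p : 'rV[int]_n * nat) := cbox (grid_box p).1 ((grid_box p).2 + const_mx p.2.+1%:R^-1) `<=` Omega.
(* The boxes are enumerated by [unpickle], so that countably many null sets are united. *)
have : {ae leb, forall x (m : nat), forall p, unpickle m = Some p -> P p -> Omega x -> box (grid_box p) x -> g x = 0}.
  apply: ae_all => m; case: (unpickle m) => [p|]; last exact: ae_true.
  have [Pp|nP] := pselect (P p); last by apply: ae_true => x q [<-].
  have p0 : 0 < p.2.+1%:R^-1 :> R by [].
  have h0 : {ae leb, forall x, Omega x -> box (grid_box p) x -> g x = 0}.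
    exact: fundamental_box oO ig hg p0 Pp.
  by apply: (ae_imp h0) => x h q [<-] _ Ox; exact: h.
move=> h; apply: (ae_imp h) => {h} x h Ox; have [p [px pO]] := grid_cover oO Ox.
by apply: (h (pickle p) p) => //; exact: pickleK.
Qed.

End fundamental_lemma.

(** * Sobolev spaces *)

Section subspace.
Variables (R : realType) (V : lmodType R) (P : set V).
Hypothesis P0 : P 0.
Hypothesis Plin : forall k u v, P u -> P v -> P (k *: u + v).

(** The closure proofs are phantom parameters, so that the type alone determines its module
    structure. *)
Definition subsp_of (h0 : P 0) (hlin : forall k u v, P u -> P v -> P (k *: u + v)) :=
  {x : V | `[< P x >]}.

Let T := subsp_of P0 Plin.
HB.instance Definition _ := [isSub of T for @sval V (fun x => `[< P x >])].
HB.instance Definition _ := [Choice of T by <:].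
Fact subsp_closed : subsemimod_closed (fun x : V => `[< P x >]).
Proof.
split; last by move=> k u /asboolP hu; apply/asboolP; rewrite -[_ *: _]addr0; exact: Plin.
split; first exact/asboolP.
by move=> u v /asboolP hu /asboolP hv; apply/asboolP; rewrite -[u]scale1r; exact: Plin.
Qed.
HB.instance Definition _ := GRing.SubChoice_isSubLmodule.Build R V (fun x => `[< P x >]) T subsp_closed.

Definition subsp : lmodType R := T.
Definition sval_of (x : subsp) : V := val (x : T).

Lemma subspP (x : subsp) : P (sval_of x).
Proof. exact/asboolP/(valP (x : T)). Qed.

Definition to_subsp x (h : P x) : subsp := exist (fun x => `[< P x >]) x (asboolT h).

Lemma to_subspK x (h : P x) : sval_of (to_subsp h) = x. Proof. by []. Qed.

Lemma sval_ofD x y : sval_of (x + y) = sval_of x + sval_of y. Proof. exact: raddfD. Qed.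
Lemma sval_ofZ k x : sval_of (k *: x) = k *: sval_of x. Proof. exact: linearZ. Qed.
Lemma sval_ofB x y : sval_of (x - y) = sval_of x - sval_of y. Proof. exact: raddfB. Qed.

End subspace.

Section product_form.
Variables (R : realType) (V W : lmodType R) (a : V -> V -> R) (b : W -> W -> R).
Hypotheses (ha : semi_inner a) (hb : semi_inner b).

Definition si_prod (x y : V * W) : R := a x.1 y.1 + b x.2 y.2.

Lemma si_prodP : semi_inner si_prod.
Proof.
split; rewrite /si_prod.
- by move=> x y z; rewrite (siDl ha) (siDl hb) addrACA.
- by move=> k x z; rewrite (siZl ha) (siZl hb) mulrDr.
- by move=> x y; rewrite (siC ha) (siC hb).
- by move=> x; exact: addr_ge0 (si_ge0 ha _) (si_ge0 hb _).
Qed.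

Lemma sn_prod x : sn si_prod x ^+ 2 = sn a x.1 ^+ 2 + sn b x.2 ^+ 2.
Proof. by rewrite (sn_sqr si_prodP) (sn_sqr ha) (sn_sqr hb). Qed.

Lemma sn_prod_ge1 x : sn a x.1 <= sn si_prod x.
Proof. by apply: ler_wsqrtr; rewrite lerDl; exact: si_ge0. Qed.

Lemma sn_prod_ge2 x : sn b x.2 <= sn si_prod x.
Proof. by apply: ler_wsqrtr; rewrite lerDr; exact: si_ge0. Qed.

Lemma sn_prod_le x : sn si_prod x <= sn a x.1 + sn b x.2.
Proof.
apply: (sn_le2 si_prodP); first exact: addr_ge0 (sn_ge0 _ _) (sn_ge0 _ _).
rewrite -(sn_sqr si_prodP) sn_prod.
by have := sn_ge0 a x.1; have := sn_ge0 b x.2; nra.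
Qed.

Lemma si_prod_complete : si_complete a -> si_complete b -> si_complete si_prod.
Proof.
move=> ca cb z_ hz.
have [|x hx] := ca (fun k => (z_ k).1).
  move=> e /hz[N HN]; exists N => m n Nm Nn.
  exact: le_lt_trans (sn_prod_ge1 (z_ m - z_ n)) (HN _ _ Nm Nn).
have [|y hy] := cb (fun k => (z_ k).2).
  move=> e /hz[N HN]; exists N => m n Nm Nn.
  exact: le_lt_trans (sn_prod_ge2 (z_ m - z_ n)) (HN _ _ Nm Nn).
exists (x, y).
apply: (Rsqueeze0 (h := fun k => sn a ((z_ k).1 - x) + sn b ((z_ k).2 - y))).
  by move=> k; apply/andP; split; [exact: sn_ge0|exact: sn_prod_le].
by rewrite -(addr0 (0 : R)); exact: cvgD.
Qed.

End product_form.

Section L2_space.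
Context d (T : measurableType d) (R : realType).
Variables (mu : {measure set T -> \bar R}) (D : set T).
Hypotheses (mD : measurable D) (muD : (mu D < +oo)%E).
Local Notation I f := (\int[mu]_(x in D) f x).

Lemma L2_Lnorm (u : T -> R) : measurable_fun D u ->
  ('N[mu]_2%:E[EFin \o (u \_ D)] = (\int[mu]_(x in D) (u x ^+ 2)%:E) `^ 2^-1)%E.
Proof.
move=> mu_; rewrite unlock; congr (_ `^ _)%E.
rewrite [RHS]integral_mkcond; apply: eq_integral => x _ /=.
by rewrite powR_mulrn// real_normK ?num_real// !patchE; case: ifP => //; rewrite expr0n.
Qed.

Lemma L2_Lfun (u : T -> R) : u \_ D \in Lfun mu 2%:E <-> L2 mu D u.
Proof.
split.
  move=> h; have h2 := Lfun2_integrable_sqr h; move: h.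
  rewrite inE => /andP[/[!inE] mf _]; split; first exact: (measurable_restrictT _ mD).2.
  apply: (integrable_mkcond _ mD).2; apply: eq_integrable h2 => // x _.
  by rewrite /= !patchE; case: ifP => //; rewrite expr0n.
move=> [mu_ iu]; rewrite inE; apply/andP; split; rewrite inE /=.
  exact: (measurable_restrictT _ mD).1.
rewrite /finite_norm L2_Lnorm// poweR_lty//.
by rewrite (Rint_nneg iu) ?ltry// => x _; exact: sqr_ge0.
Qed.

Lemma Linf_bounded (u : T -> R) : u \_ D \in Lfun mu +oo%E ->
  measurable_fun D u /\ exists M : R, {ae mu, forall x, D x -> `|u x| <= M}.
Proof.
rewrite inE => /andP[/[!inE] mf hf]; split; first exact: (measurable_restrictT _ mD).2.
(* The norm is the essential supremum when the space has positive measure; otherwise every bound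
   holds almost everywhere. *)
have [muT|muT] := ltP 0%E (mu setT); last first.
  exists 0; exists setT; split => //; first by apply/eqP; rewrite eq_le muT measure_ge0.
have hs : (ess_sup mu (abse \o (EFin \o (u \_ D))) < +oo)%E.
  by move: hf; rewrite /= /finite_norm unlock muT.
have h1 := ess_sup_ge mu (abse \o (EFin \o (u \_ D))).
exists (fine (ess_sup mu (abse \o (EFin \o (u \_ D))))).
apply: (ae_imp h1) => x /= hx Dx; rewrite -lee_fin fineK.
  by move: hx; rewrite patchE mem_set.
by rewrite fin_numElt hs andbT (lt_le_trans _ hx)// ltNyr.
Qed.

Lemma L2_set0 : L2 mu D (0 : T -> R).
Proof. exact: L2_0. Qed.

Lemma L2_setlin (k : R) (u v : T -> R) : L2 mu D u -> L2 mu D v -> L2 mu D (k *: u + v).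
Proof. by move=> hu hv; exact: (L2_lin mD k hu hv). Qed.

Definition L2sp : lmodType R := subsp L2_set0 L2_setlin.

Definition L2ip (u v : T -> R) : R := I (fun x => u x * v x).

Lemma L2ipDl u v w : L2 mu D u -> L2 mu D v -> L2 mu D w -> L2ip (u + v) w = L2ip u w + L2ip v w.
Proof.
move=> hu hv hw; rewrite /L2ip -RintegralD//; [|exact: L2_mul|exact: L2_mul].
by apply: eq_Rintegral => x _; rewrite -mulrDl.
Qed.

Lemma L2ipZl k u w : L2 mu D u -> L2 mu D w -> L2ip (k *: u) w = k * L2ip u w.
Proof.
move=> hu hw; rewrite /L2ip -RintegralZl//; last exact: L2_mul.
by apply: eq_Rintegral => x _; rewrite mulrA.
Qed.

Lemma L2ipC u v : L2ip u v = L2ip v u.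
Proof. by apply: eq_Rintegral => x _; rewrite mulrC. Qed.

Lemma L2ip_ge0 u : 0 <= L2ip u u.
Proof. by apply: Rintegral_ge0 => x _; rewrite -expr2 sqr_ge0. Qed.

Lemma L2ip_eq0 u : L2 mu D u -> L2ip u u = 0 -> {ae mu, forall x, D x -> u x = 0}.
Proof.
move=> hu; rewrite /L2ip (@eq_Rintegral _ _ _ _ _ (fun x => u x ^+ 2)) => [h|x _]; last by rewrite expr2.
apply: (ae_imp (Rint_eq0_ae mD hu.2 (fun x _ => sqr_ge0 _) h)) => x hx Dx.
by apply/eqP; rewrite -sqrf_eq0; apply/eqP/hx.
Qed.

Lemma ae_L2ip u u' v v' : L2 mu D u -> L2 mu D u' -> L2 mu D v -> L2 mu D v' ->
  {ae mu, forall x, D x -> u x = u' x} -> {ae mu, forall x, D x -> v x = v' x} ->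
  L2ip u v = L2ip u' v'.
Proof.
move=> hu hu' hv hv' uu vv; apply: ae_Rint.
- exact: mD.
- by apply: measurable_funM; [exact: hu.1|exact: hv.1].
- by apply: measurable_funM; [exact: hu'.1|exact: hv'.1].
- by apply: (ae_imp2 uu vv) => x h1 h2 Dx; rewrite h1// h2.
Qed.

Definition L2form (u v : L2sp) : R := L2ip (sval_of u) (sval_of v).

Lemma L2formP : semi_inner L2form.
Proof.
split; rewrite /L2form.
- by move=> x y z; rewrite sval_ofD L2ipDl//; exact: subspP.
- by move=> k x y; rewrite sval_ofZ L2ipZl//; exact: subspP.
- by move=> x y; exact: L2ipC.
- by move=> x; exact: L2ip_ge0.
Qed.

Lemma sn_L2form u : sn L2form u = Num.sqrt (I (fun x => sval_of u x ^+ 2)).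
Proof. by congr Num.sqrt; apply: eq_Rintegral => x _; rewrite expr2. Qed.

End L2_space.

Section test_function_algebra.
Variables (R : realType) (n : nat).
Hypothesis n0 : (0 < n)%N.
Implicit Types (f g : 'rV[R]_n -> R) (Omega : set 'rV[R]_n).

Lemma is_derive_lin (k : R) f g (x v : 'rV[R]_n) (df dg : R) :
  is_derive x v f df -> is_derive x v g dg ->
  is_derive x v (k *: f + g) (k * df + dg).
Proof. by move=> hf hg; exact: (is_deriveD (is_deriveZ k hf) hg). Qed.

Lemma iter_partial_lin (k : R) f g s : smooth f -> smooth g ->
  iter_partial s (k *: f + g) = k *: iter_partial s f + iter_partial s g.
Proof.
move=> sf sg; elim: s => [//|i s IH].
rewrite [LHS]/= -/(iter_partial s _) IH; apply/funext => x.
have df : is_derive x (delta_mx 0 i) (iter_partial s f) (iter_partial (i :: s) f x).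
  by split => //; exact: (sf s).2.
have dg : is_derive x (delta_mx 0 i) (iter_partial s g) (iter_partial (i :: s) g x).
  by split => //; exact: (sg s).2.
by have [_ h] := is_derive_lin k df dg; exact: h.
Qed.

Lemma smooth_lin (k : R) f g : smooth f -> smooth g -> smooth (k *: f + g).
Proof.
move=> sf sg s; rewrite iter_partial_lin//.
have [cf df] := sf s; have [cg dg] := sg s; split.
  by move=> x; exact: (cvgD (cvgM (cvg_cst k) (cf x)) (cg x)).
by move=> i x; apply: derivableD => //; apply: derivableZ.
Qed.

Lemma test_lin Omega (k : R) f g : test_function Omega f -> test_function Omega g ->
  test_function Omega (k *: f + g).
Proof.
move=> [sf cf fO] [sg cg gO].
have S : closure [set x | (k *: f + g) x != 0] `<=`
    closure [set x | f x != 0] `|` closure [set x | g x != 0].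
  rewrite -closureU; apply: closure_subset => x /= h.
  have [fx|fx] := eqVneq (f x) 0; last by left.
  right; apply: contra_neq h => gx.
  by rewrite -[(k *: f + g) x]/(k * f x + g x) fx gx mulr0 addr0.
split; first exact: smooth_lin.
- apply: subclosed_compact S; [exact: closed_closure|exact: compactU].
- by move=> x /S[/fO|/gO].
Qed.

Lemma test0 Omega : test_function Omega (0 : 'rV[R]_n -> R).
Proof.
have E : closure [set x : 'rV[R]_n | (0 : 'rV[R]_n -> R) x != 0] = set0.
  by rewrite (_ : [set x | _] = set0) ?closure0//; apply/seteqP; split => x //=; rewrite eqxx.
split; rewrite ?E; [|exact: compact0|by []].
have -> : (0 : 'rV[R]_n -> R) = fun=> 0 by [].
exact/flat_poly_smooth/fp_cst.
Qed.

Lemma test_supp Omega f i x : test_function Omega f -> ~ Omega x -> f x = 0 /\ partial i f x = 0.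
Proof.
move=> [sf cf fO] Ox.
have nc : ~ closure [set x | f x != 0] x by move=> /fO.
split; first by apply: contrapT => /eqP fx; apply: nc; exact: subset_closure.
have E : \forall y \near x, 0 = f y.
  have := open_nbhs_nbhs (conj (closed_openC (@closed_closure _ [set x | f x != 0])) nc).
  apply: filterS => y /= hy; have [->//|fy] := eqVneq (f y) 0.
  by exfalso; apply: hy; exact: subset_closure.
by rewrite /partial; have [_ ->] := near_eq_is_derive E (is_derive_cst (0 : R) x (delta_mx 0 i)).
Qed.

Lemma C1c_mul i f g M L M' L' : C1c i f M L -> C1c i g M' L' ->
  partial i (fun x => f x * g x) = (fun x => f x * partial i g x + g x * partial i f x) /\
  exists M'', C1c i (fun x => f x * g x) M'' L.
Proof.
move=> [cf cdf df bf zf] [cg cdg dg bg zg].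
have D x : is_derive x (delta_mx 0 i) (fun x => f x * g x) (f x * partial i g x + g x * partial i f x).
  have dfx : is_derive x (delta_mx 0 i) f (partial i f x) by split.
  have dgx : is_derive x (delta_mx 0 i) g (partial i g x) by split.
  exact: (is_deriveM dfx dgx).
have E : partial i (fun x => f x * g x) = (fun x => f x * partial i g x + g x * partial i f x).
  by apply/funext => x; have [_] := D x.
split => //; apply: (@C1cI _ _ i (fun x => f x * g x) L).
- by move=> x; exact: (cvgM (cf x) (cg x)).
- by rewrite E => x; exact: (cvgD (cvgM (cf x) (cdg x)) (cvgM (cg x) (cdf x))).
- by move=> x; have [] := D x.
- by move=> x /zf[-> _]; rewrite mul0r.
Qed.

Lemma int_by_parts i (f g : Rn R n -> R) M L M' L' : C1c i f M L -> C1c i g M' L' ->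
  \int[leb]_x (f x * (partial i g : Rn R n -> R) x) =
  - \int[leb]_x ((partial i f : Rn R n -> R) x * g x).
Proof.
move=> hf hg; have [E [M'' hfg]] := C1c_mul hf hg.
have [bf bdf] := C1c_bcs n0 hf; have [bg bdg] := C1c_bcs n0 hg.
have := int_partial0 n0 hfg; rewrite E.
rewrite (@RintegralD _ _ _ _ _ (fun x => f x * (partial i g : Rn R n -> R) x) (fun x => g x * (partial i f : Rn R n -> R) x) measurableT); last 2 first.
- exact: (bcs_intg n0 measurableT (bcs_mul bf bdg)).
- exact: (bcs_intg n0 measurableT (bcs_mul bg bdf)).
move=> /eqP; rewrite addr_eq0 => /eqP ->; congr (- _).
by apply: eq_Rintegral => x _; rewrite mulrC.
Qed.

End test_function_algebra.

Section test_function_integrals.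
Variables (R : realType) (n : nat).
Hypothesis n0 : (0 < n)%N.
Variable Omega : set 'rV[R]_n.
Hypotheses (oO : open Omega) (bO : bounded_set Omega).
Local Notation D := (Omega : set (Rn R n)).

Lemma measurable_domain : measurable D. Proof. exact: (measurable_open n0 oO). Qed.
Lemma leb_domain : (leb D < +oo)%E. Proof. exact: (leb_bounded n0 bO). Qed.

Lemma test_L2 (phi : Rn R n -> R) i : test_function Omega phi ->
  L2 leb D phi /\ L2 leb D (partial i phi : Rn R n -> R).
Proof.
move=> tphi; have [M [L h]] := test_C1c i tphi; have [b1 b2] := C1c_bcs n0 h.
by split; [exact: (bcs_L2 n0 measurable_domain b1)|exact: (bcs_L2 n0 measurable_domain b2)].
Qed.

Lemma test_by_parts i (phi psi : Rn R n -> R) : test_function Omega phi -> test_function Omega psi ->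
  \int[leb]_(x in D) (phi x * (partial i psi : Rn R n -> R) x) =
  - \int[leb]_(x in D) ((partial i phi : Rn R n -> R) x * psi x).
Proof.
move=> tphi tpsi; have [M [L h1]] := test_C1c i tphi; have [M' [L' h2]] := test_C1c i tpsi.
have E1 : forall x : Rn R n, ~ D x -> phi x * (partial i psi : Rn R n -> R) x = 0.
  by move=> x Ox; rewrite (test_supp i tphi Ox).1 mul0r.
have E2 : forall x : Rn R n, ~ D x -> (partial i phi : Rn R n -> R) x * psi x = 0.
  by move=> x Ox; rewrite (test_supp i tpsi Ox).1 mulr0.
have H := int_by_parts n0 h1 h2.
rewrite (Rint_supp leb E1) (Rint_supp leb E2) in H.
exact: H.
Qed.

End test_function_integrals.

Lemma Rcvg_sum0 (R : realType) (I : Type) (s : seq I) (F : set_system nat) {FF : Filter F}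
  (f : I -> nat -> R) : (forall i, f i @ F --> (0 : R)) ->
  (fun k => \sum_(i <- s) f i k) @ F --> (0 : R).
Proof.
move=> h; elim: s => [|i s IH].
  by under eq_fun do rewrite big_nil; exact: cvg_cst.
under eq_fun do rewrite big_cons.
by have h2 := cvgD (h i) IH; rewrite addr0 in h2; exact: h2.
Qed.

(* The Sobolev spaces are built over an abstract [(T, mu, D, test, pd)], which
   will be [(R^n, leb, Omega, test_function Omega, partial)]; [sob], [wpd], [dir]
   and [sob0] are then convertible to [H1], [wD], [dirichlet] and [H10]. *)
Section weak_derivatives.
Context d (T : measurableType d) (R : realType).
Variables (mu : {measure set T -> \bar R}) (D : set T) (n : nat).
Variables (test : set (T -> R)) (pd : 'I_n -> (T -> R) -> T -> R).
Implicit Types (u v w g phi : T -> R).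

Definition weak_pd i u g := forall phi, test phi ->
  \int[mu]_(x in D) (u x * pd i phi x) = - \int[mu]_(x in D) (g x * phi x).

Definition sob u := u \_ D \in Lfun mu 2%:E /\
  forall i, exists g, g \_ D \in Lfun mu 2%:E /\ weak_pd i u g.

Definition wpd u (i : 'I_n) : T -> R :=
  get [set g | g \_ D \in Lfun mu 2%:E /\ weak_pd i u g].

Definition dir u v : R := \int[mu]_(x in D) \sum_(i < n) wpd u i x * wpd v i x.

Definition sob_norm u : R :=
  Num.sqrt (\int[mu]_(x in D) (u x ^+ 2) + dir u u).

Definition sob0 u := sob u /\ forall e : R, 0 < e ->
  exists2 phi, test phi & sob_norm (u \- phi) < e.

(** The interface between the domain and the functional analysis: [ds_by_parts] makes classical
    derivatives of test functions weak ones, and [ds_fundamental] makes weak derivatives unique. *)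
Record dirichlet_setting : Prop := DirichletSetting {
  ds_meas : measurable D;
  ds_fin : (mu D < +oo)%E;
  ds_test0 : test 0;
  ds_test_lin : forall k phi psi, test phi -> test psi -> test (k *: phi + psi);
  ds_test_L2 : forall phi i, test phi -> L2 mu D phi /\ L2 mu D (pd i phi);
  ds_by_parts : forall i phi psi, test phi -> test psi ->
    \int[mu]_(x in D) (phi x * pd i psi x) = - \int[mu]_(x in D) (pd i phi x * psi x);
  ds_fundamental : forall g, mu.-integrable D (EFin \o g) ->
    (forall phi, test phi -> \int[mu]_(x in D) (g x * phi x) = 0) ->
    {ae mu, forall x, D x -> g x = 0} }.

Hypothesis ds : dirichlet_setting.
Hypothesis n0 : (0 < n)%N.

Let mD := ds_meas ds.
Let muD := ds_fin ds.
Local Notation L2D := (L2 mu D).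
Local Notation ip := (L2ip mu D).
Local Notation "u =ae v" := {ae mu, forall x, D x -> u x = v x} (at level 70).

Lemma in_L2 u : u \_ D \in Lfun mu 2%:E <-> L2D u.
Proof. exact: L2_Lfun mD u. Qed.

Lemma L2_intg u : L2D u -> mu.-integrable D (EFin \o u).
Proof.
move=> hu; apply: (eq_intg mD _ (L2_mul mD hu (L2_cst mD muD 1))) => x _.
by rewrite mulr1.
Qed.

Lemma setting_test_L2 phi : test phi -> L2D phi.
Proof. by move=> /(ds_test_L2 ds (Ordinal n0))[]. Qed.

Lemma weak_pd_unique i u g g' : L2D g -> L2D g' -> weak_pd i u g -> weak_pd i u g' -> g =ae g'.
Proof.
move=> hg hg' wg wg'.
have L : L2D (fun x => g x - g' x) by exact: (L2_B mD hg hg').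
have h : {ae mu, forall x, D x -> g x - g' x = 0}.
  apply: (ds_fundamental ds (L2_intg L)) => phi tphi; have hphi := setting_test_L2 tphi.
  have E : ip g phi = ip g' phi by apply: oppr_inj; rewrite -wg// -wg'.
  rewrite (@eq_Rintegral _ _ _ _ _ (fun x => g x * phi x - g' x * phi x)).
    rewrite RintegralB//; [by rewrite [X in X - _]E subrr|exact: (L2_mul mD hg hphi)|exact: (L2_mul mD hg' hphi)].
  by move=> x _; rewrite mulrBl.
by apply: (ae_imp h) => x hx Dx; apply/eqP; rewrite -subr_eq0 hx.
Qed.

Lemma wpd_spec u i : sob u -> L2D (wpd u i) /\ weak_pd i u (wpd u i).
Proof.
move=> [_ /(_ i)[g [/in_L2 hg wg]]].
have : [set g | g \_ D \in Lfun mu 2%:E /\ weak_pd i u g] (wpd u i).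
  by apply: getPex; exists g; split => //; apply/in_L2.
by move=> [/in_L2].
Qed.

Lemma wpd_L2 u i : sob u -> L2D (wpd u i). Proof. by case/(wpd_spec i). Qed.

Lemma sob_L2 u : sob u -> L2D u. Proof. by case=> /in_L2. Qed.

(** As [wpd] is a mere choice among weak derivatives, it is computed through uniqueness: any square
    integrable candidate agrees with it almost everywhere. *)
Lemma sobP u (g : 'I_n -> T -> R) : L2D u -> (forall i, L2D (g i)) ->
  (forall i, weak_pd i u (g i)) -> sob u /\ forall i, wpd u i =ae g i.
Proof.
move=> hu hg wg.
have h : sob u by split; [exact/in_L2|move=> i; exists (g i); split => //; exact/in_L2].
split => // i; have [h1 h2] := wpd_spec i h.
exact: (weak_pd_unique h1 (hg i) h2 (wg i)).
Qed.

Lemma test_sob phi : test phi -> sob phi /\ forall i, wpd phi i =ae pd i phi.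
Proof.
move=> tphi; apply: (sobP (g := fun i => pd i phi)).
- exact: setting_test_L2.
- by move=> i; have [] := ds_test_L2 ds i tphi.
- by move=> i psi tpsi; exact: ds_by_parts.
Qed.

Lemma sob_lin_spec (k : R) u v : sob u -> sob v -> sob (k *: u + v) /\
  forall i, wpd (k *: u + v) i =ae (k *: wpd u i + wpd v i).
Proof.
move=> hu hv; have Lu := sob_L2 hu; have Lv := sob_L2 hv.
have wu i := wpd_spec i hu; have wv i := wpd_spec i hv.
apply: (sobP (g := fun i => k *: wpd u i + wpd v i)).
- exact: L2_setlin mD _ _ _ Lu Lv.
- by move=> i; apply: (L2_setlin mD); [exact: (wu i).1|exact: (wv i).1].
- move=> i phi tphi; have [Lp Ldp] := ds_test_L2 ds i tphi.
  have [L1 w1] := wu i; have [L2' w2] := wv i.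
  have LZ w : L2D w -> L2D (k *: w).
    by move=> hw; have := L2_setlin mD k hw (L2_set0 mu mD); rewrite addr0.
  rewrite -/(ip _ _) -[in RHS]/(ip (k *: wpd u i + wpd v i) phi).
  rewrite -[LHS]/(ip (k *: u + v) (pd i phi)).
  rewrite (L2ipDl mD (LZ _ Lu) Lv Ldp) (L2ipZl mD _ Lu Ldp).
  rewrite (L2ipDl mD (LZ _ L1) L2' Lp) (L2ipZl mD _ L1 Lp).
  have E1 : ip u (pd i phi) = - ip (wpd u i) phi by exact: w1.
  have E2 : ip v (pd i phi) = - ip (wpd v i) phi by exact: w2.
  move: E1 E2; move: (ip u _) (ip (wpd u i) _) (ip v _) (ip (wpd v i) _) => a b c e -> ->.
  by rewrite mulrN opprD.
Qed.

Lemma sob_zero : sob 0.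
Proof. exact: (test_sob (ds_test0 ds)).1. Qed.

Lemma sob_lin k u v : sob u -> sob v -> sob (k *: u + v).
Proof. by move=> hu hv; have [] := sob_lin_spec k hu hv. Qed.

Lemma dirE u v : sob u -> sob v -> dir u v = \sum_i ip (wpd u i) (wpd v i).
Proof.
move=> hu hv; rewrite /dir Rint_sum//.
by move=> i; apply: (L2_mul mD); exact: wpd_L2.
Qed.

Lemma dirC u v : dir u v = dir v u.
Proof. by apply: eq_Rintegral => x _; apply: eq_bigr => i _; rewrite mulrC. Qed.

Lemma dir_lin k u v w : sob u -> sob v -> sob w ->
  dir (k *: u + v) w = k * dir u w + dir v w.
Proof.
move=> hu hv hw; have [huv wuv] := sob_lin_spec k hu hv.
rewrite !dirE// mulr_sumr -big_split /=; apply: eq_bigr => i _.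
have L1 := wpd_L2 i hu; have L2' := wpd_L2 i hv; have L3 := wpd_L2 i hw.
have LZ : L2D (k *: wpd u i).
  by have := L2_setlin mD k L1 (L2_set0 mu mD); rewrite addr0.
rewrite -(L2ipZl mD k L1 L3) -(L2ipDl mD LZ L2' L3); apply: (ae_L2ip mD) => //.
- exact: wpd_L2.
- exact: L2_setlin.
- exact: ae_true.
Qed.

Definition H1sp : lmodType R := subsp sob_zero sob_lin.

Definition h1 (u v : H1sp) : R := ip (sval_of u) (sval_of v) + dir (sval_of u) (sval_of v).

Lemma dirDl u v w : sob u -> sob v -> sob w -> dir (u + v) w = dir u w + dir v w.
Proof. by move=> hu hv hw; have := dir_lin 1 hu hv hw; rewrite scale1r mul1r. Qed.

Lemma dirZl k u w : sob u -> sob w -> dir (k *: u) w = k * dir u w.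
Proof.
move=> hu hw; have h : dir 0 w = 0.
  have := dirDl sob_zero sob_zero hw; rewrite addr0 => /eqP; rewrite -subr_eq0 opprD addrA subrr sub0r.
  by rewrite oppr_eq0 => /eqP.
by have := dir_lin k hu sob_zero hw; rewrite addr0 h addr0.
Qed.

Lemma dir_ge0 u : 0 <= dir u u.
Proof. by apply: Rintegral_ge0 => x _; apply: sumr_ge0 => i _; rewrite -expr2 sqr_ge0. Qed.

Lemma h1P : semi_inner h1.
Proof.
split; rewrite /h1.
- move=> x y z; rewrite sval_ofD.
  have hx := subspP x; have hy := subspP y; have hz := subspP z.
  by rewrite dirDl// (L2ipDl mD (sob_L2 hx) (sob_L2 hy) (sob_L2 hz)) addrACA.
- move=> k x y; have hx := subspP x; have hy := subspP y.
  by rewrite sval_ofZ dirZl// (L2ipZl mD _ (sob_L2 hx) (sob_L2 hy)) mulrDr.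
- by move=> x y; rewrite dirC L2ipC.
- by move=> x; rewrite addr_ge0 ?dir_ge0 ?L2ip_ge0.
Qed.

Lemma sob_normE (u : H1sp) : sob_norm (sval_of u) = sn h1 u.
Proof. by rewrite /sob_norm /sn /h1; congr (Num.sqrt (_ + _)); apply: eq_Rintegral => x _; rewrite expr2. Qed.

Lemma wpdB u v i : sob u -> sob v -> wpd (u - v) i =ae (wpd u i - wpd v i).
Proof.
move=> hu hv; have [_ /(_ i) h] := sob_lin_spec (-1) hv hu.
have E : u - v = -1 *: v + u by rewrite scaleN1r addrC.
rewrite E; apply: (ae_imp h) => x hx Dx; rewrite hx//.
by rewrite -[LHS]/(-1 * wpd v i x + wpd u i x) mulN1r addrC.
Qed.

Lemma sobB u v : sob u -> sob v -> sob (u - v).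
Proof. by move=> hu hv; rewrite addrC -scaleN1r; exact: sob_lin. Qed.

Lemma dirB u v : sob u -> sob v ->
  dir (u - v) (u - v) = \sum_i \int[mu]_(x in D) ((wpd u i x - wpd v i x) ^+ 2).
Proof.
move=> hu hv; have huv := sobB hu hv; rewrite dirE//; apply: eq_bigr => i _.
have Lu := wpd_L2 i hu; have Lv := wpd_L2 i hv; have Luv := wpd_L2 i huv.
have LB : L2D (wpd u i - wpd v i) by exact: (L2_B mD Lu Lv).
rewrite (ae_L2ip mD Luv LB Luv LB (wpdB i hu hv) (wpdB i hu hv)).
by apply: eq_Rintegral => x _; rewrite expr2.
Qed.

Lemma h1B (x y : H1sp) : sn h1 (x - y) ^+ 2 =
  \int[mu]_(t in D) ((sval_of x t - sval_of y t) ^+ 2) +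
  \sum_i \int[mu]_(t in D) ((wpd (sval_of x) i t - wpd (sval_of y) i t) ^+ 2).
Proof.
rewrite (sn_sqr h1P) /h1 sval_ofB dirB; [|exact: subspP|exact: subspP].
by congr (_ + _); apply: eq_Rintegral => t _; rewrite expr2.
Qed.

Lemma L2_cvg_ip (F : set_system nat) {FF : Filter F} (u_ : nat -> T -> R) u v :
  (forall k, L2D (u_ k)) -> L2D u -> L2D v ->
  (fun k => \int[mu]_(x in D) ((u_ k x - u x) ^+ 2)) @ F --> (0 : R) ->
  (fun k => ip (u_ k) v) @ F --> (ip u v : R).
Proof.
move=> hu_ hu hv H.
pose U k : L2sp mu mD := to_subsp (L2_set0 mu mD) (L2_setlin mD) (hu_ k).
pose X : L2sp mu mD := to_subsp (L2_set0 mu mD) (L2_setlin mD) hu.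
pose Y : L2sp mu mD := to_subsp (L2_set0 mu mD) (L2_setlin mD) hv.
apply: (@cvg_sn_a _ _ _ (L2formP mu mD) nat F U X Y FF).
rewrite -(sqrtr0 R) (_ : (fun k => _) = (fun k => Num.sqrt (\int[mu]_(x in D) ((u_ k x - u x) ^+ 2)))).
  by apply: continuous_cvg => //; exact: sqrt_continuous.
by apply/funext => k; rewrite sn_L2form; congr Num.sqrt; apply: eq_Rintegral => x _; rewrite sval_ofB.
Qed.

Opaque L2ip dir h1.

(** The functions and each of their weak derivatives converge in L^2, and the identity that defines
    weak derivatives passes to the limit against every test function. *)
Lemma h1_complete : si_complete h1.
Proof.
move=> x_ hx.
pose dI i m k := \int[mu]_(t in D) ((wpd (sval_of (x_ m)) i t - wpd (sval_of (x_ k)) i t) ^+ 2).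
have dI0 i m k : 0 <= dI i m k by apply: Rintegral_ge0 => t _; exact: sqr_ge0.
have C (e : R) : 0 < e -> exists N, forall m k, (N <= m)%N -> (N <= k)%N -> sn h1 (x_ m - x_ k) ^+ 2 < e.
  move=> e0; have [|N HN] := hx (Num.sqrt e); first by rewrite sqrtr_gt0.
  exists N => m k Nm Nk; rewrite -(sqr_sqrtr (ltW e0)) ltrXn2r// ?nnegrE ?sn_ge0 ?sqrtr_ge0//.
  exact: HN.
have sx k : sob (sval_of (x_ k)) by exact: subspP.
have [k|e /C[N HN]|u hu cu] := @L2_complete _ _ R mu D mD muD (fun k => sval_of (x_ k)).
- exact: sob_L2.
- exists N => m k Nm Nk; apply: le_lt_trans (HN m k Nm Nk); rewrite h1B lerDl.
  by apply: sumr_ge0 => i _; exact: dI0.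
have /choice[g gP] : forall i, exists g, L2D g /\
    (fun k => \int[mu]_(t in D) ((wpd (sval_of (x_ k)) i t - g t) ^+ 2)) @ \oo --> (0 : R).
  move=> i; have [k|e /C[N HN]|g hg cg] := @L2_complete _ _ R mu D mD muD (fun k => wpd (sval_of (x_ k)) i).
  - exact: wpd_L2.
  - exists N => m k Nm Nk; apply: le_lt_trans (HN m k Nm Nk); rewrite h1B.
    rewrite (bigD1 i)//= addrCA lerDl addr_ge0//.
      by apply: Rintegral_ge0 => t _; exact: sqr_ge0.
    by apply: sumr_ge0 => j _; exact: dI0.
  - by exists g.
have [su wu] : sob u /\ forall i, wpd u i =ae g i.
  apply: sobP => // [i|i phi tphi]; first exact: (gP i).1.
  have [L1 L2'] := ds_test_L2 ds i tphi.
  have c1 : (fun k => ip (sval_of (x_ k)) (pd i phi)) @ \oo --> (ip u (pd i phi) : R) by exact: (L2_cvg_ip (fun k => sob_L2 (sx k)) hu L2' cu).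
  have c2 : (fun k => ip (wpd (sval_of (x_ k)) i) phi) @ \oo --> (ip (g i) phi : R) by exact: (L2_cvg_ip (fun k => wpd_L2 i (sx k)) (gP i).1 L1 (gP i).2).
  have c3 : (fun k => ip (sval_of (x_ k)) (pd i phi)) @ \oo --> - ip (g i) phi.
    rewrite (_ : (fun k => _) = (fun k => - ip (wpd (sval_of (x_ k)) i) phi)); first by apply: cvgN; exact: c2.
    by apply/funext => k; exact: (wpd_spec i (sx k)).2.
  exact: (Rcvg_unique c1 c3).
pose X : H1sp := to_subsp sob_zero sob_lin su.
have E k : sn h1 (x_ k - X) = Num.sqrt (\int[mu]_(t in D) ((sval_of (x_ k) t - u t) ^+ 2) +
  \sum_i \int[mu]_(t in D) ((wpd (sval_of (x_ k)) i t - g i t) ^+ 2)).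
  rewrite -[LHS]ger0_norm ?sn_ge0// -sqrtr_sqr h1B; congr (Num.sqrt (_ + _)).
  apply: eq_bigr => i _; apply: ae_Rint.
  - exact: mD.
  - by apply: measurable_funX; apply: measurable_funB; [exact: (wpd_L2 i (sx k)).1|exact: (wpd_L2 i su).1].
  - by apply: measurable_funX; apply: measurable_funB; [exact: (wpd_L2 i (sx k)).1|exact: (gP i).1.1].
  - by apply: (ae_imp (wu i)) => t ht Dt; rewrite ht.
exists X; rewrite (funext E) -{2}(sqrtr0 R); apply: continuous_cvg; first exact: sqrt_continuous.
have c : (fun k => \sum_i \int[mu]_(t in D) ((wpd (sval_of (x_ k)) i t - g i t) ^+ 2)) @ \oo --> (0 : R).
  by apply: (Rcvg_sum0 _ (f := fun i k => \int[mu]_(t in D) ((wpd (sval_of (x_ k)) i t - g i t) ^+ 2))) => i; exact: (gP i).2.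
by have h2 := cvgD cu c; rewrite addr0 in h2; exact: h2.
Qed.

Lemma sob00 : sob0 0.
Proof.
split; first exact: sob_zero.
move=> e e0; exists 0; first exact: ds_test0 ds.
rewrite (_ : (0 : T -> R) \- 0 = 0); last by apply/funext => x; exact: subrr.
by rewrite -[0]/(sval_of (0 : H1sp)) sob_normE (sn0 h1P).
Qed.

Lemma sob0_lin k u v : sob0 u -> sob0 v -> sob0 (k *: u + v).
Proof.
move=> [su hu] [sv hv]; split; first exact: sob_lin.
move=> e e0; have k1 : 0 < `|k| + 1 by rewrite ltr_wpDl.
have [|phi tphi hphi] := hu (e / 2 / (`|k| + 1)); first by rewrite !divr_gt0.
have [|psi tpsi hpsi] := hv (e / 2); first by rewrite divr_gt0.
exists (k *: phi + psi); first exact: ds_test_lin.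
have [sphi _] := test_sob tphi; have [spsi _] := test_sob tpsi.
pose lift w (hw : sob w) : H1sp := to_subsp sob_zero sob_lin hw.
have E : (k *: u + v) \- (k *: phi + psi) =
    sval_of (k *: (lift u su - lift phi sphi) + (lift v sv - lift psi spsi)).
  rewrite (_ : sval_of _ = k *: (u - phi) + (v - psi))//.
  by rewrite scalerBr addrACA -opprD.
rewrite E sob_normE; apply: le_lt_trans (snD h1P _ _) _; rewrite (snZ h1P).
rewrite -[u \- phi]/(sval_of (lift u su - lift phi sphi)) sob_normE in hphi.
rewrite -[v \- psi]/(sval_of (lift v sv - lift psi spsi)) sob_normE in hpsi.
move: hphi; rewrite ltr_pdivlMr// => hphi.
have := sn_ge0 h1 (lift u su - lift phi sphi); move: hphi hpsi.
by set a := sn _ _; set b := sn _ _; have := normr_ge0 k; nra.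
Qed.

Definition H0sp : lmodType R := subsp sob00 sob0_lin.

Definition inj0 (x : H0sp) : H1sp := to_subsp sob_zero sob_lin (subspP x).1.

Lemma inj0D x y : inj0 (x + y) = inj0 x + inj0 y. Proof. exact: val_inj. Qed.
Lemma inj0Z k x : inj0 (k *: x) = k *: inj0 x. Proof. exact: val_inj. Qed.
Lemma inj0B x y : inj0 (x - y) = inj0 x - inj0 y. Proof. exact: val_inj. Qed.

Definition h10 (x y : H0sp) : R := h1 (inj0 x) (inj0 y).

Lemma h10P : semi_inner h10.
Proof.
split; rewrite /h10.
- by move=> x y z; rewrite inj0D (siDl h1P).
- by move=> k x y; rewrite inj0Z (siZl h1P).
- by move=> x y; rewrite (siC h1P).
- by move=> x; exact: (si_ge0 h1P).
Qed.

Lemma h10_complete : si_complete h10.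
Proof.
move=> x_ hx; have [|X cX] := h1_complete (x_ := fun k => inj0 (x_ k)).
  by move=> e /hx[N HN]; exists N => m k Nm Nk; rewrite -inj0B; exact: HN.
(* A test function close to a late term of the sequence is close to the limit. *)
have h0 : sob0 (sval_of X).
  split; first exact: subspP.
  move=> e e0; have e2 : 0 < e / 2 by rewrite divr_gt0.
  move/cvgr0Pnorm_lt : cX => /(_ _ e2)[N _ /(_ N (leqnn _))] /=.
  rewrite ger0_norm ?sn_ge0// => hN.
  have [_ /(_ _ e2)[phi tphi]] := subspP (x_ N).
  have [sphi _] := test_sob tphi; pose Phi : H1sp := to_subsp sob_zero sob_lin sphi.
  rewrite -[_ \- phi]/(sval_of (inj0 (x_ N) - Phi)) sob_normE => hphi.
  exists phi => //; rewrite -[_ \- phi]/(sval_of (X - Phi)) sob_normE.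
  apply: le_lt_trans (sn_dist h1P X (inj0 (x_ N)) Phi) _.
  by rewrite [e]splitr; apply: ltrD; [rewrite (snB h1P); exact: hN|exact: hphi].
exists (to_subsp sob00 sob0_lin h0).
rewrite (_ : (fun k => _) = (fun k => sn h1 (inj0 (x_ k) - X)))//.
Qed.

Definition energy (x y : H0sp) : R := dir (sval_of x) (sval_of y).

Lemma energyP : semi_inner energy.
Proof.
split; rewrite /energy.
- move=> x y z; rewrite sval_ofD; exact: (dirDl (subspP x).1 (subspP y).1 (subspP z).1).
- by move=> k x y; rewrite sval_ofZ; exact: (dirZl _ (subspP x).1 (subspP y).1).
- by move=> x y; rewrite dirC.
- by move=> x; exact: dir_ge0.
Qed.

Lemma h10E x y : h10 x y = ip (sval_of x) (sval_of y) + energy x y. Proof. by []. Qed.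

End weak_derivatives.

Section absolute_power.
Variables (R : realType) (q : R).
Hypothesis q0 : 0 < q.

Definition apow (t : R) : R := `|t| `^ q.

Lemma apow_ge0 t : 0 <= apow t. Proof. exact: powR_ge0. Qed.

Lemma apow0 : apow 0 = 0. Proof. by rewrite /apow normr0 powR0// gt_eqF. Qed.

Lemma apow_le s t : `|s| <= `|t| -> apow s <= apow t.
Proof. by move=> st; apply: ge0_ler_powR; rewrite ?nnegrE// ltW. Qed.

Lemma apow_norm t : apow `|t| = apow t. Proof. by rewrite /apow normr_id. Qed.

Lemma apow_lt s t : `|s| < `|t| -> apow s < apow t.
Proof. by move=> st; apply: gt0_ltr_powR; rewrite ?nnegrE. Qed.

Lemma apowN t : apow (- t) = apow t. Proof. by rewrite /apow normrN. Qed.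

Lemma apowM s t : apow (s * t) = apow s * apow t.
Proof. by rewrite /apow normrM powRM. Qed.

Lemma apow_root e : 0 < e -> exists2 r, 0 < r & apow r = e.
Proof.
move=> e0; exists (e `^ q^-1); first exact: powR_gt0.
by rewrite /apow ger0_norm ?powR_ge0// -powRrM mulVf ?gt_eqF// powRr1// ltW.
Qed.

Lemma apow_cvg0 (F : set_system nat) {FF : Filter F} (f : nat -> R) : f @ F --> (0 : R) ->
  (fun k => apow (f k)) @ F --> (0 : R).
Proof.
move=> /cvgr0Pnorm_lt H; apply/cvgr0Pnorm_lt => e e0.
have [r r0 <-] := apow_root e0; apply: filterS (H _ r0) => k hk.
by rewrite ger0_norm ?apow_ge0//; apply: apow_lt; rewrite [X in _ < X]gtr0_norm.
Qed.

Lemma apow_continuous : continuous apow.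
Proof.
move=> t; have [->|t0] := eqVneq t 0.
  apply/cvgrPdist_lt => e e0; have [r r0 re] := apow_root e0.
  have := nbhsx_ballx (0 : R) r r0; apply: filterS => s.
  rewrite /ball /= sub0r normrN => sr; rewrite apow0 sub0r normrN ger0_norm ?apow_ge0// -re.
  by apply: apow_lt; rewrite [X in _ < X]gtr0_norm.
apply: (@continuous_comp _ _ _ (fun t : R => `|t|) (fun t => t `^ q)); first exact: norm_continuous.
apply: differentiable_continuous; apply/derivable1_diffP; apply: derivable_powR.
by rewrite in_itv /= andbT normr_gt0.
Qed.

Lemma measurable_apow : measurable_fun setT apow.
Proof. exact: continuous_measurable_fun apow_continuous. Qed.

(** From |s + t| <= 2 max(|s|, |t|). *)
Lemma apowD s t : apow (s + t) <= apow 2 * (apow s + apow t).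
Proof.
rewrite mulrDr -!apowM; wlog st : s t / `|s| <= `|t|.
  by move=> H; have [/H//|/ltW/H] := leP `|s| `|t|; rewrite addrC [X in _ <= X]addrC.
apply: (@le_trans _ _ (apow (2 * t))); last by rewrite lerDr apow_ge0.
apply: apow_le; rewrite normrM ger0_norm//.
by apply: le_trans (ler_normD _ _) _; lra.
Qed.

End absolute_power.

(** * The compact Sobolev embedding *)

Section compact_embedding.
Context d (T : measurableType d) (R : realType).
Variables (mu : {measure set T -> \bar R}) (D : set T) (n : nat).
Variables (test : set (T -> R)) (pd : 'I_n -> (T -> R) -> T -> R).
Hypothesis ds : dirichlet_setting mu D test pd.
Hypothesis n0 : (0 < n)%N.
Let mD := ds_meas ds.
Let muD := ds_fin ds.
Local Notation L2D := (L2 mu D).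
Local Notation ip := (L2ip mu D).
Local Notation I f := (\int[mu]_(x in D) f x).
Local Notation H0 := (H0sp ds n0).
Local Notation snorm := (sob_norm mu D test pd).
Local Notation sob0 := (sob0 mu D test pd).

Definition Lq q (u : T -> R) := measurable_fun D u /\
  mu.-integrable D (EFin \o (fun x => apow q (u x))).

Definition fin_rank N (E F : 'I_N -> T -> R) (u : T -> R) : T -> R :=
  fun x => \sum_j ip u (E j) * F j x.

(* Both the Sobolev embedding into L^q and its compactness: test functions are
   approximated in L^q by a finite rank operator, uniformly on the unit ball of
   the Sobolev norm. *)
Definition finite_rank_approx (q : R) := forall e : R, 0 < e ->
  exists N (E F : 'I_N -> T -> R), [/\ forall j, L2D (E j),
    forall j, measurable_fun D (F j) /\ (forall x, `|F j x| <= 1) &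
    forall phi, test phi -> Lq q (fun x => phi x - fin_rank E F phi x) /\
      I (fun x => apow q (phi x - fin_rank E F phi x)) <= apow q (e * snorm phi)].

Lemma measurable_fin_rank N (E F : 'I_N -> T -> R) u :
  (forall j, measurable_fun D (F j)) -> measurable_fun D (fin_rank E F u).
Proof. by move=> mF; apply: measurable_sum => j; apply: measurable_funM. Qed.

Lemma sob0_approx u : sob0 u -> exists phi_ : nat -> T -> R,
  [/\ forall k, test (phi_ k), forall k, snorm (phi_ k) <= snorm u + 1,
    (fun k => I (fun x => (phi_ k x - u x) ^+ 2)) @ \oo --> (0 : R) &
    {ae mu, forall x, D x -> (fun k => phi_ k x) @ \oo --> u x}].
Proof.
move=> [su hu].
have /choice[p_ pP] : forall k : nat, exists phi, test phi /\ snorm (u \- phi) < k.+1%:R^-1.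
  move=> k; have k0 : 0 < k.+1%:R^-1 :> R by [].
  by have [phi] := hu _ k0; exists phi.
pose lift w (hw : sob mu D test pd w) : H1sp ds n0 := to_subsp (sob_zero ds n0) (sob_lin ds n0) hw.
have sp k := (test_sob ds n0 (pP k).1).1.
have H k : sn (h1 (ds := ds) (n0 := n0)) (lift _ (sp k) - lift _ su) <= k.+1%:R^-1.
  by rewrite (snB (h1P ds n0)) -sob_normE; exact: ltW (pP k).2.
have c2 : (fun k => I (fun x => (p_ k x - u x) ^+ 2)) @ \oo --> (0 : R).
  apply: (Rsqueeze0 (h := fun k => k.+1%:R^-1)); last exact: cvg_harmonic.
  move=> k; apply/andP; split; first by apply: Rintegral_ge0 => x _; exact: sqr_ge0.
  apply: (@le_trans _ _ (sn (h1 (ds := ds) (n0 := n0)) (lift _ (sp k) - lift _ su) ^+ 2)).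
    rewrite h1B lerDl; apply: sumr_ge0 => i _.
    by apply: Rintegral_ge0 => x _; exact: sqr_ge0.
  have := H k; have := sn_ge0 (h1 (ds := ds) (n0 := n0)) (lift _ (sp k) - lift _ su).
  have : k.+1%:R^-1 <= 1 :> R by rewrite invf_le1// ler1n.
  move: (sn _ _) (k.+1%:R^-1) => a b; nra.
have [psi [psij aepsi]] := L2_ae_subseq mD (fun k => sob_L2 ds (sp k)) (sob_L2 ds su) c2.
exists (fun k => p_ (psi k)); split.
- by move=> k; exact: (pP _).1.
- move=> k; have k1 : (psi k).+1%:R^-1 <= 1 :> R by rewrite invf_le1// ler1n.
  rewrite -[p_ (psi k)]/(sval_of (lift _ (sp (psi k)))) -[u]/(sval_of (lift _ su)) !sob_normE.
  have := snD (h1P ds n0) (lift _ su) (lift _ (sp (psi k)) - lift _ su); rewrite addrC subrK => h.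
  by apply: le_trans h _; rewrite lerD2l (le_trans (H _) k1).
- apply/cvgr0Pnorm_lt => e e0; move/cvgr0Pnorm_lt : c2 => /(_ e e0)[N _ HN].
  by exists N => // k /= Nk; apply: HN => /=; exact: leq_trans (psij k).
- exact: aepsi.
Qed.

Lemma fin_rank_cvg (F : set_system nat) {FF : Filter F} N (E G : 'I_N -> T -> R) (u_ : nat -> T -> R) u x :
  (forall j, L2D (E j)) -> (forall k, L2D (u_ k)) -> L2D u ->
  (fun k => I (fun x => (u_ k x - u x) ^+ 2)) @ F --> (0 : R) ->
  (fun k => fin_rank E G (u_ k) x) @ F --> (fin_rank E G u x : R).
Proof.
move=> LE Lu_ Lu cu.
have c : (fun k => \sum_j (ip (u_ k) (E j) - ip u (E j)) * G j x) @ F --> (0 : R).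
  apply: (Rcvg_sum0 _ (f := fun j k => (ip (u_ k) (E j) - ip u (E j)) * G j x)) => j.
  have h : (fun k => ip (u_ k) (E j)) @ F --> (ip u (E j) : R) by exact: (L2_cvg_ip ds Lu_ Lu (LE j) cu).
  have h3 := cvgM (cvgB h (cvg_cst (ip u (E j)))) (cvg_cst (G j x)).
  by rewrite subrr mul0r in h3; exact: h3.
have h2 : (fun k => \sum_j (ip (u_ k) (E j) - ip u (E j)) * G j x + fin_rank E G u x) @ F --> (0 + fin_rank E G u x : R).
  by apply: cvgD => //; exact: cvg_cst.
rewrite add0r in h2; rewrite (_ : (fun k => _) = (fun k => \sum_j (ip (u_ k) (E j) - ip u (E j)) * G j x + fin_rank E G u x))//.
by apply/funext => k; rewrite /fin_rank -big_split /=; apply: eq_bigr => j _; rewrite mulrBl subrK.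
Qed.

(** Fatou's lemma along test functions that converge in L^2 and almost everywhere; the added 1
    absorbs the difference between their norms and that of [u]. *)
Lemma approx_sob0 q (e : R) N (E F : 'I_N -> T -> R) : 0 < q -> 0 < e ->
  (forall j, L2D (E j)) -> (forall j, measurable_fun D (F j) /\ (forall x, `|F j x| <= 1)) ->
  (forall phi, test phi -> Lq q (fun x => phi x - fin_rank E F phi x) /\
      I (fun x => apow q (phi x - fin_rank E F phi x)) <= apow q (e * snorm phi)) ->
  forall u, sob0 u -> Lq q (fun x => u x - fin_rank E F u x) /\
      I (fun x => apow q (u x - fin_rank E F u x)) <= apow q (e * (snorm u + 1)).
Proof.
move=> q0 e0 LE mF H u su.
have [phi_ [tphi nphi cphi aephi]] := sob0_approx su.
have Lu := sob_L2 ds su.1; have Lphi k := setting_test_L2 ds n0 (tphi k).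
have mu_ : measurable_fun D (fun x => u x - fin_rank E F u x).
  apply: measurable_funB; first exact: Lu.1.
  by apply: measurable_fin_rank => j; exact: (mF j).1.
have mq : measurable_fun D (fun x => apow q (u x - fin_rank E F u x)).
  by apply: (measurableT_comp (measurable_apow q0)).
have [||||||h1 h2] := @Rfatou _ _ R mu D mD (fun k x => apow q (phi_ k x - fin_rank E F (phi_ k) x))
  (fun x => apow q (u x - fin_rank E F u x)) (apow q (e * (snorm u + 1))).
- by move=> k; exact: (H _ (tphi k)).1.2.
- by move=> k x _; exact: apow_ge0.
- exact: mq.
- by move=> x _; exact: apow_ge0.
- apply: (ae_imp aephi) => x hx Dx; apply: continuous_cvg; first exact: apow_continuous.
  by apply: cvgB; [exact: hx|exact: fin_rank_cvg].
- move=> k; apply: le_trans (H _ (tphi k)).2 _; apply: apow_le => //.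
  rewrite !normrM ler_wpM2l// ger0_norm ?sqrtr_ge0// ger0_norm ?nphi//.
  by rewrite addr_ge0// sqrtr_ge0.
- by split.
Qed.

Lemma fin_rank_le N (E F : 'I_N -> T -> R) u x : (forall j x, `|F j x| <= 1) ->
  `|fin_rank E F u x| <= \sum_j `|ip u (E j)|.
Proof.
move=> F1; apply: le_trans (ler_norm_sum _ _ _) _; apply: ler_sum => j _.
by rewrite normrM ler_piMr.
Qed.

(** The finite rank part is bounded pointwise by the sum of the absolute values of its coefficients,
    since each [F j] is bounded by 1. *)
Lemma Lq_finite_rank (q : R) N (E F : 'I_N -> T -> R) (u : T -> R) (B : R) : 0 < q ->
  (forall j, measurable_fun D (F j) /\ (forall x, `|F j x| <= 1)) ->
  measurable_fun D u ->
  Lq q (fun x => u x - fin_rank E F u x) ->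
  I (fun x => apow q (u x - fin_rank E F u x)) <= B ->
  Lq q u /\ I (fun x => apow q (u x)) <=
    apow q 2 * (B + apow q (\sum_j `|ip u (E j)|) * fine (mu D)).
Proof.
move=> q0 mF mu_ [mud iud] hB; pose s : R := \sum_j `|ip u (E j)|; rewrite -/s.
have mq : measurable_fun D (fun x => apow q (u x)).
  by apply: (measurableT_comp (measurable_apow q0)).
have hle x : D x -> apow q (u x) <= apow q 2 * (apow q (u x - fin_rank E F u x) + apow q s).
  move=> Dx; rewrite -{1}[u x](subrK (fin_rank E F u x)).
  apply: le_trans (apowD q0 _ _) _; rewrite ler_wpM2l ?apow_ge0// lerD2l.
  apply: apow_le => //; rewrite [X in _ <= X]ger0_norm ?sumr_ge0//.
  by apply: fin_rank_le => j; exact: (mF j).2.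
have ib : mu.-integrable D (EFin \o (fun x => apow q 2 * (apow q (u x - fin_rank E F u x) + apow q s))).
  exact: (intgZ mD _ (intgD mD iud (intg_cst mD muD _))).
have iu : mu.-integrable D (EFin \o (fun x => apow q (u x))).
  by apply: (intg_le mD mq ib) => x Dx; rewrite ger0_norm ?apow_ge0// hle.
split; first by split.
apply: le_trans (le_Rintegral mD iu ib hle) _.
rewrite RintegralZl//; last exact: (intgD mD iud (intg_cst mD muD _)).
rewrite RintegralD//; last exact: (intg_cst mD muD).
by rewrite Rintegral_cst// ler_wpM2l ?apow_ge0// lerD2r.
Qed.

Lemma Lq_sob0 q u : 0 < q -> finite_rank_approx q -> sob0 u -> Lq q u.
Proof.
move=> q0 hq su; have [N [E [F [LE mF H]]]] := hq 1 ltr01.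
have [h1 h2] := approx_sob0 q0 ltr01 LE mF H su.
exact: (Lq_finite_rank q0 mF (sob_L2 ds su.1).1 h1 h2).1.
Qed.

Section rellich.
(** The form [a] is the H^1 form as long as Poincare's inequality is not known, and the energy
    afterwards. *)
Variables (a : H0 -> H0 -> R) (C : R).
Hypotheses (ha : semi_inner a) (hcomp : si_complete a).
Hypothesis hC : forall x, sn (@h10 _ _ _ _ _ _ _ _ ds n0) x <= C * sn a x.
Local Notation sn10 := (sn (@h10 _ _ _ _ _ _ _ _ ds n0)).

Lemma snorm_sn10 (x : H0) : snorm (sval_of x) = sn10 x.
Proof. by rewrite -[sval_of x]/(sval_of (inj0 x)) sob_normE. Qed.

Lemma ip_le_sn10 (x : H0) e : L2D e -> `|ip (sval_of x) e| <= sn10 x * Num.sqrt (ip e e).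
Proof.
move=> Le.
pose X : L2sp mu mD := to_subsp (L2_set0 mu mD) (L2_setlin mD) (sob_L2 ds (subspP x).1).
pose Y : L2sp mu mD := to_subsp (L2_set0 mu mD) (L2_setlin mD) Le.
have := si_CS (L2formP mu mD) X Y => /le_trans; apply.
by rewrite ler_wpM2r ?sqrtr_ge0//; apply: ler_wsqrtr; rewrite h10E lerDl; exact: (si_ge0 (energyP ds n0)).
Qed.

(** The functional is bounded for [a], so Riesz's theorem writes it as a pairing by [a], to which
    weak convergence applies. *)
Lemma ip_wlim (U : set_system nat) {FU : Filter U} x_ x e : L2D e -> wlim a U x_ x ->
  (fun k => ip (sval_of (x_ k)) e) @ U --> (ip (sval_of x) e : R).
Proof.
move=> Le hw.
have [|||z hz] := si_riesz ha hcomp (l := fun y : H0 => ip (sval_of y) e) (C := C * Num.sqrt (ip e e)).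
- move=> y z; rewrite sval_ofD; exact: (L2ipDl mD (sob_L2 ds (subspP y).1) (sob_L2 ds (subspP z).1) Le).
- move=> k y; rewrite sval_ofZ; exact: (L2ipZl mD _ (sob_L2 ds (subspP y).1) Le).
- move=> y; apply: le_trans (ip_le_sn10 y Le) _.
  by rewrite mulrAC ler_wpM2r ?sqrtr_ge0.
rewrite (hz x) (siC ha); under eq_fun do rewrite hz (siC ha).
exact: hw.
Qed.

(** The coefficients of the finite rank part of [x_ k - x] tend to 0 by weak convergence, while the
    remainder is small uniformly on bounded sets. *)
Lemma rellich (q : R) U x_ x M : 0 < q -> finite_rank_approx q -> UltraFilter U ->
  (forall k, sn a (x_ k) <= M) -> wlim a U x_ x ->
  (fun k => I (fun t => apow q (sval_of (x_ k) t - sval_of x t))) @ U --> (0 : R).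
Proof.
move=> q0 hq UU xM hw.
pose y_ k := x_ k - x.
have ynorm : exists2 B : R, 0 < B & forall k, snorm (sval_of (y_ k)) <= B.
  exists (`|C| * (`|M| + sn a x) + 1).
    by rewrite ltr_wpDl// mulr_ge0// addr_ge0// sn_ge0.
  move=> k; rewrite snorm_sn10; apply: le_trans (hC _) _.
  apply: (@le_trans _ _ (`|C| * (`|M| + sn a x))); last by rewrite lerDl.
  apply: (@le_trans _ _ (`|C| * sn a (y_ k))).
    by rewrite ler_wpM2r ?sn_ge0// ler_norm.
  rewrite ler_wpM2l//; apply: le_trans (snD ha _ _) _; rewrite snN// lerD2r.
  exact: le_trans (xM k) (ler_norm _).
have [B B0 hB] := ynorm.
apply/cvgr0Pnorm_lt; move=> z z0; pose e : R := z; have e0 : 0 < e by [].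
rewrite -/e {z0}.
have c0 : 0 < apow q 2 by apply: powR_gt0; rewrite normr_gt0.
set m := fine (mu D).
have e2 : 0 < e / (2 * apow q 2) by rewrite divr_gt0// mulr_gt0.
(* With [apow q r] equal to [e / (2 * apow q 2)] the remainder contributes at most [e / 2]; dividing
   [r] by [B + 1] below compensates the norm bound in [approx_sob0]. *)
have [r r0 re] := apow_root q0 e2.
have B1 : 0 < B + 1 by rewrite addr_gt0.
have [N [E [F [LE mF H]]]] := hq (r / (B + 1)) (divr_gt0 r0 B1).
pose s k := \sum_j `|ip (sval_of (y_ k)) (E j)|.
have sc : s @ U --> (0 : R).
  apply: (Rcvg_sum0 _ (f := fun j k => `|ip (sval_of (y_ k)) (E j)|)) => j.
  have c1 : (fun k => ip (sval_of (x_ k)) (E j)) @ U --> (ip (sval_of x) (E j) : R) by exact: ip_wlim.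
  have c2 : (fun k => ip (sval_of (y_ k)) (E j)) @ U --> (0 : R).
    rewrite -(subrr (ip (sval_of x) (E j))).
    rewrite (_ : (fun k => _) = (fun k => ip (sval_of (x_ k)) (E j) - ip (sval_of x) (E j))).
      by apply: cvgB => //; exact: cvg_cst.
    apply/funext => k; rewrite /y_ sval_ofD -scaleN1r sval_ofZ.
    have Lx := sob_L2 ds (subspP x).1.
    have LZ : L2D (-1 *: sval_of x) by have := L2_setlin mD (-1) Lx (L2_set0 mu mD); rewrite addr0.
    by rewrite (L2ipDl mD (sob_L2 ds (subspP (x_ k)).1) LZ (LE j)) (L2ipZl mD _ Lx (LE j)) mulN1r.
  by rewrite -(normr0 R); apply: cvg_norm.
have sq : (fun k => apow q 2 * (apow q (s k) * m)) @ U --> (0 : R).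
  have h2 : (fun k => apow q 2 * (apow q (s k) * m)) @ U --> (apow q 2 * (0 * m) : R).
    by apply: cvgMr; apply: cvgMl; exact: apow_cvg0.
  by rewrite mul0r mulr0 in h2.
move/cvgr0Pnorm_lt : sq => /(_ (e / 2) (divr_gt0 e0 (ltr0Sn _ 1))); apply: filterS => k hk.
have [h1 h2] := approx_sob0 q0 (divr_gt0 r0 B1) LE mF H (subspP (y_ k)).
have h3 : I (fun t => apow q (sval_of (y_ k) t - fin_rank E F (sval_of (y_ k)) t)) <= apow q r.
  apply: le_trans h2 _; apply: apow_le => //.
  rewrite ger0_norm ?(gtr0_norm r0); last first.
    by rewrite mulr_ge0 ?divr_ge0 ?(ltW r0) ?(ltW B1)// addr_ge0// sqrtr_ge0.
  by rewrite mulrAC ler_pdivrMr// ler_pM2l// lerD2r.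
have [_ h4] := Lq_finite_rank q0 mF (sob_L2 ds (subspP (y_ k)).1).1 h1 h3.
rewrite ger0_norm; last by apply: Rintegral_ge0 => t _; exact: apow_ge0.
rewrite (@eq_Rintegral _ _ _ _ _ (fun t => apow q (sval_of (y_ k) t))); last first.
  by move=> t _; rewrite sval_ofB.
apply: le_lt_trans h4 _; rewrite mulrDr re -/m -/(s k).
have -> : apow q 2 * (e / (2 * apow q 2)) = e / 2 by field; rewrite gt_eqF.
have := le_lt_trans (ler_norm _) hk; lra.
Qed.

End rellich.

End compact_embedding.

Lemma semi_innerB (R : realType) (V : lmodType R) (a b : V -> V -> R) (m : R) :
  semi_inner a -> semi_inner b -> (forall w, m * b w w <= a w w) ->
  semi_inner (fun y z => a y z - m * b y z).
Proof.
move=> ha hb hm; split.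
- by move=> y y' z; rewrite (siDl ha) (siDl hb); ring.
- by move=> k y z; rewrite (siZl ha) (siZl hb); ring.
- by move=> y z; rewrite (siC ha) (siC hb).
- by move=> y; rewrite subr_ge0.
Qed.

(** * The first eigenvalue and Poincare's inequality *)

Section first_eigenvalue.
Context d (T : measurableType d) (R : realType).
Variables (mu : {measure set T -> \bar R}) (D : set T) (n : nat).
Variables (test : set (T -> R)) (pd : 'I_n -> (T -> R) -> T -> R).
Hypothesis ds : dirichlet_setting mu D test pd.
Hypothesis n0 : (0 < n)%N.
Hypothesis approx2 : finite_rank_approx mu D test pd 2.
Hypothesis test_nontrivial : exists2 phi, test phi & 0 < L2ip mu D phi phi.
Let mD := ds_meas ds.
Let muD := ds_fin ds.
Local Notation ip := (L2ip mu D).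
Local Notation I f := (\int[mu]_(x in D) f x).
Local Notation H0 := (H0sp ds n0).
Local Notation E := (@energy _ _ _ _ _ _ _ _ ds n0).
Local Notation H := (@h10 _ _ _ _ _ _ _ _ ds n0).
Implicit Types x y w : H0.

Definition mass x y : R := ip (sval_of x) (sval_of y).

Lemma massP : semi_inner mass.
Proof.
split; rewrite /mass.
- move=> x y z; rewrite sval_ofD.
  exact: (L2ipDl mD (sob_L2 ds (subspP x).1) (sob_L2 ds (subspP y).1) (sob_L2 ds (subspP z).1)).
- move=> k x y; rewrite sval_ofZ.
  exact: (L2ipZl mD _ (sob_L2 ds (subspP x).1) (sob_L2 ds (subspP y).1)).
- by move=> x y; exact: L2ipC.
- by move=> x; exact: L2ip_ge0.
Qed.

Lemma massE x : mass x x = I (fun t => apow 2 (sval_of x t)).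
Proof.
Transparent L2ip.
rewrite /mass /L2ip; apply: eq_Rintegral => t _.
by rewrite /apow powR_mulrn// real_normK ?num_real// expr2.
Opaque L2ip.
Qed.

Lemma H_E x y : H x y = mass x y + E x y. Proof. exact: h10E. Qed.

Lemma mass_wcont (a : H0 -> H0 -> R) (C : R) : semi_inner a -> si_complete a ->
  (forall x, sn H x <= C * sn a x) -> forall (U : set_system nat) (x_ : nat -> H0) x M, UltraFilter U -> \oo `<=` U ->
  (forall k, sn a (x_ k) <= M) -> wlim a U x_ x ->
  (fun k => sn mass (x_ k - x)) @ U --> (0 : R).
Proof.
move=> ha ca hC U x_ x M UU oU xM hw.
have h := rellich ha ca hC (ltr0Sn R 1) approx2 UU xM hw.
rewrite -(sqrtr0 R) (_ : (fun k => _) = (fun k => Num.sqrt (I (fun t => apow 2 (sval_of (x_ k) t - sval_of x t))))).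
  by apply: continuous_cvg => //; exact: sqrt_continuous.
by apply/funext => k; rewrite /sn massE; congr Num.sqrt; apply: eq_Rintegral => t _; rewrite sval_ofB.
Qed.

(** A minimizing sequence of unit mass has a weak limit. By compactness the limit also has unit
    mass, so it does not degenerate to 0. *)
Lemma rayleigh_min : exists (m : R) x, [/\ mass x x = 1, forall w, E x w = m * mass x w &
  forall w, m * mass w w <= E w w].
Proof.
pose A := [set E x x | x in [set x | mass x x = 1]].
have norm1 w : 0 < mass w w -> mass ((sn mass w)^-1 *: w) ((sn mass w)^-1 *: w) = 1.
  move=> w0; rewrite (siZl massP) (siZr massP) mulrA -expr2 -(sn_sqr massP w) -exprMn mulVf ?expr1n//.
  by rewrite gt_eqF// sqrtr_gt0.
have A0 : has_inf A.
  have [phi tphi phi0] := test_nontrivial.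
  have sphi : sob0 mu D test pd phi.
    split; first exact: (test_sob ds n0 tphi).1.
    move=> e e0; exists phi => //; rewrite (_ : phi \- phi = 0); last by apply/funext => t; exact: subrr.
    by rewrite -[0]/(sval_of (0 : H1sp ds n0)) sob_normE (sn0 (h1P ds n0)).
  pose w : H0 := to_subsp (sob00 ds n0) (sob0_lin ds n0) sphi.
  split; last by exists 0 => _ [x _ <-]; exact: (si_ge0 (energyP ds n0)).
  by exists (E ((sn mass w)^-1 *: w) ((sn mass w)^-1 *: w)); exists ((sn mass w)^-1 *: w) => //; exact: norm1.
pose m := inf A.
have /choice[x_ xP] : forall k : nat, exists x, mass x x = 1 /\ E x x < m + k.+1%:R^-1.
  move=> k; have k0 : 0 < k.+1%:R^-1 :> R by [].
  by have [_ [x x1 <-] hx] := inf_adherent k0 A0; exists x.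
have [U [UU oU]] := free_ultrafilter.
have HM k : sn H (x_ k) <= 1 + (1 + (m + 1)).
  have m0 : 0 <= m by apply: lb_le_inf A0.1 _ => _ [x _ <-]; exact: (si_ge0 (energyP ds n0)).
  apply: (sn_le2 (h10P ds n0)); first by lra.
  rewrite H_E (xP k).1; have := (xP k).2; have : k.+1%:R^-1 <= 1 :> R by rewrite invf_le1// ler1n.
  by move: (E _ _) (k.+1%:R^-1) => a b; nra.
have [x hx] := wlim_exists (h10P ds n0) (h10_complete (ds := ds) (n0 := n0)) UU HM.
have idC y : sn H y <= 1 * sn H y by rewrite mul1r.
have ms := mass_wcont (h10P ds n0) (h10_complete (ds := ds) (n0 := n0)) idC UU oU HM hx.
have x1 : mass x x = 1.
  have c : (fun k => sn mass (x_ k)) @ U --> sn mass x.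
    apply/cvgrPdist_lt => e e0; move/cvgr0Pnorm_lt : ms => /(_ e e0); apply: filterS => k.
    rewrite distrC; apply: le_lt_trans; rewrite [leRHS]ger0_norm ?sn_ge0//.
    exact: sn_ltB massP _ _.
  have c1 : (fun k => sn mass (x_ k)) @ U --> (1 : R).
    rewrite (_ : (fun k => _) = fun=> 1); first exact: cvg_cst.
    by apply/funext => k; rewrite /sn (xP k).1 sqrtr1.
  by rewrite -(sn_sqr massP) (Rcvg_unique c c1) expr1n.
have cE : (fun k => H (x_ k) (x_ k)) @ U --> 1 + m.
  have c0 : (fun k => E (x_ k) (x_ k) - m) @ U --> (0 : R).
    apply: (Rsqueeze0 (h := fun k => k.+1%:R^-1)); last exact: (free_cvg oU (@cvg_harmonic R)).
    move=> k; rewrite subr_ge0 lerBlDl (ltW (xP k).2) andbT.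
    by apply: ge_inf; [exact: A0.2|exists (x_ k) => //; exact: (xP k).1].
  have := cvgD c0 (cvg_cst (1 + m)); rewrite add0r.
  rewrite (_ : (fun k => E (x_ k) (x_ k) - m) + (fun=> 1 + m) = (fun k => H (x_ k) (x_ k)))//.
    by move=> h; exact: h.
  by apply/funext => k; rewrite H_E (xP k).1 -[LHS]/(E (x_ k) (x_ k) - m + (1 + m)); ring.
have Ex : E x x <= m.
  have h : H x x <= 1 + m by exact: (wlim_lsc (h10P ds n0) hx cE).
  by move: h; rewrite H_E x1 lerD2l.
have lower w : m * mass w w <= E w w.
  have := si_ge0 massP w; rewrite le_eqVlt => /predU1P[<-|w0].
    by rewrite mulr0; exact: (si_ge0 (energyP ds n0)).
  have : m <= E ((sn mass w)^-1 *: w) ((sn mass w)^-1 *: w).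
    by apply: ge_inf; [exact: A0.2|exists ((sn mass w)^-1 *: w) => //; exact: norm1].
  rewrite (siZl (energyP ds n0)) (siZr (energyP ds n0)) mulrA -expr2 exprVn (sn_sqr massP).
  by rewrite mulrC ler_pdivlMr.
exists m, x; split => // w.
(* This form is positive semidefinite and vanishes at [x], so by the Cauchy-Schwarz inequality [x]
   is in its kernel: this is the eigenvalue equation. *)
pose b y z := E y z - m * mass y z.
have hb : semi_inner b by exact: semi_innerB (energyP ds n0) massP lower.
have bxx : b x x = 0.
  by apply/eqP; rewrite eq_le (si_ge0 hb) andbT /b x1 mulr1 subr_le0.
have := si_CS2 hb x w; rewrite bxx mul0r => h.
have : b x w ^+ 2 == 0 by rewrite eq_le h sqr_ge0.
by rewrite sqrf_eq0 subr_eq0 => /eqP.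
Qed.

Section poincare.
Variable m : R.
Hypotheses (m0 : 0 < m) (hm : forall w, m * mass w w <= E w w).

Lemma sn_h10_energy x : sn H x <= Num.sqrt (1 + m^-1) * sn E x.
Proof.
rewrite -sqrtrM ?addr_ge0 ?invr_ge0 ?(ltW m0)//; apply: ler_wsqrtr.
rewrite H_E mulrDl mul1r addrC lerD2l mulrC ler_pdivlMr// mulrC.
exact: hm.
Qed.

Lemma energy_complete : si_complete E.
Proof.
move=> x_ hx; pose C := Num.sqrt (1 + m^-1).
have C0 : 0 < C by rewrite sqrtr_gt0 ltr_wpDr// invr_ge0 ltW.
have [|x cx] := @h10_complete _ _ _ _ _ _ _ _ ds n0 x_.
  move=> e e0; have [N HN] := hx (e / C) (divr_gt0 e0 C0); exists N => k l Nk Nl.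
  apply: le_lt_trans (sn_h10_energy _) _.
  by rewrite mulrC -ltr_pdivlMr//; exact: HN.
exists x; apply: Rsqueeze0 cx => k; rewrite sn_ge0 /=.
by apply: ler_wsqrtr; rewrite H_E lerDr; exact: (si_ge0 massP).
Qed.

End poincare.

End first_eigenvalue.

(** * The functionals *)

Section two_variables.
Variable R : realType.
Implicit Types (F f : R -> R -> R) (a b s t : R).

Lemma mvt_between (h dh : R -> R) : (forall x : R, is_derive x (1 : R) h (dh x)) ->
  forall x y : R, exists2 z : R, `|z - x| <= `|y - x| & h y - h x = dh z * (y - x).
Proof.
move=> hd x y.
have ch : continuous h.
  by move=> t; apply: differentiable_continuous; apply/derivable1_diffP; have [] := hd t.
have [xy|yx] := leP x y.
  have [z] := MVT_segment xy (fun t _ => hd t) (continuous_subspaceT ch).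
  rewrite in_itv /= => /andP[h1 h2] E; exists z => //.
  by rewrite !ger0_norm ?subr_ge0// lerD2r.
have [z] := MVT_segment (ltW yx) (fun t _ => hd t) (continuous_subspaceT ch).
rewrite in_itv /= => /andP[h1 h2] E; exists z.
  by rewrite !ler0_norm ?subr_le0 ?(ltW yx)// !opprB lerD2l lerN2.
by rewrite -opprB E -mulrN opprB.
Qed.

Lemma continuous2P f a b : continuous_at (a, b) (fun z : R * R => f z.1 z.2) <->
  forall e, 0 < e -> exists2 r, 0 < r & forall a' b', `|a' - a| < r -> `|b' - b| < r ->
    `|f a' b' - f a b| < e.
Proof.
split=> [cf e e0|H].
  move/cvgrPdist_lt : cf => /(_ e e0) /nbhs_ballP[r /= r0 hr]; exists r => // a' b' ha hb.
  have := hr (a', b'); rewrite /= distrC; apply.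
  by split; rewrite /= /ball /= distrC.
apply/cvgrPdist_lt => e e0; have [r r0 hr] := H e e0.
exists (ball a r, ball b r); first by split; exact: nbhsx_ballx.
move=> -[a' b'] [/= h1 h2].
by rewrite distrC; apply: hr; rewrite distrC.
Qed.

Lemma C1_du F a b : C1 F -> is_derive a (1 : R) (fun s => F s b) (du F a b).
Proof. by move=> [h _ _ _]; split; [exact: h|rewrite /du derive1E]. Qed.

Lemma C1_dv F a b : C1 F -> is_derive b (1 : R) (F a) (dv F a b).
Proof. by move=> [_ h _ _]; split; [exact: h|rewrite /dv derive1E]. Qed.

Lemma C1_increment F a b a' b' : C1 F -> exists s t, [/\ `|s - a| <= `|a' - a|,
  `|t - b| <= `|b' - b| &
  F a' b' - F a b = du F s b' * (a' - a) + dv F a t * (b' - b)].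
Proof.
move=> hF.
have [s hs Es] := mvt_between (fun x => C1_du x b' hF) a a'.
have [t ht Et] := mvt_between (fun x => C1_dv a x hF) b b'.
by exists s, t; split => //; rewrite -Es -Et; ring.
Qed.

Lemma C1_continuous F : C1 F -> continuous (fun z : R * R => F z.1 z.2).
Proof.
move=> hF [a b]; have [_ _ cu cv] := hF; apply/continuous2P => e e0.
have [r r0 hr] := (continuous2P _ _ _).1 (cu (a, b)) 1 ltr01.
have [r' r'0 hr'] := (continuous2P _ _ _).1 (cv (a, b)) 1 ltr01.
set B := `|du F a b| + `|dv F a b| + 2.
have B0 : 0 < B by rewrite ltr_wpDl// addr_ge0.
exists (Num.min (Num.min r r') (e / (2 * B))).
  by rewrite !lt_min r0 r'0 divr_gt0// mulr_gt0.
move=> a' b'; rewrite !lt_min => /andP[/andP[ar ar'] ae] /andP[/andP[br br'] be].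
have [s [t [hs ht ->]]] := C1_increment a b a' b' hF.
have h1 : `|du F s b'| <= B.
  have := hr s b' (le_lt_trans hs ar) br => h.
  have := ler_normD (du F s b' - du F a b) (du F a b); rewrite subrK.
  by have := normr_ge0 (dv F a b); move: h; rewrite /B; clear; lra.
have h2 : `|dv F a t| <= B.
  have := hr' a t; rewrite subrr normr0 => /(_ r'0 (le_lt_trans ht br')) h.
  have := ler_normD (dv F a t - dv F a b) (dv F a b); rewrite subrK.
  by have := normr_ge0 (du F a b); move: h; rewrite /B; clear; lra.
apply: le_lt_trans (ler_normD _ _) _; rewrite !normrM.
have k1 : `|du F s b'| * `|a' - a| <= B * `|a' - a| by rewrite ler_wpM2r.
have k2 : `|dv F a t| * `|b' - b| <= B * `|b' - b| by rewrite ler_wpM2r.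
have k3 : B * `|a' - a| < e / 2 by rewrite mulrC -ltr_pdivlMr// (lt_le_trans ae)// invfM mulrA.
have k4 : B * `|b' - b| < e / 2 by rewrite mulrC -ltr_pdivlMr// (lt_le_trans be)// invfM mulrA.
lra.
Qed.

(** [C1] speaks of partial derivatives only; their continuity gives total differentiability, on
    which the chain rule along lines rests. *)
Lemma C1_total F a b e : C1 F -> 0 < e -> exists2 r : R, 0 < r &
  forall h k : R, `|h| < r -> `|k| < r ->
  `|F (a + h) (b + k) - F a b - (du F a b * h + dv F a b * k)| <= e * (`|h| + `|k|).
Proof.
move=> hF e0; have [_ _ cu cv] := hF.
have [r r0 hr] := (continuous2P _ _ _).1 (cu (a, b)) e e0.
have [r' r'0 hr'] := (continuous2P _ _ _).1 (cv (a, b)) e e0.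
exists (Num.min r r'); first by rewrite lt_min r0.
move=> h k; rewrite !lt_min => /andP[h1 h2] /andP[k1 k2].
have E z w : z + w - z = w :> R by ring.
have [s [t [hs ht ->]]] := C1_increment a b (a + h) (b + k) hF.
rewrite !E in hs ht *.
have kx : `|du F s (b + k) - du F a b| <= e.
  by apply/ltW/hr; [exact: le_lt_trans hs h1|rewrite E].
have ky : `|dv F a t - dv F a b| <= e.
  by apply/ltW/hr'; [rewrite subrr normr0|exact: le_lt_trans ht k2].
have -> : du F s (b + k) * h + dv F a t * k - (du F a b * h + dv F a b * k) =
  (du F s (b + k) - du F a b) * h + (dv F a t - dv F a b) * k by ring.
by apply: le_trans (ler_normD _ _) _; rewrite !normrM mulrDr lerD// ler_wpM2r.
Qed.

Lemma C1_quotient F a b p q e : C1 F -> 0 < e -> exists2 r : R, 0 < r &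
  forall h : R, h != 0 -> `|h| < r ->
  `|h^-1 * (F (a + h * p) (b + h * q) - F a b) - (du F a b * p + dv F a b * q)| <= e.
Proof.
move=> hF e0.
pose B : R := `|p| + `|q| + 1; have B0 : 0 < B by rewrite ltr_wpDl// addr_ge0.
have [r r0 hr] := C1_total a b hF (divr_gt0 e0 B0).
exists (r / B); first by rewrite divr_gt0.
move=> h h0; rewrite ltr_pdivlMr// => hB.
have hn := normr_ge0 h; have pn := normr_ge0 p; have qn := normr_ge0 q.
have := hr (h * p) (h * q); rewrite !normrM => /(_ _ _)-H.
have -> : h^-1 * (F (a + h * p) (b + h * q) - F a b) - (du F a b * p + dv F a b * q) =
  h^-1 * (F (a + h * p) (b + h * q) - F a b - (du F a b * (h * p) + dv F a b * (h * q))).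
  by field.
rewrite normrM normfV mulrC ler_pdivrMr ?normr_gt0//.
apply: le_trans (H _ _) _.
- by apply: le_lt_trans hB; rewrite ler_wpM2l// /B; lra.
- by apply: le_lt_trans hB; rewrite ler_wpM2l// /B; lra.
have -> : e / B * (`|h| * `|p| + `|h| * `|q|) = e * `|h| * ((`|p| + `|q|) / B) by ring.
rewrite ler_piMr ?mulr_ge0 ?(ltW e0)// ler_pdivrMr// mul1r /B lerDl.
exact: ler01.
Qed.

Lemma C1_chain F a b p q s : C1 F ->
  is_derive s (1 : R) (fun s => F (a + s * p) (b + s * q))
    (du F (a + s * p) (b + s * q) * p + dv F (a + s * p) (b + s * q) * q).
Proof.
move=> hF; set u := a + s * p; set v := b + s * q; set l := _ + _.
have H : (fun h : R => h^-1 *: (F (a + (h *: 1 + s) * p) (b + (h *: 1 + s) * q) - F u v)) @ 0^' --> l.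
  apply/cvgrPdist_le => e e0; have [r r0 hr] := C1_quotient u v p q hF e0.
  near=> h; rewrite [h *: 1]mulr1.
  have h0 : h != 0 by near: h; exact: nbhs_dnbhs_neq.
  have hr0 : `|h| < r by near: h; exact: dnbhs0_lt.
  have -> : a + (h + s) * p = u + h * p by rewrite /u; ring.
  have -> : b + (h + s) * q = v + h * q by rewrite /v; ring.
  by rewrite distrC; exact: hr.
split; first by apply/cvg_ex; exists l.
exact: cvg_lim H.
Unshelve. all: by end_near. Qed.

End two_variables.

Section grid.
Variable R : realType.

(** Rounding to a countable grid reduces the measurability of [f x (u x) (v x)] to that of [f] with
    constant second and third arguments. *)
Definition grid (k : nat) (t : R) : R := (Num.floor (t * k.+1%:R))%:~R / k.+1%:R.

Lemma grid_dist k t : `|grid k t - t| <= k.+1%:R^-1.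
Proof.
have k0 : 0 < k.+1%:R :> R by [].
have h1 := ge_floor (t * k.+1%:R); have h2 := floorD1_gt (t * k.+1%:R).
rewrite intrD in h2; rewrite -[t in _ - t](mulfK (lt0r_neq0 k0)) /grid -mulrBl.
rewrite normrM [X in _ * X]gtr0_norm ?invr_gt0// ler_piMl ?invr_ge0//.
by rewrite ler_norml; move: h1 h2; move: (_ * _) (_%:~R) => a b; lra.
Qed.

Lemma grid_cvg t : (fun k => grid k t) @ \oo --> t.
Proof.
apply/cvgrPdist_le => e e0; have [N _ HN] := near_infty_natSinv_lt (PosNum e0).
by exists N => // k /HN /= h; rewrite distrC; apply: le_trans (grid_dist k t) (ltW h).
Qed.

End grid.

(** * Caratheodory functions and superposition operators *)

Section caratheodory.
Context d (T : measurableType d) (R : realType).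
Variables (mu : {measure set T -> \bar R}) (D : set T).
Hypotheses (mD : measurable D).
Implicit Types (f : T -> R -> R -> R) (u v : T -> R).

Definition carath f := (forall a b, measurable_fun D (fun x => f x a b)) /\
  forall x, D x -> continuous (fun z : R * R => f x z.1 z.2).

Lemma carath_grid f u v k : carath f -> measurable_fun D u -> measurable_fun D v ->
  measurable_fun D (fun x => f x (grid k (u x)) (grid k (v x))).
Proof.
move=> [mf _] mu_ mv.
pose S (w : T -> R) (i : int) := [set x | i%:~R <= w x * k.+1%:R < (i + 1)%:~R].
have mS w i : measurable_fun D w -> measurable (D `&` S w i).
  move=> mw; have -> : S w i = (fun x => w x * k.+1%:R) @^-1` `[i%:~R, (i + 1)%:~R[%classic.
    by apply/seteqP; split => x; rewrite /= in_itv.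
  by apply: measurable_funM.
pose E (m : nat) := if @unpickle (int * int)%type m is Some ij then
  (D `&` S u ij.1) `&` (D `&` S v ij.2) else set0.
have mE m : measurable (E m).
  by rewrite /E; case: unpickle => [[i j]|]//; apply: measurableI; exact: mS.
have Sf (w : T -> R) i x : S w i x -> Num.floor (w x * k.+1%:R) = i.
  move=> /= h; apply/eqP; rewrite floor_eq//.
have DE : D = \bigcup_m E m.
  apply/seteqP; split => [x Dx|x [m _]]; last by rewrite /E; case: unpickle => [[i j] [[]]|].
  pose ij : int * int := (Num.floor (u x * k.+1%:R), Num.floor (v x * k.+1%:R)).
  have hE : E (pickle ij) x.
    by rewrite /E pickleK /S /=; split; split => //; rewrite ge_floor floorD1_gt.
  by exists (pickle ij); [exact: Logic.I|exact: hE].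
rewrite DE; apply/measurable_fun_bigcup => // m; rewrite /E.
case: unpickle => [[i j]|]; last exact: measurable_fun_set0.
apply: (eq_measurable_fun (fun x => f x (i%:~R / k.+1%:R) (j%:~R / k.+1%:R))).
  by move=> x; rewrite inE => -[[_ /Sf hi] [_ /Sf hj]]; rewrite /grid hi hj.
apply: measurable_funS (mf _ _); [exact: mD|by move=> x [[]]].
Qed.

Lemma carath_measurable f u v : carath f -> measurable_fun D u -> measurable_fun D v ->
  measurable_fun D (fun x => f x (u x) (v x)).
Proof.
move=> hf mu_ mv.
apply: (@measurable_fun_cvg _ _ _ D (fun k x => f x (grid k (u x)) (grid k (v x)))).
  by move=> k; exact: carath_grid.
move=> x Dx.
have cu : (fun k => grid k (u x)) @ \oo --> u x by exact: grid_cvg.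
have cv : (fun k => grid k (v x)) @ \oo --> v x by exact: grid_cvg.
exact: (cvg_comp _ _ (cvg_pair cu cv) (hf.2 x Dx (u x, v x))).
Qed.

Section nemytskii.
Variables (q C : R) (f : T -> R -> R -> R) (g u v : T -> R).
Hypotheses (q0 : 0 < q) (C0 : 0 <= C) (hf : carath f).
Hypotheses (ig : mu.-integrable D (EFin \o g)).
Hypotheses (mu_ : measurable_fun D u) (mv : measurable_fun D v).
Hypotheses (iu : mu.-integrable D (EFin \o (fun x => apow q (u x))))
  (iv : mu.-integrable D (EFin \o (fun x => apow q (v x)))).
Hypothesis growth : forall x a b, D x -> `|f x a b| <= g x + C * (apow q a + apow q b).
(** A normalization: continuity of a superposition operator at [(u, v)] becomes convergence to 0
    after the value there is subtracted inside [f]. *)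
Hypothesis f_uv : forall x, D x -> f x (u x) (v x) = 0.
Local Notation I f := (\int[mu]_(x in D) f x).

Let dist (w z : T -> R) x := apow q (w x - u x) + apow q (z x - v x).

(** [ae_cvg_subseq] applied to the distances yields both convergence almost everywhere and, through
    [growth], an integrable majorant for dominated convergence. *)
Lemma nemytskii_seq (u_ v_ : nat -> T -> R) : (forall j, measurable_fun D (u_ j)) ->
  (forall j, measurable_fun D (v_ j)) ->
  (forall j, mu.-integrable D (EFin \o dist (u_ j) (v_ j))) ->
  (fun j => I (dist (u_ j) (v_ j))) @ \oo --> (0 : R) ->
  exists psi : nat -> nat, (fun j => I (fun x => `|f x (u_ (psi j) x) (v_ (psi j) x)|)) @ \oo --> (0 : R).
Proof.
move=> mu__ mv_ id cd.
have d0 w z x : 0 <= dist w z x by rewrite addr_ge0// apow_ge0.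
have [//|psi [psij [G iG aeG]]] := ae_cvg_subseq mD id _ cd.
exists psi.
pose K := apow q 2.
have K0 : 0 <= K by exact: apow_ge0.
pose h x := g x + C * (K * G x + K * (apow q (u x) + apow q (v x))).
have ih : mu.-integrable D (EFin \o h).
  apply: (intgD mD ig); apply: (intgZ mD); apply: (intgD mD); first exact: intgZ.
  by apply: (intgZ mD); exact: intgD.
have := @RDCT _ _ _ mu D mD (fun j x => `|f x (u_ (psi j) x) (v_ (psi j) x)|) (fun=> 0) h.
rewrite (@Rintegral_cst _ _ _ _ _ mD 0) mul0r; move=> H; apply: (H _ _ ih _ _).2.
- move=> j; apply: measurableT_comp => //; exact: carath_measurable.
- exact: measurable_cst.
- apply: (ae_imp aeG) => x hx Dx; have [c _] := hx Dx.
  have small (w : nat -> R) (y : R) : (forall j, apow q (w j - y) <= dist (u_ (psi j)) (v_ (psi j)) x) ->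
      w @ \oo --> y.
    move=> hw; apply/cvgrPdist_lt => e e0; have p0 : 0 < apow q e by apply: powR_gt0; rewrite normr_gt0 gt_eqF.
    move/cvgr0Pnorm_lt : c => /(_ _ p0); apply: filterS => j hj.
    rewrite ltNge; apply/negP => ej; move: hj; rewrite ger0_norm// ltNge; apply/negP; rewrite negbK.
    by apply: le_trans (hw j); apply: apow_le => //; rewrite (gtr0_norm e0) distrC.
  have cu : (fun j => u_ (psi j) x) @ \oo --> u x by apply: small => j; rewrite lerDl apow_ge0.
  have cv : (fun j => v_ (psi j) x) @ \oo --> v x by apply: small => j; rewrite lerDr apow_ge0.
  have cf : (fun j => f x (u_ (psi j) x) (v_ (psi j) x)) @ \oo --> f x (u x) (v x).
    exact: (cvg_comp _ _ (cvg_pair cu cv) (hf.2 x Dx (u x, v x))).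
  by rewrite f_uv// in cf; rewrite -(normr0 R); exact: cvg_norm.
- apply: (ae_imp aeG) => x hx Dx j; have [_ b] := hx Dx; rewrite normr_id.
  apply: le_trans (growth _ _ Dx) _; rewrite lerD2l ler_wpM2l//.
  have E (w y : R) : apow q w <= K * (apow q (w - y) + apow q y).
    by rewrite -{1}(subrK y w); exact: apowD.
  apply: le_trans (lerD (E _ (u x)) (E _ (v x))) _.
  rewrite -mulrDr -mulrDr ler_wpM2l// addrACA lerD2r; exact: b.
Qed.

(* Otherwise the indices where the integral is at least some [e > 0] form a set of
   the ultrafilter, which contains a sequence along which the distances tend to 0;
   this contradicts [nemytskii_seq]. *)
Lemma nemytskii_ultra (U : set_system nat) (u_ v_ : nat -> T -> R) : UltraFilter U ->
  \oo `<=` U -> (forall j, measurable_fun D (u_ j)) -> (forall j, measurable_fun D (v_ j)) ->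
  (forall j, mu.-integrable D (EFin \o (fun x => apow q (u_ j x - u x)))) ->
  (forall j, mu.-integrable D (EFin \o (fun x => apow q (v_ j x - v x)))) ->
  (fun j => I (fun x => apow q (u_ j x - u x))) @ U --> (0 : R) ->
  (fun j => I (fun x => apow q (v_ j x - v x))) @ U --> (0 : R) ->
  (fun j => I (fun x => `|f x (u_ j x) (v_ j x)|)) @ U --> (0 : R).
Proof.
move=> UU oU mu__ mv_ iu_ iv_ cu cv.
apply/cvgr0Pnorm_lt => e e0; apply: contrapT => nU.
pose B := [set j | e <= I (fun x => `|f x (u_ j x) (v_ j x)|)].
have UB : U B.
  have [|h] := in_ultra_setVsetC [set j | `|I (fun x => `|f x (u_ j x) (v_ j x)|)| < e] UU; first by move/nU.
  apply: filterS h => j /= /negP; rewrite -leNgt ger0_norm//.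
  by apply: Rintegral_ge0.
have id j : mu.-integrable D (EFin \o dist (u_ j) (v_ j)) by exact: intgD.
have cd : (fun j => I (dist (u_ j) (v_ j))) @ U --> (0 : R).
  rewrite (_ : (fun j => _) = (fun j => I (fun x => apow q (u_ j x - u x)) + I (fun x => apow q (v_ j x - v x)))).
    by have h := cvgD cu cv; rewrite addr0 in h; exact: h.
  by apply/funext => j; rewrite -RintegralD.
have /choice[s sP] : forall j : nat, exists k, B k /\ I (dist (u_ k) (v_ k)) <= j.+1%:R^-1.
  move=> j; have j0 : 0 < j.+1%:R^-1 :> R by [].
  move/cvgr0Pnorm_lt : cd => /(_ _ j0) Uj.
  have [k [Bk /= hk]] : (B `&` [set k | `|I (dist (u_ k) (v_ k))| < j.+1%:R^-1]) !=set0.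
    exact: (filter_ex (filterI UB Uj)).
  by exists k; split => //; apply: le_trans (ler_norm _) (ltW hk).
have [|psi c] := nemytskii_seq (fun j => mu__ (s j)) (fun j => mv_ (s j)) (fun j => id (s j)).
  apply: (Rsqueeze0 (h := fun j => j.+1%:R^-1)); last exact: cvg_harmonic.
  move=> j; rewrite (sP j).2 andbT; apply: Rintegral_ge0 => x _.
  by rewrite addr_ge0// apow_ge0.
suff : e <= 0 by rewrite leNgt e0.
by apply: (Rcvg_ge c) => j; exact: (sP (psi j)).1.
Qed.

End nemytskii.

End caratheodory.

Section growth_inequalities.
Variables (R : realType) (p : R).
Hypothesis p0 : 0 < p.
Let q := p + 1.
(** The conjugate exponent of [q]: a function of growth [p] maps L^q to L^r, which pairs with
    L^q. *)
Let r := q / p.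
Implicit Types s t a b e : R.

Let q0 : 0 < q. Proof. by rewrite addr_gt0. Qed.
Let r0 : 0 < r. Proof. by rewrite divr_gt0. Qed.

Lemma apowS t : apow p t * `|t| = apow q t.
Proof. by rewrite /apow mulrC -[X in X * _](@powRr1 _ `|t|)// mulrC /q powRD// (gt_eqF q0). Qed.

Lemma apow_apow t : apow r (apow p t) = apow q t.
Proof.
rewrite /apow [X in X `^ r]ger0_norm ?powR_ge0// -powRrM; congr (_ `^ _).
by rewrite /r mulrC divfK// gt_eqF.
Qed.

Lemma young s t : apow p s * `|t| <= apow q s + apow q t.
Proof.
have [h|h] := leP `|s| `|t|.
  apply: (@le_trans _ _ (apow q t)); last by rewrite lerDr apow_ge0.
  by rewrite -apowS ler_wpM2r// apow_le// ltW.
apply: (@le_trans _ _ (apow q s)); last by rewrite lerDl apow_ge0.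
by rewrite -apowS ler_wpM2l ?apow_ge0// ltW.
Qed.

Lemma norm_le_apow t : `|t| <= 1 + apow q t.
Proof.
have [h|h] := leP `|t| 1; first by apply: le_trans h _; rewrite lerDl apow_ge0.
apply: (@le_trans _ _ (apow q t)); last by rewrite lerDr.
by apply: le1r_powR; [exact: ltW|rewrite lerDr ltW].
Qed.

(** Either |s| <= e |t|^p, and the first term suffices, or |t| is at most (|s| / e)^(1/p), and the
    second one does because r = 1 + 1/p. *)
Lemma young_eps e : 0 < e -> exists2 K : R, 0 <= K & forall s t,
  `|s| * `|t| <= e * apow q t + K * apow r s.
Proof.
move=> e0; exists (e^-1 `^ p^-1); first exact: powR_ge0.
move=> s t; have [h|h] := leP `|s| (e * apow p t).
  apply: (@le_trans _ _ (e * apow q t)).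
    by rewrite -apowS mulrA ler_wpM2r.
  by rewrite lerDl mulr_ge0 ?powR_ge0.
apply: (@le_trans _ _ (e^-1 `^ p^-1 * apow r s)); last first.
  by rewrite lerDr mulr_ge0 ?apow_ge0// ltW.
have ht : `|t| <= (e^-1 * `|s|) `^ p^-1.
  have -> : `|t| = (apow p t) `^ p^-1.
    by rewrite /apow -powRrM mulfV ?gt_eqF// powRr1.
  apply: ge0_ler_powR; rewrite ?nnegrE ?invr_ge0 ?apow_ge0 ?mulr_ge0 ?(ltW p0) ?invr_ge0 ?(ltW e0)//.
  by rewrite mulrC ler_pdivlMr// mulrC ltW.
apply: le_trans (ler_wpM2l (normr_ge0 s) ht) _.
rewrite powRM ?invr_ge0 ?(ltW e0)// mulrCA ler_wpM2l ?powR_ge0//.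
have -> : r = 1 + p^-1 by rewrite /r /q mulrDl mulfV ?gt_eqF// div1r.
have pV : 0 < 1 + p^-1 by rewrite addr_gt0// invr_gt0.
by rewrite /apow powRD ?powRr1// (gt_eqF pV).
Qed.

Lemma growth_apow (h : R -> R -> R) (M : R) : 0 <= M ->
  (forall a b, `|h a b| <= M * (1 + apow p a + apow p b)) ->
  forall a b, apow r (h a b) <= apow r M * apow r 2 * apow r 2 * (1 + apow q a + apow q b).
Proof.
move=> M0 hM a b.
apply: (@le_trans _ _ (apow r (M * (1 + apow p a + apow p b)))).
  apply: apow_le => //; rewrite [X in _ <= X]ger0_norm//.
  by rewrite mulr_ge0// !addr_ge0 ?apow_ge0.
rewrite apowM -!mulrA ler_wpM2l ?apow_ge0//.
apply: le_trans (apowD r0 _ _) _; rewrite ler_wpM2l ?apow_ge0//.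
rewrite apow_apow mulrDr lerD//; last first.
  rewrite ler_peMl ?apow_ge0//; apply: (@le_trans _ _ (apow r 1)).
    by rewrite /apow normr1 powR1.
  by apply: apow_le => //; rewrite normr1 ger0_norm// ler1n.
apply: le_trans (apowD r0 _ _) _; rewrite apow_apow.
by rewrite /apow normr1 powR1.
Qed.

Lemma C1_growth (F : R -> R -> R) (M N : R) : 0 <= M -> C1 F -> `|F 0 0| <= N ->
  (forall a b, `|du F a b| + `|dv F a b| <= M * (1 + apow p a + apow p b)) ->
  forall a b, `|F a b| <= (N + 2 * M) + 4 * M * (apow q a + apow q b).
Proof.
move=> M0 hF hN hM a b.
have [s [t [hs ht E]]] := C1_increment 0 0 a b hF.
rewrite !subr0 in hs ht E.
have -> : F a b = F 0 0 + (du F s b * a + dv F 0 t * b) by rewrite -E addrC subrK.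
apply: le_trans (ler_normD _ _) _.
have h1 : `|du F s b * a| <= M * (1 + 3 * apow q a + apow q b).
  rewrite normrM; apply: (@le_trans _ _ (M * (1 + apow p a + apow p b) * `|a|)).
    rewrite ler_wpM2r//; apply: le_trans (_ : _ <= M * (1 + apow p s + apow p b)) _.
      by apply: le_trans (hM s b); rewrite lerDl.
    by rewrite ler_wpM2l// lerD2r lerD2l apow_le.
  rewrite -mulrA ler_wpM2l// !mulrDl mul1r apowS.
  have := norm_le_apow a; have := young b a; lra.
have h2 : `|dv F 0 t * b| <= M * (1 + 2 * apow q b).
  rewrite normrM; apply: (@le_trans _ _ (M * (1 + apow p b) * `|b|)).
    rewrite ler_wpM2r//; apply: le_trans (_ : _ <= M * (1 + apow p 0 + apow p t)) _.
      by apply: le_trans (hM 0 t); rewrite lerDr.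
    by rewrite apow0// addr0 ler_wpM2l// lerD2l apow_le.
  rewrite -mulrA ler_wpM2l// !mulrDl mul1r apowS.
  have := norm_le_apow b; lra.
have A0 := apow_ge0 q a; have B0 := apow_ge0 q b.
apply: le_trans (lerD hN (le_trans (ler_normD _ _) (lerD h1 h2))) _.
have : 0 <= M * apow q a by rewrite mulr_ge0.
have : 0 <= M * apow q b by rewrite mulr_ge0.
lra.
Qed.

End growth_inequalities.

(** By homogeneity. Where the seminorm of [x] is 0 all multiples of [x] stay in the unit ball, which
    forces [l x = 0]. *)
Lemma ball_bound (R : realType) (V : lmodType R) (a : V -> V -> R) (l : V -> R) (B : R) :
  semi_inner a -> (forall k x, l (k *: x) = k * l x) -> 0 <= B ->
  (forall x, sn a x <= 1 -> `|l x| <= B) -> forall x, `|l x| <= B * sn a x.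
Proof.
move=> ha lZ B0 hB x; have := sn_ge0 a x; rewrite le_eqVlt => /predU1P[x0|x0].
  rewrite -x0 mulr0 leNgt; apply/negP => lx.
  have := hB (((B + 1) / `|l x|) *: x); rewrite (snZ ha) -x0 mulr0 => /(_ ler01).
  by rewrite lZ !normrM normfV normr_id divfK ?gt_eqF// ger0_norm ?addr_ge0//; lra.
have := hB ((sn a x)^-1 *: x); rewrite (snZ ha) ger0_norm ?invr_ge0 ?(ltW x0)// mulVf ?gt_eqF//.
by move=> /(_ (lexx _)); rewrite lZ normrM normfV (gtr0_norm x0) mulrC ler_pdivrMr.
Qed.

Lemma wlim_prod (R : realType) (V W : lmodType R) (a : V -> V -> R) (b : W -> W -> R)
  (U : set_system nat) (z_ : nat -> V * W) (z : V * W) : semi_inner a -> semi_inner b ->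
  wlim (si_prod a b) U z_ z ->
  wlim a U (fun k => (z_ k).1) z.1 /\ wlim b U (fun k => (z_ k).2) z.2.
Proof.
move=> ha hb hw; split => y.
  have E w : si_prod a b w (y, 0) = a w.1 y by rewrite /si_prod (si0r hb) addr0.
  by have := hw (y, 0); rewrite E; under eq_fun do rewrite E.
have E w : si_prod a b w (0, y) = b w.2 y by rewrite /si_prod (si0r ha) add0r.
by have := hw (0, y); rewrite E; under eq_fun do rewrite E.
Qed.

Lemma derive_seq (R : realType) (f : R -> R) (s df : R) : is_derive s (1 : R) f df ->
  (fun k => k.+1%:R * (f (k.+1%:R^-1 + s) - f s)) @ \oo --> df.
Proof.
move=> [fd <-].
have h2 : (fun k => k.+1%:R^-1 : R) @ \oo --> 0^'.
  move=> A [e /= e0 He]; move/cvgr0Pnorm_lt : (@cvg_harmonic R) => /(_ e e0); apply: filterS => k hk.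
  by apply: He => /=; [rewrite sub0r normrN|rewrite invr_eq0].
have := cvg_comp _ _ h2 fd; apply: cvg_trans; apply: near_eq_cvg; apply: nearW => k /=.
by rewrite [_ *: 1]mulr1 invrK.
Qed.

(** The majorant that justifies differentiating the potential under the integral along the line
    [z + s y], uniformly for |s| <= 2. *)
Lemma growth_line (R : realType) (p M : R) : 0 < p -> 0 <= M ->
  exists2 K : R, 0 <= K & forall z1 z2 y1 y2 s A B : R, `|s| <= 2 ->
  `|A| <= M * (1 + apow p (z1 + s * y1) + apow p (z2 + s * y2)) ->
  `|B| <= M * (1 + apow p (z1 + s * y1) + apow p (z2 + s * y2)) ->
  `|A * y1 + B * y2| <= K * (1 + apow (p + 1) z1 + apow (p + 1) z2 + apow (p + 1) y1 + apow (p + 1) y2).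
Proof.
move=> p0 M0; pose q := p + 1; rewrite -/q.
pose c := apow p 2; pose c2 := apow q 2.
have c0 : 0 <= c := apow_ge0 _ _; have c20 : 0 <= c2 := apow_ge0 _ _.
pose K1 : R := 1 + 5 * c + c * c2.
exists (2 * M * K1); first by rewrite !mulr_ge0// !addr_ge0// mulr_ge0.
move=> z1 z2 y1 y2 s A B s2 hA hB.
pose S := 1 + apow q z1 + apow q z2 + apow q y1 + apow q y2; rewrite -/S.
have lin z y : apow p (z + s * y) <= c * (apow p z + apow p (2 * y)).
  apply: le_trans (apowD p0 _ _) _; rewrite ler_wpM2l// lerD2l apow_le//.
  by rewrite !normrM ler_wpM2r// [leRHS]ger0_norm.
have key b : apow q b <= apow q y1 + apow q y2 ->
    (1 + apow p (z1 + s * y1) + apow p (z2 + s * y2)) * `|b| <= K1 * S.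
  move=> hb; have -> (P1 P2 : R) : (1 + P1 + P2) * `|b| = `|b| + P1 * `|b| + P2 * `|b| by ring.
  have t z y : apow p (z + s * y) * `|b| <= c * (apow q z + c2 * apow q y + 2 * apow q b).
    apply: (@le_trans _ _ (c * (apow p z + apow p (2 * y)) * `|b|)); first by rewrite ler_wpM2r.
    rewrite -mulrA ler_wpM2l// mulrDl.
    have := young p0 z b; have := young p0 (2 * y) b; rewrite -/q [apow q (2 * y)]apowM -/c2; lra.
  have := t z1 y1; have := t z2 y2; have := norm_le_apow p0 b; rewrite -/q.
  have := apow_ge0 q b; have := apow_ge0 q z1; have := apow_ge0 q z2.
  have := apow_ge0 q y1; have := apow_ge0 q y2.
  rewrite /K1 /S; move: hb; move: (apow q z1) (apow q z2) (apow q y1) (apow q y2) (apow q b) (apow p _ * _) (apow p _ * _).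
  move=> Z1 Z2 Y1 Y2 Q P1 P2 hb Y20 Y10 Z20 Z10 Q0 h1 h2 h3.
  have k1 : 0 <= c * (Y1 + Y2 - Q) by rewrite mulr_ge0// subr_ge0.
  have k2 : 0 <= c * Z1 by rewrite mulr_ge0.
  have k3 : 0 <= c * Z2 by rewrite mulr_ge0.
  have k4 : 0 <= c * Y1 by rewrite mulr_ge0.
  have k5 : 0 <= c * Y2 by rewrite mulr_ge0.
  have k6 : 0 <= c * c2 * (1 + Z1 + Z2) by rewrite mulr_ge0 ?mulr_ge0// !addr_ge0.
  nra.
have h1 : `|A * y1| <= M * (K1 * S).
  rewrite normrM; apply: le_trans (ler_wpM2r (normr_ge0 _) hA) _.
  by rewrite -mulrA ler_wpM2l// key// lerDl apow_ge0.
have h2 : `|B * y2| <= M * (K1 * S).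
  rewrite normrM; apply: le_trans (ler_wpM2r (normr_ge0 _) hB) _.
  by rewrite -mulrA ler_wpM2l// key// lerDr apow_ge0.
apply: le_trans (ler_normD _ _) _; apply: le_trans (lerD h1 h2) _.
by rewrite le_eqVlt; apply/orP; left; apply/eqP; ring.
Qed.

Section functionals.
Context d (T : measurableType d) (R : realType).
Variables (mu : {measure set T -> \bar R}) (D : set T) (n : nat).
Variables (test : set (T -> R)) (pd : 'I_n -> (T -> R) -> T -> R).
Hypothesis ds : dirichlet_setting mu D test pd.
Hypothesis n0 : (0 < n)%N.
Let mD := ds_meas ds.
Let muD := ds_fin ds.
Local Notation ip := (L2ip mu D).
Local Notation intg f := (mu.-integrable D (EFin \o f)).
Local Notation I f := (\int[mu]_(x in D) f x).
Local Notation H0 := (H0sp ds n0).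
Local Notation E := (@energy _ _ _ _ _ _ _ _ ds n0).
Local Notation H := (@h10 _ _ _ _ _ _ _ _ ds n0).
Local Notation V := (H0 * H0)%type.
Local Notation a := (si_prod E E).

Variable m : R.
Hypotheses (m0 : 0 < m) (hm : forall w : H0, m * mass w w <= E w w).
Let haE : semi_inner E := energyP ds n0.
Let ha : semi_inner a := si_prodP haE haE.
Let hcE : si_complete E := energy_complete m0 hm.
Let C := Num.sqrt (1 + m^-1).
Let hC : forall x, sn H x <= C * sn E x := sn_h10_energy m0 hm.

Variable p : R.
Hypothesis p0 : 0 < p.
Let q := p + 1.
Let r := q / p.
Hypothesis approxq : finite_rank_approx mu D test pd q.

Let q0 : 0 < q. Proof. by rewrite addr_gt0. Qed.
Let r0 : 0 < r. Proof. by rewrite divr_gt0. Qed.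

Lemma H0_Lq (x : H0) : Lq mu D q (sval_of x).
Proof. exact: (Lq_sob0 ds n0 q0 approxq (subspP x)). Qed.

Lemma H0_meas (x : H0) : measurable_fun D (sval_of x).
Proof. by have [] := H0_Lq x. Qed.

(** Sobolev's inequality read off the finite rank approximation with [e = 1]: on the unit ball the
    remainder and the coefficients are both bounded. *)
Lemma ball_Lq : exists2 B : R, 0 <= B & forall x : H0, sn E x <= 1 -> I (fun t => apow q (sval_of x t)) <= B.
Proof.
have [N [e [F [Le mF hF]]]] := approxq ltr01.
pose s := \sum_j (C * Num.sqrt (ip (e j) (e j))).
exists (apow q 2 * (apow q (C + 1) + apow q s * fine (mu D))).
  by rewrite mulr_ge0 ?apow_ge0// addr_ge0 ?apow_ge0// mulr_ge0 ?apow_ge0// fine_ge0.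
move=> x x1; have hx : sn H x <= C.
  by apply: le_trans (hC x) _; rewrite ler_piMr// sqrtr_ge0.
have [h1 h2] := approx_sob0 ds n0 q0 ltr01 Le mF hF (subspP x).
have [_ h3] := Lq_finite_rank ds q0 mF (H0_meas x) h1 h2.
apply: le_trans h3 _; rewrite ler_wpM2l ?apow_ge0// lerD//.
  apply: apow_le => //; rewrite mul1r !ger0_norm ?addr_ge0 ?sqrtr_ge0//.
  by rewrite lerD2r snorm_sn10.
rewrite ler_wpM2r ?fine_ge0//; apply: apow_le => //.
have s0 : 0 <= \sum_j `|ip (sval_of x) (e j)| by apply: sumr_ge0.
rewrite !ger0_norm//; last by apply: sumr_ge0 => j _; rewrite mulr_ge0 ?sqrtr_ge0.
apply: ler_sum => j _; apply: le_trans (ip_le_sn10 x (Le j)) _.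
by rewrite ler_wpM2r ?sqrtr_ge0.
Qed.

Lemma rellich_pair (U : set_system nat) (z_ : nat -> V) z M : UltraFilter U ->
  (forall k, sn a (z_ k) <= M) -> wlim a U z_ z ->
  (fun k => I (fun t => apow q (sval_of (z_ k).1 t - sval_of z.1 t))) @ U --> (0 : R) /\
  (fun k => I (fun t => apow q (sval_of (z_ k).2 t - sval_of z.2 t))) @ U --> (0 : R).
Proof.
move=> UU zM /(wlim_prod haE haE)[w1 w2]; split.
  apply: (rellich haE hcE hC q0 approxq UU _ w1 (M := M)) => k.
  by apply: le_trans (zM k); exact: sn_prod_ge1.
apply: (rellich haE hcE hC q0 approxq UU _ w2 (M := M)) => k.
by apply: le_trans (zM k); exact: sn_prod_ge2.
Qed.

Lemma diff_Lq (x y : H0) : intg (fun t => apow q (sval_of x t - sval_of y t)).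
Proof.
have [_] := H0_Lq (x - y); apply: (eq_intg mD) => t _.
by rewrite sval_ofB.
Qed.

Section pairing.
Variables (h : T -> R -> R -> R) (M : R).
Hypotheses (M0 : 0 <= M) (hh : carath D h).
Hypothesis hM : forall x s t, D x -> `|h x s t| <= M * (1 + apow p s + apow p t).

Definition subst2 (f : T -> R -> R -> R) (z : V) : T -> R := fun x => f x (sval_of z.1 x) (sval_of z.2 x).

Let M' := apow r M * apow r 2 * apow r 2.
Let M'0 : 0 <= M'. Proof. by rewrite !mulr_ge0 ?apow_ge0. Qed.

Lemma hM' x s t : D x -> apow r (h x s t) <= M' * (1 + apow q s + apow q t).
Proof. by move=> Dx; apply: growth_apow => // s' t'; exact: hM. Qed.

Lemma subst2_meas z : measurable_fun D (subst2 h z).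
Proof. by apply: carath_measurable => //; exact: H0_meas. Qed.

Lemma apow_subst2_intg z : intg (fun x => apow r (subst2 h z x)).
Proof.
have i2 : intg (fun x => M' * (1 + apow q (sval_of z.1 x) + apow q (sval_of z.2 x))).
  apply: (intgZ mD); apply: (intgD mD); last exact: (H0_Lq z.2).2.
  by apply: (intgD mD); [exact: intg_cst|exact: (H0_Lq z.1).2].
apply: (intg_le mD _ i2).
  by apply: (measurableT_comp (measurable_apow r0)); exact: subst2_meas.
by move=> x Dx; rewrite ger0_norm ?apow_ge0//; exact: hM'.
Qed.

Lemma pairing_intg (g : T -> R) (y : H0) : measurable_fun D g -> intg (fun x => apow r (g x)) ->
  intg (fun x => g x * sval_of y x) /\ forall e K : R, (forall s t, `|s| * `|t| <= e * apow q t + K * apow r s) ->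
  `|I (fun x => g x * sval_of y x)| <= e * I (fun x => apow q (sval_of y x)) + K * I (fun x => apow r (g x)).
Proof.
move=> mg ig; have mgy : measurable_fun D (fun x => g x * sval_of y x).
  by apply: measurable_funM => //; exact: H0_meas.
have ib (e K : R) : intg (fun x => e * apow q (sval_of y x) + K * apow r (g x)).
  by apply: (intgD mD); [apply: (intgZ mD); exact: (H0_Lq y).2|exact: intgZ].
have iy : intg (fun x => g x * sval_of y x).
  have [K K0 hK] := young_eps p0 ltr01.
  by apply: (intg_le mD mgy (ib 1 K)) => x _; rewrite normrM; exact: hK.
split => // e K hK.
apply: le_trans (le_normr_Rintegral mD iy) _.
rewrite -!RintegralZl//; [|exact: (H0_Lq y).2].
rewrite -RintegralD//; [|by apply: (intgZ mD); exact: (H0_Lq y).2|exact: intgZ].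
apply: le_Rintegral; [exact: mD|exact: intg_abs|exact: ib|].
by move=> x _; rewrite normrM; exact: hK.
Qed.

(** Young's inequality bounds the functional on the unit ball. The representing vector is the
    inverse Dirichlet Laplacian applied to [subst2 h z]. *)
Lemma pairing_riesz z : exists g : H0, forall y, I (fun x => subst2 h z x * sval_of y x) = E g y.
Proof.
have [B B0 hB] := ball_Lq; have [K K0 hK] := young_eps p0 ltr01.
have mz := subst2_meas z; have iz := apow_subst2_intg z.
have iy y := (pairing_intg y mz iz).1.
pose l (y : H0) := I (fun x => subst2 h z x * sval_of y x).
have lZ k y : l (k *: y) = k * l y.
  rewrite /l -(RintegralZl k mD (iy y)); apply: eq_Rintegral => x _.
  by rewrite sval_ofZ -[LHS]/(subst2 h z x * (k * sval_of y x)) mulrCA.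
pose B' := 1 * B + K * I (fun x => apow r (subst2 h z x)).
have B'0 : 0 <= B'.
  by rewrite addr_ge0 ?mulr_ge0//; apply: Rintegral_ge0 => x _; exact: apow_ge0.
apply: (si_riesz haE hcE (l := l) (C := B')).
- move=> y w; rewrite /l -RintegralD//; apply: eq_Rintegral => x _; rewrite sval_ofD.
  by rewrite -mulrDr.
- exact: lZ.
- apply: (ball_bound haE lZ B'0) => y y1.
  apply: le_trans ((pairing_intg y mz iz).2 _ _ hK) _.
  by rewrite lerD2r ler_wpM2l//; exact: hB.
Qed.

Definition pairing_grad z : H0 := projT1 (cid (pairing_riesz z)).

Lemma pairing_gradE z y : E (pairing_grad z) y = I (fun x => subst2 h z x * sval_of y x).
Proof. by rewrite /pairing_grad; case: cid => g /= ->. Qed.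

(** Rellich's theorem gives convergence in L^q, superposition with [h] is continuous from L^q to
    L^r, and L^r pairs boundedly with the unit ball of the energy. *)
Lemma pairing_grad_wscont : wscont a E pairing_grad.
Proof.
move=> U z_ z K0 UU oU zM hw.
have [c1 c2] := rellich_pair UU zM hw.
have mz := subst2_meas z; have iz := apow_subst2_intg z.
pose f x s t := apow r (h x s t - subst2 h z x).
pose c := apow r 2.
pose g x := c * (M' + apow r (subst2 h z x)).
have cf : carath D f.
  split=> [s t|x Dx].
    apply: (measurableT_comp (measurable_apow r0)); apply: measurable_funB => //.
    exact: hh.1.
  move=> w; apply: (@continuous_comp _ _ _ (fun w : R * R => h x w.1 w.2 - subst2 h z x) (apow r)); last exact: apow_continuous.
  exact: (cvgB (hh.2 x Dx w) (cvg_cst _)).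
have ig : intg g.
  by apply: (intgZ mD); apply: (intgD mD) => //; exact: intg_cst.
have gr x s t : D x -> `|f x s t| <= g x + c * M' * (apow q s + apow q t).
  move=> Dx; rewrite ger0_norm ?apow_ge0//; apply: le_trans (apowD r0 _ _) _.
  rewrite apowN /g -mulrA -mulrDr ler_wpM2l ?apow_ge0//.
  by rewrite addrAC lerD2r -{1}[M']mulr1 -mulrDr addrA; exact: hM'.
have fz x : D x -> f x (sval_of z.1 x) (sval_of z.2 x) = 0.
  by move=> _; rewrite /f /subst2 subrr apow0.
have cM0 : 0 <= c * M' by rewrite mulr_ge0 ?apow_ge0.
have := nemytskii_ultra mD q0 cM0 cf ig (H0_Lq z.1).2 (H0_Lq z.2).2 gr fz UU oU
  (fun k => H0_meas (z_ k).1) (fun k => H0_meas (z_ k).2) (fun k => diff_Lq _ _) (fun k => diff_Lq _ _) c1 c2.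
move=> cc.
have [B B0 hB] := ball_Lq.
apply/cvgr0Pnorm_lt; move=> e' e'0; pose e : R := e'; have e0 : 0 < e by []; rewrite -/e.
have B1 : 0 < B + 1 by rewrite ltr_wpDl.
(* With this weight the L^q term of Young's inequality is at most [e / 2] on the unit ball; the L^r
   term, whatever its constant [K], tends to 0. *)
have eB : 0 < e / 2 / (B + 1) by rewrite !divr_gt0.
have [K K0' hK] := young_eps p0 eB.
have ck : (fun k => K * I (fun x => `|f x (sval_of (z_ k).1 x) (sval_of (z_ k).2 x)|)) @ U --> (0 : R).
  by have h2 := cvgM (cvg_cst K) cc; rewrite mulr0 in h2; exact: h2.
move/cvgr0Pnorm_lt : ck => /(_ (e / 2) (divr_gt0 e0 (ltr0Sn _ 1))); apply: filterS => k hk.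
rewrite ger0_norm ?sn_ge0//.
pose w := pairing_grad (z_ k) - pairing_grad z.
pose gk x := subst2 h (z_ k) x - subst2 h z x.
have mgk : measurable_fun D gk by apply: measurable_funB => //; exact: subst2_meas.
have Ek : I (fun x => apow r (gk x)) = I (fun x => `|f x (sval_of (z_ k).1 x) (sval_of (z_ k).2 x)|).
  by apply: eq_Rintegral => x _; rewrite ger0_norm ?apow_ge0.
have igk : intg (fun x => apow r (gk x)).
  have ib : intg (fun x => c * (apow r (subst2 h (z_ k) x) + apow r (subst2 h z x))).
    by apply: (intgZ mD); apply: (intgD mD) => //; exact: apow_subst2_intg.
  apply: (intg_le mD _ ib).
    by apply: (measurableT_comp (measurable_apow r0)).
  move=> x _; rewrite ger0_norm ?apow_ge0//; apply: le_trans (apowD r0 _ _) _.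
  by rewrite apowN.
have Ew y : E w y = I (fun x => gk x * sval_of y x).
  rewrite (siBl haE) !pairing_gradE -RintegralB//.
  - by apply: eq_Rintegral => x _; rewrite /gk mulrBl.
  - exact: (pairing_intg y (subst2_meas _) (apow_subst2_intg _)).1.
  - exact: (pairing_intg y mz iz).1.
have bw : forall y, sn E y <= 1 -> `|E w y| <= e / 2 / (B + 1) * B + K * I (fun x => apow r (gk x)).
  move=> y y1; rewrite Ew; apply: le_trans ((pairing_intg y mgk igk).2 _ _ hK) _.
  by rewrite lerD2r ler_wpM2l ?(ltW eB)//; exact: hB.
have b2 : e / 2 / (B + 1) * B <= e / 2.
  by rewrite mulrAC ler_pdivrMr// ler_wpM2l ?divr_ge0 ?(ltW e0)// lerDl.
have b0 : 0 <= e / 2 / (B + 1) * B + K * I (fun x => apow r (gk x)).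
  apply: addr_ge0; first exact: mulr_ge0 (ltW eB) B0.
  by apply: mulr_ge0 => //; apply: Rintegral_ge0 => x _; exact: apow_ge0.
(* Testing with [w] itself turns the bound on [E w y] into one on the seminorm of [w]. *)
have := ball_bound haE (fun k y => siZr haE k w y) b0 bw w.
rewrite -(sn_sqr haE) [X in X <= _]ger0_norm ?sqr_ge0// expr2 => hw2.
have hw3 : sn E w <= e / 2 / (B + 1) * B + K * I (fun x => apow r (gk x)).
  have := sn_ge0 E w; rewrite le_eqVlt => /predU1P[<-//|w0].
  by rewrite ler_pM2r in hw2.
apply: le_lt_trans hw3 _; rewrite Ek.
have := le_lt_trans (ler_norm _) hk; move: b2.
move: (_ * B) (K * _) => x y; lra.
Qed.

End pairing.

Section potential.
Variables (F : T -> R -> R -> R) (M N : R).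
Hypotheses (M0 : 0 <= M) (F_meas : forall s t, measurable_fun D (fun x => F x s t)).
Hypothesis F_C1 : forall x, D x -> C1 (F x).
Hypothesis F_grow : forall x s t, D x ->
  `|du (F x) s t| + `|dv (F x) s t| <= M * (1 + apow p s + apow p t).
Hypothesis F_0 : forall x, D x -> `|F x 0 0| <= N.

Let Fu x s t := du (F x) s t.
Let Fv x s t := dv (F x) s t.

Lemma F_carath : carath D F.
Proof. by split => // x /F_C1; exact: C1_continuous. Qed.

(** Measurability in [x] is inherited from difference quotients. *)
Lemma Fu_carath : carath D Fu.
Proof.
split=> [s t|x /F_C1 [_ _ h _]]; last exact: h.
apply: (@measurable_fun_cvg _ _ _ D (fun k x => k.+1%:R * (F x (k.+1%:R^-1 + s) t - F x s t))).
  by move=> k; apply: measurable_funM => //; apply: measurable_funB.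
by move=> x /F_C1 h; exact: (derive_seq (C1_du s t h)).
Qed.

Lemma Fv_carath : carath D Fv.
Proof.
split=> [s t|x /F_C1 [_ _ _ h]]; last exact: h.
apply: (@measurable_fun_cvg _ _ _ D (fun k x => k.+1%:R * (F x s (k.+1%:R^-1 + t) - F x s t))).
  by move=> k; apply: measurable_funM => //; apply: measurable_funB.
by move=> x /F_C1 h; exact: (derive_seq (C1_dv s t h)).
Qed.

Lemma Fu_grow x s t : D x -> `|Fu x s t| <= M * (1 + apow p s + apow p t).
Proof. by move=> Dx; apply: le_trans (F_grow s t Dx); rewrite lerDl. Qed.

Lemma Fv_grow x s t : D x -> `|Fv x s t| <= M * (1 + apow p s + apow p t).
Proof. by move=> Dx; apply: le_trans (F_grow s t Dx); rewrite lerDr. Qed.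

Lemma F_grow0 x s t : D x -> `|F x s t| <= (N + 2 * M) + 4 * M * (apow q s + apow q t).
Proof.
move=> Dx; apply: (C1_growth p0 M0 (F_C1 Dx) (F_0 Dx)) => s' t'.
exact: F_grow.
Qed.

Lemma F_intg z : intg (subst2 F z).
Proof.
have ib : intg (fun x => (N + 2 * M) + 4 * M * (apow q (sval_of z.1 x) + apow q (sval_of z.2 x))).
  apply: (intgD mD); first exact: intg_cst.
  by apply: (intgZ mD); apply: (intgD mD); [exact: (H0_Lq z.1).2|exact: (H0_Lq z.2).2].
apply: (intg_le mD _ ib); last by move=> x; exact: F_grow0.
by apply: carath_measurable => //; [exact: F_carath|exact: H0_meas|exact: H0_meas].
Qed.

Definition potential z : R := I (subst2 F z).

Lemma potential_wcont : wcont a potential.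
Proof.
move=> U z_ z K0 UU oU zM hw.
have [c1 c2] := rellich_pair UU zM hw.
pose f x s t := F x s t - subst2 F z x.
pose g x := (N + 2 * M) + `|subst2 F z x|.
have cf : carath D f.
  split=> [s t|x Dx w].
    by apply: measurable_funB => //; exact: intg_meas (F_intg z).
  exact: (cvgB (F_carath.2 x Dx w) (cvg_cst _)).
have ig : intg g.
  by apply: (intgD mD); [exact: intg_cst|apply: (intg_abs mD); exact: F_intg].
have gr x s t : D x -> `|f x s t| <= g x + 4 * M * (apow q s + apow q t).
  move=> Dx; apply: le_trans (ler_normB _ _) _; rewrite /g addrAC lerD2r.
  exact: F_grow0.
have fz x : D x -> f x (sval_of z.1 x) (sval_of z.2 x) = 0.
  by move=> _; rewrite /f /subst2 subrr.
have cM0 : 0 <= 4 * M by rewrite mulr_ge0.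
have cc := nemytskii_ultra mD q0 cM0 cf ig (H0_Lq z.1).2 (H0_Lq z.2).2 gr fz UU oU
  (fun k => H0_meas (z_ k).1) (fun k => H0_meas (z_ k).2) (fun k => diff_Lq _ _) (fun k => diff_Lq _ _) c1 c2.
have c3 : (fun k => `|potential (z_ k) - potential z|) @ U --> (0 : R).
  apply: (Rsqueeze0 _ cc) => k; rewrite normr_ge0 /=.
  rewrite /potential -RintegralB//; [|exact: F_intg|exact: F_intg].
  apply: (le_normr_Rintegral mD); apply: (intgB mD); exact: F_intg.
apply/cvgrPdist_lt => e e0; move/cvgr0Pnorm_lt : c3 => /(_ e e0); apply: filterS => k.
by rewrite normr_id distrC.
Qed.

Definition grad z : V := (pairing_grad M0 Fu_carath Fu_grow z, pairing_grad M0 Fv_carath Fv_grow z).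

Lemma gradE z y : a (grad z) y = I (fun x => subst2 Fu z x * sval_of y.1 x) +
  I (fun x => subst2 Fv z x * sval_of y.2 x).
Proof.
exact: (congr2 +%R (pairing_gradE M0 Fu_carath Fu_grow z y.1) (pairing_gradE M0 Fv_carath Fv_grow z y.2)).
Qed.

Lemma grad_wscont : wscont a a grad.
Proof.
move=> U z_ z K0 UU oU zM hw.
have c1 := pairing_grad_wscont M0 Fu_carath Fu_grow UU oU zM hw.
have c2 := pairing_grad_wscont M0 Fv_carath Fv_grow UU oU zM hw.
apply: (Rsqueeze0 (h := fun k => sn E (grad (z_ k) - grad z).1 + sn E (grad (z_ k) - grad z).2)).
  by move=> k; rewrite sn_ge0 /=; exact: sn_prod_le.
by have h2 := cvgD c1 c2; rewrite addr0 in h2; exact: h2.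
Qed.

Let line (z y : V) (s : R) x := F x (sval_of z.1 x + s * sval_of y.1 x) (sval_of z.2 x + s * sval_of y.2 x).

Lemma subst2_line z y s : subst2 F (z + s *: y) = line z y s.
Proof.
by apply/funext => x; rewrite /subst2 /line /= !sval_ofD !sval_ofZ.
Qed.

Lemma line_derive z y s x : D x -> is_derive s (1 : R) (fun s => line z y s x)
  (subst2 Fu (z + s *: y) x * sval_of y.1 x + subst2 Fv (z + s *: y) x * sval_of y.2 x).
Proof.
move=> /F_C1 h; rewrite /subst2 /= !sval_ofD !sval_ofZ.
exact: C1_chain h.
Qed.

(** Differentiation under the integral is carried out on an open interval, chosen around [0, 1]
    because the mean value theorem is applied there. *)
Lemma potential_derive z y (s : R) : -1 < s < 2 ->
  is_derive s (1 : R) (fun s => potential (z + s *: y)) (a (grad (z + s *: y)) y).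
Proof.
move=> s12; have sI : `](-1), 2[%classic s by rewrite /= in_itv.
have E0 : (fun s => potential (z + s *: y)) = (fun s => I (line z y s)).
  by apply/funext => t; rewrite /potential subst2_line.
have [K K0 hK] := growth_line p0 M0.
pose G x := K * (1 + apow q (sval_of z.1 x) + apow q (sval_of z.2 x) + apow q (sval_of y.1 x) + apow q (sval_of y.2 x)).
have iG : intg G.
  apply: (intgZ mD); apply: (intgD mD); last exact: (H0_Lq y.2).2.
  apply: (intgD mD); last exact: (H0_Lq y.1).2.
  apply: (intgD mD); last exact: (H0_Lq z.2).2.
  by apply: (intgD mD); [exact: intg_cst|exact: (H0_Lq z.1).2].
have G0 x : 0 <= G x.
  apply: (mulr_ge0 K0); do 4 (apply: addr_ge0; last exact: apow_ge0).
  exact: ler01.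
have il t : `](-1), 2[%classic t -> intg (line z y t).
  by move=> _; rewrite -subst2_line; exact: F_intg.
have dl t x : `](-1), 2[%classic t -> D x -> derivable (line z y ^~ x) t 1.
  by move=> _ Dx; have [] := line_derive z y t Dx.
have Gb t x : `](-1), 2[%classic t -> D x -> `|partial1of2 (line z y) t x| <= G x.
  rewrite /= in_itv /= => t12 Dx; rewrite partial1of2E; have [_ ->] := line_derive z y t Dx.
  rewrite /subst2 /= !sval_ofD !sval_ofZ; apply: (hK _ _ _ _ t).
  - by rewrite ler_norml; lra.
  - exact: Fu_grow.
  - exact: Fv_grow.
split; first by rewrite E0; exact: (derivable_under_integral mD sI il dl G0 iG Gb).
rewrite E0 -derive1E (differentiation_under_integral mD sI il dl G0 iG Gb) gradE.
have iu := (pairing_intg y.1 (subst2_meas Fu_carath (z + s *: y)) (apow_subst2_intg M0 Fu_carath Fu_grow _)).1.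
have iv := (pairing_intg y.2 (subst2_meas Fv_carath (z + s *: y)) (apow_subst2_intg M0 Fv_carath Fv_grow _)).1.
rewrite -(RintegralD mD iu iv); apply: eq_Rintegral => x /[!inE] Dx.
by rewrite partial1of2E; have [_ ->] := line_derive z y s Dx.
Qed.

Lemma potential_mvt z y : exists2 s, 0 <= s <= 1 &
  potential (z + y) - potential z = a (grad (z + s *: y)) y.
Proof.
have d1 (s : R) : s \in `]0, 1[ -> is_derive s (1 : R) (fun s => potential (z + s *: y)) (a (grad (z + s *: y)) y).
  by rewrite in_itv /= => s01; apply: potential_derive; lra.
have c1 : {within `[0, 1], continuous (fun s => potential (z + s *: y))}.
  apply: derivable_within_continuous => s; rewrite in_itv /= => s01.
  by have [] := @potential_derive z y s (_ : -1 < s < 2); first by lra.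
have [s s01] := MVT (@ltr01 R) d1 c1.
rewrite scale1r scale0r addr0 subr0 mulr1 => ->; exists s => //.
by move: s01; rewrite in_itv /= => /andP[/ltW -> /ltW ->].
Qed.

End potential.

End functionals.

Section oscillating_integrand.
Variables (R : realType) (Phi K : R -> R -> R) (al be : R).
Hypotheses (hPhi : C1 Phi) (hK : C1 K).

Definition osc_integrand (s t : R) : R := al * sin (Phi s t) + be * cos (Phi s t) + K s t.

Lemma is_derive_osc (f k : R -> R) (x df dk : R) : is_derive x (1 : R) f df -> is_derive x (1 : R) k dk ->
  is_derive x (1 : R) (fun x => al * sin (f x) + be * cos (f x) + k x)
    ((al * cos (f x) - be * sin (f x)) * df + dk).
Proof.
move=> hf hk.
have h1 : is_derive x (1 : R) (sin \o f) (cos (f x) * df) by exact: is_derive1_comp.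
have h2 : is_derive x (1 : R) (cos \o f) (- sin (f x) * df) by exact: is_derive1_comp.
have h3 := is_deriveD (is_deriveD (is_deriveZ al h1) (is_deriveZ be h2)) hk.
apply: is_derive_eq h3 _; rewrite /GRing.scale /=; ring.
Qed.

Lemma osc_du s t : is_derive s (1 : R) (fun s => osc_integrand s t)
  ((al * cos (Phi s t) - be * sin (Phi s t)) * du Phi s t + du K s t).
Proof. exact: (is_derive_osc (C1_du s t hPhi) (C1_du s t hK)). Qed.

Lemma osc_dv s t : is_derive t (1 : R) (osc_integrand s)
  ((al * cos (Phi s t) - be * sin (Phi s t)) * dv Phi s t + dv K s t).
Proof. exact: (is_derive_osc (C1_dv s t hPhi) (C1_dv s t hK)). Qed.

Lemma osc_duE s t : du osc_integrand s t =
  (al * cos (Phi s t) - be * sin (Phi s t)) * du Phi s t + du K s t.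
Proof. by rewrite /du derive1E; have [_] := osc_du s t. Qed.

Lemma osc_dvE s t : dv osc_integrand s t =
  (al * cos (Phi s t) - be * sin (Phi s t)) * dv Phi s t + dv K s t.
Proof. by rewrite /dv derive1E; have [_] := osc_dv s t. Qed.

Lemma osc_C1 : C1 osc_integrand.
Proof.
have [_ _ cu cv] := hPhi; have [_ _ ku kv] := hK.
have cP := C1_continuous hPhi.
have c (z : R * R) : (fun z => al * cos (Phi z.1 z.2) - be * sin (Phi z.1 z.2)) @ z --> al * cos (Phi z.1 z.2) - be * sin (Phi z.1 z.2).
  apply: cvgB; apply: cvgMr; apply: (@continuous_comp _ _ _ (fun z : R * R => Phi z.1 z.2)).
  - exact: cP.
  - exact: continuous_cos.
  - exact: cP.
  - exact: continuous_sin.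
split=> [s t|s t|z|z].
- by have [] := osc_du s t.
- by have [] := osc_dv s t.
- rewrite /continuous_at osc_duE; under eq_fun do rewrite osc_duE.
  exact: (cvgD (cvgM (c z) (cu z)) (ku z)).
- rewrite /continuous_at osc_dvE; under eq_fun do rewrite osc_dvE.
  exact: (cvgD (cvgM (c z) (cv z)) (kv z)).
Qed.

Lemma osc_grow (A B w : R) s t : `|al| <= A -> `|be| <= B ->
  `|du Phi s t| + `|dv Phi s t| <= w -> 0 <= w ->
  `|du osc_integrand s t| + `|dv osc_integrand s t| <= (A + B) * w + (`|du K s t| + `|dv K s t|).
Proof.
move=> hA hB hw w0; rewrite osc_duE osc_dvE; set c := al * _ - _.
have hc : `|c| <= A + B.
  apply: le_trans (ler_normB _ _) _; rewrite !normrM lerD//.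
    by apply: le_trans hA; rewrite ler_piMr// cos_max.
  by apply: le_trans hB; rewrite ler_piMr// sin_max.
apply: (@le_trans _ _ (`|c| * (`|du Phi s t| + `|dv Phi s t|) + (`|du K s t| + `|dv K s t|))).
  by rewrite mulrDr addrACA lerD// -normrM ler_normD.
by rewrite lerD2r ler_pM// addr_ge0.
Qed.

End oscillating_integrand.

Section phase.
Variable R : realType.

Lemma cos_lt1 (t : R) : 0 < `|t| -> `|t| < 1 -> cos t != 1.
Proof.
move=> t0 t1; have -> : cos t = cos `|t|.
  by have [h|h] := leP 0 t; [rewrite ger0_norm|rewrite ltr0_norm// cosN].
rewrite -cos0; apply/eqP => /cos_inj E; move: t0; rewrite E ?ltxx//.
- by rewrite in_itv /= normr_ge0 /= (le_trans (ltW t1))// (le_trans _ (pi_ge2 R))// ler1n.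
- by rewrite in_itv /= lexx /= pi_ge0.
Qed.

(* Rational [r] suffice, by continuity; being countably many they can be tested
   outside a single null set. *)
Lemma phase_detect (Phi : R -> R -> R) (s t c : R) : continuous (fun z : R * R => Phi z.1 z.2) ->
  Phi 0 0 = 0 -> Phi s t != 0 -> c != 0 ->
  exists r : rat, cos (Phi (ratr r * s * c) (ratr r * t * c)) != 1.
Proof.
move=> cP P0 Pst c0.
pose g (x : R) := `|Phi (x * s * c) (x * t * c)|.
have cg : continuous g.
  move=> x; apply: (@continuous_comp _ _ _ (fun x : R => Phi (x * s * c) (x * t * c)) (fun y : R => `|y|)); last exact: norm_continuous.
  have l1 (b : R) : (fun x : R => x * b * c) @ x --> x * b * c.
    exact: (cvgM (cvgM (@cvg_id _ _) (cvg_cst b)) (cvg_cst c)).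
  exact: (cvg_comp _ _ (cvg_pair (l1 s) (l1 t)) (cP (x * s * c, x * t * c))).
have g0 : g 0 = 0 by rewrite /g !mul0r P0 normr0.
have g1 : 0 < g c^-1 by rewrite /g ![c^-1 * _]mulrC !divfK// normr_gt0.
(* A value strictly between 0 and 1, where the cosine differs from 1; by the intermediate value
   theorem [g] takes it between 0 and [c^-1]. *)
pose v : R := Num.min 2^-1 (g c^-1).
have v0 : 0 < v by rewrite lt_min g1 invr_gt0 ltr0Sn.
have v1 : v < 1 by rewrite gt_min; apply/orP; left; rewrite invf_lt1// ltr1n.
have [x gx] : exists x, g x = v.
  have vg : v <= g c^-1 by rewrite ge_min lexx orbT.
  have [cn|cp] := leP 0 c^-1.
    have [|x _ gx] := @IVT R g 0 c^-1 v cn (continuous_subspaceT cg); last by exists x.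
    by rewrite g0 ge_min le_max (ltW v0) vg !orbT.
  have [|x _ gx] := @IVT R g c^-1 0 v (ltW cp) (continuous_subspaceT cg); last by exists x.
  by rewrite g0 ge_min le_max (ltW v0) vg !orbT.
(* Within [Num.min v (1 - v)] of [v] the value of [g] stays strictly between 0 and 1. *)
have /cvgrPdist_lt := cg x; rewrite gx => /(_ (Num.min v (1 - v))).
rewrite lt_min v0 subr_gt0 v1 => /(_ isT) /nbhs_ballP[e /= e0 he].
have [|r hr] := @rat_in_itvoo R (x - e) (x + e).
  by rewrite ltrBlDr -addrA ltrDl addr_gt0.
exists r; have : `|v - g (ratr r)| < Num.min v (1 - v).
  by apply: he; move: hr; rewrite /ball /= ltr_distlC.
rewrite lt_min => /andP[]; rewrite !ltr_distl => /andP[h1 h2] /andP[h3 h4].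
apply: cos_lt1; rewrite -/(g (ratr r)); lra.
Qed.

End phase.

Section truncation.
Context d (T : measurableType d) (R : realType).
Variables (mu : {measure set T -> \bar R}) (D : set T).
Hypotheses (mD : measurable D) (muD : (mu D < +oo)%E).

(* [alpha] and [beta] are only essentially bounded, while the growth conditions
   are pointwise, so they are first truncated on a null set. *)
Definition trunc (M t : R) : R := t * \1_(`[- M, M]%classic : set R) t.

Lemma truncE M t : `|t| <= M -> trunc M t = t.
Proof. by move=> tM; rewrite /trunc indicE mem_set ?mulr1//= in_itv /= -ler_norml. Qed.

Lemma trunc_le M t : 0 <= M -> `|trunc M t| <= M.
Proof.
move=> M0; rewrite /trunc indicE; have [|_] := boolP (_ \in _); last by rewrite mulr0 normr0.
by rewrite inE /= in_itv /= -ler_norml mulr1.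
Qed.

Lemma measurable_trunc M (u : T -> R) : measurable_fun D u -> measurable_fun D (trunc M \o u).
Proof.
move=> mu_; apply: (measurableT_comp (f := trunc M)) => //.
apply: measurable_funM => //; exact: measurable_indic.
Qed.

Lemma bounded_L2 M (u : T -> R) : measurable_fun D u -> (forall x, D x -> `|u x| <= M) -> L2 mu D u.
Proof.
move=> mu_ hu; split => //; apply: (intg_le mD _ (intg_cst mD muD (M ^+ 2))).
  exact: measurable_funX.
move=> x Dx; rewrite normrX; apply: lerXn2r; rewrite ?nnegrE ?hu//.
exact: le_trans (hu x Dx).
Qed.

Lemma ae_bounded_trunc M (u : T -> R) : 0 <= M -> measurable_fun D u ->
  {ae mu, forall x, D x -> `|u x| <= M} ->
  L2 mu D u /\ {ae mu, forall x, D x -> trunc M (u x) = u x}.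
Proof.
move=> M0 mu_ hu.
have E : {ae mu, forall x, D x -> trunc M (u x) = u x}.
  by apply: (ae_imp hu) => x h Dx; exact: truncE (h Dx).
split => //; split => //.
have [_ h] : L2 mu D (trunc M \o u).
  by apply: (bounded_L2 (M := M)); [exact: measurable_trunc|move=> x _; exact: trunc_le].
apply: (ae_intg mD _ _ h); first exact: measurable_funX.
by apply: (ae_imp E) => x hx Dx /=; rewrite hx.
Qed.

End truncation.

(** * Three solutions in the abstract Dirichlet setting *)

Section abstract_theorem.
Context d (T : measurableType d) (R : realType).
Variables (mu : {measure set T -> \bar R}) (D : set T) (n : nat).
Variables (test : set (T -> R)) (pd : 'I_n -> (T -> R) -> T -> R).
Hypothesis ds : dirichlet_setting mu D test pd.
Hypothesis n0 : (0 < n)%N.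
Hypothesis test_nontrivial : exists2 phi, test phi & 0 < L2ip mu D phi phi.
Let mD := ds_meas ds.
Let muD := ds_fin ds.
Local Notation L2D := (L2 mu D).
Local Notation ip := (L2ip mu D).
Local Notation intg f := (mu.-integrable D (EFin \o f)).
Local Notation I f := (\int[mu]_(x in D) f x).
Local Notation H0 := (H0sp ds n0).
Local Notation E := (@energy _ _ _ _ _ _ _ _ ds n0).
Local Notation V := (H0 * H0)%type.
Local Notation a := (si_prod E E).
Local Notation Y := (L2sp mu mD * L2sp mu mD)%type.
Local Notation b := (si_prod (@L2form _ _ _ mu D mD) (@L2form _ _ _ mu D mD)).

Variable m : R.
Hypotheses (m0 : 0 < m) (hm : forall w : H0, m * mass w w <= E w w).
Let haE : semi_inner E := energyP ds n0.
Let ha : semi_inner a := si_prodP haE haE.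
Let hcE : si_complete E := energy_complete m0 hm.
Let hca : si_complete a := si_prod_complete haE haE hcE hcE.
Let hL : semi_inner (@L2form _ _ _ mu D mD) := L2formP mu mD.
Let hb : semi_inner b := si_prodP hL hL.

Variable p : R.
Hypothesis p0 : 0 < p.
Let q := p + 1.
Hypothesis approxq : finite_rank_approx mu D test pd q.
Let q0 : 0 < q. Proof. by rewrite addr_gt0. Qed.

Lemma potential_package (F : T -> R -> R -> R) (M N : R) : 0 <= M ->
  (forall s t, measurable_fun D (fun x => F x s t)) ->
  (forall x, D x -> C1 (F x)) ->
  (forall x s t, D x -> `|du (F x) s t| + `|dv (F x) s t| <= M * (1 + apow p s + apow p t)) ->
  (forall x, D x -> `|F x 0 0| <= N) ->
  [/\ wcont a (@potential _ _ _ _ _ _ _ _ ds n0 F), forall z : V, intg (subst2 F z) &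
  exists G : V -> V, [/\ wscont a a G,
    (forall z y, a (G z) y = I (fun x => du (F x) (sval_of z.1 x) (sval_of z.2 x) * sval_of y.1 x) +
      I (fun x => dv (F x) (sval_of z.1 x) (sval_of z.2 x) * sval_of y.2 x)) &
    forall z y, exists2 s, 0 <= s <= 1 &
      potential F (z + y) - potential F z = a (G (z + s *: y)) y]].
Proof.
move=> M0 Fm FC Fg F0; split.
- exact: (potential_wcont m0 hm p0 approxq M0 Fm FC Fg F0).
- exact: (F_intg p0 approxq M0 Fm FC Fg F0).
exists (grad m0 hm p0 approxq M0 Fm FC Fg); split.
- exact: grad_wscont.
- move=> z y; exact: gradE.
- exact: (potential_mvt m0 hm p0 approxq M0 Fm FC Fg F0).
Qed.

Variables (K : T -> R -> R -> R) (MK : R).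
Hypotheses (MK0 : 0 <= MK) (K_meas : forall s t, measurable_fun D (fun x => K x s t)).
Hypothesis K_C1 : forall x, D x -> C1 (K x).
Hypothesis K_grow : forall x s t, D x ->
  `|du (K x) s t| + `|dv (K x) s t| <= MK * (1 + apow p s + apow p t).
Hypothesis K_0 : forall x, D x -> K x 0 0 = 0.
Variable eta : R.
Hypotheses (eta0 : 0 < eta) (eta_m : eta < m / 2).
Hypothesis K_eta : forall x s t, D x -> K x s t <= eta * (s ^+ 2 + t ^+ 2).

Variables (Phi : R -> R -> R) (MP : R).
Hypotheses (MP0 : 0 <= MP) (Phi_C1 : C1 Phi) (Phi_0 : Phi 0 0 = 0).
Hypothesis Phi_grow : forall s t, `|du Phi s t| + `|dv Phi s t| <= MP * (1 + apow p s + apow p t).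
Hypothesis Phi_nonconst : ~ exists c, forall s t, Phi s t = c.

Lemma Phi_comp_meas (f : R -> R) (z : V) : continuous f ->
  measurable_fun D (fun x => f (Phi (sval_of z.1 x) (sval_of z.2 x))).
Proof.
move=> cf; apply: (measurableT_comp (f := f)); first exact: continuous_measurable_fun.
have := @carath_measurable _ _ _ D mD (fun _ => Phi) (sval_of z.1) (sval_of z.2).
apply; [split=> [s t|x _]|exact: (H0_meas p0 approxq)|exact: (H0_meas p0 approxq)].
- exact: measurable_cst.
- exact: C1_continuous.
Qed.

Lemma osc_L2 (f : R -> R) (z : V) : continuous f -> (forall t, `|f t| <= 1) ->
  L2D (fun x => f (Phi (sval_of z.1 x) (sval_of z.2 x))).
Proof.
by move=> cf f1; apply: (bounded_L2 mD muD (M := 1)) => //; exact: Phi_comp_meas.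
Qed.

Definition osc_map (z : V) : Y :=
  (to_subsp (L2_set0 mu mD) (L2_setlin mD) (osc_L2 z (@continuous_sin R) (@sin_max R)),
   to_subsp (L2_set0 mu mD) (L2_setlin mD) (osc_L2 z (@continuous_cos R) (@cos_max R))).

Lemma osc_map_norm z : b (osc_map z) (osc_map z) = fine (mu D).
Proof.
have h1 := osc_L2 z (@continuous_sin R) (@sin_max R).
have h2 := osc_L2 z (@continuous_cos R) (@cos_max R).
rewrite -[LHS]/(I (fun x => sin (Phi (sval_of z.1 x) (sval_of z.2 x)) * sin (Phi (sval_of z.1 x) (sval_of z.2 x))) +
  I (fun x => cos (Phi (sval_of z.1 x) (sval_of z.2 x)) * cos (Phi (sval_of z.1 x) (sval_of z.2 x)))).
rewrite -(RintegralD mD (L2_mul mD h1 h1) (L2_mul mD h2 h2)).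
rewrite (@eq_Rintegral _ _ _ _ _ (fun=> 1)) => [|x _]; first by rewrite Rintegral_cst// mul1r.
by rewrite -!expr2 addrC cos2Dsin2.
Qed.

(** As [f] is bounded by 1, the squared difference is bounded by 4, and [nemytskii_ultra] applies
    with a constant majorant. *)
Lemma osc_comp_wscont (f : R -> R) (cf : continuous f) (f1 : forall t, `|f t| <= 1) :
  wscont a (@L2form _ _ _ mu D mD) (fun z : V => to_subsp (L2_set0 mu mD) (L2_setlin mD) (osc_L2 z cf f1)).
Proof.
move=> U z_ z K0 UU oU zM hw.
have [c1 c2] := rellich_pair m0 hm p0 approxq UU zM hw.
pose w x := f (Phi (sval_of z.1 x) (sval_of z.2 x)).
pose F x s t := (f (Phi s t) - w x) ^+ 2.
have cF : carath D F.
  split=> [s t|x Dx y].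
    by apply: measurable_funX; apply: measurable_funB => //; exact: Phi_comp_meas.
  have h : (fun y : R * R => f (Phi y.1 y.2) - w x) @ y --> f (Phi y.1 y.2) - w x.
    apply: cvgB; last exact: cvg_cst.
    apply: (@continuous_comp _ _ _ (fun z : R * R => Phi z.1 z.2) f); [exact: C1_continuous|exact: cf].
  exact: (cvgM h h).
have F4 x s t : D x -> `|F x s t| <= 4 + 0 * (apow q s + apow q t).
  move=> Dx; rewrite mul0r addr0 ger0_norm ?sqr_ge0// /F.
  have := f1 (Phi s t); have := f1 (Phi (sval_of z.1 x) (sval_of z.2 x)); rewrite -/(w x).
  by rewrite !ler_norml; move: (f _) (w x) => u v; nra.
have Fz x : D x -> F x (sval_of z.1 x) (sval_of z.2 x) = 0.
  by move=> _; rewrite /F /w subrr expr0n.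
have Hm (x : H0) := H0_meas p0 approxq x; have HL (x : H0) := H0_Lq p0 approxq x.
have cc := nemytskii_ultra mD q0 (lexx 0) cF (intg_cst mD muD 4) (HL z.1).2 (HL z.2).2 F4 Fz UU oU
  (fun k => Hm (z_ k).1) (fun k => Hm (z_ k).2) (fun k => diff_Lq p0 approxq _ _) (fun k => diff_Lq p0 approxq _ _) c1 c2.
rewrite -(sqrtr0 R) (_ : (fun k => _) = (fun k => Num.sqrt (I (fun x => `|F x (sval_of (z_ k).1 x) (sval_of (z_ k).2 x)|)))).
  by apply: continuous_cvg; [exact: sqrt_continuous|exact: cc].
apply/funext => k; rewrite sn_L2form; congr Num.sqrt; apply: eq_Rintegral => x _.
by rewrite sval_ofB ger0_norm ?sqr_ge0.
Qed.

Lemma osc_map_wscont : wscont a b osc_map.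
Proof.
move=> U z_ z K0 UU oU zM hw.
have c1 := osc_comp_wscont (@continuous_sin R) (@sin_max R) UU oU zM hw.
have c2 := osc_comp_wscont (@continuous_cos R) (@cos_max R) UU oU zM hw.
apply: (Rsqueeze0 _ (h := fun k => sn (@L2form _ _ _ mu D mD) (osc_map (z_ k) - osc_map z).1 + sn (@L2form _ _ _ mu D mD) (osc_map (z_ k) - osc_map z).2)).
  by move=> k; rewrite sn_ge0 /=; exact: (sn_prod_le hL hL).
by have h2 := cvgD c1 c2; rewrite addr0 in h2; exact: h2.
Qed.

(** If the map were constant, comparing its value at 0 with those at rational multiples of one
    nonzero test function would give cosine 1 almost everywhere for all of them; by [phase_detect]
    the test function would vanish almost everywhere. *)
Lemma osc_map_nonconst : exists z z', 0 < sn b (osc_map z - osc_map z').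
Proof.
have [s0 [t0 Pst]] : exists s t, Phi s t != 0.
  apply: contrapT => h; apply: Phi_nonconst; exists 0 => s t.
  by apply: contrapT => /eqP hst; apply: h; exists s, t.
have [phi tphi phi0] := test_nontrivial.
have sphi : sob0 mu D test pd phi.
  split; first exact: (test_sob ds n0 tphi).1.
  move=> e e0; exists phi => //; rewrite (_ : phi \- phi = 0); last by apply/funext => t; exact: subrr.
  by rewrite -[0]/(sval_of (0 : H1sp ds n0)) sob_normE (sn0 (h1P ds n0)).
pose w : H0 := to_subsp (sob00 ds n0) (sob0_lin ds n0) sphi.
pose zr (r : rat) : V := ((ratr r * s0) *: w, (ratr r * t0) *: w).
apply: contrapT => hn.
have h0 r : sn b (osc_map (zr r) - osc_map 0) = 0.
  have [//|h] := eqVneq (sn b (osc_map (zr r) - osc_map 0)) 0.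
  by case: hn; exists (zr r), 0; rewrite lt_neqAle eq_sym h sn_ge0.
have L2phi := setting_test_L2 ds n0 tphi.
have hr r : {ae mu, forall x, D x -> cos (Phi (ratr r * s0 * phi x) (ratr r * t0 * phi x)) = 1}.
  have e2 : L2form (osc_map (zr r) - osc_map 0).2 (osc_map (zr r) - osc_map 0).2 = 0.
    rewrite -(sn_sqr hL);
    have h : sn (@L2form _ _ _ mu D mD) (osc_map (zr r) - osc_map 0).2 <= 0.
      by rewrite -(h0 r); apply: sn_prod_ge2.
    by rewrite (_ : sn _ _ = 0) ?expr0n//; apply/eqP; rewrite eq_le h sn_ge0.
  apply: (ae_imp (L2ip_eq0 mD (subspP _) e2)) => x hx Dx; have := hx Dx; rewrite sval_ofB => h1.
  have h2 : cos (Phi (ratr r * s0 * phi x) (ratr r * t0 * phi x)) - cos (Phi 0 0) = 0 by exact: h1.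
  by move/eqP: h2; rewrite Phi_0 cos0 subr_eq0 => /eqP.
have hall : {ae mu, forall x, forall k, D x -> if unpickle k is Some r then
    cos (Phi (ratr (r : rat) * s0 * phi x) (ratr r * t0 * phi x)) = 1 else True}.
  apply: ae_all => k; case: (unpickle k) => [r|]; first exact: hr.
  exact: ae_true.
have phi_ae : {ae mu, forall x, D x -> phi x = 0}.
  apply: (ae_imp hall) => x hx Dx; have [//|px] := eqVneq (phi x) 0.
  have [r] := phase_detect (C1_continuous Phi_C1) Phi_0 Pst px.
  by have := hx (pickle r) Dx; rewrite pickleK => ->; rewrite eqxx.
have E0 : ip phi phi = ip 0 0 by apply: ae_L2ip => //; exact: L2_0.
have e1 : ip 0 0 = 0 by exact: (si0l hL 0).
by move: phi0; rewrite E0 e1 ltxx.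
Qed.

Definition osc_critical (al be : T -> R) (z : V) := forall y : V, a z y =
  I (fun x => ((al x * cos (Phi (sval_of z.1 x) (sval_of z.2 x)) - be x * sin (Phi (sval_of z.1 x) (sval_of z.2 x))) *
     du Phi (sval_of z.1 x) (sval_of z.2 x) + du (K x) (sval_of z.1 x) (sval_of z.2 x)) * sval_of y.1 x) +
  I (fun x => ((al x * cos (Phi (sval_of z.1 x) (sval_of z.2 x)) - be x * sin (Phi (sval_of z.1 x) (sval_of z.2 x))) *
     dv Phi (sval_of z.1 x) (sval_of z.2 x) + dv (K x) (sval_of z.1 x) (sval_of z.2 x)) * sval_of y.2 x).

Definition osc_functional (al be : T -> R) (z : V) : R := 2^-1 * a z z -
  I (fun x => al x * sin (Phi (sval_of z.1 x) (sval_of z.2 x)) +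
              be x * cos (Phi (sval_of z.1 x) (sval_of z.2 x)) + K x (sval_of z.1 x) (sval_of z.2 x)).

(** The bound [K_eta] gives at most [eta] times the mass, and mass is at most [m^-1] times
    energy. *)
Lemma K_coercive (z : V) : (2^-1 - eta / m) * a z z <= 2^-1 * a z z - potential K z.
Proof.
have Ki : intg (subst2 K z).
  by apply: (F_intg p0 approxq MK0 K_meas K_C1 K_grow (N := 0)) => x Dx; rewrite K_0// normr0.
have L1 := sob_L2 ds (subspP z.1).1; have L2_ := sob_L2 ds (subspP z.2).1.
have hP : potential K z <= eta * (mass z.1 z.1 + mass z.2 z.2).
  have i1 := L2_mul mD L1 L1; have i2 := L2_mul mD L2_ L2_.
  rewrite -[mass z.1 z.1]/(I (fun x => sval_of z.1 x * sval_of z.1 x)) -[mass z.2 z.2]/(I (fun x => sval_of z.2 x * sval_of z.2 x)).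
  rewrite -(RintegralD mD i1 i2) -(RintegralZl eta mD (intgD mD i1 i2)).
  apply: (le_Rintegral mD Ki (intgZ mD eta (intgD mD i1 i2))) => x Dx.
  by rewrite -!expr2; exact: K_eta.
have h1 := hm z.1; have h2 := hm z.2.
rewrite -[a z z]/(E z.1 z.1 + E z.2 z.2).
move: hP h1 h2; move: (potential _ _) (mass _ _) (mass _ _) (E _ _) (E _ _) => P x1 x2 e1 e2 hP h1 h2.
rewrite mulrBl lerB//; apply: le_trans hP _.
rewrite -mulrA ler_pM2l// ler_pdivlMl// mulrDr; exact: lerD.
Qed.

Lemma osc_pairing_meas (al be w h k : T -> R) (z : V) : measurable_fun D al -> measurable_fun D be ->
  measurable_fun D h -> measurable_fun D k -> measurable_fun D w ->
  measurable_fun D (fun x => ((al x * cos (Phi (sval_of z.1 x) (sval_of z.2 x)) -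
    be x * sin (Phi (sval_of z.1 x) (sval_of z.2 x))) * h x + k x) * w x).
Proof.
move=> mal mbe mh mk mw.
apply: measurable_funM => //; apply: measurable_funD => //; apply: measurable_funM => //.
by apply: measurable_funB; apply: measurable_funM => //; apply: Phi_comp_meas;
  [exact: continuous_cos|exact: continuous_sin].
Qed.

Lemma H0_measurable_fun (x : H0) : measurable_fun D (sval_of x).
Proof. exact: (H0_meas p0 approxq). Qed.

(** The mountain pass is applied with the truncated coefficients, which satisfy the growth
    conditions everywhere; neither the functional nor the weak equations see the null set where they
    differ from [al] and [be]. *)
Lemma osc_three (al be : T -> R) (A B : R) (z1 z2 : V) : 0 <= A -> 0 <= B ->
  measurable_fun D al -> measurable_fun D be ->
  {ae mu, forall x, D x -> `|al x| <= A} -> {ae mu, forall x, D x -> `|be x| <= B} ->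
  coercive a (osc_functional al be) ->
  (forall z, osc_functional al be z1 <= osc_functional al be z) ->
  (forall z, osc_functional al be z2 <= osc_functional al be z) -> 0 < sn a (z1 - z2) ->
  exists z3, [/\ osc_critical al be z1, osc_critical al be z2, osc_critical al be z3,
    0 < sn a (z3 - z1) & 0 < sn a (z3 - z2)].
Proof.
move=> A0 B0 mal mbe hal hbe hco hz1 hz2 z12.
have [_ eal] := ae_bounded_trunc mD muD A0 mal hal.
have [_ ebe] := ae_bounded_trunc mD muD B0 mbe hbe.
have mal' := measurable_trunc A mal; have mbe' := measurable_trunc B mbe.
pose al' := trunc A \o al; pose be' := trunc B \o be.
have eab : {ae mu, forall x, D x -> al' x = al x /\ be' x = be x}.
  by apply: (ae_imp2 eal ebe) => x h1 h2 Dx; split; [exact: h1|exact: h2].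
pose F x s t := osc_integrand Phi (K x) (al' x) (be' x) s t.
have M0 : 0 <= (A + B) * MP + MK by rewrite addr_ge0// mulr_ge0// addr_ge0.
have Fm s t : measurable_fun D (fun x => F x s t).
  by apply: measurable_funD => //; apply: measurable_funD; apply: measurable_funM.
have FC x : D x -> C1 (F x) by move=> Dx; apply: osc_C1 => //; exact: K_C1.
have Fg x s t : D x -> `|du (F x) s t| + `|dv (F x) s t| <= ((A + B) * MP + MK) * (1 + apow p s + apow p t).
  move=> Dx; have w0 : 0 <= MP * (1 + apow p s + apow p t).
    by rewrite mulr_ge0// !addr_ge0 ?apow_ge0.
  have := osc_grow Phi_C1 (K_C1 Dx) (trunc_le (al x) A0) (trunc_le (be x) B0) (Phi_grow s t) w0.
  by move=> h; apply: (le_trans h); rewrite [leRHS]mulrDl -[X in _ <= X + _]mulrA lerD2l; exact: K_grow.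
have F0 x : D x -> `|F x 0 0| <= B.
  by move=> Dx; rewrite /F /osc_integrand Phi_0 sin0 cos0 mulr0 add0r mulr1 K_0// addr0 trunc_le.
have [wc Fi [G [wG GE mvt]]] := potential_package M0 Fm FC Fg F0.
have PE (z : V) : potential F z = I (fun x => al x * sin (Phi (sval_of z.1 x) (sval_of z.2 x)) +
      be x * cos (Phi (sval_of z.1 x) (sval_of z.2 x)) + K x (sval_of z.1 x) (sval_of z.2 x)).
    apply: (ae_Rint mD (intg_meas (Fi z))).
    apply: measurable_funD.
      by apply: measurable_funD; apply: measurable_funM => //; apply: Phi_comp_meas;
        [exact: continuous_sin|exact: continuous_cos].
    by apply: (carath_measurable mD (F_carath K_meas K_C1)); exact: H0_measurable_fun.
  by apply: (ae_imp eab) => x hx Dx; have [e1 e2] := hx Dx; rewrite /subst2 /F /osc_integrand e1 e2.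
have JE : osc_functional al be = (fun z => 2^-1 * a z z - potential F z).
  by apply/funext => z; rewrite PE.
have crit z : sn a (z - G z) = 0 -> osc_critical al be z.
  move=> hz y.
  have -> : a z y = a (G z) y.
    apply/eqP; rewrite -subr_eq0 -(siBl ha) -normr_le0.
    by apply: le_trans (si_CS ha _ _) _; rewrite hz mul0r.
  rewrite GE; have mz1 := H0_measurable_fun z.1; have mz2 := H0_measurable_fun z.2.
  have my1 := H0_measurable_fun y.1; have my2 := H0_measurable_fun y.2.
  have mPu : measurable_fun D (fun x => du Phi (sval_of z.1 x) (sval_of z.2 x)).
    apply: (@carath_measurable _ _ _ D mD (fun _ => du Phi)) => //; split=> [s t|x _]; first exact: measurable_cst.
    by have [] := Phi_C1.
  have mPv : measurable_fun D (fun x => dv Phi (sval_of z.1 x) (sval_of z.2 x)).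
    apply: (@carath_measurable _ _ _ D mD (fun _ => dv Phi)) => //; split=> [s t|x _]; first exact: measurable_cst.
    by have [] := Phi_C1.
  have mKu := carath_measurable mD (Fu_carath K_meas K_C1) mz1 mz2.
  have mKv := carath_measurable mD (Fv_carath K_meas K_C1) mz1 mz2.
  congr (_ + _).
    transitivity (I (fun x => ((al' x * cos (Phi (sval_of z.1 x) (sval_of z.2 x)) - be' x * sin (Phi (sval_of z.1 x) (sval_of z.2 x))) *
     du Phi (sval_of z.1 x) (sval_of z.2 x) + du (K x) (sval_of z.1 x) (sval_of z.2 x)) * sval_of y.1 x)).
      apply: eq_Rintegral => x; rewrite inE => Dx; congr (_ * _).
      by rewrite osc_duE//; exact: K_C1.
    apply: (ae_Rint mD); [exact: (osc_pairing_meas z mal' mbe' mPu mKu my1)|exact: (osc_pairing_meas z mal mbe mPu mKu my1)|].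
    by apply: (ae_imp eab) => x hx Dx; have [-> ->] := hx Dx.
  transitivity (I (fun x => ((al' x * cos (Phi (sval_of z.1 x) (sval_of z.2 x)) - be' x * sin (Phi (sval_of z.1 x) (sval_of z.2 x))) *
     dv Phi (sval_of z.1 x) (sval_of z.2 x) + dv (K x) (sval_of z.1 x) (sval_of z.2 x)) * sval_of y.2 x)).
    apply: eq_Rintegral => x; rewrite inE => Dx; congr (_ * _).
    by rewrite osc_dvE//; exact: K_C1.
  apply: (ae_Rint mD); [exact: (osc_pairing_meas z mal' mbe' mPv mKv my2)|exact: (osc_pairing_meas z mal mbe mPv mKv my2)|].
  by apply: (ae_imp eab) => x hx Dx; have [-> ->] := hx Dx.
move: hco hz1 hz2; rewrite JE => hco hz1 hz2.
have [z3 [c3 d1 d2]] := third_critical_point ha hca wc wG mvt hco hz1 hz2 z12.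
have m1 := crit z1 (min_critical ha hca wG mvt hz1); have m2 := crit z2 (min_critical ha hca wG mvt hz2).
by exists z3; split; [exact: m1|exact: m2|exact: (crit z3 c3)|exact: d1|exact: d2].
Qed.

Definition essentially_bounded (u : T -> R) := measurable_fun D u /\
  exists M : R, {ae mu, forall x, D x -> `|u x| <= M}.

Lemma essentially_boundedP u : essentially_bounded u -> measurable_fun D u /\
  exists2 M : R, 0 <= M & {ae mu, forall x, D x -> `|u x| <= M}.
Proof.
move=> [mu_ [M hM]]; split => //; exists `|M| => //.
by apply: (ae_imp hM) => x h Dx; exact: le_trans (h Dx) (ler_norm _).
Qed.

Theorem abstract_three_solutions (S : set ((T -> R) * (T -> R))) :
  (forall ab, S ab -> essentially_bounded ab.1 /\ essentially_bounded ab.2) ->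
  (forall ab ab' t, 0 <= t <= 1 -> S ab -> S ab' -> S (t *: ab + (1 - t) *: ab')) ->
  (forall f g, L2D f -> L2D g -> forall e : R, 0 < e -> exists2 ab, S ab &
    Num.sqrt (I (fun x => (f x - ab.1 x) ^+ 2)) < e /\ Num.sqrt (I (fun x => (g x - ab.2 x) ^+ 2)) < e) ->
  exists al be, S (al, be) /\ exists z1 z2 z3 : V,
   [/\ osc_critical al be z1, osc_critical al be z2 & osc_critical al be z3] /\
   [/\ 0 < sn a (z1 - z2), 0 < sn a (z1 - z3) & 0 < sn a (z2 - z3)] /\
   forall z, osc_functional al be z1 <= osc_functional al be z /\ osc_functional al be z2 <= osc_functional al be z.
Proof.
move=> Sb Sc Sd; apply: contrapT => habs.
have bL2 u : essentially_bounded u -> L2D u.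
  by move=> /essentially_boundedP[mu_ [M M0 hM]]; exact: (ae_bounded_trunc mD muD M0 mu_ hM).1.
have c00 : 0 < 2^-1 - eta / m.
  by rewrite subr_gt0 ltr_pdivrMr// [2^-1 * _]mulrC.
pose S' : set Y := [set y | S (sval_of y.1, sval_of y.2)].
have wK : wcont a (@potential _ _ _ _ _ _ _ _ ds n0 K).
  by apply: (potential_wcont m0 hm p0 approxq MK0 K_meas K_C1 K_grow (N := 0)) => x Dx; rewrite K_0// normr0.
have JE (y : Y) z : 2^-1 * a z z - (potential K z + b (osc_map z) y) = osc_functional (sval_of y.1) (sval_of y.2) z.
  congr (_ - _).
  have Ki : intg (subst2 K z).
    by apply: (F_intg p0 approxq MK0 K_meas K_C1 K_grow (N := 0)) => x Dx; rewrite K_0// normr0.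
  have L1 := subspP y.1; have L2_ := subspP y.2.
  have i1 := L2_mul mD L1 (osc_L2 z (@continuous_sin R) (@sin_max R)).
  have i2 := L2_mul mD L2_ (osc_L2 z (@continuous_cos R) (@cos_max R)).
  rewrite (RintegralD mD (intgD mD i1 i2) Ki) (RintegralD mD i1 i2) addrC; congr (_ + _).
  by congr (_ + _); exact: L2ipC.
apply: (@two_minima_absurd _ _ a ha hca _ b hb (@potential _ _ _ _ _ _ _ _ ds n0 K) osc_map (fine (mu D)) (2^-1 - eta / m) S') => //.
- exact: osc_map_wscont.
- exact: osc_map_norm.
- exact: osc_map_nonconst.
- exact: K_coercive.
- move=> y y' t ht Sy Sy'.
  have e1 (u v : L2sp mu mD) : sval_of (t *: u + (1 - t) *: v) = t *: sval_of u + (1 - t) *: sval_of v.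
    by rewrite sval_ofD !sval_ofZ.
  rewrite -[S' _]/(S (sval_of (t *: y.1 + (1 - t) *: y'.1), sval_of (t *: y.2 + (1 - t) *: y'.2))) !e1.
  exact: (Sc (sval_of y.1, sval_of y.2) (sval_of y'.1, sval_of y'.2) t ht Sy Sy').
- move=> y e e0; have e20 : 0 < e / 2 by rewrite divr_gt0.
  have [[f g] Sfg [h1 h2]] := Sd _ _ (subspP y.1) (subspP y.2) (e / 2) e20.
  have [b1 b2] := Sb _ Sfg.
  exists (to_subsp (L2_set0 mu mD) (L2_setlin mD) (bL2 _ b1), to_subsp (L2_set0 mu mD) (L2_setlin mD) (bL2 _ b2)) => //.
  rewrite (snB hb); apply: le_lt_trans (sn_prod_le hL hL _) _.
  by rewrite [ltRHS](splitr e) ltrD// sn_L2form.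
(* Two minimizers at positive distance would produce a third critical point, against [habs]; so
   minimizers are unique for every [y] in [S']. *)
move=> y Sy z1 z2 h1 h2; have [//|h] := eqVneq (sn a (z1 - z2)) 0.
have z12 : 0 < sn a (z1 - z2) by rewrite lt_neqAle eq_sym h sn_ge0.
have [/essentially_boundedP[mal [A A0 hA]] /essentially_boundedP[mbe [B B0 hB]]] := Sb _ Sy.
have hco : coercive a (osc_functional (sval_of y.1) (sval_of y.2)).
  have := coercive_pairing hb osc_map_norm c00 K_coercive y.
  by rewrite (_ : (fun x => _) = osc_functional (sval_of y.1) (sval_of y.2)) //; apply/funext => z; exact: JE.
have le_of_eq (x x' : R) : x = x' -> x <= x' by move=> ->.
have k1 z : osc_functional (sval_of y.1) (sval_of y.2) z1 <= osc_functional (sval_of y.1) (sval_of y.2) z.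
  exact: (le_trans (le_of_eq _ _ (esym (JE y z1))) (le_trans (h1 z) (le_of_eq _ _ (JE y z)))).
have k2 z : osc_functional (sval_of y.1) (sval_of y.2) z2 <= osc_functional (sval_of y.1) (sval_of y.2) z.
  exact: (le_trans (le_of_eq _ _ (esym (JE y z2))) (le_trans (h2 z) (le_of_eq _ _ (JE y z)))).
have [z3 [c1 c2 c3 d1 d2]] := osc_three A0 B0 mal mbe hA hB hco k1 k2 z12.
case: habs; exists (sval_of y.1), (sval_of y.2); split; first exact: Sy.
exists z1, z2, z3; split; first by split; [exact: c1|exact: c2|exact: c3].
split.
  by split; [exact: z12|rewrite (snB ha); exact: d1|rewrite (snB ha); exact: d2].
by move=> z; split; [exact: k1|exact: k2].
Qed.

End abstract_theorem.

(** * Averages over boxes *)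

Section telescoping.
Variables (R : realType) (q : R).
Hypothesis q0 : 0 < q.

(* With [x] the largest of the [|a k / w k|], [|sum a k| <= x * sum w k <= x]. *)
Lemma apow_weighted_sum (I : Type) (s : seq I) (a w : I -> R) : (forall k, 0 < w k) ->
  \sum_(k <- s) w k <= 1 -> apow q (\sum_(k <- s) a k) <= \sum_(k <- s) apow q (a k / w k).
Proof.
move=> w0 w1.
have [x [x0 hx hq]] : exists x : R, [/\ 0 <= x, `|\sum_(k <- s) a k| <= x * \sum_(k <- s) w k &
    apow q x <= \sum_(k <- s) apow q (a k / w k)].
  elim: s {w1} => [|k s [x [x0 hx hq]]].
    by exists 0; rewrite !big_nil normr0 mul0r apow0.
  have hk : `|a k| = `|a k / w k| * w k.
    by rewrite normrM normfV (gtr0_norm (w0 k)) divfK// gt_eqF.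
  have sw : 0 <= \sum_(j <- s) w j by apply: sumr_ge0 => j _; exact: ltW.
  exists (Num.max `|a k / w k| x); rewrite !big_cons; split.
  - by rewrite le_max normr_ge0.
  - apply: le_trans (ler_normD _ _) _; rewrite mulrDr lerD//.
      by rewrite hk ler_pM2r// le_max lexx.
    by apply: (le_trans hx); rewrite ler_wpM2r// le_max lexx orbT.
  - rewrite maxEle; case: ifP => _.
      by apply: (le_trans hq); rewrite lerDr apow_ge0.
    by rewrite apow_norm lerDl sumr_ge0// => j _; exact: apow_ge0.
apply: le_trans hq; apply: (apow_le q0); apply: (le_trans hx).
by rewrite (ger0_norm x0) ler_piMr.
Qed.

Lemma apowX (x : R) k : apow q (x ^+ k) = apow q x ^+ k.
Proof. by elim: k => [|k IH]; rewrite ?expr0 ?exprS ?apowM ?IH// /apow normr1 powR1. Qed.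

Lemma geometric_le (x : R) k : 0 < x < 1 -> \sum_(i < k) x ^+ i <= (1 - x)^-1.
Proof.
move=> /andP[x0 x1]; have d0 : 0 < 1 - x by rewrite subr_gt0.
have E : (1 - x) * \sum_(i < k) x ^+ i = 1 - x ^+ k.
  elim: k => [|k IH]; first by rewrite big_ord0 mulr0 expr0 subrr.
  by rewrite big_ord_recr /= mulrDr IH exprS; ring.
by rewrite -[_^-1]mulr1 ler_pdivlMl// E gerBl exprn_ge0// ltW.
Qed.

Lemma powR_lt1 (x r : R) : 0 < x < 1 -> 0 < r -> 0 < x `^ r < 1.
Proof.
move=> /andP[x0 x1] r0; rewrite powR_gt0//= -[ltRHS](_ : 1 `^ r = 1); last by rewrite powR1.
by apply: gt0_ltr_powR; rewrite // nnegrE ltW.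
Qed.

(** The weights [(1 - sg) * sg ^+ i] have sum at most 1, and [apow q sg] is the square root [ta] of
    [rho]. Dividing the increments by them costs a factor ta^-i, which leaves the summable ta^i out
    of rho^i. *)
Lemma telescope_Lq (rho : R) : 0 < rho < 1 -> exists2 K : R, 0 <= K &
  forall d (T : measurableType d) (mu : {measure set T -> \bar R}) (D : set T) (F : nat -> T -> R) (B : R),
  measurable D -> 0 <= B -> (forall m, measurable_fun D (F m)) ->
  (forall m, Lq mu D q (fun x => F m.+1 x - F m x) /\
    \int[mu]_(x in D) apow q (F m.+1 x - F m x) <= B * rho ^+ m) ->
  forall J k, mu.-integrable D (EFin \o (fun x => apow q (F (J + k)%N x - F J x))) /\
    \int[mu]_(x in D) apow q (F (J + k)%N x - F J x) <= B * K * rho ^+ J.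
Proof.
move=> rho01; pose sg := rho `^ (2 * q)^-1; pose ta := rho `^ 2^-1.
have sg01 : 0 < sg < 1 by apply: powR_lt1; rewrite // invr_gt0 mulr_gt0.
have ta01 : 0 < ta < 1 by apply: powR_lt1; rewrite // invr_gt0.
have [sg0 sg1] := andP sg01; have [ta0 ta1] := andP ta01.
have Esg : apow q sg = ta.
  by rewrite /apow ger0_norm ?ltW// /sg -powRrM invfM -mulrA mulVf ?mulr1// gt_eqF.
have Erho : rho = ta * ta.
  rewrite /ta -powRD; last by rewrite gt_eqF ?addr_gt0 ?invr_gt0.
  by rewrite (_ : 2^-1 + 2^-1 = 1 :> R) ?powRr1//; [rewrite ltW//; case/andP: rho01|lra].
have Esg' : apow q sg^-1 = ta^-1.
  apply: (mulIf (lt0r_neq0 ta0)); rewrite mulVf ?lt0r_neq0// -Esg -apowM mulVf ?lt0r_neq0//.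
  by rewrite /apow normr1 powR1.
pose u := apow q (1 - sg)^-1.
have K0 : 0 <= u / (1 - ta) by rewrite divr_ge0 ?apow_ge0// subr_ge0 ltW.
exists (u / (1 - ta)) => // d T mu D F B mD B0 mF hF J k.
pose w (i : 'I_k) := (1 - sg) * sg ^+ i.
have w0 i : 0 < w i by rewrite mulr_gt0 ?exprn_gt0// subr_gt0.
have w1 : \sum_i w i <= 1.
  by rewrite -mulr_sumr -ler_pdivlMl ?subr_gt0// mulr1 geometric_le.
pose a x (i : 'I_k) := F (J + i).+1 x - F (J + i)%N x.
have tele x : F (J + k)%N x - F J x = \sum_i a x i.
  rewrite /a; elim: (k) => [|k' IH]; first by rewrite big_ord0 addn0 subrr.
  by rewrite big_ord_recr /= -IH addnS; ring.
have apE x i : apow q (a x i / w i) = u * (ta^-1 ^+ i) * apow q (a x i).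
  by rewrite apowM mulrC /w invfM -exprVn apowM apowX Esg'.
have hi i : mu.-integrable D (EFin \o (fun x => apow q (a x i / w i))).
  apply: (eq_intg mD _ (intgZ mD (u * (ta^-1 ^+ i)) (hF (J + i)%N).1.2)) => x _.
  by rewrite apE.
have hs := intg_sum mD (index_enum 'I_k) hi.
have mk : measurable_fun D (fun x => apow q (F (J + k)%N x - F J x)).
  by apply: (measurableT_comp (measurable_apow q0)); exact: measurable_funB.
have le x : apow q (F (J + k)%N x - F J x) <= \sum_i apow q (a x i / w i).
  by rewrite tele; exact: apow_weighted_sum.
have hk : mu.-integrable D (EFin \o (fun x => apow q (F (J + k)%N x - F J x))).
  by apply: (intg_le mD mk hs) => x _; rewrite ger0_norm ?apow_ge0.
split => //; apply: le_trans (le_Rintegral mD hk hs (fun x _ => le x)) _.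
rewrite (Rint_sum mD _ hi); apply: (@le_trans _ _ (\sum_(i < k) B * u * rho ^+ J * ta ^+ i)).
  apply: ler_sum => i _.
  have -> : \int[mu]_(x in D) apow q (a x i / w i) = u * ta^-1 ^+ i * \int[mu]_(x in D) apow q (a x i).
    by rewrite -(RintegralZl _ mD (hF (J + i)%N).1.2); apply: eq_Rintegral => x _; rewrite apE.
  have h := (hF (J + i)%N).2; have c0 : 0 <= u * ta^-1 ^+ i.
    by rewrite mulr_ge0 ?apow_ge0// exprn_ge0// invr_ge0 ltW.
  apply: le_trans (ler_wpM2l c0 h) _.
  have E : rho ^+ i * ta^-1 ^+ i = ta ^+ i.
    by rewrite -exprMn Erho -mulrA mulfV ?mulr1// gt_eqF.
  by rewrite exprD -E le_eqVlt; apply/orP; left; apply/eqP; ring.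
rewrite -mulr_sumr -mulrA; have := geometric_le k ta01.
set s := \sum_(i < k) _ => hsum.
have -> : B * (u / (1 - ta)) * rho ^+ J = B * u * (rho ^+ J * (1 - ta)^-1) by ring.
apply: ler_wpM2l; first by rewrite mulr_ge0// apow_ge0.
by apply: ler_wpM2l => //; rewrite exprn_ge0// ltW//; case/andP: rho01.
Qed.

End telescoping.

Section halving.
Variables (R : realType) (n : nat).
Hypothesis n0 : (0 < n)%N.
Variable M : R.
Hypothesis M0 : 0 < M.
Local Notation cell := ('rV[R]_n * 'rV[R]_n)%type.
Local Notation chi c := (\1_(box (c : cell) : set (Rn R n)) : Rn R n -> R).

(** The directions are cut in turn, so that all sides shrink at the same rate; [ncut m i] counts the
    cuts in direction [i] among the first [m]. *)
Definition cut_dir (m : nat) : 'I_n := Ordinal (ltn_pmod m n0).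
Definition ncut (m : nat) (i : 'I_n) : nat := (m %/ n + (i < m %% n))%N.
Definition side m i : R := 2 * M / 2 ^+ ncut m i.
Definition vol m : R := (2 * M) ^+ n / 2 ^+ m.

Lemma ncutS m i : ncut m.+1 i = (ncut m i + (i == cut_dir m))%N.
Proof.
rewrite /ncut divnS// modnS -val_eqE /=.
have := ltn_pmod m n0; have := ltn_ord i.
have [h|h] := boolP (n %| m.+1)%N; last by lia.
have : (m %% n).+1 = n.
  apply/eqP; rewrite eqn_leq ltn_pmod//= dvdn_leq//.
  by rewrite -(dvdn_addr _ (dvdn_mull (m %/ n) (dvdnn n))) addnS -divn_eq.
lia.
Qed.

Lemma sideS m i : side m.+1 i = if i == cut_dir m then side m i / 2 else side m i.
Proof.
rewrite /side ncutS; case: eqP => _; last by rewrite addn0.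
by rewrite /= addn1 exprS invfM [2^-1 * _]mulrC mulrA.
Qed.

Lemma side_gt0 m i : 0 < side m i.
Proof. by rewrite divr_gt0 ?mulr_gt0// exprn_gt0. Qed.

Lemma vol_gt0 m : 0 < vol m.
Proof. by rewrite divr_gt0 ?exprn_gt0// mulr_gt0. Qed.

Lemma volS m : vol m.+1 = vol m / 2.
Proof. by rewrite /vol exprS invfM mulrA mulrAC. Qed.

Lemma prod_side m : \prod_i side m i = vol m.
Proof.
elim: m => [|m IH].
  rewrite /vol expr0 divr1 (eq_bigr (fun=> 2 * M)) ?prodr_const ?card_ord// => i _.
  by rewrite /side /ncut div0n mod0n ltn0 addn0 expr0 divr1.
rewrite volS -IH (bigD1 (cut_dir m))//= [in RHS](bigD1 (cut_dir m))//= sideS eqxx.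
rewrite mulrAC; congr (_ * _ * _); apply: eq_bigr => i /negbTE hi; by rewrite sideS hi.
Qed.

Definition midpoint (m : nat) (c : cell) : R := (c.1 0 (cut_dir m) + c.2 0 (cut_dir m)) / 2.
Definition lo m (c : cell) : cell := cell_lo c (cut_dir m) (midpoint m c).
Definition hi m (c : cell) : cell := cell_hi c (cut_dir m) (midpoint m c).

Definition left_half m (c : cell) (x : 'rV[R]_n) : bool := x 0 (cut_dir m) <= midpoint m c.

Fixpoint cells (m : nat) : seq cell :=
  if m is k.+1 then flatten [seq [:: lo k c; hi k c] | c <- cells k]
  else [:: (const_mx (- M), const_mx M)].

Lemma sum_cellsS m (F : cell -> R) :
  \sum_(c <- cells m.+1) F c = \sum_(c <- cells m) (F (lo m c) + F (hi m c)).
Proof.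
rewrite /= big_flatten big_map; apply: eq_bigr => c _.
by rewrite !big_cons big_nil /= addr0.
Qed.

Lemma cells_side m c : c \in cells m -> forall i, c.2 0 i - c.1 0 i = side m i.
Proof.
elim: m c => [|m IH] c.
  rewrite inE => /eqP -> i /=; rewrite !mxE /side /ncut div0n mod0n ltn0 addn0 expr0 divr1; lra.
move=> /flattenP[_ /mapP[c' hc' ->]]; have h := IH _ hc'.
rewrite !inE => /orP[]/eqP -> i; rewrite sideS /= !mxE; case: eqP => [->|_] //=; rewrite -h /midpoint.
  have := side_gt0 m (cut_dir m); rewrite -h => s0; rewrite minEle; case: leP; lra.
have := side_gt0 m (cut_dir m); rewrite -h => s0; rewrite maxEle; case: leP; lra.
Qed.

Lemma leb_cell m c : c \in cells m -> leb (box c : set (Rn R n)) = (vol m)%:E.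
Proof.
move=> hc; rewrite (leb_box n0) /box_vol -(prod_side m); congr EFin; apply: eq_bigr => i _.
by rewrite (cells_side hc) max_r// ltW// side_gt0.
Qed.

Lemma chi_intg (A : set (Rn R n)) c m : measurable A -> c \in cells m -> (@leb R n).-integrable A (EFin \o chi c).
Proof.
move=> mA hc; apply: (integrableS measurableT mA) => //.
have h : (leb (box c : set (Rn R n)) < +oo)%E by rewrite (leb_cell hc) ltry.
exact: (intg_indic measurableT (measurable_box n0 c) h).
Qed.

Lemma chi01 c x : chi c x = (x \in box c)%:R. Proof. by rewrite indicE. Qed.

Lemma chi_lo m c x : chi (lo m c) x = chi c x * (left_half m c x)%:R.
Proof.
rewrite !chi01 box_lo in_setI -natrM mulnb; congr (_ && _)%:R.
by apply/idP/idP; rewrite inE.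
Qed.

Lemma chi_hi m c x : chi (hi m c) x = chi c x * (~~ left_half m c x)%:R.
Proof.
rewrite !chi01 box_hi in_setI -natrM mulnb; congr (_ && _)%:R.
rewrite in_setC; congr (~~ _); by apply/idP/idP; rewrite inE.
Qed.

Lemma chi_split m c x : chi (lo m c) x + chi (hi m c) x = chi c x.
Proof. by rewrite chi_lo chi_hi -mulrDr -natrD; case: left_half; rewrite /= mulr1. Qed.

Lemma cells_partition m x : \sum_(c <- cells m) chi c x = chi (const_mx (- M), const_mx M) x.
Proof.
elim: m => [|m IH]; first by rewrite big_seq1.
by rewrite sum_cellsS -IH; apply: eq_bigr => c _; exact: chi_split.
Qed.

(** The identity for arbitrary [A] expresses that [x] lies in exactly one member of the list,
    counted once. *)
Lemma cells_eval m x : box (const_mx (- M), const_mx M) x -> exists c, [/\ c \in cells m, box c x &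
  forall A : cell -> R, \sum_(c <- cells m) A c * chi c x = A c].
Proof.
move=> hx; elim: m => [|m [c [hc cx hA]]].
  exists (const_mx (- M), const_mx M); split; rewrite ?inE// => A.
  by rewrite big_seq1 chi01 mem_set// mulr1.
have hin c' : c' \in [:: lo m c; hi m c] -> c' \in cells m.+1.
  by move=> hc'; apply/flattenP; exists [:: lo m c; hi m c] => //; apply/mapP; exists c.
pose A' (A : cell -> R) c := A (lo m c) * (left_half m c x)%:R +
  A (hi m c) * (~~ left_half m c x)%:R.
have AE A : \sum_(c <- cells m.+1) A c * chi c x = A' A c.
  rewrite sum_cellsS -hA; apply: eq_bigr => c' _.
  by rewrite chi_lo chi_hi /A' mulrDl; congr (_ + _); rewrite -mulrA; congr (_ * _); rewrite mulrC.
have [h|h] := boolP (left_half m c x).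
  exists (lo m c); split; [by apply: hin; rewrite inE eqxx|by rewrite box_lo; split|].
  by move=> A; rewrite AE /A' h mulr1 mulr0 addr0.
exists (hi m c); split; [by apply: hin; rewrite !inE eqxx orbT|by rewrite box_hi; split => //; apply/negP|].
by move=> A; rewrite AE /A' (negbTE h) mulr1 mulr0 add0r.
Qed.

Lemma lo_translate m c x : c \in cells m ->
  chi (hi m c) (translate (side m.+1 (cut_dir m) *: delta_mx 0 (cut_dir m)) x) = chi (lo m c) x.
Proof.
move=> hc; have hs := cells_side hc; rewrite !chi01; congr (_ %:R); congr nat_of_bool.
have s0 := side_gt0 m (cut_dir m); rewrite -hs in s0.
have tE : side m.+1 (cut_dir m) = (c.2 0 (cut_dir m) - c.1 0 (cut_dir m)) / 2 by rewrite sideS eqxx hs.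
have tx i : (translate (side m.+1 (cut_dir m) *: delta_mx 0 (cut_dir m)) x : 'rV[R]_n) 0 i =
    x 0 i + side m.+1 (cut_dir m) * (i == cut_dir m)%:R by rewrite !mxE eqxx.
have h1 i : (hi m c).1 0 i = if i == cut_dir m then midpoint m c else c.1 0 i.
  rewrite mxE; case: eqP => // _; rewrite maxEle /midpoint; case: leP; lra.
have h2 i : (lo m c).2 0 i = if i == cut_dir m then midpoint m c else c.2 0 i.
  rewrite mxE; case: eqP => // _; rewrite minEle /midpoint; case: leP; lra.
apply/idP/idP => /set_mem h; apply/mem_set => i; have := h i; rewrite tx h1 h2 tE /midpoint;
  (case: (eqVneq i (cut_dir m)) => [->|_]; rewrite ?mulr1 ?mulr0 ?addr0//=);
  move: s0; move: (x 0 _) (c.1 0 _) (c.2 0 _) => r1 r2 r3; lra.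
Qed.

Lemma chi_L2 (A : set (Rn R n)) c m : measurable A -> c \in cells m -> L2 leb A (chi c).
Proof.
move=> mA hc; have h := chi_intg mA hc; split; first exact: (intg_meas h).
apply: (eq_intg mA _ h) => x _; rewrite chi01.
by case: (_ \in _); rewrite ?expr1n ?expr0n.
Qed.

Lemma Rint_chi c m : c \in cells m -> \int[leb]_x chi c x = vol m.
Proof.
move=> hc; have h : (\int[leb]_x (chi c x)%:E = (vol m)%:E)%E.
  rewrite -(leb_cell hc); have := @integral_indic _ _ _ (@leb R n) setT measurableT _ (measurable_box n0 c).
  by rewrite setIT.
by rewrite /Rintegral h.
Qed.

(** After step [m] the direction just cut has been halved floor(m / n) + 1 times, which is more than
    m / n. *)
Lemma side_cut_le m : side m.+1 (cut_dir m) <= 2 * M * 2 `^ (- (m%:R / n%:R)).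
Proof.
have nR : 0 < n%:R :> R by rewrite ltr0n.
rewrite sideS eqxx /side /ncut ltnn addn0 -mulrA ler_pM2l ?mulr_gt0// -invfM -exprSr -powR_mulrn// -powRN.
apply: ler_powR; rewrite ?ler1n// lerN2 ler_pdivrMr// -natrM ler_nat.
by rewrite mulSn {1}(divn_eq m n) addnC leq_add2r ltnW// ltn_pmod.
Qed.

Lemma volE m : vol m = (2 * M) ^+ n * 2 `^ (- m%:R).
Proof. by rewrite /vol powRN powR_mulrn. Qed.

(** Sides are of order 2^(-m/n) and volumes of order 2^-m, so the product behaves like 2^(e m) with
    e = (1 - 2/n) (q - 2)/2 - 2/n. This is negative exactly when (n - 2) (q - 2) < 4, that is, for n
    > 2, when q < 2n / (n - 2). *)
Lemma jump_rate (q : R) : 2 <= q -> (n%:R - 2) * (q - 2) < 4 -> exists C rho : R, [/\ 0 <= C, 0 < rho < 1 &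
  forall m, Num.sqrt (2^-1 * (vol m)^-1 * side m.+1 (cut_dir m) ^+ 2) `^ (q - 2) *
    (2^-1 * side m.+1 (cut_dir m) ^+ 2) <= C * rho ^+ m].
Proof.
move=> q2 hq; have nR : 0 < n%:R :> R by rewrite ltr0n.
pose A := 2^-1 * ((2 * M) ^+ n)^-1 * (2 * M) ^+ 2.
have M2 : 0 < 2 * M by rewrite mulr_gt0.
have A0 : 0 < A by rewrite !mulr_gt0 ?invr_gt0 ?exprn_gt0.
pose e : R := (1 - 2 / n%:R) * ((q - 2) / 2) - 2 / n%:R.
have e0 : e < 0.
  have -> : e = ((n%:R - 2) * (q - 2) - 4) / (2 * n%:R) by rewrite /e; field; rewrite gt_eqF.
  by rewrite pmulr_llt0 ?subr_lt0// invr_gt0 mulr_gt0.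
exists (A `^ ((q - 2) / 2) * (2^-1 * (2 * M) ^+ 2)), (2 `^ e); split.
- by apply: mulr_ge0; [exact: powR_ge0|apply: mulr_ge0 => //; exact: sqr_ge0].
- rewrite powR_gt0//=; have -> : e = - (- e) by rewrite opprK.
  rewrite powRN invf_lt1 ?powR_gt0//.
  rewrite -[ltLHS](_ : 1 `^ (- e) = 1); last by rewrite powR1.
  by apply: gt0_ltr_powR; rewrite ?oppr_gt0 ?nnegrE// ltr1n.
move=> m; set t := side _ _.
have t0 : 0 < t by exact: side_gt0.
have ht : t ^+ 2 <= (2 * M) ^+ 2 * 2 `^ (- (2 * m%:R / n%:R)).
  apply: (@le_trans _ _ ((2 * M * 2 `^ (- (m%:R / n%:R))) ^+ 2)).
    apply: (lerXn2r _ _ _ (side_cut_le m)); rewrite nnegrE ?(ltW t0)//.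
    by rewrite mulr_ge0 ?powR_ge0// ltW.
  rewrite (exprMn 2) -[_ `^ _ ^+ 2]powR_mulrn ?powR_ge0// -powRrM le_eqVlt; apply/orP; left; apply/eqP.
  by congr (_ * _ `^ _); field; rewrite gt_eqF.
have hS : 2^-1 * (vol m)^-1 * t ^+ 2 <= A * 2 `^ (m%:R * (1 - 2 / n%:R)).
  apply: (@le_trans _ _ (2^-1 * (vol m)^-1 * ((2 * M) ^+ 2 * 2 `^ (- (2 * m%:R / n%:R))))).
    by rewrite ler_wpM2l// mulr_ge0// invr_ge0 ltW// vol_gt0.
  rewrite volE invfM -powRN opprK.
  have -> : 2 `^ (m%:R * (1 - 2 / n%:R)) = 2 `^ m%:R * 2 `^ (- (2 * m%:R / n%:R)) :> R.
    rewrite -powRD; last by apply/implyP => _; rewrite pnatr_eq0.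
    by congr (_ `^ _); field; rewrite gt_eqF.
  by rewrite /A le_eqVlt; apply/orP; left; apply/eqP; ring.
have s0 : 0 <= 2^-1 * (vol m)^-1 * t ^+ 2.
  by rewrite mulr_ge0 ?sqr_ge0// mulr_ge0// invr_ge0 ltW// vol_gt0.
have q20 : 0 <= (q - 2) / 2 by rewrite divr_ge0// subr_ge0.
have -> : Num.sqrt (2^-1 * (vol m)^-1 * t ^+ 2) `^ (q - 2) = (2^-1 * (vol m)^-1 * t ^+ 2) `^ ((q - 2) / 2).
  rewrite -[in RHS](sqr_sqrtr s0) -(powR_mulrn 2 (sqrtr_ge0 _)) -powRrM; congr (_ `^ _); by field.
apply: (@le_trans _ _ ((A * 2 `^ (m%:R * (1 - 2 / n%:R))) `^ ((q - 2) / 2) *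
    (2^-1 * ((2 * M) ^+ 2 * 2 `^ (- (2 * m%:R / n%:R)))))).
  apply: ler_pM; [exact: powR_ge0|by rewrite mulr_ge0 ?sqr_ge0| |by rewrite ler_pM2l].
  apply: (ge0_ler_powR q20); rewrite ?nnegrE ?s0//.
  by rewrite mulr_ge0 ?powR_ge0// ltW.
rewrite powRM ?powR_ge0 ?(ltW A0)// -powRrM -(powR_mulrn m (powR_ge0 2 e)) -powRrM.
have -> : 2 `^ (e * m%:R) = 2 `^ (m%:R * (1 - 2 / n%:R) * ((q - 2) / 2)) * 2 `^ (- (2 * m%:R / n%:R)) :> R.
  rewrite -powRD; last by apply/implyP => _; rewrite pnatr_eq0.
  by congr (_ `^ _); rewrite /e; field; rewrite gt_eqF.
by rewrite le_eqVlt; apply/orP; left; apply/eqP; ring.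
Qed.

Lemma side_small (e : R) : 0 < e -> exists N, forall m i, (N <= m)%N -> side m i < e.
Proof.
move=> e0; have := @cvg_expr R 2^-1; rewrite ger0_norm ?invr_ge0// => /(_ _)/cvgr0Pnorm_lt h.
have h1 : 2^-1 < 1 :> R by rewrite invf_lt1// ltr1n.
have h2 : 0 < e / (2 * M) by rewrite divr_gt0// mulr_gt0.
have [N _ hN] := h h1 _ h2.
exists (n * N)%N => m i hm; have M2 : 0 < 2 * M by rewrite mulr_gt0.
have Nk : (N <= ncut m i)%N by rewrite /ncut (leq_trans _ (leq_addr _ _))// leq_divRL// mulnC.
have := hN _ Nk; rewrite /= ger0_norm ?exprn_ge0 ?invr_ge0// exprVn ltr_pdivlMr// mulrC.
by [].
Qed.

Variable Omega : set 'rV[R]_n.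
Hypotheses (oO : open Omega) (bO : bounded_set Omega).
Hypothesis OQ : Omega `<=` box (const_mx (- M), const_mx M).
Local Notation D := (Omega : set (Rn R n)).
Let mD : measurable D := measurable_domain n0 oO.
Let muD : (leb D < +oo)%E := leb_domain n0 bO.
Local Notation I f := (\int[leb]_(x in D) f x).

Definition cell_avg m (f : Rn R n -> R) c : R := (vol m)^-1 * I (fun x => f x * chi c x).
Definition cell_approx m f (x : Rn R n) : R := \sum_(c <- cells m) cell_avg m f c * chi c x.
(** A Haar coefficient: the mean over the lower half of [c] exceeds the mean over [c] by this
    amount, and the mean over the upper half falls short by the same amount. [cell_sign] is the
    corresponding sign. *)
Definition cell_jump m f c : R := (vol m)^-1 * (I (fun x => f x * chi (lo m c) x) - I (fun x => f x * chi (hi m c) x)).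
Definition cell_sign m c x : R := (left_half m c x)%:R - (~~ left_half m c x)%:R.

Lemma lo_in m c : c \in cells m -> lo m c \in cells m.+1.
Proof. by move=> hc; apply/flattenP; exists [:: lo m c; hi m c]; [apply/mapP; exists c|rewrite inE eqxx]. Qed.

Lemma hi_in m c : c \in cells m -> hi m c \in cells m.+1.
Proof. by move=> hc; apply/flattenP; exists [:: lo m c; hi m c]; [apply/mapP; exists c|rewrite !inE eqxx orbT]. Qed.

Section approximation.
Variable f : Rn R n -> R.
Hypothesis tf : test_function Omega f.
Let fL2 : L2 leb D f := (test_L2 n0 oO (Ordinal n0) tf).1.
Local Notation delta m x := (cell_approx m.+1 f x - cell_approx m f x).

Lemma f_chi_intg m c : c \in cells m -> (@leb R n).-integrable D (EFin \o (fun x => f x * chi c x)).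
Proof. by move=> hc; exact: (L2_mul mD fL2 (chi_L2 mD hc)). Qed.

Lemma cell_approxB m x : delta m x = \sum_(c <- cells m) cell_jump m f c * cell_sign m c x * chi c x.
Proof.
rewrite /cell_approx sum_cellsS -sumrB big_seq [RHS]big_seq; apply: eq_bigr => c hc.
have -> : cell_avg m f c = (vol m)^-1 * (I (fun x => f x * chi (lo m c) x) + I (fun x => f x * chi (hi m c) x)).
  rewrite -(RintegralD mD (f_chi_intg (lo_in hc)) (f_chi_intg (hi_in hc))); congr (_ * _).
  by apply: eq_Rintegral => y _; rewrite -(chi_split m) mulrDr.
rewrite /cell_avg /cell_jump /cell_sign volS chi_lo chi_hi invfM invrK.
move: (vol m)^-1 (@Rintegral _ _ _ _ _ _) (@Rintegral _ _ _ _ _ _) (chi c x) => v a b k.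
by case: left_half => /=; lra.
Qed.

Let j m := cut_dir m.
Let t m := side m.+1 (j m).
Let g m : Rn R n -> R := diff (j m) f (t m).

Lemma diff_L2 m : L2 leb setT (g m).
Proof.
have [A [L hA]] := test_C1c (j m) tf.
have t0 : t m != 0 by rewrite gt_eqF// side_gt0.
have b := dq_bcs n0 hA t0 (lexx `|t m|).
have h := L2_lin measurableT (t m) (bcs_L2 n0 measurableT b) (L2_0 leb measurableT).
apply: (L2_ext measurableT _ h) => x _ /=.
by rewrite addr0 -diff_dq.
Qed.

(* The upper half of [c] is the translate of its lower half by [side m.+1], so the
   difference of the two means is the mean of a difference of [f]. *)
Lemma cell_jumpE m c : c \in cells m ->
  cell_jump m f c = - ((vol m)^-1 * \int[leb]_x (g m x * chi (lo m c) x)).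
Proof.
move=> hc; have f0 x : ~ D x -> f x = 0 by move=> hx; have [] := test_supp (Ordinal n0) tf hx.
have I1 c' m' : c' \in cells m' -> (@leb R n).-integrable setT (EFin \o (fun x => f x * chi c' x)).
  move=> hc'; have h0 x : ~ D x -> f x * chi c' x = 0 by move=> /f0 ->; rewrite mul0r.
  exact: (intg_supp leb mD h0).2 (f_chi_intg hc').
have I2 c' m' : c' \in cells m' -> I (fun x => f x * chi c' x) = \int[leb]_x (f x * chi c' x).
  by move=> hc'; rewrite (Rint_supp leb (D := D))// => x /f0 ->; rewrite mul0r.
have e : \int[leb]_x (f x * chi (hi m c) x) = \int[leb]_x (f (translate (t m *: delta_mx 0 (j m)) x) * chi (lo m c) x).
  rewrite -(integral_translate n0 (t m *: delta_mx 0 (j m)) (I1 _ _ (hi_in hc))).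
  by apply: eq_Rintegral => x _; rewrite lo_translate.
have i2 : (@leb R n).-integrable setT (EFin \o (fun x => f (translate (t m *: delta_mx 0 (j m)) x) * chi (lo m c) x)).
  have := integrable_translate n0 (t m *: delta_mx 0 (j m)) (I1 _ _ (hi_in hc)).
  apply: eq_intg => // x _; by rewrite lo_translate.
rewrite /cell_jump (I2 _ _ (lo_in hc)) (I2 _ _ (hi_in hc)) e -mulrN; congr (_ * _).
rewrite -(RintegralB measurableT (I1 _ _ (lo_in hc)) i2) -mulN1r -RintegralZl//.
  by apply: eq_Rintegral => x _; rewrite /g /diff /translate /=; ring.
exact: (L2_mul measurableT (diff_L2 m) (chi_L2 measurableT (lo_in hc))).
Qed.

Lemma g2_intg m c : c \in cells m -> (@leb R n).-integrable setT (EFin \o (fun x => g m x ^+ 2 * chi (lo m c) x)).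
Proof.
move=> hc; have [mg ig] := diff_L2 m.
apply: (intg_le measurableT _ ig).
  apply: measurable_funM; first exact: (intg_meas ig).
  exact: (intg_meas (chi_intg measurableT (lo_in hc))).
move=> x _; rewrite normrM ger0_norm ?sqr_ge0// chi01.
by case: (_ \in _); rewrite ?normr1 ?mulr1// normr0 mulr0 sqr_ge0.
Qed.

(** The Cauchy-Schwarz inequality on the lower half, whose measure [vol m / 2] is the origin of the
    factor [2^-1]. *)
Lemma cell_jump_sqr m c : c \in cells m ->
  cell_jump m f c ^+ 2 <= 2^-1 * (vol m)^-1 * \int[leb]_x (g m x ^+ 2 * chi (lo m c) x).
Proof.
move=> hc; have hg := diff_L2 m; have hl := chi_L2 measurableT (lo_in hc).
have chi2 x : chi (lo m c) x * chi (lo m c) x = chi (lo m c) x.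
  by rewrite chi01; case: (_ \in _); rewrite ?mulr1 ?mulr0.
have hgl : L2 leb setT (fun x => g m x * chi (lo m c) x).
  split; first exact: (intg_meas (L2_mul measurableT hg hl)).
  apply: (eq_intg measurableT _ (g2_intg hc)) => x _.
  by rewrite [in RHS]expr2 mulrACA chi2 -expr2.
have := si_CS2 (L2formP leb measurableT)
  (to_subsp (L2_set0 _ _) (L2_setlin measurableT) hgl) (to_subsp (L2_set0 _ _) (L2_setlin measurableT) hl).
rewrite /L2form !to_subspK /L2ip.
have -> : \int[leb]_x (g m x * chi (lo m c) x * chi (lo m c) x) = \int[leb]_x (g m x * chi (lo m c) x).
  by apply: eq_Rintegral => x _; rewrite -mulrA chi2.
have -> : \int[leb]_x (g m x * chi (lo m c) x * (g m x * chi (lo m c) x)) = \int[leb]_x (g m x ^+ 2 * chi (lo m c) x).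
  by apply: eq_Rintegral => x _; rewrite mulrACA chi2 -expr2.
have -> : \int[leb]_x (chi (lo m c) x * chi (lo m c) x) = vol m / 2.
  by rewrite -volS -(Rint_chi (lo_in hc)); apply: eq_Rintegral => x _; rewrite chi2.
rewrite cell_jumpE// sqrrN exprMn; have := vol_gt0 m.
move: (vol m) (@Rintegral _ _ _ _ _ _) (@Rintegral _ _ _ _ _ _) => v p r v0 h.
have -> : 2^-1 * v^-1 * p = v^-1 ^+ 2 * (p * (v / 2)) by field; rewrite gt_eqF.
by rewrite ler_wpM2l// sqr_ge0.
Qed.

Variable G : R.
Hypotheses (G0 : 0 <= G) (hG : forall i, I (fun x => (partial i f : Rn R n -> R) x ^+ 2) <= G ^+ 2).

Lemma g2_le m : \int[leb]_x (g m x ^+ 2) <= t m ^+ 2 * G ^+ 2.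
Proof.
have [A [L hA]] := test_C1c (j m) tf.
apply: (le_trans (diff_sqr_le n0 (t m) hA)); rewrite ler_wpM2l ?sqr_ge0//.
rewrite (Rint_supp leb (D := D)) ?hG// => x hx.
by have [_ ->] := test_supp (j m) tf hx; rewrite expr0n.
Qed.

Lemma cell_jump_le m c : c \in cells m -> cell_jump m f c ^+ 2 <= 2^-1 * (vol m)^-1 * (t m ^+ 2 * G ^+ 2).
Proof.
move=> hc; apply: (le_trans (cell_jump_sqr hc)); apply: ler_wpM2l.
  by rewrite mulr_ge0// ?invr_ge0// ltW// vol_gt0.
apply: le_trans (g2_le m); apply: (le_Rintegral measurableT (g2_intg hc) (diff_L2 m).2) => x _.
rewrite chi01; case: (_ \in _); rewrite ?mulr1// mulr0; exact: sqr_ge0.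
Qed.

(** The lower halves are disjoint, so the local integrals of the squared difference add up to at
    most the global one. *)
Lemma sum_jump_le m : \sum_(c <- cells m) cell_jump m f c ^+ 2 * vol m <= 2^-1 * (t m ^+ 2 * G ^+ 2).
Proof.
apply: (@le_trans _ _ (2^-1 * \sum_(c <- cells m) \int[leb]_x (g m x ^+ 2 * (if c \in cells m then chi (lo m c) x else 0)))).
  rewrite mulr_sumr big_seq [X in _ <= X]big_seq; apply: ler_sum => c hc; rewrite hc.
  have := cell_jump_sqr hc; have := vol_gt0 m; move: (vol m) (\int[leb]_x _) => v r v0 h.
  by rewrite -ler_pdivlMr// mulrAC.
(* The guard makes the integrand integrable for every [c], as exchanging sum and integral requires,
   and not only for cells. *)
have ik c : (@leb R n).-integrable setT (EFin \o (fun x => g m x ^+ 2 * (if c \in cells m then chi (lo m c) x else 0))).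
  have [hc|_] := boolP (c \in cells m); first exact: g2_intg.
  by apply: (eq_intg measurableT _ (intg0 _ _)) => // x _; rewrite mulr0.
rewrite ler_pM2l// -(Rint_sum measurableT _ ik).
apply: le_trans (g2_le m).
have hi_ : (@leb R n).-integrable setT (EFin \o (fun x => \sum_(c <- cells m) (g m x ^+ 2 * (if c \in cells m then chi (lo m c) x else 0)))).
  exact: (intg_sum measurableT _ ik).
apply: (le_Rintegral measurableT hi_ (diff_L2 m).2) => x _; rewrite -mulr_sumr ler_piMr ?sqr_ge0//.
apply: (@le_trans _ _ (\sum_(c <- cells m) chi c x)).
  rewrite big_seq [X in _ <= X]big_seq; apply: ler_sum => c hc; rewrite hc chi_lo ler_piMr ?chi01 ?ler0n//.
  by case: left_half.
by rewrite cells_partition chi01; case: (_ \in _).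
Qed.

Lemma delta_sqr m x : Omega x -> exists2 c, c \in cells m & delta m x ^+ 2 = cell_jump m f c ^+ 2 /\
  \sum_(c <- cells m) cell_jump m f c ^+ 2 * chi c x = cell_jump m f c ^+ 2.
Proof.
move=> Ox; have [c [hc cx hA]] := cells_eval m (OQ Ox); exists c => //; split; last first.
  exact: (hA (fun c => cell_jump m f c ^+ 2)).
rewrite cell_approxB (hA (fun c => cell_jump m f c * cell_sign m c x)) exprMn /cell_sign.
by case: left_half; rewrite /= ?subr0 ?sub0r ?sqrrN expr1n mulr1.
Qed.

Lemma delta_bound m x : Omega x -> delta m x ^+ 2 <= 2^-1 * (vol m)^-1 * (t m ^+ 2 * G ^+ 2).
Proof. by move=> Ox; have [c hc [-> _]] := delta_sqr m Ox; exact: cell_jump_le. Qed.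

Lemma cell_approx_meas m : measurable_fun D (cell_approx m f).
Proof.
apply: measurable_sum => c; apply: measurable_funM => //.
by apply: measurable_funTS; apply: measurable_indic; exact: measurable_box.
Qed.

(* The L^q norm is interpolated between the supremum and the L^2 norm of [delta]. *)
Lemma delta_Lq (q : R) m : 2 <= q -> Lq leb D q (fun x => delta m x) /\
  I (fun x => apow q (delta m x)) <=
    (Num.sqrt (2^-1 * (vol m)^-1 * t m ^+ 2) `^ (q - 2) * (2^-1 * t m ^+ 2)) * apow q G.
Proof.
move=> q2; have q0 : 0 < q by exact: lt_le_trans q2.
set S := Num.sqrt _.
have S20 : 0 <= 2^-1 * (vol m)^-1 * t m ^+ 2.
  by rewrite mulr_ge0 ?sqr_ge0// mulr_ge0// invr_ge0 ltW// vol_gt0.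
have md : measurable_fun D (fun x => delta m x) by apply: measurable_funB; exact: cell_approx_meas.
have dle x : D x -> `|delta m x| <= S * G.
  move=> Dx; rewrite -(ler_pXn2r (n := 2)) ?nnegrE// ?mulr_ge0 ?sqrtr_ge0//.
  by rewrite real_normK ?num_real// (exprMn 2) sqr_sqrtr// -[leRHS]mulrA; exact: delta_bound.
have d2i : (@leb R n).-integrable D (EFin \o (fun x => delta m x ^+ 2)).
  exact: (bounded_L2 mD muD md dle).2.
have apE x : apow q (delta m x) = apow (q - 2) (delta m x) * delta m x ^+ 2.
  rewrite /apow (_ : `|_| `^ q = `|delta m x| `^ (q - 2 + 2)); last by rewrite subrK.
  rewrite powRD; last by rewrite subrK gt_eqF.
  by rewrite powR_mulrn// real_normK ?num_real.
have ap_le x : D x -> apow q (delta m x) <= (S * G) `^ (q - 2) * delta m x ^+ 2.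
  move=> Dx; rewrite apE ler_wpM2r ?sqr_ge0//.
  by apply: ge0_ler_powR; rewrite ?nnegrE ?subr_ge0// ?mulr_ge0 ?sqrtr_ge0//; exact: dle.
have map_ : measurable_fun D (fun x => apow q (delta m x)).
  exact: (measurableT_comp (measurable_apow q0)).
have api : (@leb R n).-integrable D (EFin \o (fun x => apow q (delta m x))).
  apply: (intg_le mD map_ (intgZ mD ((S * G) `^ (q - 2)) d2i)) => x Dx.
  by rewrite ger0_norm ?apow_ge0//; exact: ap_le.
have hc c : (@leb R n).-integrable D (EFin \o (fun x => cell_jump m f c ^+ 2 * (if c \in cells m then chi c x else 0))).
  apply: (intgZ mD); have [h|h] := boolP (c \in cells m); first exact: chi_intg h.
  exact: intg0.
have d2 : I (fun x => delta m x ^+ 2) <= 2^-1 * (t m ^+ 2 * G ^+ 2).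
  apply: (@le_trans _ _ (I (fun x => \sum_(c <- cells m) cell_jump m f c ^+ 2 * (if c \in cells m then chi c x else 0)))).
    apply: (le_Rintegral mD d2i (intg_sum mD _ hc)) => x Dx.
    have [c hc' [-> e2]] := delta_sqr m Dx; rewrite -e2 big_seq [X in _ <= X]big_seq.
    by apply: ler_sum => c' ->.
  rewrite (Rint_sum mD _ hc); apply: le_trans (sum_jump_le m).
  rewrite big_seq [X in _ <= X]big_seq; apply: ler_sum => c h; rewrite h.
  rewrite (RintegralZl _ mD (chi_intg mD h)); apply: ler_wpM2l; first exact: sqr_ge0.
  rewrite -(Rint_chi h) /Rintegral fine_le//.
  - exact: (integrable_fin_num mD (chi_intg mD h)).
  - exact: (integrable_fin_num measurableT (chi_intg measurableT h)).
  - apply: ge0_subset_integral; [exact: mD|exact: measurableT| | |by []].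
      by apply/measurable_EFinP; exact: (intg_meas (chi_intg measurableT h)).
    by move=> y _; rewrite lee_fin chi01.
split; first by split.
apply: (le_trans (le_Rintegral mD api (intgZ mD ((S * G) `^ (q - 2)) d2i) ap_le)).
rewrite (RintegralZl _ mD d2i); apply: le_trans (ler_wpM2l (powR_ge0 _ _) d2) _.
rewrite powRM ?sqrtr_ge0//.
have -> : apow q G = G `^ (q - 2) * G ^+ 2.
  rewrite /apow ger0_norm// (_ : G `^ q = G `^ (q - 2 + 2)); last by rewrite subrK.
  by rewrite powRD ?powR_mulrn// subrK gt_eqF.
by rewrite le_eqVlt; apply/orP; left; apply/eqP; ring.
Qed.

(** As [f] is continuous and the sides of the cells tend to 0, its means over the cells around [x]
    tend to [f x]. *)
Lemma cell_approx_cvg x : Omega x -> (fun m => cell_approx m f x) @ \oo --> f x.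
Proof.
move=> Ox; have [A [L hA]] := test_C1c (Ordinal n0) tf; have [cf _ _ _ _] := hA.
have f0 y : ~ D y -> f y = 0 by move=> hy; have [] := test_supp (Ordinal n0) tf hy.
apply/cvgrPdist_le => e' e'0; pose e : R := e'; have e0 : 0 < e by []; rewrite -/e.
have /cvgrPdist_le /(_ e e0)/nbhs_ballP[dl /= dl0 hdl] := cf x.
have [N hN] := side_small dl0.
exists N => // m /= Nm; have [c [hc cx hav]] := cells_eval m (OQ Ox).
rewrite /cell_approx (hav (cell_avg m f)).
have near y : box c y -> `|f x - f y| <= e.
  move=> cy; apply: hdl; apply/ball_rowE; split => // i.
  have := hN m i Nm; rewrite -(cells_side hc); have := cx i; have := cy i.
  rewrite ltr_distl; move: (x 0 i) (y 0 i) (c.1 0 i) (c.2 0 i) => r1 r2 r3 r4; lra.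
have ic : (@leb R n).-integrable setT (EFin \o chi c) := chi_intg measurableT hc.
have h0 y : ~ D y -> f y * chi c y = 0 by move=> /f0 ->; rewrite mul0r.
have ifc : (@leb R n).-integrable setT (EFin \o (fun y => f y * chi c y)).
  exact: (intg_supp leb mD h0).2 (f_chi_intg hc).
have bnd y : (f x - e) * chi c y <= f y * chi c y <= (f x + e) * chi c y.
  rewrite chi01; have [|_] := boolP (y \in box c); last by rewrite !mulr0 lexx.
  by rewrite inE => /near; rewrite !mulr1 ler_distlC.
have v0 := vol_gt0 m.
have b1 : (f x - e) * vol m <= I (fun y => f y * chi c y).
  rewrite -(Rint_supp leb (D := D) h0) -(Rint_chi hc) -(RintegralZl _ measurableT ic).
  by apply: (le_Rintegral measurableT (intgZ measurableT _ ic) ifc) => y _; case/andP: (bnd y).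
have b2 : I (fun y => f y * chi c y) <= (f x + e) * vol m.
  rewrite -(Rint_supp leb (D := D) h0) -(Rint_chi hc) -(RintegralZl _ measurableT ic).
  by apply: (le_Rintegral measurableT ifc (intgZ measurableT _ ic)) => y _; case/andP: (bnd y).
by rewrite ler_distlC /cell_avg ler_pdivlMl// ler_pdivrMl// ![vol m * _]mulrC b1 b2.
Qed.

End approximation.
End halving.

Section domain_setting.
Variables (R : realType) (n : nat).
Hypothesis n0 : (0 < n)%N.
Variable Omega : set 'rV[R]_n.
Hypotheses (oO : open Omega) (bO : bounded_set Omega).
Local Notation D := (Omega : set (Rn R n)).
Local Notation test := (test_function Omega : set (Rn R n -> R)).
Local Notation pd := (@partial R n : 'I_n -> (Rn R n -> R) -> Rn R n -> R).

Lemma domain_dirichlet_setting : dirichlet_setting leb D test pd.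
Proof.
split.
- exact: measurable_domain.
- exact: leb_domain.
- exact: test0.
- by move=> k phi psi; exact: test_lin.
- by move=> phi i; exact: test_L2.
- by move=> i phi psi; exact: test_by_parts.
- by move=> g ig hg; exact: fundamental_lemma ig hg.
Qed.

Lemma partial_le_sob_norm (phi : Rn R n -> R) i : test phi ->
  \int[leb]_(x in D) (pd i phi x ^+ 2) <= sob_norm leb D test pd phi ^+ 2.
Proof.
move=> tphi; have ds := domain_dirichlet_setting; have mD := ds_meas ds.
have [sphi hw] := test_sob ds n0 tphi.
have hL k := (test_L2 n0 oO k tphi).2.
have E k : L2ip leb D (wpd leb D test pd phi k) (wpd leb D test pd phi k) = \int[leb]_(x in D) (pd k phi x ^+ 2).
  rewrite (ae_L2ip mD (wpd_L2 ds k sphi) (hL k) (wpd_L2 ds k sphi) (hL k) (hw k) (hw k)).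
  by apply: eq_Rintegral => x _; rewrite expr2.
have P k : 0 <= \int[leb]_(x in D) (pd k phi x ^+ 2).
  by apply: Rintegral_ge0 => x _; exact: sqr_ge0.
have P0 : 0 <= \int[leb]_(x in D) (phi x ^+ 2).
  by apply: Rintegral_ge0 => x _; exact: sqr_ge0.
have le_term (A : 'I_n -> R) : (forall k, 0 <= A k) -> A i <= \sum_k A k.
  by move=> A0; rewrite (bigD1 i)//= lerDl sumr_ge0.
have Q k : 0 <= L2ip leb D (wpd leb D test pd phi k) (wpd leb D test pd phi k) by rewrite E.
have Q0 := @sumr_ge0 _ _ (index_enum 'I_n) (fun=> true) _ (fun k (_ : true) => Q k).
rewrite /sob_norm (dirE ds sphi sphi) sqr_sqrtr; last exact: (addr_ge0 P0 Q0).
by rewrite -(E i); apply: (le_trans (le_term _ Q)); rewrite lerDr.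
Qed.

(** The average after [J] halvings is itself the finite rank operator: its coefficients are the
    means over the cells and its functions are their indicators. *)
Theorem domain_finite_rank_approx (q : R) : 2 <= q -> (n%:R - 2) * (q - 2) < 4 ->
  finite_rank_approx leb D test pd q.
Proof.
move=> q2 hq; have q0 : 0 < q by exact: lt_le_trans q2.
have ds := domain_dirichlet_setting; have mD := ds_meas ds; have muD := ds_fin ds.
have [M [M0 OM]] := bounded_sub_box bO.
have [C [rho [C0 rho01 hC]]] := jump_rate n0 M0 q2 hq.
have [K K0 hK] := telescope_Lq q0 rho01.
have [r0 r1] := andP rho01.
move=> e e0; have ae0 : 0 < apow q e by rewrite powR_gt0 ?normr_gt0 ?gt_eqF.
(* The remaining halvings contribute a tail of order rho^J, which is made smaller than the required
   bound. *)
have [J hJ] : exists J, C * K * rho ^+ J <= apow q e.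
  have h : (fun J => C * K * rho ^+ J) @ \oo --> C * K * 0.
    by apply: cvgMr; apply: cvg_expr; rewrite ger0_norm ?ltW.
  rewrite mulr0 in h; move/cvgr0Pnorm_le: h => /(_ _ ae0)[J _ hJ].
  by exists J; have := hJ J (leqnn J); rewrite /= ger0_norm// !mulr_ge0// exprn_ge0// ltW.
pose cl := cells n0 M J; pose c0 := (const_mx (- M), const_mx M) : 'rV[R]_n * 'rV[R]_n.
pose ch (j : 'I_(size cl)) : Rn R n -> R := \1_(box (nth c0 cl j) : set (Rn R n)).
have hin (j : 'I_(size cl)) : nth c0 cl j \in cells n0 M J by exact: mem_nth.
exists (size cl), (fun j x => (vol n M J)^-1 * ch j x), ch; split.
- move=> j; have h := chi_L2 M0 mD (hin j).
  by apply: (L2_ext mD _ (L2_lin mD (vol n M J)^-1 h (L2_0 leb mD))) => x _; rewrite addr0.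
- move=> j; split; first exact: (intg_meas (chi_intg M0 mD (hin j))).
  by move=> x; rewrite /ch indicE; case: (_ \in _); rewrite ?normr1 ?normr0.
move=> phi tphi; set G := sob_norm _ _ _ _ phi.
have G0 : 0 <= G by exact: sqrtr_ge0.
have hG i : \int[leb]_(x in D) (pd i phi x ^+ 2) <= G ^+ 2 by exact: partial_le_sob_norm.
have FE x : fin_rank leb D (fun j x => (vol n M J)^-1 * ch j x) ch phi x = cell_approx n0 M Omega J phi x.
  rewrite /fin_rank /cell_approx (big_nth c0) big_mkord; apply: eq_bigr => j _; congr (_ * _).
  rewrite /cell_avg -(RintegralZl _ mD (f_chi_intg M0 oO tphi (hin j))).
  by apply: eq_Rintegral => y _; rewrite mulrCA.
under [fun x => apow q _]eq_fun do rewrite FE.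
under [fun x => phi x - _]eq_fun do rewrite FE.
have step m := delta_Lq n0 M0 oO bO OM tphi G0 hG m q2.
have B0 : 0 <= C * apow q G by rewrite mulr_ge0// apow_ge0.
have hs m : Lq leb D q (fun x => cell_approx n0 M Omega m.+1 phi x - cell_approx n0 M Omega m phi x) /\
    \int[leb]_(x in D) apow q (cell_approx n0 M Omega m.+1 phi x - cell_approx n0 M Omega m phi x) <= C * apow q G * rho ^+ m.
  have [h1 h2] := step m; split => //; apply: (le_trans h2).
  by rewrite [leRHS]mulrAC ler_wpM2r ?apow_ge0.
have mF m : measurable_fun D (cell_approx n0 M Omega m phi) by exact: cell_approx_meas.
have T := hK _ _ _ _ (fun m => cell_approx n0 M Omega m phi) _ mD B0 mF hs J.
have mphi : measurable_fun D phi by exact: (test_L2 n0 oO (Ordinal n0) tphi).1.1.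
have md : measurable_fun D (fun x => phi x - cell_approx n0 M Omega J phi x) by exact: measurable_funB.
(* The bound on the tail does not depend on the number of further halvings; Fatou's lemma carries it
   over to the limit [phi]. *)
have [hi hI] : (@leb R n).-integrable D (EFin \o (fun x => apow q (phi x - cell_approx n0 M Omega J phi x))) /\
   \int[leb]_(x in D) apow q (phi x - cell_approx n0 M Omega J phi x) <= C * apow q G * K * rho ^+ J.
  apply: (Rfatou mD (fun k => (T k).1)).
  - by move=> k x _; exact: apow_ge0.
  - exact: (measurableT_comp (measurable_apow q0)).
  - by move=> x _; exact: apow_ge0.
  - apply: ae_true => x Dx.
    have h : (fun k => cell_approx n0 M Omega (J + k) phi x) @ \oo --> phi x.
      have := cell_approx_cvg n0 M0 oO OM tphi Dx; rewrite -(cvg_shiftn J).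
      by under eq_fun do rewrite addnC.
    have h2 : (fun k => cell_approx n0 M Omega (J + k) phi x - cell_approx n0 M Omega J phi x) @ \oo -->
        phi x - cell_approx n0 M Omega J phi x by apply: cvgB => //; exact: cvg_cst.
    by apply: continuous_cvg; [exact: apow_continuous|exact: h2].
  - by move=> k; exact: (T k).2.
split; first by split.
apply: (le_trans hI); rewrite apowM mulrAC -mulrA mulrAC mulrA ler_wpM2r ?apow_ge0//.
by rewrite mulrAC.
Qed.

End domain_setting.

(** * The theorem *)

Section growth_change.
Variables (R : realType) (p P : R).
Hypotheses (p0 : 0 < p) (pP : p <= P).

Lemma apow_exponent_le t : apow p t <= 1 + apow P t.
Proof.
have [h|h] := leP `|t| 1.
  apply: (@le_trans _ _ 1); last by rewrite lerDl apow_ge0.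
  by have := apow_le p0 (s := t) (t := 1); rewrite /apow normr1 powR1; apply.
apply: (@le_trans _ _ (apow P t)); last by rewrite lerDr.
by apply: ler_powR => //; exact: ltW.
Qed.

Lemma growth_exponent_le (M a s t : R) : 0 <= a -> a / (1 + `|s| `^ p + `|t| `^ p) <= M ->
  a <= (3 * `|M|) * (1 + apow P s + apow P t).
Proof.
move=> a0; have w0 : 0 < 1 + `|s| `^ p + `|t| `^ p.
  by rewrite -addrA ltr_pwDl// addr_ge0 ?powR_ge0.
rewrite ler_pdivrMr// => h; apply: (le_trans h).
apply: (@le_trans _ _ (`|M| * (1 + apow p s + apow p t))).
  by rewrite ler_wpM2r ?ler_norm// ltW.
rewrite [3 * _]mulrC -mulrA ler_wpM2l//.
have := apow_exponent_le s; have := apow_exponent_le t.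
have := apow_ge0 P s; have := apow_ge0 P t; lra.
Qed.

End growth_change.

Lemma Rint_zero d (T : measurableType d) (R : realType) (mu : {measure set T -> \bar R}) (D : set T) :
  measurable D -> \int[mu]_(x in D) (0 : R) = 0.
Proof. by move=> mD; rewrite Rintegral_cst// mul0r. Qed.

Section ae_zero.
Context d (T : measurableType d) (R : realType).
Variables (mu : {measure set T -> \bar R}) (D : set T) (n : nat).
Variables (test : set (T -> R)) (pd : 'I_n -> (T -> R) -> T -> R).
Hypothesis ds : dirichlet_setting mu D test pd.
Hypothesis n0 : (0 < n)%N.

(** The function 0 is a weak derivative of [u] in each direction, and weak derivatives are unique
    almost everywhere. *)
Lemma dir_ae0 (u : T -> R) : sob mu D test pd u -> {ae mu, forall x, D x -> u x = 0} ->
  dir mu D test pd u u = 0.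
Proof.
move=> su hu; have mD := ds_meas ds.
rewrite (dirE ds su su); apply: big1 => i _.
have [hL hw] := wpd_spec ds i su.
have w0 : weak_pd mu D test pd i u (fun=> 0).
  move=> phi tphi; rewrite (_ : \int[mu]_(x in D) (0 * phi x) = 0); last first.
    rewrite -[RHS](Rint_zero mu mD); apply: eq_Rintegral => x _; exact: mul0r.
  rewrite oppr0 -[RHS](Rint_zero mu mD).
  have hp := (ds_test_L2 ds i tphi).2.
  apply: (ae_Rint mD).
  - by apply: measurable_funM; [exact: (sob_L2 ds su).1|exact: hp.1].
  - exact: measurable_cst.
  - by apply: (ae_imp hu) => x hx Dx; rewrite hx// mul0r.
have e := weak_pd_unique ds n0 hL (L2_0 mu mD) hw w0.
rewrite (ae_L2ip mD hL (L2_0 mu mD) hL (L2_0 mu mD) e e).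
by rewrite -[RHS](Rint_zero mu mD); apply: eq_Rintegral => x _; exact: mul0r.
Qed.

(** If all test functions vanished almost everywhere, the fundamental lemma applied to the constant
    1 would give [D] measure 0. *)
Lemma test_exists_gt0 : (0 < mu D)%E -> exists2 phi, test phi & 0 < L2ip mu D phi phi.
Proof.
move=> D0; apply: contrapT => h; have mD := ds_meas ds; have muD := ds_fin ds.
have i1 : mu.-integrable D (EFin \o (fun=> 1 : R)) := intg_cst mD muD 1.
have e : {ae mu, forall x, D x -> 1 = 0 :> R}.
  apply: (ds_fundamental ds i1) => phi tphi.
  have hp : L2 mu D phi := (ds_test_L2 ds (Ordinal n0) tphi).1.
  have p0 : L2ip mu D phi phi = 0.
    apply/eqP; rewrite eq_le L2ip_ge0 andbT leNgt; apply/negP => h1; apply: h; by exists phi.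
  rewrite -[RHS](Rint_zero mu mD); apply: (ae_Rint mD).
  - by apply: measurable_funM => //; exact: hp.1.
  - exact: measurable_cst.
  - by apply: (ae_imp (L2ip_eq0 mD hp p0)) => x hx Dx; rewrite hx// mulr0.
have E : \int[mu]_(x in D) (1 : R) = \int[mu]_(x in D) (0 : R).
  by apply: (ae_Rint mD) => //; exact: measurable_cst.
move: E; rewrite (Rint_zero mu mD) Rintegral_cst// mul1r => E.
have fD : mu D \is a fin_num by rewrite ge0_fin_numE ?measure_ge0.
by move: D0; rewrite -(fineK fD) E ltxx.
Qed.

End ae_zero.

Section concrete_domain.
Variables (R : realType) (n : nat).
Hypothesis n0 : (0 < n)%N.
Variable Omega : set 'rV[R]_n.
Hypotheses (oO : open Omega) (bO : bounded_set Omega) (neO : Omega !=set0).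
Local Notation D := (Omega : set (Rn R n)).
Local Notation test := (test_function Omega : set (Rn R n -> R)).
Local Notation pd := (@partial R n : 'I_n -> (Rn R n -> R) -> Rn R n -> R).
Let ds : dirichlet_setting leb D test pd := domain_dirichlet_setting n0 oO bO.
Let mD := ds_meas ds.
Local Notation H0 := (H0sp ds n0).

Transparent dir L2ip.
Lemma dirichletE u v : dirichlet Omega u v = dir leb D test pd u v.
Proof. by []. Qed.
Lemma domain_massE (x y : H0) : mass x y = \int[leb]_(t in D) (sval_of x t * sval_of y t).
Proof. by []. Qed.
Opaque dir L2ip.

Lemma domain_test_gt0 : exists2 phi, test phi & 0 < L2ip leb D phi phi.
Proof. exact: (test_exists_gt0 ds n0 (leb_open_gt0 n0 oO neO)). Qed.

(** The Rayleigh minimum is attained at an eigenfunction, so [m] belongs to the set whose infimum is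
    [lambda1 Omega]. *)
Lemma lambda1_le_rayleigh : exists2 m : R, lambda1 Omega <= m &
  forall w : H0, m * mass w w <= energy w w.
Proof.
have a2 : finite_rank_approx leb D test pd 2.
  by apply: (domain_finite_rank_approx n0 oO bO); rewrite // subrr mulr0.
have [m [x [x1 xm hm]]] := rayleigh_min ds n0 a2 domain_test_gt0.
exists m => //; apply: ge_inf.
  (* The infimum is a lower bound only for a set that is bounded below: eigenvalues are nonnegative,
     as the energy and the mass of an eigenfunction show. *)
  exists 0 => l [u [Hu u0 hu]].
  have := hu u Hu; rewrite dirichletE => E.
  have hd := dir_ge0 leb D test pd u.
  have uL : L2 leb D u := sob_L2 ds Hu.1.
  have hp : 0 < \int[leb]_(x in D) (u x * u x).
    rewrite lt_neqAle eq_sym; apply/andP; split; last by apply: Rintegral_ge0 => y _; rewrite -expr2 sqr_ge0.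
    apply/eqP => h; apply: u0; exact: (L2ip_eq0 mD uL h).
  by move: hd; rewrite E pmulr_lge0.
exists (sval_of x); split.
- exact: (subspP x).
- move=> h; have : mass x x = 0.
    rewrite domain_massE -[RHS](Rint_zero leb mD); apply: (ae_Rint mD).
    + by apply: measurable_funM; exact: (sob_L2 ds (subspP x).1).1.
    + exact: measurable_cst.
    + by apply: (ae_imp h) => y hy Dy; rewrite hy// mul0r.
  by rewrite x1 => /eqP; rewrite oner_eq0.
- move=> phi Hphi; have := xm (to_subsp (sob00 ds n0) (sob0_lin ds n0) Hphi).
  by rewrite dirichletE domain_massE.
Qed.

Lemma eq_ae_energy (x y : H0) : eq_ae_Omega Omega (sval_of x) (sval_of y) -> energy (x - y) (x - y) = 0.
Proof.
move=> h; rewrite /energy; apply: (dir_ae0 ds n0 (subspP (x - y)).1).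
by apply: (ae_imp h) => t ht Dt; rewrite sval_ofB -[LHS]/(sval_of x t - sval_of y t) ht// subrr.
Qed.

Lemma in_Lp_bounded (u : Rn R n -> R) : in_Lp Omega +oo%E u -> essentially_bounded leb D u.
Proof. by move=> h; exact: (Linf_bounded mD h). Qed.

Lemma L2_dist_lt (f g : Rn R n -> R) (e : R) : L2 leb D f -> L2 leb D g ->
  ('N[leb]_2%:E[EFin \o ((f \- g)%R \_ Omega)] < e%:E)%E ->
  Num.sqrt (\int[leb]_(x in D) ((f x - g x) ^+ 2)) < e.
Proof.
move=> Lf Lg; have L := L2_B mD Lf Lg.
rewrite (L2_Lnorm leb L.1) (Rint_nneg L.2 (fun x _ => sqr_ge0 _)) poweR_EFin lte_fin powR12_sqrt//.
by apply: Rintegral_ge0 => x _; exact: sqr_ge0.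
Qed.

Lemma pairing_components (f g : Rn R n -> R) (z : H0 * H0) :
  (forall y : H0 * H0, energy z.1 y.1 + energy z.2 y.2 =
     \int[leb]_(x in D) (f x * sval_of y.1 x) + \int[leb]_(x in D) (g x * sval_of y.2 x)) ->
  (forall phi, H10 Omega phi -> dirichlet Omega (sval_of z.1) phi = \int[leb]_(x in D) (f x * phi x)) /\
  (forall psi, H10 Omega psi -> dirichlet Omega (sval_of z.2) psi = \int[leb]_(x in D) (g x * psi x)).
Proof.
move=> hz; have E0 (w : H0) : energy w 0 = 0 := si0r (energyP ds n0) w.
have I0 (h : Rn R n -> R) : \int[leb]_(x in D) (h x * sval_of (0 : H0) x) = 0.
  by rewrite -[RHS](Rint_zero leb mD); apply: eq_Rintegral => x _; exact: mulr0.
split=> phi Hphi; rewrite dirichletE; pose y : H0 := to_subsp (sob00 ds n0) (sob0_lin ds n0) Hphi.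
- have h : energy z.1 y + energy z.2 0 =
     \int[leb]_(x in D) (f x * phi x) + \int[leb]_(x in D) (g x * sval_of (0 : H0) x) := hz (y, 0).
  by rewrite (E0 z.2) (I0 g) !addr0 in h; exact: h.
- have h : energy z.1 0 + energy z.2 y =
     \int[leb]_(x in D) (f x * sval_of (0 : H0) x) + \int[leb]_(x in D) (g x * phi x) := hz (0, y).
  by rewrite (E0 z.1) (I0 f) !add0r in h; exact: h.
Qed.

Lemma critical_weak_solution (K : Rn R n -> R -> R -> R) (Phi : R -> R -> R) (al be : Rn R n -> R) (z : H0 * H0) :
  osc_critical K Phi al be z ->
  weak_solution Omega
    (fun x s t => (al x * cos (Phi s t) - be x * sin (Phi s t)) * du Phi s t + du (K x) s t)
    (fun x s t => (al x * cos (Phi s t) - be x * sin (Phi s t)) * dv Phi s t + dv (K x) s t)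
    (sval_of z.1) (sval_of z.2).
Proof.
move=> /pairing_components[h1 h2].
by split; [exact: (subspP z.1)|exact: (subspP z.2)|exact: h1|exact: h2].
Qed.

Lemma osc_functionalE (K : Rn R n -> R -> R -> R) (Phi : R -> R -> R) (al be : Rn R n -> R) (z : H0 * H0) :
  osc_functional K Phi al be z =
  2^-1 * (dirichlet Omega (sval_of z.1) (sval_of z.1) + dirichlet Omega (sval_of z.2) (sval_of z.2)) -
    \int[leb]_(x in Omega) (al x * sin (Phi (sval_of z.1 x) (sval_of z.2 x)) +
       be x * cos (Phi (sval_of z.1 x) (sval_of z.2 x)) + K x (sval_of z.1 x) (sval_of z.2 x)).
Proof. by rewrite !dirichletE. Qed.

Lemma osc_global_min (K : Rn R n -> R -> R -> R) (Phi : R -> R -> R) (al be : Rn R n -> R) (z : H0 * H0) :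
  (forall z' : H0 * H0, osc_functional K Phi al be z <= osc_functional K Phi al be z') ->
  global_min_H10 Omega (fun u v => 2^-1 * (dirichlet Omega u u + dirichlet Omega v v) -
    \int[leb]_(x in Omega) (al x * sin (Phi (u x) (v x)) + be x * cos (Phi (u x) (v x)) + K x (u x) (v x)))
    (sval_of z.1) (sval_of z.2).
Proof.
move=> h; split; [exact: (subspP z.1)|exact: (subspP z.2)|] => u v Hu Hv.
pose z' : H0 * H0 := (to_subsp (sob00 ds n0) (sob0_lin ds n0) Hu, to_subsp (sob00 ds n0) (sob0_lin ds n0) Hv).
have hz := h z'; rewrite (osc_functionalE K Phi al be z) (osc_functionalE K Phi al be z') in hz.
exact: hz.
Qed.

Lemma distinct_neq_pair (z z' : H0 * H0) :
  0 < sn (si_prod (@energy _ _ _ _ _ _ _ _ ds n0) (@energy _ _ _ _ _ _ _ _ ds n0)) (z - z') ->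
  ~ eq_pair Omega (sval_of z.1, sval_of z.2) (sval_of z'.1, sval_of z'.2).
Proof.
move=> h [h1 h2]; move: h; rewrite /sn.
have -> : si_prod (@energy _ _ _ _ _ _ _ _ ds n0) (@energy _ _ _ _ _ _ _ _ ds n0) (z - z') (z - z') =
    energy (z.1 - z'.1) (z.1 - z'.1) + energy (z.2 - z'.2) (z.2 - z'.2) by [].
by rewrite (eq_ae_energy h1) (eq_ae_energy h2) addr0 sqrtr0 ltxx.
Qed.

End concrete_domain.

Theorem corollary2p1 (R : realType) (n : nat) (hn : (2 <= n)%N)
  (Omega : set 'rV[R]_n)
  (hOmega : bounded_domain Omega) (hbd : smooth_boundary Omega)
  (K : Rn R n -> R -> R -> R) (hK : classA Omega K)
  (hK0 : forall x, Omega x -> K x 0 0 = 0)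
  (hKeta : exists eta : R, [/\ 0 < eta, eta < lambda1 Omega / 2 &
     forall x s t, Omega x -> K x s t <= eta * (s ^+ 2 + t ^+ 2)])
  (Phi : R -> R -> R)
  (hPhi_nonconst : ~ exists c, forall s t, Phi s t = c)
  (hPhi_C1 : C1 Phi)
  (hPhi0 : Phi 0 0 = 0)
  (hPhiA : exists p : R, ((2 < n)%N -> p = 2 / (n%:R - 2)) /\
     classA_exp Omega p (fun _ => Phi))
  (S : set ((Rn R n -> R) * (Rn R n -> R)))
  (hS_Linfty : forall ab, S ab ->
     in_Lp Omega +oo%E ab.1 /\ in_Lp Omega +oo%E ab.2)
  (hS_convex : convex_set S)
  (hS_dense : dense_L2L2 Omega S) :
  exists alpha beta : Rn R n -> R, S (alpha, beta) /\
  let f x s t := (alpha x * cos (Phi s t) - beta x * sin (Phi s t)) *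
                 du Phi s t + du (K x) s t in
  let g x s t := (alpha x * cos (Phi s t) - beta x * sin (Phi s t)) *
                 dv Phi s t + dv (K x) s t in
  let J u v := 2^-1 * (dirichlet Omega u u + dirichlet Omega v v) -
    \int[leb]_(x in Omega) (alpha x * sin (Phi (u x) (v x)) +
                            beta x * cos (Phi (u x) (v x)) +
                            K x (u x) (v x)) in
  exists u1 v1 u2 v2 u3 v3 : Rn R n -> R,
    [/\ weak_solution Omega f g u1 v1,
        weak_solution Omega f g u2 v2 &
        weak_solution Omega f g u3 v3] /\
    [/\ ~ eq_pair Omega (u1, v1) (u2, v2),
        ~ eq_pair Omega (u1, v1) (u3, v3) &
        ~ eq_pair Omega (u2, v2) (u3, v3)] /\
    global_min_H10 Omega J u1 v1 /\ global_min_H10 Omega J u2 v2.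
Proof.
have n0 : (0 < n)%N by exact: leq_trans hn.
have [oO _ neO bO] := hOmega.
pose ds := domain_dirichlet_setting n0 oO bO; have mD := ds_meas ds.
have [p1 [K_meas K_C1 p10 p1n [M1 hM1]]] := hK.
have [p2 [_ [_ _ p20 p2n [M2 hM2]]]] := hPhiA.
(* Growth conditions weaken as the exponent increases up to the critical one. *)
pose p := Num.max 1 (Num.max p1 p2).
(* The maximum with 1 ensures [p + 1 >= 2], as the interpolation with L^2 requires; for n > 2 it
   stays subcritical since 1 < (n + 2) / (n - 2). *)
have p_ge1 : 1 <= p by rewrite le_max lexx.
have p1p : p1 <= p by rewrite !le_max lexx orbT.
have p2p : p2 <= p by rewrite !le_max lexx !orbT.
have p0 : 0 < p by exact: lt_le_trans p_ge1.
(* For n = 2 the left-hand side is 0, and for n > 2 the inequality is p < (n + 2) / (n - 2). *)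
have hp : (n%:R - 2) * (p + 1 - 2) < 4.
  have [n2|n2] := leqP n 2.
    have -> : n = 2%N by apply/eqP; rewrite eqn_leq n2 hn.
    by rewrite subrr mul0r.
  have d0 : 0 < n%:R - 2 :> R by rewrite subr_gt0 ltr_nat.
  have : p < (n%:R + 2) / (n%:R - 2).
    by rewrite !gt_max p1n// p2n// andbT ltr_pdivlMr// mul1r; lra.
  by rewrite ltr_pdivlMr// => h; nra.
have approxq : finite_rank_approx leb (Omega : set (Rn R n)) (test_function Omega : set (Rn R n -> R))
    (@partial R n : 'I_n -> (Rn R n -> R) -> Rn R n -> R) (p + 1).
  by apply: (domain_finite_rank_approx n0 oO bO) => //; lra.
have [m lm hm] := lambda1_le_rayleigh n0 oO bO neO.
have [eta [eta0 eta_l K_eta]] := hKeta.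
have eta_m : eta < m / 2 by apply: (lt_le_trans eta_l); rewrite ler_pM2r// invr_gt0.
(* Poincare's inequality, i.e. positivity of the Rayleigh minimum [m], is read off
   the hypothesis [0 < eta < lambda1 / 2]. *)
have m0 : 0 < m by move: (lt_trans eta0 eta_m); rewrite pmulr_lgt0// invr_gt0.
have K_grow x s t : Omega x -> `|du (K x) s t| + `|dv (K x) s t| <= 3 * `|M1| * (1 + apow p s + apow p t).
  by move=> Ox; apply: (growth_exponent_le p10 p1p); [exact: addr_ge0|exact: hM1].
have [x0 Ox0] := neO.
have Phi_grow s t : `|du Phi s t| + `|dv Phi s t| <= 3 * `|M2| * (1 + apow p s + apow p t).
  by apply: (growth_exponent_le p20 p2p); [exact: addr_ge0|exact: (hM2 x0)].
have G1 : 0 <= 3 * `|M1| by rewrite mulr_ge0.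
have G2 : 0 <= 3 * `|M2| by rewrite mulr_ge0.
have Sb ab : S ab -> essentially_bounded leb (Omega : set (Rn R n)) ab.1 /\ essentially_bounded leb (Omega : set (Rn R n)) ab.2.
  by move=> /hS_Linfty[h1 h2]; split; exact: in_Lp_bounded.
have Sc ab ab' t : 0 <= t <= 1 -> S ab -> S ab' -> S (t *: ab + (1 - t) *: ab').
  move=> /andP[t0 t1] h1 h2; have := hS_convex ab ab' (Itv01 t0 t1) (mem_set h1) (mem_set h2).
  exact: set_mem.
have Sd f g : L2 leb (Omega : set (Rn R n)) f -> L2 leb (Omega : set (Rn R n)) g -> forall e : R, 0 < e ->
    exists2 ab, S ab & Num.sqrt (\int[leb]_(x in Omega) ((f x - ab.1 x) ^+ 2)) < e /\
      Num.sqrt (\int[leb]_(x in Omega) ((g x - ab.2 x) ^+ 2)) < e.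
  move=> Lf Lg e e0.
  have [ab Sab [h1 h2]] := hS_dense f g ((L2_Lfun leb mD f).2 Lf) ((L2_Lfun leb mD g).2 Lg) e e0.
  have [b1 b2] := Sb ab Sab; exists ab => //.
  have bL2 u : essentially_bounded leb (Omega : set (Rn R n)) u -> L2 leb (Omega : set (Rn R n)) u.
    by move=> /essentially_boundedP[mu_ [M M0 hM]]; exact: (ae_bounded_trunc mD (ds_fin ds) M0 mu_ hM).1.
  by split; apply: L2_dist_lt => //; exact: bL2.
have [al [be [Sab [z1 [z2 [z3 [[c1 c2 c3] [[d12 d13 d23] hmin]]]]]]]] :=
  abstract_three_solutions (domain_test_gt0 n0 oO bO neO) m0 hm p0 approxq G1 K_meas K_C1 K_grow hK0
    eta0 eta_m K_eta G2 hPhi_C1 hPhi0 Phi_grow hPhi_nonconst Sb Sc Sd.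
exists al, be; split => //=.
exists (sval_of z1.1), (sval_of z1.2), (sval_of z2.1), (sval_of z2.2), (sval_of z3.1), (sval_of z3.2).
split; [split; [exact: critical_weak_solution c1|exact: critical_weak_solution c2|exact: critical_weak_solution c3]|].
split; [split; [exact: distinct_neq_pair d12|exact: distinct_neq_pair d13|exact: distinct_neq_pair d23]|].
by split; [exact: osc_global_min (fun z' => (hmin z').1)|exact: osc_global_min (fun z' => (hmin z').2)].
Qed.
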